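(* Let $N=(N_1,\dots,N_d)$ be a multivariate Hawkes process with parameters $\mu\in[0,\infty)^d$ and $\boldsymbol{\varphi}=(\varphi_{ij})_{1\le i,j\le d}$, $\varphi_{ij}:[0,\infty)\to[0,\infty)$. Assume that $\int_0^\infty\varphi_{ij}(t)\,dt<\infty$ for all $i,j$, that the spectral radius of $\mathbf K=\int_0^\infty\boldsymbol{\varphi}(t)\,dt$ satisfies $\rho(\mathbf K)<1$, and that $\int_0^\infty t^{1/2}\varphi_{ij}(t)\,dt<\infty$ for all $i,j$. Then the processes $$\sqrt T\Bigl(\frac1TN_{Tv}-v(\mathbf{Id}-\mathbf K)^{-1}\mu\Bigr),\quad v\in[0,1],$$ converge in law for the Skorokhod topology, as $T\to\infty$, to $$(\mathbf{Id}-\mathbf K)^{-1}\mathbf\Sigma^{1/2}W_v,\quad v\in[0,1],$$ where $(W_v)_{v\in[0,1]}$ is a standard $d$-dimensional Brownian motion and $\mathbf\Sigma$ is the diagonal matrix with $\mathbf\Sigma_{ii}=\bigl((\mathbf{Id}-\mathbf K)^{-1}\mu\bigr)_i$.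
   Context: A multivariate Hawkes process with parameters $(\mu,\boldsymbol\varphi)$ is defined as follows. Let $(T_n)_{n\ge1}$ be a non-decreasing sequence of random variables with values in $(0,\infty]$ with $T_n<T_{n+1}$ on $\{T_n<\infty\}$, and $(Z_n)_{n\ge1}$ random variables with values in $\{1,\dots,d\}$. Put $N_{i,t}=\sum_{n\ge1}\mathbf 1_{\{T_n\le t\}\cap\{Z_n=i\}}$ for $t\ge0$ (so $N_{i,0}=0$ and no two components jump simultaneously) and let $\mathscr F_t=\sigma(N_{i,s}:s\le t,\,1\le i\le d)$. Let $\mu_i\ge 0$ and let $\varphi_{ij}:[0,\infty)\to[0,\infty)$ be (Borel) functions. $N$ is a Hawkes process under $P$ if for all $n\ge1$ and $i$ the process $N_{i,t\wedge T_n}-\int_0^{t\wedge T_n}\lambda_{i,s}\,ds$ is an $(\mathscr F_t)$-martingale, where $$\lambda_{i,t}=\mu_i+\int_{(0,t)}\sum_{j=1}^d\varphi_{ij}(t-s)\,dN_{j,s}.$$ No stationarity is assumed. $\mu$ and $N_t$ are regarded as column vectors, integrals of matrices are componentwise, $\mathbf{Id}$ is the identity matrix. *)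

(* Defs.v *)
From HB Require Import structures.
From mathcomp Require Import all_boot all_order all_algebra.
From mathcomp Require Import all_classical all_reals all_analysis.
From mathcomp Require Import measurable_realfun.
From mathcomp Require Import complex.

Set Implicit Arguments.
Unset Strict Implicit.
Unset Printing Implicit Defensive.

Import Order.TTheory GRing.Theory Num.Theory.
Import numFieldNormedType.Exports.

Local Open Scope classical_set_scope.
Local Open Scope ring_scope.

Definition spectral_radius (R : realType) (d : nat) (K : 'M[R]_d) : R :=
  sup [set Normc.normc z | z in
        [set z : R[i] | eigenvalue (map_mx (real_complex R) K) z]].

Section hawkes.
Context (R : realType) (disp : measure_display) (Omega : measurableType disp).
Context (P : probability Omega R) (d : nat).

(** Sequences are indexed from 0: [tau n] and [Z n] stand for the
    [(n+1)]-th jump time and mark. *)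
Context (tau : nat -> Omega -> \bar R) (Z : nat -> Omega -> 'I_d).

Definition marked_jumps : Prop :=
  [/\ forall n, measurable_fun setT (tau n),
      forall n i, measurable (Z n @^-1` [set i]),
      forall n w, (0 < tau n w)%E,
      forall n w, (tau n w <= tau n.+1 w)%E
    & forall n w, (tau n w < +oo)%E -> (tau n w < tau n.+1 w)%E].

(** Extended-real valued: nothing excludes explosion a priori. *)
Definition jump_count (i : 'I_d) (t : R) (w : Omega) : \bar R :=
  (\sum_(0 <= n <oo) ((tau n w <= t%:E)%E && (Z n w == i))%:R%:E)%E.

Definition point_mass (t : \bar R) : {measure set R -> \bar R} :=
  if t is r%:E then \d_r else mzero.

(** The random measure [dN_j]: a unit mass at each finite jump time of
    mark [j]. *)
Definition jump_measure (j : 'I_d) (w : Omega) : {measure set R -> \bar R} :=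
  mseries (fun n => if Z n w == j then point_mass (tau n w) else mzero) 0.

Definition intensity (mu : 'cV[R]_d) (phi : 'I_d -> 'I_d -> R -> R)
    (i : 'I_d) (t : R) (w : Omega) : \bar R :=
  ((mu i 0)%:E + \sum_(j < d)
     \int[jump_measure j w]_(s in `]0%R, t[) (phi i j (t - s)%R)%:E)%E.

Definition history (t : R) : set (set Omega) :=
  <<s \bigcup_(p in [set p : 'I_d * R | 0 <= p.2 <= t])
        preimage_set_system setT (jump_count p.1 p.2) measurable >>.

(** [M] is a martingale on [[0, +oo[]; the last clause is
    [E[M t | F s] = M s] spelled out, conditional expectation being
    characterized by its integrals over the events of [F s]. *)
Definition martingale (F : R -> set (set Omega)) (M : R -> Omega -> \bar R) :=
  [/\ forall t, 0 <= t -> forall B, measurable B -> F t (M t @^-1` B),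
      forall t, 0 <= t -> P.-integrable setT (M t)
    & forall s t, 0 <= s <= t -> forall A, F s A ->
        (\int[P]_(w in A) M t w = \int[P]_(w in A) M s w)%E].

Definition stopped_time (n : nat) (t : R) (w : Omega) : R :=
  fine (Order.min t%:E (tau n w)).

Definition compensated (mu : 'cV[R]_d) (phi : 'I_d -> 'I_d -> R -> R)
    (n : nat) (i : 'I_d) (t : R) (w : Omega) : \bar R :=
  let u := stopped_time n t w in
  (jump_count i u w
   - \int[lebesgue_measure]_(s in `[0%R, u]) intensity mu phi i s w)%E.

Definition hawkes (mu : 'cV[R]_d) (phi : 'I_d -> 'I_d -> R -> R) : Prop :=
  marked_jumps /\
  forall n i, martingale history (compensated mu phi n i).

Definition count_vec (t : R) (w : Omega) : 'cV[R]_d :=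
  \col_i fine (jump_count i t w).

End hawkes.

Definition kernel_mass (R : realType) (d : nat) (phi : 'I_d -> 'I_d -> R -> R) :
    'M[R]_d :=
  \matrix_(i, j) \int[lebesgue_measure]_(t in `[0%R, +oo[) phi i j t.

(** The square root of the diagonal matrix with nonnegative diagonal [v]. *)
Definition sqrt_diag (R : realType) (d : nat) (v : 'cV[R]_d) : 'M[R]_d :=
  diag_mx (\row_i Num.sqrt (v i 0)).

Section skorokhod.
Context (R : realType) (d : nat).
Implicit Types x y z : R -> 'cV[R]_d.

(** Only the values on [[0, 1]] matter. *)
Definition cadlag x : Prop :=
  (forall t, 0 <= t < 1 -> x s @[s --> t^'+] --> x t) /\
  (forall t, 0 < t <= 1 -> cvg (x s @[s --> t^'-])).

(** An increasing bijection of [[0, 1]] is automatically a homeomorphism. *)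
Definition time_change (lam : R -> R) : Prop :=
  set_bij `[0, 1] `[0, 1] lam /\
  {in `[0, 1] &, {homo lam : s t / s < t}}.

(** Up to replacing [<] by [<=], this says that the distance
    [inf_lam max (sup_t |lam t - t|, sup_t |x t - y (lam t)|)]
    is less than [e]; both families of balls define the J1 topology.
    A single [lam] serves all the components. *)
Definition skorokhod_ball x (e : R) y : Prop :=
  exists2 lam, time_change lam &
    forall t, t \in `[0, 1] -> `|lam t - t| < e /\ ball (x t) e (y (lam t)).

Lemma time_change_id : time_change id.
Proof. by split => //; split => // t t01; exists t. Qed.

Lemma time_change_comp (lam1 lam2 : R -> R) :
  time_change lam1 -> time_change lam2 -> time_change (lam2 \o lam1).
Proof.
move=> [bij1 inc1] [bij2 inc2]; split; first exact: set_bij_comp bij1 bij2.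
have [fun1 _ _] := bij1.
by move=> s t s01 t01 st; apply: inc2 (inc1 _ _ s01 t01 st); apply: fun1.
Qed.

Lemma time_change_inv (lam : R -> R) : time_change lam ->
  exists2 lam', time_change lam' &
    forall t, t \in `[0, 1] -> lam' t \in `[0, 1] /\ lam (lam' t) = t.
Proof.
move=> [[lam01 lam_inj lam_surj] lam_inc].
have /choice[lam' lam'P] t : exists s : R,
    t \in `[0, 1] -> s \in `[0, 1] /\ lam s = t.
  have [t01|nt01] := boolP (t \in `[0, 1]); last by exists 0.
  by have [s s01 <-] := lam_surj _ t01; exists s.
exists lam' => //; split; first split.
- by move=> t /lam'P[].
- move=> s t /set_mem/lam'P[_ sK] /set_mem/lam'P[_ tK] st.
  by rewrite -sK -tK st.
- move=> s s01; exists (lam s); first exact: lam01.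
  have [l01 lK] := lam'P _ (lam01 _ s01).
  by apply: lam_inj => //; exact/mem_set.
- move=> s t /lam'P[s01 sK] /lam'P[t01 tK] st; rewrite ltNge; apply/negP.
  rewrite le_eqVlt => /orP[/eqP ts|ts].
    by move: st; rewrite -sK -tK ts ltxx.
  by have := lam_inc _ _ t01 s01 ts; rewrite sK tK ltNge (ltW st).
Qed.

Lemma skorokhod_ball_center x (e : R) : 0 < e -> skorokhod_ball x e x.
Proof.
move=> e0; exists id; first exact: time_change_id.
by move=> t _; rewrite subrr normr0; split => //; exact: ballxx.
Qed.

Lemma skorokhod_ball_sym x y (e : R) :
  skorokhod_ball x e y -> skorokhod_ball y e x.
Proof.
move=> [lam /time_change_inv[lam' tc' lamK] xy]; exists lam' => // t t01.
have [t'01 tK] := lamK _ t01; have [+ +] := xy _ t'01.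
by rewrite tK distrC => ? /ball_sym.
Qed.

Lemma skorokhod_ball_triangle x y z (e1 e2 : R) :
  skorokhod_ball x e1 y -> skorokhod_ball y e2 z ->
  skorokhod_ball x (e1 + e2) z.
Proof.
move=> [lam1 tc1 xy] [lam2 tc2 yz].
exists (lam2 \o lam1); first exact: time_change_comp.
move=> t t01; have [[lam101 _ _] _] := tc1.
have [t1 xt] := xy _ t01; have [t2 yt] := yz _ (lam101 _ t01).
split; last exact: ball_triangle xt yt.
by rewrite -(subrKA (lam1 t)) addrC (le_lt_trans (ler_normD _ _)) ?ltrD.
Qed.

End skorokhod.

Definition skorokhod_space (R : realType) (d : nat) : Type :=
  {x : R -> 'cV[R]_d | cadlag x}.

Section skorokhod_topology.
Context (R : realType) (d : nat).
Local Notation D := (skorokhod_space R d).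

HB.instance Definition _ := gen_eqMixin D.
HB.instance Definition _ := gen_choiceMixin D.

Let dball (x : D) (e : R) (y : D) := skorokhod_ball (sval x) e (sval y).
Let dent : set_system (D * D) := entourage_ dball.
Let dnbhs (x : D) : set_system D := nbhs_ dent x.

Let dnbhsE : dnbhs = nbhs_ dent. Proof. by []. Qed.

HB.instance Definition _ := hasNbhs.Build D dnbhs.

Let dball_center (x : D) (e : R) : 0 < e -> dball x e x.
Proof. exact: skorokhod_ball_center. Qed.

Let dball_sym (x y : D) (e : R) : dball x e y -> dball y e x.
Proof. exact: skorokhod_ball_sym. Qed.

Let dball_triangle (x y z : D) (e1 e2 : R) :
  dball x e1 y -> dball y e2 z -> dball x (e1 + e2) z.
Proof. exact: skorokhod_ball_triangle. Qed.

Let dentE : dent = entourage_ dball. Proof. by []. Qed.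

HB.instance Definition _ := @Nbhs_isPseudoMetric.Build R D
  dent dnbhsE dball dball_center dball_sym dball_triangle dentE.

Lemma cadlag0 : cadlag (fun _ : R => 0 : 'cV[R]_d).
Proof.
by split=> t _; [|apply: (@is_cvg_cst 'cV[R]_d)]; exact: cvg_cst.
Qed.

(** Paths that fail to be cadlag are sent to the zero path; this is applied
    to processes whose paths are almost surely cadlag. *)
Definition to_skorokhod (x : R -> 'cV[R]_d) : D :=
  if pselect (cadlag x) is left cx then exist _ x cx else exist _ _ cadlag0.

End skorokhod_topology.

Section laws.
Context (R : realType) (d : nat).

(** Processes are written [X v w], with time [v] first. *)
Definition cadlag_process (disp : measure_display) (Omega : measurableType disp)
    (P : probability Omega R) (X : R -> Omega -> 'cV[R]_d) : Prop :=
  (forall v i, v \in `[0, 1] -> measurable_fun setT (fun w => X v w i 0)) /\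
  {ae P, forall w, cadlag (X ^~ w)}.

Definition cvg_in_law_skorokhod
    (disp : measure_display) (Omega : measurableType disp)
    (P : probability Omega R) (X : R -> R -> Omega -> 'cV[R]_d)
    (disp' : measure_display) (Omega' : measurableType disp')
    (P' : probability Omega' R) (Y : R -> Omega' -> 'cV[R]_d) : Prop :=
  [/\ forall T, 0 < T -> cadlag_process P (X T),
      cadlag_process P' Y
    & forall f : skorokhod_space R d -> R, continuous f ->
        (exists M, forall x, `|f x| <= M) ->
        ('E_P[fun w => f (to_skorokhod (X T ^~ w))] @[T --> +oo%R] -->
         'E_P'[fun w => f (to_skorokhod (Y ^~ w))])%E].

(** Taking [B i = setT] for some indices yields the product rule for every
    subfamily. *)
Definition mutually_independent
    (disp : measure_display) (Omega : measurableType disp)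
    (P : probability Omega R) (I : finType) (X : I -> Omega -> R) : Prop :=
  forall B : I -> set R, (forall i, measurable (B i)) ->
    P (\bigcap_i (X i @^-1` B i)) = (\prod_(i : I) P (X i @^-1` B i))%E.

(** Brownian motion on the time interval [[0, 1]]. *)
Definition standard_brownian
    (disp : measure_display) (Omega : measurableType disp)
    (P : probability Omega R) (W : R -> Omega -> 'cV[R]_d) : Prop :=
  [/\ forall v i, v \in `[0, 1] -> measurable_fun setT (fun w => W v w i 0),
      {ae P, forall w, W 0 w = 0},
      {ae P, forall w, {within `[0, 1], continuous (W ^~ w)}},
      forall i s t, 0 <= s -> s < t -> t <= 1 ->
        forall B, measurable B ->
          P ((fun w => W t w i 0 - W s w i 0) @^-1` B)
          = normal_prob 0 (Num.sqrt (t - s)) B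
    & forall (n : nat) (t : nat -> R),
        0 <= t 0%N -> (forall k, (k < n)%N -> t k <= t k.+1) -> t n <= 1 ->
        mutually_independent P (fun (p : 'I_n * 'I_d) w =>
          W (t p.1.+1) w p.2 0 - W (t p.1) w p.2 0)].

End laws.

(* Submission.v *)
Require Import Defs.
From HB Require Import structures.
From mathcomp Require Import all_boot all_order all_algebra.
From mathcomp Require Import all_classical all_reals all_analysis.
From mathcomp Require Import measurable_realfun.
From mathcomp Require Import complex ring lra.

Set Implicit Arguments.
Unset Strict Implicit.
Unset Printing Implicit Defensive.

Import Order.TTheory GRing.Theory Num.Theory.
Import numFieldNormedType.Exports.

Local Open Scope classical_set_scope.
Local Open Scope ring_scope.

(** Write [Lambda] for the compensator of [N], [M = N - Lambda] and [phi * N] for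
    the convolution, so that [Lambda t = mu t + (phi * N) t]. With
    [R = K N - phi * N >= 0] this gives [(1 - K) N = M + mu t - R], hence
    [N t - t A mu = A (M t - R t)] where [A = (1 - K)^-1] has nonnegative
    entries. The expectation of this identity bounds [E N], rules out
    explosion, and (through the half moment of [phi]) yields the law of large
    numbers [E |N t - t A mu| = O(sqrt t)].

    [M] is a square-integrable martingale with jumps of size one and bracket
    [N]. A second-order expansion of the cosine over a fine partition gives
    [E cos (a + theta . (M_t - M_s) / sqrt T) - exp (- q / 2) E cos a -> 0] for
    [a] measurable at time [s], where [q] is the limiting variance; iterating
    over blocks identifies the finite-dimensional limits. Doob's inequality for
    the convex function [x ^ 2 - 2 (1 - cos x)] gives equicontinuity. On the
    event of small oscillation of [M] the renewal equation bounds the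
    oscillation of [N], hence [R], which is uniformly [o(sqrt T)].

    The rescaled process is thus uniformly close to a step path built from
    finitely many increments of [M], and likewise for Brownian motion. A
    nonnegative continuous functional is the increasing limit of its Lipschitz
    minorants for the uniform distance, which are functions of those finitely
    many increments up to small errors; this gives the lower bound
    [liminf E f(X_T) >= E f(Y)], and applying it to [M - f] the upper one. *)

(** * Expectations and Doob's inequality *)

(** The kernel has only a half moment, so the rescaled martingale is controlled in second moment
    only. In the expansion of the cosine, the quadratic variation is compared with its deterministic
    limit, since its products with exit events have no other bound. For tightness, the mean of [psi]
    is of order [q ^ 2] at variance [q], so a union over [m] blocks of variance [1 / m] costs
    [O(1 / m)]. Without stationarity, all constants come from one comparison principle:
    [y <= z + K y] implies [y <= A z]. It is applied to means of truncated counts, to increments of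
    the mean and to windows of a single path. A functional of a whole path comes with no
    measurability in [w]. Its integral is then a lower integral, monotone and superadditive; hence
    lower bounds are proved, and the upper one is deduced from the complement. Jumps of the rescaled
    process have size [1 / sqrt T] and the limit is continuous, so a fixed grid and the uniform
    distance suffice. Cosines with a free phase reach Lipschitz functions of the increments through
    Bernstein polynomials in sines. *)

Section real_integral.
Context d (T : measurableType d) (R : realType).
Variables (mu : {measure set T -> \bar R}) (D : set T).
Hypothesis mD : measurable D.

Lemma le_integrableR (f g : T -> R) : measurable_fun D f ->
  (forall x, D x -> `|f x| <= g x) -> mu.-integrable D (EFin \o g) ->
  mu.-integrable D (EFin \o f).
Proof.
move=> mf fg; apply: le_integrable => //; first exact/measurable_EFinP.
by move=> x Dx /=; rewrite lee_fin (le_trans (fg _ Dx))// ler_norm.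
Qed.

Lemma Rintegral_dominated (f_ : nat -> T -> R) (f g : T -> R) :
  (forall n, measurable_fun D (f_ n)) -> measurable_fun D f ->
  {ae mu, forall x, D x -> f_ ^~ x @ \oo --> f x} ->
  mu.-integrable D (EFin \o g) ->
  {ae mu, forall x, D x -> forall n, `|f_ n x| <= g x} ->
  mu.-integrable D (EFin \o f) /\
  (\int[mu]_(x in D) f_ n x @[n --> \oo] --> \int[mu]_(x in D) f x).
Proof.
move=> mf_ mf f_f ig f_g.
have [| | | | |if_ _ cf] := @dominated_convergence _ _ _ mu D mD
    (fun n => EFin \o f_ n) (EFin \o f) (EFin \o g).
- by move=> n; exact/measurable_EFinP.
- exact/measurable_EFinP.
- apply: filterS f_f => x fx Dx.
  by apply: cvg_EFin; [exact: nearW | exact: fx].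
- by [].
- by apply: filterS f_g => x fx n Dx; rewrite /= lee_fin fx.
split => //.
apply: fine_cvg; rewrite /Rintegral fineK//.
exact: integrable_fin_num.
Qed.
End real_integral.

Section expectation.
Context d (T : measurableType d) (R : realType) (P : probability T R).
Implicit Types (f g h : T -> R).

(** The value is real: [fine] reads an infinite integral as 0, so linearity is available only under
    [Li]. *)
Definition Ex f : R := \int[P]_(x in setT) f x.
Definition Li f : Prop := P.-integrable setT (EFin \o f).

Lemma LiM f : Li f -> measurable_fun setT f.
Proof. by move=> /(measurable_int P) /measurable_EFinP. Qed.

Lemma Li_le_ae f g : measurable_fun setT f -> Li g ->
  {ae P, forall w, `|f w| <= g w} -> Li f.
Proof.
move=> mf Lg fg; apply/integrableP; split; first exact/measurable_EFinP.
have mg := LiM Lg.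
have /integrableP[_] := Lg; apply: le_lt_trans.
apply: ae_ge0_le_integral => //.
- by apply/measurable_EFinP; exact: measurableT_comp.
- by apply/measurable_EFinP; exact: measurableT_comp.
- apply: filterS fg => w fgw _ /=.
  by rewrite lee_fin (le_trans fgw)// ler_norm.
Qed.

Lemma Li_le f g : measurable_fun setT f -> Li g -> (forall w, `|f w| <= g w) ->
  Li f.
Proof. by move=> mf Lg fg; apply: (Li_le_ae mf Lg); exact: aeW. Qed.

Lemma Li_norm f : Li f -> Li (fun w => `|f w|).
Proof. exact: integrable_norm. Qed.

Lemma Li_cst (c : R) : Li (fun=> c).
Proof. exact: (@finite_measure_integrable_cst _ _ _ P). Qed.

Lemma Li_bounded f (M : R) : measurable_fun setT f -> (forall w, `|f w| <= M) ->
  Li f.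
Proof. by move=> mf fM; apply: (Li_le mf (Li_cst M)). Qed.

Lemma LiD f g : Li f -> Li g -> Li (fun w => f w + g w).
Proof. by move=> Lf Lg; apply: (integrableD _ Lf Lg). Qed.

Lemma LiB f g : Li f -> Li g -> Li (fun w => f w - g w).
Proof. by move=> Lf Lg; apply: (integrableB _ Lf Lg). Qed.

Lemma LiZ (c : R) f : Li f -> Li (fun w => c * f w).
Proof. by move=> Lf; apply: (integrableZl _ c Lf). Qed.

Lemma Li_sum (I : Type) (s : seq I) (p : pred I) (F : I -> T -> R) :
  (forall i, p i -> Li (F i)) -> Li (fun w => \sum_(i <- s | p i) F i w).
Proof.
move=> LF; have := @integrable_sum _ _ _ P _ measurableT _ s p
  (fun i => EFin \o F i) LF.
rewrite /Li; congr (integrable _ _ _).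
by apply/funext => w /=; rewrite sumEFin.
Qed.

Lemma Li_indic (A : set T) : measurable A -> Li (\1_A).
Proof. by move=> mA; exact: integrable_indic. Qed.

Lemma ExD f g : Li f -> Li g -> Ex (fun w => f w + g w) = Ex f + Ex g.
Proof. by move=> Lf Lg; rewrite /Ex RintegralD. Qed.

Lemma ExB f g : Li f -> Li g -> Ex (fun w => f w - g w) = Ex f - Ex g.
Proof. by move=> Lf Lg; rewrite /Ex RintegralB. Qed.

Lemma ExZ (c : R) f : Li f -> Ex (fun w => c * f w) = c * Ex f.
Proof. by move=> Lf; rewrite /Ex RintegralZl. Qed.

Lemma Ex_cst (c : R) : Ex (fun=> c) = c.
Proof. by rewrite /Ex Rintegral_cst// [X in fine X]probability_setT mulr1. Qed.

Lemma Ex_sum (I : Type) (s : seq I) (F : I -> T -> R) :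
  (forall i, Li (F i)) ->
  Ex (fun w => \sum_(i <- s) F i w) = \sum_(i <- s) Ex (F i).
Proof.
move=> LF; elim: s => [|i s IH].
  by rewrite big_nil -[RHS](Ex_cst 0); congr Ex; apply/funext => w; rewrite big_nil.
rewrite big_cons -IH -ExD//; last by apply: Li_sum.
by congr Ex; apply/funext => w; rewrite big_cons.
Qed.

Lemma Ex_ae_eq f g : measurable_fun setT f -> measurable_fun setT g ->
  {ae P, forall w, f w = g w} -> Ex f = Ex g.
Proof.
move=> mf mg fg; rewrite /Ex /Rintegral; congr fine; apply: ae_eq_integral => //.
- exact/measurable_EFinP.
- exact/measurable_EFinP.
- by apply: filterS fg => w /= ->.
Qed.

Lemma Ex_le_ae f g : Li f -> Li g -> {ae P, forall w, f w <= g w} -> Ex f <= Ex g.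
Proof.
move=> Lf Lg fg; have mf := LiM Lf; have mg := LiM Lg.
(* [max f g] equals [g] almost everywhere and turns the inequality into a pointwise one. *)
rewrite (@Ex_ae_eq g (fun w => Num.max (f w) (g w)))//.
- apply: le_Rintegral => //.
    apply: (@Li_le _ (fun w => `|f w| + `|g w|)).
    + exact: measurable_maxr.
    + by apply: LiD; exact: Li_norm.
    + move=> w; rewrite /Num.max; case: ifP => _.
        by rewrite lerDr.
      by rewrite lerDl.
  by move=> w _; rewrite le_max lexx.
- exact: measurable_maxr.
- by apply: filterS fg => w fgw; apply/esym/max_idPr.
Qed.

Lemma Ex_le f g : Li f -> Li g -> (forall w, f w <= g w) -> Ex f <= Ex g.
Proof. by move=> Lf Lg fg; apply: Ex_le_ae => //; exact: aeW. Qed.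

Lemma Ex_ge0 f : (forall w, 0 <= f w) -> 0 <= Ex f.
Proof. by move=> f0; apply: Rintegral_ge0. Qed.

Lemma Ex_abs f : Li f -> `|Ex f| <= Ex (fun w => `|f w|).
Proof. by move=> Lf; apply: le_normr_Rintegral. Qed.

Lemma Ex_indic (A : set T) : measurable A -> Ex (\1_A) = fine (P A).
Proof. by move=> mA; rewrite /Ex /Rintegral integral_indic// setIT. Qed.

Lemma Ex_dominated (f_ : nat -> T -> R) f g :
  (forall n, measurable_fun setT (f_ n)) -> measurable_fun setT f ->
  {ae P, forall w, f_ ^~ w @ \oo --> f w} -> Li g ->
  {ae P, forall w, forall n, `|f_ n w| <= g w} ->
  Li f /\ (Ex (f_ n) @[n --> \oo] --> Ex f).
Proof.
move=> mf_ mf f_f Lg f_g; apply: (Rintegral_dominated _ mf_ mf _ Lg) => //.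
- by apply: filterS f_f.
- by apply: filterS f_g.
Qed.

(* The Fatou bound: it yields integrability of the limit. *)
Lemma Li_limit (f_ : nat -> T -> R) f (M : R) :
  (forall n, Li (f_ n)) -> measurable_fun setT f ->
  (forall n w, 0 <= f_ n w) ->
  {ae P, forall w, f_ ^~ w @ \oo --> f w} ->
  (forall n, Ex (f_ n) <= M) -> Li f /\ Ex f <= M.
Proof.
move=> Lf_ mf f_0 f_f fM.
have intE n : (\int[P]_w (f_ n w)%:E)%E = (Ex (f_ n))%:E.
  by rewrite /Ex /Rintegral fineK//; apply: integrable_fin_num => //; exact: Lf_.
have f0 : {ae P, forall w, 0 <= f w}.
  apply: filterS f_f => w fw; rewrite -(cvg_lim _ fw)//.
  apply: limr_ge; first by apply/cvg_ex; exists (f w).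
  by apply: nearW => n; exact: f_0.
have le : (\int[P]_w `|(f w)%:E| <= M%:E)%E.
  apply: (@le_trans _ _ (\int[P]_w limn_einf (fun n => (f_ n w)%:E))%E).
    apply: ae_ge0_le_integral => //.
    - by apply/measurable_EFinP; exact: measurableT_comp.
    - move=> w _.
      rewrite limn_einf_lim; apply: lime_ge; first exact: is_cvg_einfs.
      apply: nearW => n; apply: le_ereal_inf_tmp => _ [m _ <-].
      by rewrite lee_fin.
    - rewrite (_ : (fun _ => _) = (fun w => - limn_esup (fun n => - (f_ n w)%:E))%E); last first.
        by [].
      apply: measurableT_comp => //; apply: measurable_fun_limn_esup => n; apply: measurableT_comp => //.
      by apply/measurable_EFinP; apply: LiM.
    - apply: filterS2 f_f f0 => w fw f0w _; rewrite /= ger0_norm//.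
      have fw' : (f_ n w)%:E @[n --> \oo] --> (f w)%:E.
        by apply: cvg_EFin; [exact: nearW | exact: fw].
      by have [-> _] := cvg_limn_einf_sup fw'.
  apply: (@le_trans _ _ (limn_einf (fun n => \int[P]_w (f_ n w)%:E)%E)).
    apply: fatou => //.
    + by move=> n; apply/measurable_EFinP; apply: LiM.
    + by move=> n w _; rewrite lee_fin.
  under eq_fun do rewrite intE.
  rewrite limn_einf_lim; apply: lime_le; first exact: is_cvg_einfs.
  apply: nearW => n; apply: (@le_trans _ _ (Ex (f_ n))%:E).
    by apply: ereal_inf_lbound; exists n => //=.
  by rewrite lee_fin.
have Lf : Li f.
  apply/integrableP; split; first exact/measurable_EFinP.
  by apply: (le_lt_trans le); rewrite ltry.
split => //.
rewrite -lee_fin; apply: le_trans le.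
rewrite /Ex /Rintegral fineK; last exact: integrable_fin_num.
apply: (le_trans _ (le_abse_integral _ _ _)) => //; first exact: lee_abs.
exact/measurable_EFinP.
Qed.

End expectation.

Lemma cvg_sumr (R : realType) (T : Type) (F : set_system T) (FF : Filter F)
    (I : Type) (s : seq I) (p : pred I) (f : I -> T -> R) (l : I -> R) :
  (forall i, f i x @[x --> F] --> l i) ->
  \sum_(i <- s | p i) f i x @[x --> F] --> \sum_(i <- s | p i) l i.
Proof.
move=> fl; elim: s => [|i s IH].
  by rewrite big_nil; under eq_fun do rewrite big_nil; exact: cvg_cst.
rewrite big_cons; under eq_fun do rewrite big_cons.
by case: (p i) => //; exact: cvgD.
Qed.

Import HBNNSimple.

Section sub_sigma_algebra.
Context d (T : measurableType d) (R : realType) (P : probability T R).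
Implicit Types (f g h X H : T -> R) (G : set (set T)).

Definition Gm G f := @measurable_fun _ _ (g_sigma_algebraType G) R setT f.

Lemma Gm_sub G G' f : <<s G >> `<=` <<s G' >> -> Gm G f -> Gm G' f.
Proof. by move=> GG' mf _ B mB; apply: GG'; apply: mf. Qed.

Lemma Gm_measurable G f : <<s G >> `<=` measurable -> Gm G f ->
  measurable_fun setT f.
Proof. by move=> GG' mf _ B mB; apply: GG'; apply: mf. Qed.

Lemma Ex_orth G X H : <<s G >> `<=` measurable -> Li P X ->
  (forall A, <<s G >> A -> Ex P (fun w => \1_A w * X w) = 0) ->
  Gm G H -> Li P (fun w => H w * X w) -> Ex P (fun w => H w * X w) = 0.
Proof.
move=> GM LX X0.
have mX := LiM LX.
have nnsfun0 (g : {nnsfun (g_sigma_algebraType G) >-> R}) :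
    Ex P (fun w => g w * X w) = 0.
  have -> : (fun w => g w * X w) = (fun w => \sum_(i <- finmap.enum_fset (fset_set (range g)))
      i * (\1_(g @^-1` [set i]) w * X w)).
    apply/funext => w; rewrite fimfunE fsbig_finite//= mulr_suml.
    by apply: eq_bigr => i _; rewrite mulrA.
  have mg i : <<s G >> (g @^-1` [set i]).
    by rewrite -[_ @^-1` _]setTI; apply: (measurable_funPT g).
  have Lg i : Li P (fun w => \1_(g @^-1` [set i]) w * X w).
    apply: (Li_le _ (Li_norm LX)).
      by apply: measurable_funM => //; apply: measurable_indic; apply: GM; exact: mg.
    by move=> w; rewrite normrM ler_piMl// indicE; case: (_ \in _); rewrite normr_nat.
  rewrite Ex_sum; last by move=> i; exact: LiZ.
  by rewrite big1// => i _; rewrite ExZ// X0 ?mulr0.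
have pos H' : Gm G H' -> (forall w, 0 <= H' w) -> Li P (fun w => H' w * X w) ->
    Ex P (fun w => H' w * X w) = 0.
  move=> mH H0 LH.
  have mEH : @measurable_fun _ _ (g_sigma_algebraType G) _ setT (EFin \o H').
    exact/measurable_EFinP.
  pose g := nnsfun_approx measurableT mEH.
  have gH w : g n w @[n --> \oo] --> H' w.
    have /fine_cvgP[_ ] := @cvg_nnsfun_approx _ _ _ setT measurableT _ mEH
      (fun x _ => H0 x) w I.
    by apply.
  have ndg w : nondecreasing_seq (g ^~ w).
    by move=> m n mn; have /lefP := nd_nnsfun_approx measurableT mEH mn; apply.
  have gle n w : g n w <= H' w.
    have <- := cvg_lim (@Rhausdorff R) (gH w).
    by apply: nondecreasing_cvgn_le (ndg w) _ n; apply/cvg_ex; exists (H' w).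
  have [| | |_ +] := @Ex_dominated _ _ _ P (fun n w => g n w * X w)
    (fun w => H' w * X w) (fun w => `|H' w * X w|)
    (fun n => measurable_funM (Gm_measurable GM (measurable_funPT (g n))) mX)
    (LiM LH).
  - by apply: aeW => w; apply: cvgM; [exact: gH | exact: cvg_cst].
  - exact: Li_norm.
  - apply: aeW => w n; rewrite !normrM ler_wpM2r// !ger0_norm ?gle//.
  under eq_fun do rewrite nnsfun0.
  by move=> /(cvg_lim (@Rhausdorff R)) <-; exact: lim_cst.
move=> mH LH.
have LHp : Li P (fun w => Num.max (H w) 0 * X w).
  apply: (Li_le _ (Li_norm LH)).
    apply: measurable_funM => //; apply: measurable_maxr => //.
    exact: Gm_measurable mH.
  move=> w; rewrite !normrM ler_wpM2r// /Num.max; case: ifP => //.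
  by rewrite normr0.
have LHn : Li P (fun w => Num.max (- H w) 0 * X w).
  apply: (Li_le _ (Li_norm LH)).
    apply: measurable_funM => //; apply: measurable_maxr => //.
    by apply: measurableT_comp => //; exact: Gm_measurable mH.
  move=> w; rewrite !normrM ler_wpM2r// /Num.max; case: ifP => //.
    by rewrite normr0.
  by rewrite normrN.
have -> : (fun w => H w * X w) =
    (fun w => Num.max (H w) 0 * X w - Num.max (- H w) 0 * X w).
  apply/funext => w; rewrite -mulrBl; congr (_ * _).
  rewrite /Num.max oppr_lt0; have [H0|H0|->] := ltgtP (H w) 0.
  - by rewrite sub0r opprK.
  - by rewrite subr0.
  - by rewrite oppr0 subr0.
rewrite ExB// !pos ?subr0//.
- apply: measurable_maxr => //; apply: measurableT_comp => //.
- by move=> w; rewrite le_max lexx orbT.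
- exact: measurable_maxr.
- by move=> w; rewrite le_max lexx orbT.
Qed.

Lemma prod01 (m : nat) (u : 'I_m -> R) : (forall i, 0 <= u i <= 1) ->
  0 <= \prod_(i < m) u i <= 1.
Proof.
move=> u01; apply: (big_ind (fun x : R => 0 <= x <= 1)) => //.
  by rewrite ler01 lexx.
by move=> x z /andP[x0 x1] /andP[z0 z1]; rewrite mulr_ge0//= mulr_ile1.
Qed.

Section doob.
Variables (F : nat -> set (set T)) (y : nat -> T -> R) (n : nat).
Hypothesis FM : forall k, <<s F k >> `<=` measurable.
Hypothesis Fnd : forall j k, (j <= k)%N -> <<s F j >> `<=` <<s F k >>.
Hypothesis Fy : forall k, (k <= n)%N -> Gm (F k) (y k).
Hypothesis yorth : forall k A, (k <= n)%N -> <<s F k >> A ->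
  Ex P (fun w => \1_A w * (y n w - y k w)) = 0.
Hypothesis Ly : forall k, (k <= n)%N -> Li P (y k).

(** The indicator of a visit to [B] by time [n]. As one minus a product it is visibly measurable,
    and its increments in [n] are the indicators of first entrance. *)
Definition hits (B : set R) (n : nat) (w : T) : R :=
  1 - \prod_(k < n.+1) \1_(~` B) (y k w).

Lemma hits01 B m w : 0 <= hits B m w <= 1.
Proof.
have : (0 : R) <= \prod_(k < m.+1) (\1_(~` B) (y k w) : R) <= 1.
  by apply: prod01 => i; rewrite indicE; case: (_ \in _); rewrite ?lexx ler01.
by rewrite /hits => /andP[? ?]; apply/andP; split; lra.
Qed.

Lemma hits0 B m w : hits B m w < 1 -> forall k, (k <= m)%N -> ~ B (y k w).
Proof.
rewrite /hits => + k km Bk.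
have -> : \prod_(k < m.+1) \1_(~` B) (y k w) = 0 :> R.
  apply/eqP/prodf_eq0; exists (Ordinal (km : (k < m.+1)%N)) => //=.
  by rewrite indicE memNset// => /(_ Bk).
by rewrite subr0 ltxx.
Qed.

Lemma measurable_hits B m : measurable B -> (m <= n)%N ->
  measurable_fun setT (hits B m).
Proof.
move=> mB mn; apply: measurable_funB => //; apply: measurable_prod => k _.
apply: (@measurableT_comp _ _ _ _ _ _ (\1_(~` B) : R -> R)).
  by apply: measurable_indic; exact: measurableC.
apply: Gm_measurable (FM (k := k)) _.
by apply: Fy; rewrite (leq_trans _ mn)// -ltnS.
Qed.

(* [g' (y k)] on the event of first entrance at time [k] is an admissible
   integrand, and [g (y n) >= g (y k) + g' (y k) * (y n - y k)]. *)
Lemma doob_convex (g g' : R -> R) (B : set R) (c C : R) :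
  measurable B -> 0 <= c -> (forall x, 0 <= g x) ->
  (forall x z, g x + g' x * (z - x) <= g z) ->
  (forall x, B x -> c <= g x) ->
  measurable_fun setT g' ->
  (forall k, (k <= n)%N -> Li P (fun w => g' (y k w) * (y n w - y k w))) ->
  Li P (g \o y n) ->
  c * Ex P (hits B n) <= Ex P (g \o y n).
Proof.
move=> mB c0 g0 gg' Bg mg' Lg' Lg.
(* [p k] says that [B] is avoided before time [k], and [a k] that it is first entered at time
   [k]. *)
pose p k w : R := \prod_(j < k) \1_(~` B) (y j w).
pose a k w : R := p k w * \1_B (y k w).
have p01 k w : 0 <= p k w <= 1.
  by apply: prod01 => i; rewrite indicE; case: (_ \in _); rewrite ?lexx ler01.
have a01 k w : 0 <= a k w <= 1.
  have /andP[p0 p1] := p01 k w; rewrite /a indicE; case: (_ \in _).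
    by rewrite mulr1 p0.
  by rewrite mulr0 lexx ler01.
have aE k w : a k w = p k w - p k.+1 w.
  rewrite /a /p big_ord_recr/= -[in RHS](mulr1 (\prod_(j < k) _)) -mulrA -mulrBr.
  by congr (_ * _); rewrite mul1r !indicE in_setC; case: (_ \in _); rewrite /= ?subr0 ?subrr.
have sumaE w : \sum_(k < n.+1) a k w = hits B n w.
  rewrite (eq_bigr (fun k : 'I_n.+1 => p k w - p k.+1 w)); last first.
    by move=> i _; exact: aE.
  have -> m : \sum_(k < m) (p k w - p k.+1 w) = p 0%N w - p m w.
    elim: m => [|m IH]; first by rewrite big_ord0 subrr.
    by rewrite big_ord_recr/= IH; ring.
  by rewrite /p big_ord0.
have Ga k : (k <= n)%N -> Gm (F k) (a k).
  move=> kn; apply: (@measurable_funM _ (g_sigma_algebraType (F k))).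
    apply: (@measurable_prod _ (g_sigma_algebraType (F k))) => j _.
    apply: (@measurableT_comp _ _ _ _ _ _ (\1_(~` B) : R -> R)).
      by apply: measurable_indic; exact: measurableC.
    have jk : (j <= k)%N by rewrite ltnW.
    by apply: Gm_sub (Fnd jk) _; apply: Fy; rewrite (leq_trans jk).
  apply: (@measurableT_comp _ _ _ _ _ _ (\1_B : R -> R)).
    exact: measurable_indic.
  exact: Fy.
have Lgy k : (k <= n)%N ->
    Li P (fun w => a k w * g' (y k w) * (y n w - y k w)).
  move=> kn; apply: (Li_le _ (Li_norm (Lg' _ kn))).
    apply: measurable_funM.
      apply: measurable_funM; first exact: Gm_measurable (FM (k:=k)) (Ga _ kn).
      by apply: measurableT_comp => //; apply/LiM/Ly.
    by apply: measurable_funB; apply/LiM/Ly.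
  move=> w; rewrite -mulrA normrM ler_piMl//.
  by have /andP[? ?] := a01 k w; rewrite ger0_norm.
have E0 k : (k <= n)%N ->
    Ex P (fun w => a k w * g' (y k w) * (y n w - y k w)) = 0.
  move=> kn; apply: (@Ex_orth (F k)) => //.
  - by apply: LiB; exact: Ly.
  - by move=> A FA; exact: yorth.
  - apply: (@measurable_funM _ (g_sigma_algebraType (F k))); first exact: Ga.
    by apply: (measurableT_comp mg'); exact: Fy.
  - exact: Lgy.
have Lsum : Li P (fun w => \sum_(k < n.+1)
    a k w * g' (y k w) * (y n w - y k w)).
  by apply: Li_sum => k _; apply: Lgy; rewrite -ltnS.
(* Subtracting a martingale transform of mean zero reduces the claim to a pointwise inequality. *)
have -> : Ex P (g \o y n) = Ex P (fun w => g (y n w) - \sum_(k < n.+1)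
    a k w * g' (y k w) * (y n w - y k w)).
  rewrite ExB// Ex_sum; last by move=> k; apply: Lgy; rewrite -ltnS.
  by rewrite big1 ?subr0// => k _; apply: E0; rewrite -ltnS.
have Lh : Li P (hits B n).
  apply: (@Li_bounded _ _ _ _ _ 1); first exact: measurable_hits.
  by move=> w; have /andP[? ?] := hits01 B n w; rewrite ger0_norm.
rewrite -ExZ//; apply: Ex_le.
- exact: LiZ.
- exact: LiB.
move=> w; rewrite -sumaE mulr_sumr.
rewrite lerBrDr -big_split/=.
apply: (@le_trans _ _ (\sum_(k < n.+1) a k w * g (y n w))).
  apply: ler_sum => k _; rewrite -mulrA mulrC -mulrDr.
  have /andP[ak0 _] := a01 k w.
  have [Bk|Bk] := boolP (y k w \in B).
    rewrite ler_wpM2l// (le_trans _ (gg' (y k w) _))// lerD2r.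
    by apply: Bg; rewrite inE in Bk.
  by rewrite /a indicE (negbTE Bk) mulr0 !mul0r.
rewrite -mulr_suml sumaE ler_piMl//.
by have /andP[] := hits01 B n w.
Qed.

End doob.
End sub_sigma_algebra.

(** * Nonnegative matrices of spectral radius below one *)

Section spectral.
Context (R : realType) (d : nat) (K : 'M[R]_d).
Hypothesis K0 : forall i j, 0 <= K i j.
Hypothesis rhoK : spectral_radius K < 1.

(** A supremum bounds its elements only when the set is bounded above; here the sum of the moduli of
    the roots of the characteristic polynomial is a bound. *)
Lemma eigenvalue_lt1 (z : R[i]) :
  eigenvalue (map_mx (real_complex R) K) z -> Normc.normc z < 1.
Proof.
move=> ev; apply: le_lt_trans rhoK; apply: ub_le_sup; last by exists z.
have [r pE] := closed_field_poly_normal (char_poly (map_mx (real_complex R) K)).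
exists (\sum_(x <- r) Normc.normc x) => _ [x /= + <-].
rewrite eigenvalue_root_char pE (monicP (char_poly_monic _)) scale1r.
rewrite root_prod_XsubC => xr; rewrite (perm_big _ (perm_to_rem xr))/= big_cons.
rewrite lerDl; apply: sumr_ge0 => -[a b] _.
by rewrite /Normc.normc sqrtr_ge0.
Qed.

(** A left kernel vector of [1 - t K] would produce the eigenvalue [t^-1 >= 1]. *)
Lemma det_subZ_neq0 (t : R) : 0 <= t <= 1 -> \det (1%:M - t *: K) != 0.
Proof.
move=> /andP[t0 t1]; apply/det0P => -[v v0].
rewrite mulmxBr mulmx1 -scalemxAr => /eqP; rewrite subr_eq0 => /eqP vE.
have tn0 : t != 0.
  by apply: contra_neq v0 => t00; rewrite vE t00 scale0r.
have : eigenvalue (map_mx (real_complex R) K) (real_complex R t^-1).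
  rewrite eigenvalue_map; apply/eigenvalueP; exists v => //.
  by rewrite [in RHS]vE scalerA mulVf// scale1r.
move=> /eigenvalue_lt1; rewrite /Normc.normc/= expr0n/= addr0 sqrtr_sqr.
rewrite ger0_norm ?invr_ge0// invf_lt1 ?lt_neqAle 1?eq_sym ?tn0//.
by rewrite eq_sym => /andP[/negP]; rewrite /= => + t1'; move: t1; rewrite le_eqVlt => /orP[/eqP->//|]; rewrite ltNge t1'.
Qed.

Let B (t : R) := 1%:M - t *: K.
(** Cramer's rule for [B t *m x t = 1]: the entries are rational in [t], hence continuous as long as
    the determinant does not vanish. *)
Let x (t : R) : 'cV[R]_d := (\det (B t))^-1 *: (\adj (B t) *m const_mx 1).

Let Bx t : 0 <= t <= 1 -> B t *m x t = const_mx 1.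
Proof.
move=> t01; rewrite /x -scalemxAr mulmxA mul_mx_adj -mul_scalar_mx mulmxA.
by rewrite -scalar_mxM mulVf ?mul1mx// det_subZ_neq0.
Qed.

Let x_ge1 t : 0 <= t <= 1 -> (forall i, 0 <= x t i 0) -> forall i, 1 <= x t i 0.
Proof.
move=> t01 x0 i; have /matrixP/(_ i 0) := Bx t01.
rewrite mulmxBl mul1mx -scalemxAl !mxE => /eqP; rewrite subr_eq => /eqP ->.
have /andP[t0 _] := t01.
rewrite lerDl mulr_ge0// sumr_ge0// => j _.
by rewrite mulr_ge0.
Qed.

Let cx i t : 0 <= t <= 1 -> {for t, continuous (fun t => x t i 0)}.
Proof.
move=> t01.
pose PB : 'M[{poly R}]_d := 1%:M - 'X *: map_mx polyC K.
have PBE s : map_mx (horner_eval s) PB = B s.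
  apply/matrixP => a b; rewrite !mxE /= /horner_eval !hornerE.
  by rewrite hornerMn hornerC.
rewrite (_ : (fun t => _) = fun s => (\det PB).[s]^-1 *
    \sum_j (\adj PB i j).[s]); last first.
  apply/funext => s; rewrite /x !mxE -PBE det_map_mx -map_mx_adj; congr (_ * _).
  by apply: eq_bigr => j _; rewrite !mxE mulr1.
apply: continuousM.
  apply: continuousV; last exact: continuous_horner.
  have := det_subZ_neq0 t01; rewrite -/(B t) -PBE det_map_mx.
  by rewrite /= /horner_eval.
by apply: cvg_sumr => j; exact: continuous_horner.
Qed.

(** Continuity method along [t K]. By [x_ge1] a nonnegative solution has all entries at least 1, so
    the smallest entry, which starts at 1, cannot cross the gap between 0 and 1. At [t = 1] the
    solution satisfies [u = 1 + K u]. *)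
Lemma subK_positive_vector : exists u : 'cV[R]_d,
  (forall i, 0 < u i 0) /\ (forall i, (K *m u) i 0 < u i 0).
Proof.
have t1 : (0 : R) <= (1 : R) <= 1 by rewrite ler01 lexx.
(* The cap at 1 serves as the default value of the minimum and gives [m 0 = 1] in every
   dimension. *)
pose m t := \big[Num.min/1]_(i < d) x t i 0.
have cm t : 0 <= t <= 1 -> {for t, continuous m}.
  move=> t01; rewrite /m.
  have : forall s : seq 'I_d, (fun t => \big[Num.min/1]_(i <- s) x t i 0) @ t -->
      (\big[Num.min/1]_(i <- s) x t i 0 : R).
    elim=> [|i s IH].
      by rewrite big_nil; under eq_fun do rewrite big_nil; exact: cvg_cst.
    rewrite big_cons; under eq_fun do rewrite big_cons.
    by apply: continuous_min => //; exact: cx.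
  exact.
have m0 : m 0 = 1.
  rewrite /m (eq_bigr (fun=> 1)) => [|i _].
    by elim/big_ind: _ => // a b -> ->; rewrite minxx.
  by rewrite /x /B scale0r subr0 det1 invr1 scale1r adj1 mul1mx mxE.
have mle t i : m t <= x t i 0 by rewrite /m (bigD1 i)//= ge_min lexx.
have mge t : (forall i, 1 <= x t i 0) -> 1 <= m t.
  move=> x1; rewrite /m; elim/big_ind: _ => // a b a1 b1.
  by rewrite le_min a1 b1.
have m1 : 0 <= m 1.
  rewrite leNgt; apply/negP => m1.
  have [||c c01 mc] := @IVT R m 0 1 (1/2) ler01.
  - apply: continuous_in_subspaceT => t; rewrite inE/= in_itv/= => t01.
    exact: cm.
  - rewrite m0 ge_min le_max; apply/andP; split; apply/orP; [right|left]; lra.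
  have c01' : 0 <= c <= 1 by move: c01; rewrite in_itv.
  have : 1 <= m c.
    apply: mge => i; apply: x_ge1 => // j.
    by rewrite (le_trans _ (mle c j))// mc; lra.
  by rewrite mc; lra.
have x0 i : 0 <= x 1 i 0 by rewrite (le_trans m1).
have x1 := x_ge1 t1 x0.
exists (x 1); split=> i; first by rewrite (lt_le_trans ltr01).
have /matrixP/(_ i 0) := Bx t1.
rewrite mulmxBl mul1mx scale1r !mxE => /eqP; rewrite subr_eq => /eqP ->.
by rewrite ltrDr.
Qed.

(* Minimum principle, for the ratios [y i / u i]. *)
Lemma subK_inverse_positive (y : 'cV[R]_d) :
  (forall i, 0 <= ((1%:M - K) *m y) i 0) -> forall i, 0 <= y i 0.
Proof.
have [u [u0 Ku]] := subK_positive_vector => y0 i0.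
pose r i := y i 0 / u i 0.
case: (arg_minP r (erefl : xpredT i0)) => i _ rmin.
suff ri : 0 <= r i.
  have := le_trans ri (rmin i0 isT).
  by rewrite /r pmulr_lge0 ?invr_gt0.
rewrite leNgt; apply/negP => ri.
have := y0 i; rewrite mulmxBl mul1mx mxE [X in _ + X]mxE subr_ge0 leNgt => /negP; apply.
have yE j : y j 0 = r j * u j 0 by rewrite /r divfK// gt_eqF.
rewrite yE; apply: (@lt_le_trans _ _ (r i * (K *m u) i 0)).
  by rewrite ltr_nM2l.
rewrite !mxE mulr_sumr; apply: ler_sum => j _.
by rewrite yE mulrCA ler_wpM2l// ler_wpM2r ?rmin// ltW.
Qed.

Lemma subK_unit : (1%:M - K) \in unitmx.
Proof.
rewrite unitmxE unitfE; have := @det_subZ_neq0 1.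
by rewrite scale1r; apply; rewrite ler01 lexx.
Qed.

Lemma invmx_subK_ge0 i j : 0 <= invmx (1%:M - K) i j.
Proof.
have := @subK_inverse_positive (col j (invmx (1%:M - K))) _ i.
rewrite mxE; apply => k.
rewrite (_ : _ *m _ = col j ((1%:M - K) *m invmx (1%:M - K))); last first.
  by apply/matrixP => a b; rewrite !mxE; apply: eq_bigr => c _; rewrite !mxE.
rewrite mulmxV ?subK_unit// !mxE.
exact: ler0n.
Qed.

(** The comparison principle: it plays the role of Gronwall's lemma for every renewal inequality
    that follows. *)
Lemma le_invmx_subK (y z : 'cV[R]_d) :
  (forall i, y i 0 <= z i 0 + (K *m y) i 0) ->
  forall i, y i 0 <= (invmx (1%:M - K) *m z) i 0.
Proof.
move=> yz i; rewrite -subr_ge0.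
have : 0 <= (invmx (1%:M - K) *m z - y) i 0.
  apply: subK_inverse_positive => k.
  rewrite mulmxBr mulmxA mulmxV ?subK_unit// mul1mx mulmxBl mul1mx.
  rewrite mxE [X in _ + X]mxE [X in _ - X]mxE [X in _ - (_ + X)]mxE.
  by have := yz k; lra.
by rewrite mxE [X in _ + X]mxE.
Qed.

End spectral.

(** * The compensator and the stopped martingales *)

Section shift_integral.
Local Open Scope ereal_scope.
Context {R : realType}.
Local Notation leb := lebesgue_measure.

Lemma lebesgue_measure_shift (r : R) (A : set R) : measurable A ->
  pushforward leb ((fun s : R => s - r)%R : _ -> measurableTypeR R) A = leb A.
Proof.
have mf : measurable_fun setT ((fun s : R => s - r)%R : _ -> measurableTypeR R).
  exact: measurable_funB.
move=> mA; apply/esym/lebesgue_measure_unique => //= _ [[a b]] _ <-.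
rewrite /pushforward (_ : _ @^-1` _ = `](a + r)%R, (b + r)%R]%classic); last first.
  by apply/seteqP; split => x /=; rewrite !in_itv/= ltrBrDr lerBlDr.
by rewrite !lebesgue_measure_itv/= !lte_fin ltrD2r -!EFinB opprD addrACA subrr addr0.
Qed.

Lemma ge0_integral_shift (r : R) (f : R -> \bar R) : measurable_fun setT f ->
  (forall x, 0 <= f x) ->
  \int[leb]_s f (s - r)%R = \int[leb]_x f x.
Proof.
move=> mf f0.
have mS : measurable_fun setT ((fun s : R => s - r)%R : _ -> measurableTypeR R).
  exact: measurable_funB.
rewrite -[in LHS](preimage_setT ((fun s : R => s - r)%R : _ -> measurableTypeR R)).
rewrite -[LHS]/(\int[leb]_(s in (fun s : R => s - r)%R @^-1` setT)
  (f \o (fun s : R => s - r)%R : _ -> \bar R) s).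
rewrite -(@ge0_integral_pushforward _ _ (measurableTypeR R) (measurableTypeR R) R
  _ mS leb setT f)//.
by apply: eq_measure_integral => A mA _; exact: lebesgue_measure_shift.
Qed.

End shift_integral.

Lemma indic_iff (R : pzRingType) (T : Type) (A : set T) (b : bool) x :
  (A x <-> b) -> \1_A x = b%:R :> R.
Proof.
move=> Ab; rewrite indicE; congr ((nat_of_bool _)%:R).
by apply/idP/idP => [/set_mem/Ab|/Ab/mem_set].
Qed.

Section cumulated_intensity.
Context (R : realType) (disp : measure_display) (Omega : measurableType disp).
Context (d : nat) (tau : nat -> Omega -> \bar R) (Z : nat -> Omega -> 'I_d).
Context (mu : 'cV[R]_d) (phi : 'I_d -> 'I_d -> R -> R).
Hypothesis mu_ge0 : forall i, 0 <= mu i 0.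
Hypothesis phi_ge0 : forall i j (t : R), 0 <= t -> 0 <= phi i j t.
Hypothesis phi_meas : forall i j, measurable_fun (`[0%R, +oo[ : set R) (phi i j).
Hypothesis tau_gt0 : forall n w, (0 < tau n w)%E.
Local Notation leb := lebesgue_measure.

(** Extension by zero to negative delays. As counts vanish at nonpositive times, convolutions become
    integrals over the whole line. *)
Definition kern i j : R -> R := phi i j \_ `[0, +oo[.

Lemma kern_ge0 i j x : 0 <= kern i j x.
Proof. by rewrite /kern /patch; case: ifPn => //; rewrite inE/= in_itv/= andbT => /phi_ge0. Qed.

Lemma measurable_kern i j : measurable_fun setT (kern i j).
Proof. by apply/(measurable_restrictT _ _).1 => //; exact: phi_meas. Qed.
Hint Resolve measurable_kern kern_ge0 : core.

Definition hit j n (t : R) w : R := ((tau n w <= t%:E)%E && (Z n w == j))%:R.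

Lemma hit_ge0 j n t w : 0 <= hit j n t w. Proof. exact: ler0n. Qed.

Lemma measurable_hit_sub j n (u : R) (w : Omega) :
  measurable_fun setT (fun x : R => hit j n (u - x) w).
Proof.
rewrite /hit; case: (Z n w == j); last first.
  by rewrite (_ : (fun _ => _) = cst 0); [exact: measurable_cst|apply/funext => x; rewrite andbF].
under eq_fun do rewrite andbT.
case: (tau n w) (tau_gt0 n w) => [r _| _|//] /=.
- rewrite (_ : (fun _ => _) = \1_(`]-oo, u - r]%classic : set R)); last first.
    apply/funext => x; apply/esym/indic_iff; rewrite lee_fin/= in_itv/=.
    by rewrite lerBrDr -lerBrDl.
  exact: measurable_indic.
- exact: measurable_cst.
Qed.

(** The share of jump [n] in the intensity at time [s]. The strict [r < s] mirrors the open interval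
    in the definition of the intensity. *)
Let kernS i j n (s : R) w : \bar R :=
  if Z n w == j then
    (if tau n w is r%:E then (kern i j (s - r) * (r < s)%R%:R)%:E else 0%E)
  else 0%E.

Let kernS_ge0 i j n s w : (0 <= kernS i j n s w)%E.
Proof.
rewrite /kernS; case: ifP => // _; case: (tau n w) => // r.
by rewrite lee_fin mulr_ge0.
Qed.

Let indic_lt (r : R) : (fun s => (r < s)%R%:R) = \1_(`]r, +oo[%classic : set R) :> (R -> R).
Proof.
by apply/funext => s; apply/esym/indic_iff; rewrite /= in_itv/= andbT.
Qed.

Let indic_le (r : R) : (fun s => (s <= r)%R%:R) = \1_(`]-oo, r]%classic : set R) :> (R -> R).
Proof.
by apply/funext => s; apply/esym/indic_iff; rewrite /= in_itv/=.
Qed.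

Let measurable_kernS i j n w : measurable_fun setT (fun s : R => kernS i j n s w).
Proof.
rewrite /kernS; case: (_ == _); last exact: measurable_cst.
case: (tau n w) => [r| |]; last 2 first; [exact: measurable_cst..|].
apply/measurable_EFinP; apply: measurable_funM.
  by apply: measurableT_comp => //; exact: measurable_funB.
by rewrite indic_lt; exact: measurable_indic.
Qed.

Lemma intensityE i s w : 0 <= s ->
  intensity tau Z mu phi i s w =
  ((mu i 0)%:E + \sum_(j < d) \sum_(0 <= n <oo) kernS i j n s w)%E.
Proof.
move=> s0; rewrite /intensity; congr (_ + _)%E; apply: eq_bigr => j _.
have mk : measurable_fun (`]0, s[%classic : set R) (fun r => (phi i j (s - r))%:E).
  apply/measurable_EFinP.
  apply: (@eq_measurable_fun _ _ _ _ _ (fun r : R => kern i j (s - r))).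
    move=> r; rewrite inE/= in_itv/= => /andP[r0 rs].
    by rewrite /kern patchE mem_set//= in_itv/= andbT subr_ge0 ltW.
  apply: measurable_funTS; apply: measurableT_comp => //.
  exact: measurable_funB.
rewrite ge0_integral_measure_series//; last first.
  by move=> r; rewrite /= in_itv/= => /andP[_ rs]; rewrite lee_fin phi_ge0// subr_ge0 ltW.
apply: eq_eseriesr => n _; rewrite /kernS; case: ifP => _; last first.
  by rewrite integral_measure_zero.
rewrite /point_mass; move: (tau_gt0 n w); case: (tau n w) => [r r0| |]; rewrite ?integral_measure_zero//.
rewrite integral_dirac//; rewrite diracE.
have [rs|rs] := ltP r s.
  rewrite mem_set/=; last by rewrite in_itv/= rs andbT.
  rewrite mul1e mulr1 /kern patchE mem_set//= in_itv/= andbT subr_ge0.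
  exact: ltW.
by rewrite memNset ?mul0e ?mulr0//= in_itv/= [r < s]ltNge rs andbF.
Qed.

Let integral_kernS i j n u w : 0 <= u ->
  (\int[leb]_(s in `[0%R, u]) kernS i j n s w =
   \int[leb]_x ((kern i j x)%:E * (hit j n (u - x) w)%:E))%E.
Proof.
move=> u0; rewrite /kernS /hit; case: (Z n w == j); last first.
  by rewrite integral0; apply/esym/integral0_eq => x _; rewrite andbF mule0.
move: (tau_gt0 n w); case: (tau n w) => [r r0|_|//]; last first.
  by rewrite integral0; apply/esym/integral0_eq => x _; rewrite leye_eq/= mule0.
pose g x : R := kern i j x * ((0 < x)%R%:R * (x <= u - r)%R%:R).
have mg : measurable_fun setT g.
  apply: measurable_funM => //; apply: measurable_funM.
    by rewrite indic_lt; exact: measurable_indic.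
  by rewrite indic_le; exact: measurable_indic.
have g0 x : 0 <= g x by rewrite !mulr_ge0.
rewrite integral_mkcond.
transitivity (\int[leb]_s (g (s - r))%:E)%E.
  apply: eq_integral => s _; rewrite patchE /g subr_gt0 lerD2r.
  case: ifPn => [|].
    by rewrite inE/= in_itv/= => /andP[s0 ->]; rewrite mulr1.
  rewrite notin_setE/= in_itv/= => /negP; rewrite negb_and -!ltNge => /orP[s0|us].
    by rewrite ltNge (le_trans (ltW s0) (ltW r0)) !(mul0r, mulr0).
  by rewrite [s <= u]leNgt us !mulr0.
rewrite (ge0_integral_shift r (f := EFin \o g)); last 2 first.
- exact/measurable_EFinP.
- by move=> x; rewrite lee_fin.
apply: ge0_ae_eq_integral => //.
- exact/measurable_EFinP.
- apply: emeasurable_funM; first by apply/measurable_EFinP; exact: measurable_kern.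
  apply/measurable_EFinP; rewrite (_ : (fun _ => _) = (fun x => (x <= u - r)%R%:R)); last first.
    by apply/funext => x; rewrite lee_fin andbT lerBrDr -lerBrDl.
  by rewrite indic_le; exact: measurable_indic.
- by move=> x _; rewrite lee_fin.
- by move=> x _; rewrite mule_ge0// lee_fin.
(* The two integrands can differ only at delay 0, because a jump does not contribute to the
   intensity at its own time. *)
exists [set 0]; split => //; first exact: lebesgue_measure_set1.
move=> x; apply: contra_notP => /eqP x0 _ /=.
rewrite /g -EFinM lee_fin andbT lerBrDr -lerBrDl.
have [x_gt0|x_le0] := ltP 0 x; first by rewrite mul1r.
rewrite /kern patchE memNset ?mul0r//= in_itv/= andbT => x_ge0.
by case/eqP: x0; apply/eqP; rewrite eq_le x_le0 x_ge0.
Qed.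

Lemma jump_countE j t w : jump_count tau Z j t w = (\sum_(0 <= n <oo) (hit j n t w)%:E)%E.
Proof. by []. Qed.

Lemma jump_count_ge0 j t w : (0 <= jump_count tau Z j t w)%E.
Proof. by apply: nneseries_ge0 => n _ _; rewrite lee_fin. Qed.

(** All terms are nonnegative, so sums and integrals are exchanged in the extended reals, on
    exploding paths as well. *)
Lemma cumulated_intensity i u w : 0 <= u ->
  (\int[leb]_(s in `[0%R, u]) intensity tau Z mu phi i s w =
   (mu i 0 * u)%:E +
   \sum_(j < d) \int[leb]_x ((kern i j x)%:E * jump_count tau Z j (u - x) w))%E.
Proof.
move=> u0.
under eq_integral => s.
  rewrite inE/= in_itv/= => /andP[s0 _]; rewrite intensityE//.
  over.
have mser j : measurable_fun `[0, u] (fun s => \sum_(0 <= n <oo) kernS i j n s w)%E.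
  apply: ge0_emeasurable_sum => n.
    by move=> x _ _; exact: kernS_ge0.
  by move=> _; apply: measurable_funTS; exact: measurable_kernS.
have ser0 j s : (0 <= \sum_(0 <= n <oo) kernS i j n s w)%E.
  by apply: nneseries_ge0 => n _ _; exact: kernS_ge0.
rewrite ge0_integralD//; last 3 first.
- by move=> s _; rewrite lee_fin.
- by move=> s _; apply: sume_ge0.
- exact: emeasurable_sum.
rewrite integral_cst//= lebesgue_measure_itv/= lte_fin.
congr (_ + _)%E.
  rewrite EFinM; congr (_ * _)%E.
  by move: u0; rewrite le_eqVlt => /predU1P[<-|->]; rewrite ?ltxx ?oppr0 ?adde0.
rewrite ge0_integral_sum//; apply: eq_bigr => j _.
rewrite integral_nneseries//; last first.
  by move=> n; apply: measurable_funTS; exact: measurable_kernS.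
under eq_eseriesr do rewrite integral_kernS//.
transitivity (\int[leb]_x \sum_(0 <= n <oo)
    ((kern i j x)%:E * (hit j n (u - x) w)%:E))%E; last first.
  apply: eq_integral => x _; rewrite jump_countE nneseriesZl//.
  by move=> n _; rewrite lee_fin.
rewrite integral_nneseries//.
- move=> n; apply: emeasurable_funM; first by apply/measurable_EFinP; exact: measurable_kern.
  by apply/measurable_EFinP; exact: measurable_hit_sub.
- by move=> n x _; rewrite mule_ge0// lee_fin.
Qed.

End cumulated_intensity.

(** * Counts and compensators restricted to finitely many jumps *)

Section finite_paths.
Context (R : realType) (disp : measure_display) (Omega : measurableType disp).
Context (d : nat) (tau : nat -> Omega -> \bar R) (Z : nat -> Omega -> 'I_d).
Context (mu : 'cV[R]_d) (phi : 'I_d -> 'I_d -> R -> R).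
Hypothesis mu_ge0 : forall i, 0 <= mu i 0.
Hypothesis phi_ge0 : forall i j (t : R), 0 <= t -> 0 <= phi i j t.
Hypothesis phi_meas : forall i j, measurable_fun (`[0%R, +oo[ : set R) (phi i j).
Hypothesis phi_int : forall i j,
  (\int[lebesgue_measure]_(t in `[0%R, +oo[) (phi i j t)%:E < +oo)%E.
Hypothesis tau_gt0 : forall n w, (0 < tau n w)%E.
Hypothesis tau_nd : forall n w, (tau n w <= tau n.+1 w)%E.
Hypothesis tau_inc : forall n w, (tau n w < +oo)%E -> (tau n w < tau n.+1 w)%E.
Local Notation leb := (@lebesgue_measure R).
Local Notation kern := (kern phi).
Local Notation hit := (hit tau Z).
Local Notation K := (kernel_mass phi).

Lemma integrable_kern i j : leb.-integrable setT (EFin \o kern i j).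
Proof.
apply/integrableP; split; first by apply/measurable_EFinP; exact: measurable_kern.
under eq_integral do rewrite /= ger0_norm ?kern_ge0//.
rewrite (_ : (fun x => _) = (fun x => (phi i j x)%:E) \_ `[0, +oo[); last first.
  by apply/funext => x; rewrite /kern /patch; case: ifP.
by rewrite -integral_mkcond; exact: phi_int.
Qed.

Lemma kernel_massE i j : K i j = \int[leb]_(x in setT) kern i j x.
Proof. by rewrite mxE Rintegral_mkcond. Qed.

Lemma kernel_mass_ge0 i j : 0 <= K i j.
Proof. by rewrite kernel_massE; apply: Rintegral_ge0 => x _; exact: kern_ge0. Qed.

Definition wint i j (f : R -> R) : R := \int[leb]_(x in setT) (kern i j x * f x).

Lemma wint_integrable i j (f : R -> R) (B : R) : measurable_fun setT f ->
  (forall x, 0 <= x -> `|f x| <= B) ->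
  leb.-integrable setT (EFin \o (fun x => kern i j x * f x)).
Proof.
move=> mf fB.
apply: (@le_integrableR _ _ _ leb setT measurableT _ (fun x => kern i j x * B)).
- by apply: measurable_funM => //; exact: measurable_kern.
- move=> x _; rewrite normrM.
  have [x0|x0] := ltP x 0.
    by rewrite /kern patchE memNset ?normr0 ?mul0r//= in_itv/= andbT leNgt x0.
  by rewrite ger0_norm ?kern_ge0// ler_wpM2l ?kern_ge0// fB.
- rewrite (_ : EFin \o _ = (fun x => B%:E * (kern i j x)%:E)%E).
    by apply: integrableZl => //; exact: integrable_kern.
  by apply/funext => x; rewrite -EFinM mulrC.
Qed.

Lemma wint_le i j (f g : R -> R) (B : R) : measurable_fun setT f -> measurable_fun setT g ->
  (forall x, 0 <= x -> `|f x| <= B) -> (forall x, 0 <= x -> `|g x| <= B) ->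
  (forall x, 0 <= x -> f x <= g x) -> wint i j f <= wint i j g.
Proof.
move=> mf mg fB gB fg; apply: le_Rintegral => //; [exact: wint_integrable fB|exact: wint_integrable gB|].
move=> x _; have [x0|x0] := ltP x 0.
  by rewrite /kern patchE memNset ?mul0r//= in_itv/= andbT leNgt x0.
by rewrite ler_wpM2l ?kern_ge0// fg.
Qed.

Lemma wint_cst i j c : wint i j (fun=> c) = K i j * c.
Proof.
rewrite /wint kernel_massE RintegralZr//; exact: integrable_kern.
Qed.

Lemma wintB i j (f g : R -> R) (B : R) : measurable_fun setT f -> measurable_fun setT g ->
  (forall x, 0 <= x -> `|f x| <= B) -> (forall x, 0 <= x -> `|g x| <= B) ->
  wint i j (fun x => f x - g x) = wint i j f - wint i j g.
Proof.
move=> mf mg fB gB; rewrite /wint -RintegralB//.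
- by apply: eq_Rintegral => x _; rewrite mulrBr.
- exact: wint_integrable fB.
- exact: wint_integrable gB.
Qed.

Lemma wint_sum i j p (f : nat -> R -> R) (B : R) :
  (forall k, measurable_fun setT (f k)) ->
  (forall k x, 0 <= x -> `|f k x| <= B) ->
  wint i j (fun x => \sum_(k < p) f k x) = \sum_(k < p) wint i j (f k).
Proof.
move=> mf fB; elim: p => [|p IH].
  rewrite big_ord0 -[RHS](mulr0 (K i j)) -wint_cst; apply: eq_Rintegral => x _.
  by rewrite big_ord0.
rewrite big_ord_recr/= -IH /wint -RintegralD//.
- by apply: eq_Rintegral => x _; rewrite big_ord_recr/= mulrDr.
- apply: (wint_integrable _ _ (B := \sum_(k < p) B)).
    exact: measurable_sum.
  by move=> x x0; apply: (le_trans (ler_norm_sum _ _ _)); apply: ler_sum => k _; exact: fB.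
- by apply: (wint_integrable _ _ (mf p) (B := B)) => x x0; exact: fB.
Qed.

Lemma wint_ge0 i j (f : R -> R) : (forall x, 0 <= x -> 0 <= f x) -> 0 <= wint i j f.
Proof.
move=> f0; apply: Rintegral_ge0 => x _; have [x0|x0] := ltP x 0.
  by rewrite /kern patchE memNset ?mul0r//= in_itv/= andbT leNgt x0.
by rewrite mulr_ge0 ?kern_ge0// f0.
Qed.

(* Uniform absolute continuity of [kern i j]. *)
Lemma kern_window i j (e : R) : 0 < e -> exists2 g : R, 0 < g &
  forall a b, a <= b -> b - a < g ->
    wint i j (fun x => (a < x <= b)%R%:R) <= e.
Proof.
move=> e0.
(* The excess of the kernel over level [n] has small integral for [n] large; below that level a
   window contributes at most [n] times its length. *)
pose f_ n x : R := Num.max 0 (kern i j x - n%:R).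
have mf n : measurable_fun setT (f_ n).
  apply: measurable_maxr => //; apply: measurable_funB => //; exact: measurable_kern.
have f_ge0 n x : 0 <= f_ n x by rewrite le_max lexx.
have f_le n x : `|f_ n x| <= kern i j x.
  by rewrite ger0_norm// ge_max kern_ge0//= lerBlDr lerDl.
have [||||intf cvf] := @Rintegral_dominated _ _ R leb setT measurableT f_ (cst 0) (kern i j) mf.
- exact: measurable_cst.
- apply: aeW => x _.
  apply: (@cvg_near_cst _ R^o) => //.
  have : \forall n \near \oo, kern i j x <= n%:R by exact: nbhs_infty_ger.
  by apply: filterS => n /= xn; rewrite /f_ max_l// subr_le0.
- exact: integrable_kern.
- by apply: aeW => x _ n; exact: f_le.
have {cvf} : \forall n \near \oo, \int[leb]_(x in setT) f_ n x < e / 2.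
  move: cvf; rewrite Rintegral_cst// mul0r => /cvgrPdist_lt/(_ (e/2)).
  rewrite divr_gt0// => /(_ isT); apply: filterS => n.
  by rewrite sub0r normrN; apply: le_lt_trans; rewrite ler_norm.
case=> n _ /(_ n (leqnn n)) /= fne.
exists (e / (2 * n.+1%:R)); first by rewrite divr_gt0.
move=> a b ab bag.
have mI : measurable_fun setT (fun x : R => (a < x <= b)%R%:R : R).
  rewrite (_ : (fun _ => _) = \1_(`]a, b]%classic : set R)).
    exact: measurable_indic.
  by apply/funext => x; apply/esym/indic_iff; rewrite /= in_itv/=.
have If : leb.-integrable setT (EFin \o f_ n).
  exact: (@le_integrableR _ _ _ leb setT measurableT _ (kern i j) (mf n)
    (fun x _ => f_le n x) (integrable_kern i j)).
have II : leb.-integrable setT (EFin \o (\1_(`]a, b]%classic : set R) : R -> R)).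
  exact: integrable_indic_itv.
have IZ : leb.-integrable setT (EFin \o (fun x => n%:R * (\1_(`]a, b]%classic : set R) x : R))).
  exact: (integrableZl _ (n%:R) II).
apply: (@le_trans _ _ (\int[leb]_(x in setT)
    (f_ n x + n%:R * (\1_(`]a, b]%classic : set R) x : R)))).
  apply: le_Rintegral => //.
  - apply: (wint_integrable _ _ (B := 1)) => // x _.
    by case: (_ && _); rewrite ?normr1 ?normr0.
  - exact: (integrableD _ If IZ).
  - move=> x _; rewrite (@indic_iff _ _ _ (a < x <= b)); last by rewrite /= in_itv/=.
    case: (_ && _); last by rewrite !mulr0 addr0.
    by rewrite !mulr1 -lerBlDr le_max lexx orbT.
rewrite RintegralD// RintegralZl//.
have -> : \int[leb]_(x in setT) (\1_(`]a, b]%classic : set R) x : R) =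
    fine (leb (`]a, b]%classic : set R)).
  by rewrite /Rintegral integral_indic// setIT.
rewrite lebesgue_measure_itv/= lte_fin.
rewrite [leRHS](splitr e) lerD//; first exact: ltW.
apply: (@le_trans _ _ (n%:R * (b - a))).
  by case: ifPn => // _; rewrite /= mulr0 mulr_ge0// subr_ge0.
apply: (@le_trans _ _ (n.+1%:R * (e / (2 * n.+1%:R)))).
  by rewrite ler_pM// ?subr_ge0 ?ler_nat// ltW.
by rewrite invfM mulrCA [X in _ * X]mulrCA mulfV ?mulr1// pnatr_eq0.
Qed.

(** Keeping only the first [p] jumps makes every quantity finite before explosion is ruled out. *)
Definition np p j (u : R) w : R := \sum_(k < p) hit j k u w.

Definition lp p i (u : R) w : R :=
  mu i 0 * u + \sum_(j < d) wint i j (fun x => np p j (u - x) w).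

Lemma np_ge0 p j u w : 0 <= np p j u w.
Proof. by apply: sumr_ge0 => k _; exact: hit_ge0. Qed.

Lemma hit_le1 j k u w : hit j k u w <= 1.
Proof. by rewrite /hit; case: (_ && _); rewrite ?ler01. Qed.

Lemma np_le p j u w : np p j u w <= p%:R.
Proof.
apply: (@le_trans _ _ (\sum_(k < p) 1)); last by rewrite sumr_const card_ord.
by apply: ler_sum => k _; exact: hit_le1.
Qed.

Lemma np_abs p j u w : `|np p j u w| <= p%:R.
Proof. by rewrite ger0_norm ?np_ge0// np_le. Qed.

Lemma hit_nd j k u v w : u <= v -> hit j k u w <= hit j k v w.
Proof.
move=> uv; rewrite /hit ler_nat; case: (Z k w == j); last by rewrite !andbF.
rewrite !andbT; case: leP => // ku.
by rewrite (le_trans ku)// lee_fin.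
Qed.

Lemma np_nd p j u v w : u <= v -> np p j u w <= np p j v w.
Proof. by move=> uv; apply: ler_sum => k _; exact: hit_nd. Qed.

Lemma np0 p j u w : u <= 0 -> np p j u w = 0.
Proof.
move=> u0; rewrite /np big1// => k _; rewrite /hit.
by rewrite leNgt (le_lt_trans _ (tau_gt0 k w)) ?lee_fin.
Qed.

Lemma measurable_np_sub p j (u : R) (w : Omega) :
  measurable_fun setT (fun x : R => np p j (u - x) w).
Proof. by apply: measurable_sum => k; exact: measurable_hit_sub. Qed.

Lemma lp_le p i u w :
  lp p i u w <= mu i 0 * u + \sum_(j < d) K i j * np p j u w.
Proof.
rewrite lerD2l; apply: ler_sum => j _; rewrite -wint_cst.
apply: (wint_le _ _ (B := p%:R)) => //.
- exact: measurable_np_sub.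
- by move=> x x0; exact: np_abs.
- by move=> x x0; exact: np_abs.
- by move=> x x0; apply: np_nd; rewrite gerBl.
Qed.

Lemma lp_ge0 p i u w : 0 <= u -> 0 <= lp p i u w.
Proof.
move=> u0; rewrite addr_ge0// ?mulr_ge0// sumr_ge0// => j _.
by apply: wint_ge0 => x _; exact: np_ge0.
Qed.

Lemma lp_nd p i u v w : u <= v -> lp p i u w <= lp p i v w.
Proof.
move=> uv; rewrite lerD ?ler_wpM2l//; apply: ler_sum => j _.
apply: (wint_le _ _ (B := p%:R)); try by move=> x _; exact: np_abs.
- exact: measurable_np_sub.
- exact: measurable_np_sub.
- by move=> x _; apply: np_nd; rewrite lerD2r.
Qed.

(** Each jump contributes to an increment of the compensator the mass of the kernel on a window of
    length [b - a], which is uniformly small by [kern_window]. *)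
Lemma lp_unif p i w (e : R) : 0 < e -> exists2 g : R, 0 < g &
  forall a b, a <= b -> b - a < g -> lp p i b w - lp p i a w <= e.
Proof.
move=> e0.
(* One share for the drift and one for each pair of a mark and a jump. *)
pose e' := e / (d * p).+1%:R.
have e'0 : 0 < e' by rewrite divr_gt0.
have : exists2 g : R, 0 < g & forall j a b, a <= b -> b - a < g ->
    wint i j (fun x => (a < x <= b)%R%:R) <= e'.
  suff : forall s : seq 'I_d, exists2 g : R, 0 < g & forall j, j \in s ->
      forall a b, a <= b -> b - a < g -> wint i j (fun x => (a < x <= b)%R%:R) <= e'.
    move=> /(_ (enum 'I_d))[g g0 gP]; exists g => // j.
    by apply: gP; rewrite mem_enum.
  elim=> [|j s [g g0 gP]]; first by exists 1.
  have [g' g'0 g'P] := kern_window i j e'0.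
  exists (Num.min g g'); first by rewrite lt_min g0.
  move=> j'; rewrite inE => /predU1P[->|j's] a b ab; rewrite lt_min => /andP[? ?].
    exact: g'P.
  exact: gP.
move=> [g g0 gP].
exists (Num.min g (e' / (mu i 0 + 1))).
  by rewrite lt_min g0 divr_gt0// ltr_wpDl.
move=> a b ab; rewrite lt_min => /andP[bag bam].
rewrite /lp opprD addrACA -mulrBr -sumrB.
have -> : e = e' + \sum_(j < d) \sum_(k < p) e'.
  rewrite !sumr_const !card_ord -mulrnA -mulrS -mulr_natl mulnC.
  by rewrite /e' mulrC divfK// pnatr_eq0.
apply: lerD.
  apply: (@le_trans _ _ ((mu i 0 + 1) * (b - a))).
    by rewrite ler_wpM2r ?subr_ge0// lerDl.
  by rewrite mulrC -ler_pdivlMr ?ltr_wpDl// ltW.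
apply: ler_sum => j _.
rewrite -(wintB _ _ (B := p%:R)); try by move=> x _; exact: np_abs.
all: try exact: measurable_np_sub.
rewrite (_ : (fun x => _) = (fun x => \sum_(k < p)
    (hit j k (b - x) w - hit j k (a - x) w))); last first.
  by apply/funext => x; rewrite -sumrB.
have mh k : measurable_fun setT (fun x : R => hit j k (b - x) w - hit j k (a - x) w).
  by apply: measurable_funB; exact: measurable_hit_sub.
have hB k (x : R) : 0 <= x -> `|hit j k (b - x) w - hit j k (a - x) w| <= 1.
  move=> _; rewrite ger0_norm; last by rewrite subr_ge0 hit_nd// lerD2r.
  by rewrite lerBlDr (le_trans (hit_le1 _ _ _ _))// lerDl hit_ge0.
rewrite (wint_sum _ _ _ mh hB).
apply: ler_sum => k _.
case tk: (tau k w) (tau_gt0 k w) => [r|  |//] _; last first.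
  rewrite (_ : (fun x => _) = fun=> 0); first by rewrite wint_cst mulr0 ltW.
  by apply/funext => x; rewrite /hit tk !leye_eq/= subrr.
(* A jump at [r] is counted at [b - x] but not at [a - x] exactly when [a - r < x <= b - r]. *)
apply: le_trans (gP j (a - r) (b - r) _ _); last 2 first.
- by rewrite lerD2r.
- by rewrite opprB addrA subrK.
apply: (wint_le _ _ (B := 1)).
- exact: mh.
- rewrite (_ : (fun _ => _) = \1_(`]a - r, b - r]%classic : set R)).
    exact: measurable_indic.
  by apply/funext => x; apply/esym/indic_iff; rewrite /= in_itv/=.
- exact: hB.
- by move=> x _; case: (_ && _); rewrite ?normr1 ?normr0.
move=> x _; rewrite /hit tk !lee_fin ![r <= _]lerBrDr -![r + x <= _]lerBrDl.
case: (Z k w == j); rewrite ?andbF ?subrr// !andbT.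
have [xa|xa] := leP x (a - r).
  by rewrite (le_trans xa) ?lerD2r// subrr.
by case: (x <= b - r); rewrite subr0.
Qed.

End finite_paths.

(** * Quadratic variation of a path with isolated unit jumps *)

Section path_quadratic_variation.
Context (R : realType) (d : nat) (n l : 'I_d -> R -> R) (s t : R).
Context (theta : 'I_d -> R).
Hypothesis st : s <= t.
Hypothesis n_nd : forall i a b, s <= a -> a <= b -> b <= t -> n i a <= n i b.
Hypothesis l_nd : forall i a b, s <= a -> a <= b -> b <= t -> l i a <= l i b.

(** At most one coordinate jumps in a short window, and by one unit. Hence cross terms vanish and
    the square of [\sum theta_i dn_i] is [\sum theta_i ^ 2 dn_i]. *)
Definition sparse : Prop := exists2 g : R, 0 < g &
  forall a b, s <= a -> a <= b -> b <= t -> b - a < g ->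
    (forall i, n i b - n i a = 0) \/
    (exists i0, forall i, n i b - n i a = (i == i0)%:R).

Definition unif_cont : Prop := forall i (e : R), 0 < e -> exists2 g : R, 0 < g &
  forall a b, s <= a -> a <= b -> b <= t -> b - a < g -> l i b - l i a <= e.

Hypothesis n_sparse : sparse.
Hypothesis l_unif : unif_cont.

(** There are [r.+1] cells, so the mesh is meaningful for every [r] and the last point has index
    [r.+1]. *)
Definition grid (r k : nat) : R := s + (t - s) * (k%:R / r.+1%:R).

Lemma grid0 r : grid r 0 = s.
Proof. by rewrite /grid mul0r mulr0 addr0. Qed.

Lemma gridn r : grid r r.+1 = t.
Proof. by rewrite /grid divff ?pnatr_eq0// mulr1 addrC subrK. Qed.

Lemma grid_le r j k : (j <= k)%N -> grid r j <= grid r k.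
Proof.
by move=> jk; rewrite lerD2l ler_wpM2l ?subr_ge0// ler_wpM2r// ler_nat.
Qed.

Lemma grid_ge r k : s <= grid r k.
Proof. by rewrite -(grid0 r) grid_le. Qed.

Lemma grid_le_end r k : (k <= r.+1)%N -> grid r k <= t.
Proof. by move=> kr; rewrite -[leRHS](gridn r) grid_le. Qed.

Lemma grid_step r k : grid r k.+1 - grid r k = (t - s) / r.+1%:R.
Proof.
rewrite /grid opprD addrACA subrr add0r -mulrBr -mulrBl -natrB// subSnn.
by rewrite mul1r.
Qed.

Lemma grid_mesh (g : R) : 0 < g -> \forall r \near \oo, forall k, grid r k.+1 - grid r k < g.
Proof.
move=> g0; have : \forall r \near \oo, (t - s) / g + 1 <= r%:R by exact: nbhs_infty_ger.
apply: filterS => r /= gr k; rewrite grid_step ltr_pdivrMr//.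
rewrite mulrC -ltr_pdivrMr//.
by rewrite (lt_le_trans _ (le_trans gr _)) ?ltrDl// ler_nat.
Qed.

Lemma sum_grid (f : R -> R) r :
  \sum_(k < r.+1) (f (grid r k.+1) - f (grid r k)) = f t - f s.
Proof.
have H m : \sum_(k < m) (f (grid r k.+1) - f (grid r k)) = f (grid r m) - f (grid r 0).
  elim: m => [|m IH]; first by rewrite big_ord0 subrr.
  by rewrite big_ord_recr/= IH; ring.
by rewrite H gridn grid0.
Qed.

Definition ypath u := \sum_i theta i * (n i u - l i u).
Definition dy r k := ypath (grid r k.+1) - ypath (grid r k).

Let S := \sum_i `|theta i|.
Let dn r k i := n i (grid r k.+1) - n i (grid r k).
Let dl r k i := l i (grid r k.+1) - l i (grid r k).

Let dyE r k : dy r k = \sum_i theta i * dn r k i - \sum_i theta i * dl r k i.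
Proof.
rewrite /dy /ypath -!sumrB; apply: eq_bigr => i _.
by rewrite /dn /dl; ring.
Qed.

Let small (e : R) : 0 < e -> \forall r \near \oo, forall k, (k < r.+1)%N ->
  (forall i, 0 <= dl r k i <= e) /\
  ((forall i, dn r k i = 0) \/ (exists i0, forall i, dn r k i = (i == i0)%:R)).
Proof.
move=> e0.
have [g g0 gP] := n_sparse.
have : exists2 g' : R, 0 < g' & forall i a b, s <= a -> a <= b -> b <= t ->
    b - a < g' -> l i b - l i a <= e.
  suff : forall q : seq 'I_d, exists2 g' : R, 0 < g' & forall i, i \in q ->
      forall a b, s <= a -> a <= b -> b <= t -> b - a < g' -> l i b - l i a <= e.
    move=> /(_ (enum 'I_d))[g' g'0 g'P]; exists g' => // j.
    by apply: g'P; rewrite mem_enum.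
  elim=> [|j q [g1 g10 g1P]]; first by exists 1.
  have [g2 g20 g2P] := l_unif j e0.
  exists (Num.min g1 g2); first by rewrite lt_min g10.
  move=> j'; rewrite inE => /predU1P[->|j's] a b sa ab bt; rewrite lt_min => /andP[? ?].
    exact: g2P.
  exact: g1P.
move=> [g' g'0 g'P].
apply: filterS2 (grid_mesh g0) (grid_mesh g'0) => r gr g'r k kr; split.
  move=> i; rewrite /dl subr_ge0 l_nd ?grid_ge ?grid_le ?grid_le_end//=.
  by apply: g'P; rewrite ?grid_ge ?grid_le ?grid_le_end.
by apply: gP; rewrite ?grid_ge ?grid_le ?grid_le_end.
Qed.

Let S_ge i : `|theta i| <= S.
Proof. by rewrite /S (bigD1 i)//= lerDl sumr_ge0. Qed.

Let S_ge0 : 0 <= S. Proof. exact: sumr_ge0. Qed.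

Lemma dy_small : \forall r \near \oo, forall k, (k < r.+1)%N -> `|dy r k| <= 2 * S.
Proof.
apply: filterS (small ltr01) => r H k /H[dl01 dnP].
rewrite dyE (le_trans (ler_normB _ _))// mulr2n mulrDl mul1r lerD//.
  case: dnP => [dn0|[i0 dn1]].
    by rewrite big1 ?normr0// => i _; rewrite dn0 mulr0.
  rewrite (bigD1 i0)//= big1 ?addr0 ?dn1 ?eqxx ?mulr1// => i ii0.
  by rewrite dn1 (negbTE ii0) mulr0.
rewrite (le_trans (ler_norm_sum _ _ _))// ler_sum// => i _.
have /andP[l0 l1] := dl01 i.
by rewrite normrM (ger0_norm l0) ler_piMr.
Qed.

(** On a fine cell the increment is [v - b], with [v] from at most one unit jump and [b] from the
    continuous part. Then [v ^ 2] is exactly the share of the cell in the limit, and the error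
    [2 v b - b ^ 2] is a small factor times the variation over the cell. *)
Lemma quadratic_variation :
  \sum_(k < r.+1) dy r k ^+ 2 @[r --> \oo] -->
  \sum_i theta i ^+ 2 * (n i t - n i s).
Proof.
(* With continuous increments at most [e / (C + 1)], the errors of all cells add up to
   [C e / (C + 1)]. *)
pose C := S ^+ 2 * (2 * (\sum_i (n i t - n i s)) + \sum_i (l i t - l i s)).
have C0 : 0 <= C.
  rewrite mulr_ge0 ?sqr_ge0// addr_ge0// ?mulr_ge0// sumr_ge0// => i _.
    by rewrite subr_ge0 n_nd.
  by rewrite subr_ge0 l_nd.
apply/cvgrPdist_le => e e0.
have e1 : 0 < e / (C + 1) by rewrite divr_gt0// ltr_wpDl.
apply: filterS (small e1) => r H.
have -> : \sum_i theta i ^+ 2 * (n i t - n i s) =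
    \sum_(k < r.+1) \sum_i theta i ^+ 2 * dn r k i.
  rewrite exchange_big/=; apply: eq_bigr => i _; rewrite -mulr_sumr.
  by rewrite /dn sum_grid.
rewrite -sumrB.
apply: (@le_trans _ _ (\sum_(k < r.+1) S ^+ 2 * (e / (C + 1)) *
    (2 * (\sum_i dn r k i) + \sum_i dl r k i))); last first.
  have E1 : \sum_(k < r.+1) \sum_i dn r k i = \sum_i (n i t - n i s).
    by rewrite exchange_big/=; apply: eq_bigr => i _; rewrite -(sum_grid (n i) r).
  have E2 : \sum_(k < r.+1) \sum_i dl r k i = \sum_i (l i t - l i s).
    by rewrite exchange_big/=; apply: eq_bigr => i _; rewrite -(sum_grid (l i) r).
  rewrite -mulr_sumr big_split/= E2.
  have -> : \sum_(k < r.+1) 2 * (\sum_i dn r k i) = 2 * \sum_i (n i t - n i s).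
    by rewrite -E1 mulr_sumr.
  rewrite mulrAC -/C mulrCA ger_pMr// ler_pdivrMr ?ltr_wpDl//.
  by rewrite mul1r lerDl.
rewrite (le_trans (ler_norm_sum _ _ _))// ler_sum// => k _.
have [dlP dnP] := H k (ltn_ord k).
set v := \sum_i theta i * dn r k i.
set b := \sum_i theta i * dl r k i.
have dl0 i : 0 <= dl r k i by have /andP[] := dlP i.
have dn0 i : 0 <= dn r k i.
  by rewrite subr_ge0 n_nd ?grid_ge ?grid_le ?grid_le_end.
have vE : v ^+ 2 = \sum_i theta i ^+ 2 * dn r k i.
  rewrite /v; case: dnP => [dn00|[i0 dn1]].
    rewrite big1 ?expr0n => [|i _]; last by rewrite dn00 mulr0.
    by rewrite big1// => i _; rewrite dn00 mulr0.
  rewrite (bigD1 i0)//= big1 => [|i ii0]; last by rewrite dn1 (negbTE ii0) mulr0.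
  rewrite [RHS](bigD1 i0)//= big1 => [|i ii0]; last by rewrite dn1 (negbTE ii0) mulr0.
  by rewrite !addr0 dn1 eqxx !mulr1.
have vS : `|v| <= S * \sum_i dn r k i.
  rewrite (le_trans (ler_norm_sum _ _ _))// mulr_sumr ler_sum// => i _.
  by rewrite normrM (ger0_norm (dn0 i)) ler_wpM2r.
have bS : `|b| <= S * \sum_i dl r k i.
  rewrite (le_trans (ler_norm_sum _ _ _))// mulr_sumr ler_sum// => i _.
  by rewrite normrM (ger0_norm (dl0 i)) ler_wpM2r.
have be : `|b| <= S * (e / (C + 1)).
  rewrite (le_trans (ler_norm_sum _ _ _))// mulr_suml ler_sum// => i _.
  by have /andP[? ?] := dlP i; rewrite normrM (ger0_norm (dl0 i)) ler_wpM2l.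
rewrite dyE -/v -/b -vE.
rewrite (_ : _ - _ = 2 * (v * b) - b * b); last by ring.
rewrite (le_trans (ler_normB _ _))// !normrM.
rewrite [X in X * (_ * _)]ger0_norm//.
rewrite mulrDr lerD//.
  rewrite (_ : S ^+ 2 * _ * _ = 2 * ((S * \sum_i dn r k i) * (S * (e / (C + 1))))); last by ring.
  by rewrite ler_wpM2l// ler_pM.
rewrite (_ : S ^+ 2 * _ * _ = (S * \sum_i dl r k i) * (S * (e / (C + 1)))); last by ring.
by rewrite ler_pM.
Qed.

End path_quadratic_variation.

(** * Jump times, stopping and the history *)

Section jump_paths.
Context (R : realType) (disp : measure_display) (Omega : measurableType disp).
Context (P : probability Omega R).
Context (d : nat) (tau : nat -> Omega -> \bar R) (Z : nat -> Omega -> 'I_d).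
Context (mu : 'cV[R]_d) (phi : 'I_d -> 'I_d -> R -> R).
Hypothesis mu_ge0 : forall i, 0 <= mu i 0.
Hypothesis phi_ge0 : forall i j (t : R), 0 <= t -> 0 <= phi i j t.
Hypothesis phi_meas : forall i j, measurable_fun (`[0%R, +oo[ : set R) (phi i j).
Hypothesis phi_int : forall i j,
  (\int[lebesgue_measure]_(t in `[0%R, +oo[) (phi i j t)%:E < +oo)%E.
Hypothesis tau_meas : forall n, measurable_fun setT (tau n).
Hypothesis Z_meas : forall n i, measurable (Z n @^-1` [set i]).
Hypothesis tau_gt0 : forall n w, (0 < tau n w)%E.
Hypothesis tau_nd : forall n w, (tau n w <= tau n.+1 w)%E.
Hypothesis tau_inc : forall n w, (tau n w < +oo)%E -> (tau n w < tau n.+1 w)%E.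
Local Notation leb := (@lebesgue_measure R).
Local Notation kern := (kern phi).
Local Notation hit := (hit tau Z).
Local Notation np := (np tau Z).
Local Notation lp := (lp tau Z mu phi).
Local Notation K := (kernel_mass phi).
Local Notation stop := (stopped_time tau).

Lemma tau_mono n k w : (n <= k)%N -> (tau n w <= tau k w)%E.
Proof.
move=> /subnK <-; elim: (k - n)%N => [|m IH]; first by rewrite add0n.
by rewrite addSn (le_trans IH).
Qed.

Lemma tau_mono_lt n k w : (n < k)%N -> (tau n w < +oo)%E -> (tau n w < tau k w)%E.
Proof. by move=> nk /tau_inc /lt_le_trans; apply; exact: tau_mono. Qed.

(** Windows narrower than [g] contain at most one of the first [p] jump times, which yields
    [np_sparse]. *)
Lemma tau_gap p w : exists2 g : R, 0 < g & forall k k', (k < k' < p)%N ->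
  forall r r', tau k w = r%:E -> tau k' w = r'%:E -> g <= r' - r.
Proof.
elim: p => [|p [g g0 gP]]; first by exists 1 => // k k'; rewrite ltn0 andbF.
case: p gP => [|p] gP.
  by exists 1 => // k [|k'] /andP[].
have [taup|taup] := ltP (tau p.+1 w) +oo%E; last first.
  exists g => // k k' /andP[kk']; rewrite ltnS leq_eqVlt => /predU1P[->|k'p].
    by move=> r r' _ tr'; move: taup; rewrite tr' leNgt ltry.
  by apply: gP; rewrite kk'.
have pp1 : (tau p w < tau p.+1 w)%E.
  by apply: tau_inc; apply: le_lt_trans taup.
case tp : (tau p w) (tau_gt0 p w) pp1 => [r| |//] _; last by rewrite ltNge leey.
case tp1 : (tau p.+1 w) taup => [r'| |] //= _; rewrite lte_fin => rr'.
exists (Num.min g (r' - r)); first by rewrite lt_min g0 subr_gt0.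
move=> k k' /andP[kk']; rewrite ltnS leq_eqVlt => /predU1P[k'E|k'p] x x' tx tx'.
  rewrite ge_min; apply/orP; right.
  move: tx'; rewrite k'E tp1 => -[<-]; rewrite lerD2l lerN2 -lee_fin -tp -tx.
  by apply: tau_mono; rewrite -ltnS -k'E.
by rewrite ge_min (gP k k') ?kk'.
Qed.

Lemma hit_diff i k (a b : R) w : a <= b ->
  hit i k b w - hit i k a w = ((a%:E < tau k w <= b%:E)%E && (Z k w == i))%:R.
Proof.
move=> ab; rewrite /hit; case: (Z k w == i); last by rewrite !andbF subrr.
rewrite !andbT; have [ka|ka] := leP (tau k w) a%:E; last by rewrite subr0.
by rewrite (le_trans ka) ?lee_fin// subrr.
Qed.

Lemma np_sparse p s t w : sparse (fun i u => np p i u w) s t.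
Proof.
have [g g0 gP] := tau_gap p w.
exists g => // a b _ ab _ bag.
have dE i : np p i b w - np p i a w =
    \sum_(k < p) ((a%:E < tau k w <= b%:E)%E && (Z k w == i))%:R.
  by rewrite /np -sumrB; apply: eq_bigr => k _; rewrite hit_diff.
have [/existsP[k0 k0P]|] := boolP [exists k : 'I_p, (a%:E < tau k w <= b%:E)%E]; last first.
  rewrite negb_exists => /forallP kP; left => i.
  by rewrite dE big1// => k _; rewrite (negbTE (kP k)).
right; exists (Z k0 w) => i; rewrite dE (bigD1 k0)//= k0P/= eq_sym big1 ?addr0//.
move=> k kk0; case kP : (_ < _ <= _)%E => //=.
have fin x : (a%:E < tau x w <= b%:E)%E -> exists2 r, tau x w = r%:E & a < r <= b.
  by case: (tau x w) => [r|/andP[]//|/andP[]//]; rewrite lte_fin lee_fin; exists r.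
have [r0 k0E /andP[r0a r0b]] := fin _ k0P.
have [r kE /andP[ra rb]] := fin _ kP.
have [kk0'|kk0'|kk0'] := ltngtP k k0; last first.
- by move/eqP: kk0; case; apply/val_inj.
- have := gP k0 k; rewrite kk0' ltn_ord/= => /(_ isT _ _ k0E kE).
  by rewrite leNgt (le_lt_trans _ bag)// lerD// lerN2 ltW.
- have := gP k k0; rewrite kk0' ltn_ord/= => /(_ isT _ _ kE k0E).
  by rewrite leNgt (le_lt_trans _ bag)// lerD// lerN2 ltW.
Qed.

Lemma stop_le n t w : stop n t w <= t.
Proof.
rewrite /stopped_time; case tE : (tau n w) (tau_gt0 n w) => [r| |] // _.
  by rewrite -EFin_min /= ge_min lexx.
by rewrite miney.
Qed.

Lemma stop_ge0 n t w : 0 <= t -> 0 <= stop n t w.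
Proof.
move=> t0; rewrite /stopped_time; case tE : (tau n w) (tau_gt0 n w) => [r| |] //.
  by rewrite lte_fin => r0; rewrite -EFin_min /= le_min t0 ltW.
by rewrite miney.
Qed.

Lemma stopE n t w : (t%:E <= tau n w)%E -> stop n t w = t.
Proof. by move=> tn; rewrite /stopped_time min_l. Qed.

Lemma stop_nd n a b w : a <= b -> stop n a w <= stop n b w.
Proof.
move=> ab; rewrite /stopped_time; case tE : (tau n w) (tau_gt0 n w) => [r| |] // _.
  rewrite -!EFin_min /= le_min ge_min ab/= ge_min lexx orbT//.
by rewrite !miney.
Qed.

Lemma stop_lip n a b w : a <= b -> stop n b w - stop n a w <= b - a.
Proof.
move=> ab; rewrite /stopped_time; case tE : (tau n w) (tau_gt0 n w) => [r| |] // _.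
  rewrite -!EFin_min /= /Num.min; case: ltP => ?; case: ltP => ?; lra.
by rewrite !miney.
Qed.

Lemma hit_stop i n k t w : (k <= n)%N -> hit i k (stop n t w) w = hit i k t w.
Proof.
move=> kn; rewrite /hit; congr ((nat_of_bool (_ && _))%:R).
have := tau_mono w kn.
rewrite /stopped_time; case tE : (tau n w) (tau_gt0 n w) => [r| |] // _ kr.
  by rewrite -EFin_min EFin_min le_min kr andbT.
by rewrite miney.
Qed.

Lemma hit_stop0 i n k t w : (n < k)%N -> hit i k (stop n t w) w = 0.
Proof.
move=> nk; rewrite /hit leNgt.
suff -> : ((stop n t w)%:E < tau k w)%E by [].
rewrite /stopped_time; case tE : (tau n w) (tau_gt0 n w) => [r| |] // _.
  apply: (@le_lt_trans _ _ (tau n w)).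
    by rewrite tE -EFin_min lee_fin /= ge_min lexx orbT.
  by apply: tau_mono_lt => //; rewrite tE ltry.
rewrite miney/= (lt_le_trans (ltry t))// -tE.
by apply: tau_mono; exact: ltnW.
Qed.

Lemma jump_count_np i p u w : (forall k, (p <= k)%N -> hit i k u w = 0) ->
  jump_count tau Z i u w = (np p i u w)%:E.
Proof.
move=> h0; rewrite jump_countE (nneseries_split 0 p); last by move=> k _; rewrite lee_fin.
rewrite add0n [X in (_ + X)%E]eseries0 ?adde0; last by move=> k pk _; rewrite h0.
by rewrite big_mkord sumEFin.
Qed.

Lemma hit0_mono i k u v w : v <= u -> hit i k u w = 0 -> hit i k v w = 0.
Proof.
move=> vu h0; apply/eqP; rewrite eq_le hit_ge0 andbT.
by rewrite -h0 hit_nd.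
Qed.

Lemma cumulated_intensity_lp i p u w : 0 <= u ->
  (forall j k, (p <= k)%N -> hit j k u w = 0) ->
  (\int[leb]_(s in `[0%R, u]) intensity tau Z mu phi i s w = (lp p i u w)%:E)%E.
Proof.
move=> u0 h0; rewrite cumulated_intensity// /lp EFinD -sumEFin; congr (_ + _)%E.
apply: eq_bigr => j _.
rewrite /wint /Rintegral fineK.
  apply: eq_integral => x _; have [x0|x0] := ltP x 0.
    by rewrite /Submission.kern patchE memNset ?mul0r ?mul0e//= in_itv/= andbT leNgt x0.
  rewrite (jump_count_np (p := p)) ?EFinM// => k pk.
  by apply: (hit0_mono (u := u)); [rewrite gerBl | exact: h0].
apply: integrable_fin_num => //.
apply: (wint_integrable phi_ge0 phi_meas phi_int _ _ (B := p%:R)) => //.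
- exact: measurable_np_sub.
- by move=> x _; exact: np_abs.
Qed.

(** Indices start at 0, so stopping at [tau n] keeps the jumps of index 0 to [n], which explains
    [n.+1]. *)
Definition Lst n i t w : R := lp n.+1 i (stop n t w) w.
Definition Mst n i t w : R := np n.+1 i t w - Lst n i t w.

Lemma np_stop n i t w : np n.+1 i (stop n t w) w = np n.+1 i t w.
Proof. by apply: eq_bigr => k _; rewrite hit_stop// -ltnS. Qed.

Lemma compensatedE n i t w : 0 <= t ->
  compensated tau Z mu phi n i t w = (Mst n i t w)%:E.
Proof.
move=> t0; rewrite /compensated /Mst /Lst.
rewrite (@jump_count_np i n.+1); last by move=> k nk; exact: hit_stop0.
rewrite (@cumulated_intensity_lp i n.+1) ?stop_ge0//; last by move=> j k nk; exact: hit_stop0.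
by rewrite np_stop.
Qed.

Lemma Lst_ge0 n i t w : 0 <= t -> 0 <= Lst n i t w.
Proof. by move=> t0; apply: lp_ge0 => //; exact: stop_ge0. Qed.

Lemma Lst_le n i t w : 0 <= t ->
  Lst n i t w <= mu i 0 * t + \sum_(j < d) K i j * np n.+1 j t w.
Proof.
move=> t0; apply: (le_trans (lp_le Z mu phi_ge0 phi_meas phi_int tau_gt0 _ _ _ _)).
rewrite lerD ?ler_wpM2l ?stop_le// ler_sum// => j _.
by rewrite np_stop.
Qed.

Lemma Lst_nd n i a b w : a <= b -> Lst n i a w <= Lst n i b w.
Proof. by move=> ab; apply: lp_nd => //; exact: stop_nd. Qed.

Lemma Lst_unif n s t w : unif_cont (fun i u => Lst n i u w) s t.
Proof.
move=> i e e0; have [g g0 gP] := lp_unif Z mu_ge0 phi_ge0 phi_meas phi_int tau_gt0 n.+1 i w e0.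
exists g => // a b _ ab _ bag; apply: gP; first exact: stop_nd.
by rewrite (le_lt_trans _ bag)// stop_lip.
Qed.

Lemma lp_unif_cont p s t w : unif_cont (fun i u => lp p i u w) s t.
Proof.
move=> i e e0; have [g g0 gP] := lp_unif Z mu_ge0 phi_ge0 phi_meas phi_int tau_gt0 p i w e0.
by exists g => // a b _ ab _ bag; exact: gP.
Qed.

Lemma measurable_hit i k t : measurable_fun setT (hit i k t).
Proof.
rewrite (_ : hit i k t = \1_([set w | (tau k w <= t%:E)%E] `&` (Z k @^-1` [set i]))).
  apply: measurable_indic; apply: measurableI; last exact: Z_meas.
  rewrite -[X in measurable X]setTI; apply: emeasurable_fun_infty_c => //.
apply/funext => w; apply/esym/indic_iff => /=.
by split => [[-> ->]|/andP[-> /eqP ->]]; rewrite ?eqxx.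
Qed.

Lemma measurable_np p i t : measurable_fun setT (np p i t).
Proof. by apply: measurable_sum => k; exact: measurable_hit. Qed.

Lemma measurable_jump_count i t : measurable_fun setT (jump_count tau Z i t).
Proof.
apply: ge0_emeasurable_sum => n; first by move=> x _ _; rewrite lee_fin.
by move=> _; apply/measurable_EFinP; exact: measurable_hit.
Qed.

(** The generators of [history]: measurability with respect to a sub-sigma-algebra is expressed by
    [Gm] through a generating family. *)
Definition past (t : R) : set (set Omega) :=
  \bigcup_(p in [set p : 'I_d * R | 0 <= p.2 <= t])
        preimage_set_system setT (jump_count tau Z p.1 p.2) measurable.

Lemma historyE t : history tau Z t = <<s past t >>. Proof. by []. Qed.

Lemma past_measurable t : <<s past t >> `<=` measurable.
Proof.
apply: smallest_sub; first exact: sigma_algebra_measurable.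
by move=> _ [[i u] _ [B mB <-]]; apply: measurable_jump_count.
Qed.

Lemma past_nd s t : s <= t -> <<s past s >> `<=` <<s past t >>.
Proof.
move=> st; apply: sub_smallest2r; first exact: smallest_sigma_algebra.
by move=> A [p /andP[p0 ps] pA]; exists p => //=; rewrite p0 (le_trans ps).
Qed.

End jump_paths.

(** * Martingales with unit jumps *)

Section trigonometric_bounds.
Context (R : realType).
Implicit Types (a b x h : R).

Lemma MVT_between (f df : R -> R) a b : (forall x, is_derive x (1 : R) f (df x)) ->
  exists2 c, f b - f a = df c * (b - a) &
    (a <= c <= b) || (b <= c <= a).
Proof.
move=> fdf.
have cf : continuous f.
  move=> x; apply: differentiable_continuous; apply/derivable1_diffP.
  by have [] := fdf x.
have [ab|/ltW ba] := leP a b.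
  have [c + ->] := MVT_segment ab (fun x _ => fdf x) (continuous_subspaceT cf).
  by rewrite in_itv/= => cab; exists c; rewrite ?cab.
have [c + E] := MVT_segment ba (fun x _ => fdf x) (continuous_subspaceT cf).
rewrite in_itv/= => cab; exists c; last by rewrite cab orbT.
by rewrite -opprB E; ring.
Qed.

Lemma cos_lip a b : `|cos a - cos b| <= `|a - b|.
Proof.
have [c -> _] := @MVT_between cos (fun x => - sin x) b a (fun x => is_derive_cos x).
by rewrite normrM ler_piMl// normrN sin_max.
Qed.

Lemma sin_lip a b : `|sin a - sin b| <= `|a - b|.
Proof.
have [c -> _] := @MVT_between sin (@cos R) b a (fun x => is_derive_sin x).
by rewrite normrM ler_piMl// cos_max.
Qed.

Lemma sin_le_norm h : `|sin h| <= `|h|.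
Proof. by have := sin_lip h 0; rewrite sin0 !subr0. Qed.

Lemma one_sub_cos h : 1 - cos h = 2 * sin (h / 2) ^+ 2.
Proof.
rewrite -[in LHS](divfK (_ : 2 != 0 :> R) h) ?pnatr_eq0// mulr_natr cos_mulr2n.
by rewrite cos2sin2; ring.
Qed.

Lemma one_sub_cos_ge0 h : 0 <= 1 - cos h.
Proof. by rewrite subr_ge0 cos_le1. Qed.

Lemma one_sub_cos_le h : 1 - cos h <= h ^+ 2 / 2.
Proof.
rewrite one_sub_cos.
have : sin (h / 2) ^+ 2 <= (h / 2) ^+ 2.
  by rewrite -[leLHS]real_normK ?num_real// -[leRHS]real_normK ?num_real// lerXn2r ?nnegrE// sin_le_norm.
by lra.
Qed.

Lemma sin_sub_le h : `|sin h - h| <= `|h| ^+ 3 / 2.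
Proof.
have D x : is_derive x (1 : R) (fun x => sin x - x) (cos x - 1).
  by apply: is_deriveB.
have [c + cP] := @MVT_between _ _ 0 h D; rewrite sin0 !subr0 => ->.
rewrite normrM (distrC (cos c)) (ger0_norm (one_sub_cos_ge0 c)).
rewrite (_ : `|h| ^+ 3 / 2 = `|h| ^+ 2 / 2 * `|h|); last by field.
rewrite ler_wpM2r//.
apply: (le_trans (one_sub_cos_le c)); rewrite ler_wpM2r//.
rewrite -[leLHS]real_normK ?num_real// lerXn2r ?nnegrE//.
have [h0|h0] := leP 0 h.
  have : 0 <= c <= h by move: cP => /orP[//|/andP[? ?]]; apply/andP; split; lra.
  by move=> /andP[c0 ch]; rewrite !ger0_norm.
have : h <= c <= 0 by move: cP => /orP[/andP[? ?]|//]; apply/andP; split; lra.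
by move=> /andP[c0 ch]; rewrite !ler0_norm ?lerN2// ltW.
Qed.

(** The cubic bound serves for small increments. The quadratic one serves for large increments,
    where only a second moment is available. *)
Lemma cos_taylor2 a h : let r := `|cos (a + h) - (cos a - h * sin a - h ^+ 2 / 2 * cos a)| in
  r <= 3 * h ^+ 2 /\ r <= `|h| ^+ 3.
Proof.
have E : cos (a + h) - (cos a - h * sin a - h ^+ 2 / 2 * cos a) =
    cos a * (cos h - 1 + h ^+ 2 / 2) - sin a * (sin h - h).
  by rewrite cosD; ring.
have r1 : `|cos (a + h) - (cos a - h * sin a - h ^+ 2 / 2 * cos a)| <=
    `|cos h - 1 + h ^+ 2 / 2| + `|sin h - h|.
  by rewrite E (le_trans (ler_normB _ _))// !normrM lerD// ler_piMl// ?cos_max ?sin_max.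
have c0 : 0 <= cos h - 1 + h ^+ 2 / 2 by have := one_sub_cos_le h; lra.
rewrite (ger0_norm c0) in r1.
have c1 : cos h - 1 + h ^+ 2 / 2 <= h ^+ 2 / 2 by have := one_sub_cos_ge0 h; lra.
have s1 := sin_sub_le h.
have s2 : `|sin h - h| <= 2 * `|h|.
  by rewrite (le_trans (ler_normB _ _))// mulr2n mulrDl mul1r lerD ?sin_le_norm.
have c2 : cos h - 1 + h ^+ 2 / 2 <= `|h| ^+ 3 / 2.
  have [h1|h1] := leP `|h| 1.
    (* The left side is [2 ((h / 2) ^ 2 - sin (h / 2) ^ 2)]. Factoring the difference of squares
       brings in [sin_sub_le] and gives order [|h| ^ 4], stronger than needed when [|h| <= 1]. *)
    have -> : cos h - 1 + h ^+ 2 / 2 = (h / 2 - sin (h / 2)) * (h / 2 + sin (h / 2)) * 2.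
      have := one_sub_cos h; set s := sin _ => ?.
      have -> : cos h = 1 - 2 * s ^+ 2 by lra.
      by field.
    apply: (@le_trans _ _ (`|h / 2 - sin (h / 2)| * `|h / 2 + sin (h / 2)| * 2)).
      by rewrite ler_wpM2r// -normrM ler_norm.
    have s3 := sin_sub_le (h / 2); rewrite distrC in s3.
    have s4 : `|h / 2 + sin (h / 2)| <= `|h|.
      rewrite (le_trans (ler_normD _ _))// [leRHS](_ : _ = `|h / 2| + `|h / 2|).
        by rewrite lerD2l sin_le_norm.
      by rewrite normrM [`|2^-1|]ger0_norm//; field.
    rewrite normrM [`|2^-1|]ger0_norm// in s3.
    have h0 := normr_ge0 h.
    apply: (@le_trans _ _ ((`|h| / 2) ^+ 3 / 2 * `|h| * 2)).
      by rewrite ler_wpM2r// ler_pM.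
    rewrite (_ : _ * 2 = `|h| ^+ 3 / 2 * (`|h| / 4)); last by field.
    by rewrite ler_piMr// ?divr_ge0 ?exprn_ge0//; lra.
  apply: (le_trans c1); rewrite ler_wpM2r// -[leLHS]real_normK ?num_real//.
  by rewrite [leRHS]exprSr ler_peMr// ?exprn_ge0// ltW.
split; last first.
  by apply: (le_trans r1); rewrite [leRHS](splitr) lerD.
apply: (le_trans r1).
rewrite (_ : 3 * h ^+ 2 = h ^+ 2 / 2 + (2 * h ^+ 2 + h ^+ 2 / 2)); last by field.
rewrite lerD//; have [h1|h1] := leP `|h| 1.
  apply: (le_trans s1); rewrite (@le_trans _ _ (h ^+ 2 / 2))//; last first.
    by rewrite lerDr mulr_ge0// sqr_ge0.
  rewrite ler_wpM2r// -[leRHS]real_normK ?num_real// exprSr ler_piMr// exprn_ge0//.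
apply: (le_trans s2); rewrite (@le_trans _ _ (2 * h ^+ 2))//; last first.
  by rewrite lerDl divr_ge0// sqr_ge0.
by rewrite ler_wpM2l// -[leRHS]real_normK ?num_real// expr2 ler_peMl// ltW.
Qed.

(* Convex and [O(x ^ 2)], but [E psi] of a Gaussian variable is of the order of
   the square of its variance: Doob's inequality for [psi] is strong enough to
   give tightness without fourth moments. *)
Definition psi x : R := x ^+ 2 - 2 * (1 - cos x).
Definition dpsi x : R := 2 * x - 2 * sin x.

Lemma psi_ge0 x : 0 <= psi x.
Proof. by rewrite /psi; have := one_sub_cos_le x; lra. Qed.

Lemma psi_le x : psi x <= x ^+ 2.
Proof. by rewrite /psi; have := one_sub_cos_ge0 x; lra. Qed.

Lemma dpsi_le x : `|dpsi x| <= 4 * `|x|.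
Proof.
have n2 : `|2 : R| = 2 by rewrite ger0_norm.
rewrite /dpsi (le_trans (ler_normB _ _))// !normrM !n2.
by have := sin_le_norm x; lra.
Qed.

(** The gap between the two sides is [2 f (z - x)], where [f 0 = 0] and the derivative
    [y - (sin (x + y) - sin x)] has the sign of [y] because the sine is 1-Lipschitz. *)
Lemma psi_convex x z : psi x + dpsi x * (z - x) <= psi z.
Proof.
pose f y := cos (x + y) - cos x + y * sin x + y ^+ 2 / 2.
have D y : is_derive y (1 : R) f (- sin (x + y) + sin x + y).
  rewrite /f; apply: is_derive_eq; rewrite /GRing.scale/=.
  by field.
have [c + cP] := @MVT_between _ _ 0 (z - x) D.
rewrite /f addr0 subrr mul0r expr0n/= mul0r !addr0 !subr0 [x + (z - x)]addrC subrK => E.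
suff : 0 <= (- sin (x + c) + sin x + c) * (z - x).
  by rewrite -E /psi /dpsi; lra.
have xc : x + c - x = c by ring.
have := sin_lip (x + c) x; rewrite xc => /ler_normlP[s1 s2].
move: cP => /orP[/andP[? ?]|/andP[? ?]].
  by rewrite ger0_norm// in s1 s2; apply: mulr_ge0; lra.
by rewrite ler0_norm// in s1 s2; apply: mulr_le0; lra.
Qed.

Lemma psi_ge (e x : R) : 0 <= e -> e <= `|x| -> psi e <= psi x.
Proof.
move=> e0 ex; have -> : psi x = psi `|x|.
  by rewrite /psi cos_norm real_normK ?num_real.
apply: le_trans (psi_convex e _); rewrite lerDl mulr_ge0//; last by rewrite subr_ge0.
by rewrite /dpsi -mulrBr mulr_ge0// subr_ge0 (le_trans (ler_norm _))// (le_trans (sin_le_norm _))// ger0_norm.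
Qed.

Lemma psi_gt0 (e : R) : 0 < e -> 0 < psi e.
Proof.
move=> e0; pose u := Num.min e 1.
have u0 : 0 < u by rewrite lt_min e0 ltr01.
have u1 : u <= 1 by rewrite ge_min lexx orbT.
have ue : u <= `|e| by rewrite ger0_norm ?(ltW e0)// ge_min lexx.
apply: lt_le_trans (psi_ge (ltW u0) ue).
rewrite /psi one_sub_cos.
have [c cI E] : exists2 c, c \in `]0, (u/2)[ & sin (u/2) - sin 0 = cos c * (u/2 - 0).
  apply: (@MVT _ sin (@cos R)); first by rewrite divr_gt0.
  exact/continuous_subspaceT/continuous_sin.
move: cI; rewrite in_itv/= => /andP[c0 cu].
rewrite sin0 !subr0 in E; rewrite E.
have sc : 0 < sin c by apply: sin2_gt0; rewrite c0/=; lra.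
rewrite exprMn cos2sin2.
have : 0 < sin c ^+ 2 * u ^+ 2 by rewrite mulr_gt0// exprn_gt0.
rewrite (_ : 2 * (2 * _) = u ^+ 2 - sin c ^+ 2 * u ^+ 2); last by field.
by lra.
Qed.

End trigonometric_bounds.

(** * Bracket, maximal bounds and cosine expansion of a counting martingale *)

Section counting_martingale.
Context d0 (T : measurableType d0) (R : realType) (P : probability T R) (d : nat).
Context (F : R -> set (set T)) (X N : 'I_d -> R -> T -> R) (s t : R).
Local Notation Ex := (Ex P).
Local Notation Li := (Li P).

Definition nice_path (n l : 'I_d -> R -> R) : Prop :=
  [/\ forall i a b, s <= a -> a <= b -> b <= t -> n i a <= n i b,
      forall i a b, s <= a -> a <= b -> b <= t -> l i a <= l i b,
      sparse n s t & unif_cont l s t].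

(** It bounds the total variation of the paths on [[s, t]]; its square is the majorant whenever a
    limit is taken along grids. *)
Definition variation w : R := \sum_i (N i t w - N i s w) +
  \sum_i ((N i t w - X i t w) - (N i s w - X i s w)).

(* [X i] is a martingale of the form [N i - l i] on [[s, t]], with [N] counting
   simple jumps and [l] nondecreasing and continuous. *)
Record counting_martingale : Prop := CountingMartingale {
  cm_le : s <= t;
  cm_meas : forall u, <<s F u >> `<=` measurable;
  cm_nd : forall u v, u <= v -> <<s F u >> `<=` <<s F v >>;
  cm_adapted : forall i u, s <= u -> u <= t -> Gm (F u) (X i u);
  cm_Li : forall i u, s <= u -> u <= t -> Li (X i u);
  cm_orth : forall i u v A, s <= u -> u <= v -> v <= t -> <<s F u >> A ->
    Ex (fun w => \1_A w * (X i v w - X i u w)) = 0;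
  cm_N : forall i u, s <= u -> u <= t -> measurable_fun setT (N i u);
  cm_path : {ae P, forall w,
    nice_path (fun i u => N i u w) (fun i u => N i u w - X i u w)};
  cm_var : Li (fun w => variation w ^+ 2) }.

Hypothesis H : counting_martingale.
Variable theta : 'I_d -> R.

Definition inc u w : R := \sum_i theta i * (X i u w - X i s w).
Definition qv w : R := \sum_i theta i ^+ 2 * (N i t w - N i s w).
Let S : R := \sum_i `|theta i|.
Let gr := grid s t.
Let D r k w := inc (gr r k.+1) w - inc (gr r k) w.
Let Q r w := \sum_(k < r.+1) D r k w ^+ 2.

Let st := cm_le H.
Let S0 : 0 <= S. Proof. exact: sumr_ge0. Qed.

Let inc_ypath w u : inc u w = ypath (fun i u => N i u w) (fun i u => N i u w - X i u w) theta u
   - ypath (fun i u => N i u w) (fun i u => N i u w - X i u w) theta s.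
Proof. by rewrite /inc /ypath -sumrB; apply: eq_bigr => i _; ring. Qed.

Let DE r k w : D r k w = dy (fun i u => N i u w) (fun i u => N i u w - X i u w) s t theta r k.
Proof. by rewrite /D !inc_ypath /dy opprB addrA subrK. Qed.

Lemma inc_s w : inc s w = 0.
Proof. by rewrite /inc big1// => i _; rewrite subrr mulr0. Qed.

Lemma inc_Gm u : s <= u -> u <= t -> Gm (F u) (inc u).
Proof.
move=> su ut; apply: (@measurable_sum _ (g_sigma_algebraType (F u))) => i.
apply: (@measurable_funM _ (g_sigma_algebraType (F u))) => //.
apply: (@measurable_funB _ (g_sigma_algebraType (F u))).
  exact: (cm_adapted H).
by apply: Gm_sub (cm_nd H su) _; apply: (cm_adapted H).
Qed.

Lemma inc_measurable u : s <= u -> u <= t -> measurable_fun setT (inc u).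
Proof. by move=> su ut; apply: Gm_measurable (cm_meas H (u:=u)) (inc_Gm su ut). Qed.

Lemma inc_Li u : s <= u -> u <= t -> Li (inc u).
Proof.
by move=> su ut; apply: Li_sum => i _; apply/LiZ/LiB; apply: (cm_Li H).
Qed.

Lemma inc_orth u v A : s <= u -> u <= v -> v <= t -> <<s F u >> A ->
  Ex (fun w => \1_A w * (inc v w - inc u w)) = 0.
Proof.
move=> su uv vt FA.
have mA : measurable A by apply: (cm_meas H) FA.
rewrite (_ : (fun w => _) = (fun w => \sum_i theta i * (\1_A w * (X i v w - X i u w)))); last first.
  apply/funext => w; rewrite /inc -sumrB mulr_sumr; apply: eq_bigr => i _.
  by ring.
have L i : Li (fun w => \1_A w * (X i v w - X i u w)).
  apply: (Li_le _ (Li_norm (LiB (cm_Li H i (le_trans su uv) vt) (cm_Li H i su (le_trans uv vt))))).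
    apply: measurable_funM; first exact: measurable_indic.
    by apply: measurable_funB; apply: LiM; apply: (cm_Li H) => //; apply: le_trans uv _ || apply: le_trans uv.
  by move=> w; rewrite normrM ler_piMl// indicE; case: (_ \in _); rewrite normr_nat.
rewrite Ex_sum => [|i]; last exact: LiZ.
by rewrite big1// => i _; rewrite ExZ// (cm_orth H)// mulr0.
Qed.

Let path_var w : nice_path (fun i u => N i u w) (fun i u => N i u w - X i u w) ->
  forall a b, s <= a -> a <= b -> b <= t ->
  `|inc b w - inc a w| <= S * (\sum_i (N i b w - N i a w) +
  \sum_i ((N i b w - X i b w) - (N i a w - X i a w))).
Proof.
move=> [n_nd l_nd _ _] a b sa ab bt.
rewrite /inc -sumrB (le_trans (ler_norm_sum _ _ _))// -big_split/= mulr_sumr.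
apply: ler_sum => i _.
have n0 := n_nd i _ _ sa ab bt; have l0 := l_nd i _ _ sa ab bt.
rewrite -mulrBr normrM ler_pM//.
  by rewrite /S (bigD1 i)//= lerDl sumr_ge0.
rewrite (_ : _ - _ = (N i b w - N i a w) - ((N i b w - X i b w) - (N i a w - X i a w))); last by ring.
by rewrite (le_trans (ler_normB _ _))// !ger0_norm ?subr_ge0.
Qed.

Let var_ge0 w : nice_path (fun i u => N i u w) (fun i u => N i u w - X i u w) ->
  forall a b, s <= a -> a <= b -> b <= t ->
  0 <= \sum_i (N i b w - N i a w) + \sum_i ((N i b w - X i b w) - (N i a w - X i a w)).
Proof.
move=> [n_nd l_nd _ _] a b sa ab bt; rewrite addr_ge0// sumr_ge0// => i _.
  by rewrite subr_ge0 n_nd.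
by rewrite subr_ge0 l_nd.
Qed.

Let inc_le w : nice_path (fun i u => N i u w) (fun i u => N i u w - X i u w) ->
  forall u, s <= u -> u <= t -> `|inc u w| <= S * variation w.
Proof.
move=> np u su ut; have := path_var np (lexx s) su ut; rewrite inc_s subr0.
move/le_trans; apply; rewrite ler_wpM2l// /variation.
have := var_ge0 np su ut (lexx t); have [n_nd l_nd _ _] := np.
rewrite -!big_split/= => h; rewrite ler_sum// => i _.
by have := n_nd i _ _ su ut (lexx t); have := l_nd i _ _ su ut (lexx t); lra.
Qed.

Let Q_le w r : nice_path (fun i u => N i u w) (fun i u => N i u w - X i u w) ->
  0 <= Q r w <= S ^+ 2 * variation w ^+ 2.
Proof.
move=> np; apply/andP; split; first by apply: sumr_ge0 => k _; exact: sqr_ge0.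
have [n_nd l_nd _ _] := np.
pose v k := \sum_i (N i (gr r k.+1) w - N i (gr r k) w) +
  \sum_i ((N i (gr r k.+1) w - X i (gr r k.+1) w) - (N i (gr r k) w - X i (gr r k) w)).
have v0 k : (k < r.+1)%N -> 0 <= v k.
  by move=> kr; apply: var_ge0; rewrite // ?(grid_ge st) ?(grid_le st) ?(grid_le_end st).
have sv : \sum_(k < r.+1) v k = variation w.
  rewrite /v big_split/= exchange_big/= [X in _ + X]exchange_big/=.
  by congr (_ + _); apply: eq_bigr => i _; [rewrite -(sum_grid s t (fun u => N i u w) r)
   | rewrite -(sum_grid s t (fun u => N i u w - X i u w) r)].
rewrite -exprMn -sv mulr_sumr.
apply: (@le_trans _ _ (\sum_(k < r.+1) (S * v k) ^+ 2)).
  apply: ler_sum => k _; rewrite -[leLHS]real_normK ?num_real// lerXn2r ?nnegrE//.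
    by rewrite mulr_ge0// v0.
  by apply: path_var; rewrite // ?(grid_ge st) ?(grid_le st) ?(grid_le_end st).
rewrite [leRHS]expr2 mulr_suml; apply: ler_sum => k _.
rewrite expr2 ler_wpM2l ?mulr_ge0 ?v0// (bigD1 k)//= lerDl sumr_ge0// => j _.
by rewrite mulr_ge0 ?v0.
Qed.

Let gr_ge r k : s <= gr r k. Proof. exact: grid_ge. Qed.
Let gr_le r k : (k <= r.+1)%N -> gr r k <= t. Proof. exact: grid_le_end. Qed.

Let LV : Li (fun w => S ^+ 2 * variation w ^+ 2).
Proof. exact/LiZ/(cm_var H). Qed.

Lemma inc2_Li u v : s <= u -> u <= t -> s <= v -> v <= t -> Li (fun w => inc u w * inc v w).
Proof.
move=> su ut sv vt; apply: (Li_le_ae _ LV).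
  by apply: measurable_funM; exact: inc_measurable.
apply: filterS (cm_path H) => w np.
rewrite normrM -exprMn expr2 ler_pM//; exact: inc_le.
Qed.

Lemma inc_sqr_Li u : s <= u -> u <= t -> Li (fun w => inc u w ^+ 2).
Proof. by move=> su ut; under eq_fun do rewrite expr2; exact: inc2_Li. Qed.

Lemma inc_orth_Gm u v h : s <= u -> u <= v -> v <= t -> Gm (F u) h ->
  Li (fun w => h w * (inc v w - inc u w)) ->
  Ex (fun w => h w * (inc v w - inc u w)) = 0.
Proof.
move=> su uv vt; apply: Ex_orth; first exact: (cm_meas H).
  by apply: LiB; apply: inc_Li => //; [exact: le_trans uv|exact: le_trans vt].
by move=> A FA; exact: inc_orth.
Qed.

Let measurable_D r k : (k < r.+1)%N -> measurable_fun setT (D r k).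
Proof. by move=> kr; apply: measurable_funB; apply: inc_measurable; rewrite ?gr_ge ?gr_le// ltnW. Qed.

Let measurable_Q r : measurable_fun setT (Q r).
Proof. by apply: measurable_sum => k; apply: measurable_funX; exact: measurable_D. Qed.

Let Q_Li r : Li (Q r).
Proof.
apply: (Li_le_ae (measurable_Q r) LV); apply: filterS (cm_path H) => w np.
by have /andP[Q0 Q1] := Q_le r np; rewrite ger0_norm.
Qed.

Lemma qv_ge0 : {ae P, forall w, 0 <= qv w}.
Proof.
apply: filterS (cm_path H) => w [n_nd _ _ _]; apply: sumr_ge0 => i _.
by rewrite mulr_ge0 ?sqr_ge0// subr_ge0 n_nd.
Qed.

Lemma measurable_qv : measurable_fun setT qv.
Proof.
by apply: measurable_sum => i; apply: measurable_funM => //; apply: measurable_funB; apply: (cm_N H).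
Qed.

(** Almost sure convergence is [quadratic_variation]; the squared sums never exceed
    [S ^ 2 variation ^ 2], which gives convergence in mean. *)
Let Q_cvg : Li qv /\ Ex (fun w => `|Q r w - qv w|) @[r --> \oo] --> (0 : R).
Proof.
have cv : {ae P, forall w, Q r w @[r --> \oo] --> qv w}.
  apply: filterS (cm_path H) => w np; have [n_nd l_nd n_sp l_un] := np.
  have := @quadratic_variation R d _ _ s t theta st n_nd l_nd n_sp l_un.
  by rewrite /Q; under eq_fun do under eq_bigr do rewrite -DE.
have [Lq _] := Ex_dominated measurable_Q measurable_qv cv LV (filterS (fun w np r =>
   let: conj a b := andP (Q_le r np) in
   eq_ind_r (fun z => z <= _) b (ger0_norm a)) (cm_path H)).
split => //.
have [| | | | |_] := @Ex_dominated _ _ _ P (fun r w => `|Q r w - qv w|) (fun=> 0)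
  (fun w => S ^+ 2 * variation w ^+ 2 + `|qv w|).
- by move=> r; apply: measurableT_comp => //; apply: measurable_funB => //; exact: measurable_qv.
- exact: measurable_cst.
- apply: filterS cv => w Qq.
  by have := cvg_norm (cvgB Qq (cvg_cst (qv w))); rewrite subrr normr0 => c; exact: c.
- exact: (LiD LV (Li_norm Lq)).
- apply: filterS (cm_path H) => w np r; rewrite normr_id (le_trans (ler_normB _ _))// lerD2r.
  by have /andP[Q0 Q1] := Q_le r np; rewrite ger0_norm.
by rewrite Ex_cst.
Qed.

Lemma qv_Li : Li qv. Proof. by have [] := Q_cvg. Qed.

Let ExQ r : Ex (Q r) = Ex (fun w => inc t w ^+ 2).
Proof.
have kt k : (k <= r.+1)%N -> s <= gr r k /\ gr r k <= t by move=> kr; rewrite gr_ge gr_le.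
have step k : (k < r.+1)%N -> Ex (fun w => inc (gr r k.+1) w ^+ 2) =
    Ex (fun w => inc (gr r k) w ^+ 2) + Ex (fun w => D r k w ^+ 2).
  move=> kr; have [a1 a2] := kt _ (ltnW kr); have [b1 b2] := kt _ kr.
  have L1 : Li (fun w => D r k w ^+ 2).
    rewrite (_ : (fun w => _) = (fun w => inc (gr r k.+1) w ^+ 2 + inc (gr r k) w ^+ 2
       - 2 * (inc (gr r k) w * inc (gr r k.+1) w))); last first.
      by apply/funext => w; rewrite /D; ring.
    apply: LiB; last by apply: LiZ; exact: inc2_Li.
    by apply: LiD; exact: inc_sqr_Li.
  have L2 : Li (fun w => inc (gr r k) w * D r k w).
    rewrite (_ : (fun w => _) = (fun w => inc (gr r k) w * inc (gr r k.+1) w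
       - inc (gr r k) w * inc (gr r k) w)); last first.
      by apply/funext => w; rewrite /D; ring.
    by apply: LiB; exact: inc2_Li.
  rewrite (_ : (fun w => inc (gr r k.+1) w ^+ 2) = (fun w => (inc (gr r k) w ^+ 2 + D r k w ^+ 2) +
     2 * (inc (gr r k) w * D r k w))); last first.
    by apply/funext => w; rewrite /D; ring.
  rewrite ExD; [|by apply: LiD => //; exact: inc_sqr_Li|exact: LiZ].
  rewrite ExD//; last exact: inc_sqr_Li.
  have o := inc_orth_Gm a1 (grid_le st r (leqnSn k)) b2 (inc_Gm a1 a2) L2.
  by rewrite ExZ// o mulr0 addr0.
have L k : (k < r.+1)%N -> Li (fun w => D r k w ^+ 2).
  move=> kr; apply: (Li_le_ae _ LV).
    by apply: measurable_funX; exact: measurable_D.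
  apply: filterS (cm_path H) => w np; rewrite ger0_norm ?sqr_ge0//.
  have /andP[_] := Q_le r np; apply: le_trans.
  rewrite /Q (bigD1 (Ordinal kr))//= lerDl sumr_ge0// => j _; exact: sqr_ge0.
have all m : (m <= r.+1)%N -> Ex (fun w => inc (gr r m) w ^+ 2) =
    \sum_(k < m) Ex (fun w => D r k w ^+ 2).
  elim: m => [|m IH] mr.
    rewrite big_ord0 /gr grid0 -[RHS](Ex_cst P); congr (Submission.Ex _ _); apply/funext => w.
    by rewrite inc_s expr0n.
  by rewrite step// IH ?big_ord_recr// ltnW.
have := all r.+1 (leqnn _); rewrite /gr gridn => ->.
rewrite /Q; have -> : (fun w => \sum_(k < r.+1) D r k w ^+ 2) = (fun w => \sum_(k <- enum 'I_r.+1) D r k w ^+ 2).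
  by apply/funext => w; rewrite big_enum.
rewrite Ex_sum => [|k]; first by rewrite big_enum.
exact: L.
Qed.

(** By orthogonality of increments [Ex (Q r)] is the same for every grid, while [Q r] tends to [qv]
    in mean. *)
Lemma inc_isometry : Ex (fun w => inc t w ^+ 2) = Ex qv.
Proof.
have [Lq cv] := Q_cvg.
have : Ex (Q r) @[r --> \oo] --> Ex qv.
  apply/cvgrPdist_le => e e0.
  move/cvgrPdist_le: cv => /(_ e e0); apply: filterS => r.
  rewrite sub0r normrN => h; rewrite distrC (le_trans _ h)//.
  rewrite (le_trans _ (ler_norm _))// -ExB//.
  by apply: Ex_abs; exact: LiB.
under eq_fun do rewrite ExQ.
by move/(cvg_unique _ (cvg_cst _)); apply.
Qed.

Lemma inc_doob (g g' : R -> R) (B : set R) (c C : R) r :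
  measurable B -> 0 <= c -> (forall x, 0 <= g x) ->
  (forall x z, g x + g' x * (z - x) <= g z) ->
  (forall x, B x -> c <= g x) ->
  measurable_fun setT g -> measurable_fun setT g' ->
  (forall x, g x <= x ^+ 2) -> (forall x, `|g' x| <= C * `|x|) ->
  c * Ex (hits (fun k => inc (gr r k)) B r.+1) <= Ex (g \o inc t).
Proof.
move=> mB c0 g0 gc cg mg mg' gx g'x.
have kt k : (k <= r.+1)%N -> s <= gr r k /\ gr r k <= t by move=> kr; rewrite gr_ge gr_le.
have C0 : 0 <= C by have := g'x 1; rewrite normr1 mulr1; apply: le_trans.
have tE : gr r r.+1 = t by rewrite /gr gridn.
rewrite -[in X in _ <= X]tE.
apply: (@doob_convex _ _ _ P (fun k => F (gr r k)) _ r.+1 _ _ _ _ _ g g') => //.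
- by move=> k; exact: (cm_meas H).
- by move=> j k jk; apply: (cm_nd H); exact: grid_le.
- by move=> k kr; have [? ?] := kt _ kr; exact: inc_Gm.
- move=> k A kr FA; have [a1 a2] := kt _ kr; apply: inc_orth FA => //.
    by apply: grid_le.
  by rewrite tE.
- by move=> k kr; have [? ?] := kt _ kr; exact: inc_Li.
- move=> k kr; have [a1 a2] := kt _ kr.
  apply: (Li_le_ae _ (LiZ (C * 2) LV)).
    apply: measurable_funM; first by apply: measurableT_comp => //; exact: inc_measurable.
    by apply: measurable_funB; apply: inc_measurable; rewrite ?tE// (le_trans a1).
  apply: filterS (cm_path H) => w np; rewrite normrM.
  have i1 := inc_le np a1 a2; have i2 := inc_le np st (lexx t).
  apply: (@le_trans _ _ ((C * (S * variation w)) * (2 * (S * variation w)))); last first.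
    by rewrite le_eqVlt; apply/orP; left; apply/eqP; ring.
  rewrite ler_pM//.
    by apply: (le_trans (g'x _)); rewrite ler_wpM2l.
  by rewrite tE (le_trans (ler_normB _ _))// mulr2n mulrDl mul1r lerD.
- rewrite tE; apply: (Li_le _ (inc_sqr_Li st (lexx t))).
    by apply: measurableT_comp => //; apply: inc_measurable.
  by move=> w; rewrite /= ger0_norm.
Qed.

Lemma measurable_inc_hits B r : measurable B ->
  measurable_fun setT (hits (fun k => inc (gr r k)) B r.+1).
Proof.
move=> mB; apply: (@measurable_hits _ _ _ (fun k => F (gr r k)) _ r.+1) => //.
- by move=> k; exact: (cm_meas H).
- by move=> k kr; apply: inc_Gm; [exact: gr_ge | exact: gr_le].
Qed.

Lemma inc_hits_Li B r : measurable B -> Li (hits (fun k => inc (gr r k)) B r.+1).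
Proof.
move=> mB; apply: (@Li_bounded _ _ _ _ _ 1); first exact: measurable_inc_hits.
by move=> w; have /andP[? ?] := hits01 (fun k => inc (gr r k)) B r.+1 w; rewrite ger0_norm.
Qed.

Definition away (e : R) : set R := [set x | e < `|x|].

Lemma measurable_away e : measurable (away e).
Proof.
have m : measurable_fun setT (fun x : R => `|x|) by exact: measurableT_comp.
rewrite (_ : away e = setT `&` (fun x : R => `|x|) @^-1` `]e, +oo[); first exact: m.
by rewrite setTI; apply/seteqP; split => x /=; rewrite in_itv/= andbT.
Qed.

Lemma inc_hits_le e r : 0 < e ->
  Ex (hits (fun k => inc (gr r k)) (away e) r.+1) <= Ex qv / e ^+ 2.
Proof.
move=> e0; rewrite ler_pdivlMr ?exprn_gt0// mulrC -inc_isometry.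
apply: (@inc_doob (fun x => x ^+ 2) (fun x => 2 * x) _ _ 2) => //.
- exact: measurable_away.
- by rewrite sqr_ge0.
- by move=> x; rewrite sqr_ge0.
- by move=> x z; rewrite -subr_ge0 (_ : _ - _ = (z - x) ^+ 2) ?sqr_ge0//; ring.
- move=> x /= ex; rewrite -[leRHS]real_normK ?num_real//.
  by rewrite lerXn2r ?nnegrE// ltW.
- exact: measurable_funM.
- by move=> x; rewrite normrM ger0_norm.
Qed.

Section cosine.
Variable alpha : T -> R.
Hypothesis alpha_s : Gm (F s) alpha.
Variables (e qb : R).
Hypothesis e0 : 0 < e.
Hypothesis qb0 : 0 <= qb.

(** The bound of [dy_small]: increments over a fine enough grid stay below it, so [E r], the energy
    of the larger ones, vanishes for large [r]. *)
Let delta : R := 2 * S.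
Let big_sqr (x : R) : R := x ^+ 2 * \1_(away delta) x.
Let E r w : R := \sum_(k < r.+1) big_sqr (D r k w).

Let measurable_big_sqr : measurable_fun setT big_sqr.
Proof.
apply: measurable_funM; first exact: measurable_funX.
by apply: measurable_indic; exact: measurable_away.
Qed.

Let E_le r w : 0 <= E r w <= Q r w.
Proof.
have b x : 0 <= big_sqr x <= x ^+ 2.
  rewrite /big_sqr indicE; case: (_ \in _); rewrite ?mulr1 ?mulr0 ?lexx ?sqr_ge0//.
apply/andP; split.
  by apply: sumr_ge0 => k _; have /andP[] := b (D r k w).
by apply: ler_sum => k _; have /andP[] := b (D r k w).
Qed.

Let measurable_E r : measurable_fun setT (E r).
Proof.
by apply: measurable_sum => k; apply: measurableT_comp => //; exact: measurable_D.
Qed.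

Let E_Li r : Li (E r).
Proof.
apply: (Li_le (measurable_E r) (Q_Li r)) => w.
by have /andP[? ?] := E_le r w; rewrite ger0_norm.
Qed.

Let E_cvg : Ex (E r) @[r --> \oo] --> (0 : R).
Proof.
have [| | | | |_] := @Ex_dominated _ _ _ P E (fun=> 0)
  (fun w => S ^+ 2 * variation w ^+ 2).
- exact: measurable_E.
- exact: measurable_cst.
- apply: filterS (cm_path H) => w np; have [n_nd l_nd n_sp l_un] := np.
  have sm := @dy_small R d _ _ s t theta st l_nd n_sp l_un.
  apply: (@cvg_near_cst _ R^o); apply: filterS sm => r h.
  apply: big1 => k _; rewrite /big_sqr indicE memNset ?mulr0//=.
  by apply/negP; rewrite -leNgt DE; exact: h.
- exact: LV.
- apply: filterS (cm_path H) => w np r.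
  have /andP[E0 E1] := E_le r w; have /andP[_ Q1] := Q_le r np.
  by rewrite ger0_norm// (le_trans E1).
by rewrite Ex_cst.
Qed.

Let mal : measurable_fun setT alpha.
Proof. exact: Gm_measurable (cm_meas H (u := s)) alpha_s. Qed.

Let mcos : measurable_fun setT (@cos R).
Proof. by apply: continuous_measurable_fun; exact: continuous_cos. Qed.

Let msin : measurable_fun setT (@sin R).
Proof. by apply: continuous_measurable_fun; exact: continuous_sin. Qed.

Let cos_Li u : s <= u -> u <= t -> Li (fun w => cos (alpha w + inc u w)).
Proof.
move=> su ut; apply: (@Li_bounded _ _ _ _ _ 1); last by move=> w; exact: cos_max.
by apply: measurableT_comp => //; apply: measurable_funD => //; exact: inc_measurable.
Qed.

Let hitse r w := hits (fun k => inc (gr r k)) (away e) r.+1 w.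

(** The quantity to estimate plus its first-order term, which has mean zero because
    [sin (alpha + inc)] is known at the left end of each cell. *)
Let U r w : R := cos (alpha w + inc t w) - (1 - qb / 2) * cos (alpha w) +
  \sum_(k < r.+1) sin (alpha w + inc (gr r k) w) * D r k w.

Let U_le r w : `|U r w| <= (delta + e / 2) * Q r w + qb * hitse r w +
  (3 / 2 * `|Q r w - qb| + 3 * E r w).
Proof.
pose a k := alpha w + inc (gr r k) w.
have aD k : a k.+1 = a k + D r k w by rewrite /a /D; ring.
pose rho k := cos (a k.+1) - (cos (a k) - D r k w * sin (a k) - D r k w ^+ 2 / 2 * cos (a k)).
have UE : U r w = \sum_(k < r.+1) rho k
    - \sum_(k < r.+1) D r k w ^+ 2 / 2 * (cos (a k) - cos (alpha w))
    - (Q r w - qb) / 2 * cos (alpha w).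
  have tel : cos (alpha w + inc t w) - cos (alpha w) =
      \sum_(k < r.+1) (cos (a k.+1) - cos (a k)).
    have /= := sum_grid s t (fun u => cos (alpha w + inc u w)) r.
    by rewrite inc_s addr0 => <-.
  rewrite /U (_ : cos (alpha w + inc t w) - (1 - qb / 2) * cos (alpha w) =
    (cos (alpha w + inc t w) - cos (alpha w)) + qb / 2 * cos (alpha w)); last by ring.
  rewrite tel (_ : (Q r w - qb) / 2 * cos (alpha w) =
    \sum_(k < r.+1) D r k w ^+ 2 / 2 * cos (alpha w) - qb / 2 * cos (alpha w)); last first.
    by rewrite /Q -!mulr_suml; ring.
  have key : \sum_(k < r.+1) (cos (a k.+1) - cos (a k)) +
      \sum_(k < r.+1) sin (alpha w + inc (gr r k) w) * D r k w =
      \sum_(k < r.+1) rho k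
      - \sum_(k < r.+1) D r k w ^+ 2 / 2 * (cos (a k) - cos (alpha w))
      - \sum_(k < r.+1) D r k w ^+ 2 / 2 * cos (alpha w).
    rewrite -big_split -!sumrB/=; apply: eq_bigr => k _; rewrite /rho /a; ring.
  by rewrite addrAC key; ring.
have Q0 : 0 <= Q r w by apply: sumr_ge0 => k _; exact: sqr_ge0.
(* Taylor remainders: [|D| ^ 3 <= delta D ^ 2] on small increments, [3 D ^ 2] on the large ones
   collected by [E r]. *)
have h1 : `|\sum_(k < r.+1) rho k| <= delta * Q r w + 3 * E r w.
  rewrite (le_trans (ler_norm_sum _ _ _))// /Q /E !mulr_sumr -big_split/=.
  apply: ler_sum => k _; have [t1 t2] := cos_taylor2 (a k) (D r k w).
  rewrite -aD -/(rho k) in t1 t2.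
  rewrite /big_sqr indicE; have [Dk|Dk] := boolP (D r k w \in away delta).
    rewrite mulr1 (le_trans t1)// lerDr mulr_ge0 ?sqr_ge0//.
    by rewrite /delta mulr_ge0.
  rewrite !mulr0 addr0 (le_trans t2)// exprSr -[X in _ <= _ * X]real_normK ?num_real//.
  rewrite mulrC ler_wpM2r ?exprn_ge0//.
  by move: Dk; rewrite notin_setE/= /away/= => /negP; rewrite -leNgt.
(* Freezing the cosine at time [s] costs at most [e] as long as the path stays within [e] of its
   start, and at most 2 otherwise. *)
have h2 : `|\sum_(k < r.+1) D r k w ^+ 2 / 2 * (cos (a k) - cos (alpha w))| <=
    (e / 2 + hitse r w) * Q r w.
  rewrite (le_trans (ler_norm_sum _ _ _))// /Q !mulr_sumr.
  apply: ler_sum => k _; rewrite normrM [`|_ / _|]ger0_norm ?divr_ge0 ?sqr_ge0//.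
  rewrite (_ : _ / 2 * _ = `|cos (a k) - cos (alpha w)| / 2 * D r k w ^+ 2); last by field.
  rewrite ler_wpM2r ?sqr_ge0//.
  have /andP[hi0 hi1] := hits01 (fun k => inc (gr r k)) (away e) r.+1 w.
  have [hh|hh] := ltP (hitse r w) 1.
    have /(_ k) := hits0 hh; rewrite (ltnW (ltn_ord k)) => /(_ isT)/= /negP; rewrite -leNgt => ie.
    have : `|cos (a k) - cos (alpha w)| <= e.
      by apply: (le_trans (cos_lip _ _)); rewrite /a addrAC subrr add0r.
    by rewrite /hitse; lra.
  have : `|cos (a k) - cos (alpha w)| <= 2.
    by rewrite (le_trans (ler_normB _ _))// (_ : 2 = 1 + 1)// lerD ?cos_max.
  have e0' := e0; have hh' : 1 <= hitse r w by [].
  by move=> c2; lra.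
have /andP[hi0 hi1] := hits01 (fun k => inc (gr r k)) (away e) r.+1 w.
rewrite -/(hitse r w) in hi0 hi1.
have h3 : `|(Q r w - qb) / 2 * cos (alpha w)| <= `|Q r w - qb| / 2.
  rewrite !normrM [`|2^-1|]ger0_norm// ler_piMr ?cos_max//.
(* The mean of [hitse * Q] would call for more than second moments; replacing [Q] by the constant
   [qb] separates the two factors. *)
have h4 : hitse r w * Q r w <= qb * hitse r w + `|Q r w - qb|.
  have -> : hitse r w * Q r w = qb * hitse r w + hitse r w * (Q r w - qb) by ring.
  by rewrite lerD2l (le_trans (ler_norm _))// normrM ger0_norm// ler_piMl.
rewrite UE (le_trans (ler_normB _ _))//.
have h5 := ler_normB (\sum_(k < r.+1) rho k)
  (\sum_(k < r.+1) D r k w ^+ 2 / 2 * (cos (a k) - cos (alpha w))).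
have -> : (delta + e / 2) * Q r w + qb * hitse r w + (3 / 2 * `|Q r w - qb| + 3 * E r w)
  = (delta * Q r w + 3 * E r w) + (e / 2 * Q r w + (qb * hitse r w + `|Q r w - qb|))
    + `|Q r w - qb| / 2 by field.
rewrite lerD//; apply: (le_trans h5); rewrite lerD//.
by apply: (le_trans h2); rewrite mulrDl lerD2l.
Qed.

(** One step of the recursion for characteristic functions: a short interval multiplies the mean of
    the cosine by about [1 - qb / 2], with [qb] a deterministic guess of the bracket. It is the mean
    of [U_le] as the grid is refined. *)
Lemma cos_increment :
  `|Ex (fun w => cos (alpha w + inc t w)) - (1 - qb / 2) * Ex (fun w => cos (alpha w))| <=
  (2 * (\sum_i `|theta i|) + e / 2) * Ex qv + qb * (Ex qv / e ^+ 2) +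
  3 / 2 * Ex (fun w => `|qv w - qb|).
Proof.
have Lc : Li (fun w => cos (alpha w)).
  by have := cos_Li (lexx s) st; under eq_fun do rewrite inc_s addr0.
have LS r : Li (fun w => \sum_(k < r.+1) sin (alpha w + inc (gr r k) w) * D r k w) /\
    Ex (fun w => \sum_(k < r.+1) sin (alpha w + inc (gr r k) w) * D r k w) = 0.
  have L (k : 'I_r.+1) : Li (fun w => sin (alpha w + inc (gr r k) w) * D r k w) /\
      Ex (fun w => sin (alpha w + inc (gr r k) w) * D r k w) = 0.
    have b1 : gr r k.+1 <= t by apply: gr_le.
    have b2 : gr r k <= t by apply: gr_le; exact: ltnW.
    have G : Gm (F (gr r k)) (fun w => sin (alpha w + inc (gr r k) w)).
      apply: (measurableT_comp msin).
      apply: (@measurable_funD _ (g_sigma_algebraType (F (gr r k)))).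
        exact: Gm_sub (cm_nd H (gr_ge r k)) alpha_s.
      exact: inc_Gm.
    have L1 : Li (fun w => sin (alpha w + inc (gr r k) w) * D r k w).
      apply: (Li_le _ (Li_norm (LiB (inc_Li (gr_ge r k.+1) b1) (inc_Li (gr_ge r k) b2)))).
        apply: measurable_funM; last exact: measurable_D.
        exact: Gm_measurable (cm_meas H (u := _)) G.
      by move=> w; rewrite normrM ler_piMl// sin_max.
    split => //; apply: inc_orth_Gm => //; exact: grid_le.
  split; first by apply: Li_sum => k _; have [] := L k.
  rewrite (_ : (fun w => _) = (fun w => \sum_(k <- enum 'I_r.+1)
    sin (alpha w + inc (gr r k) w) * D r k w)); last first.
    by apply/funext => w; rewrite big_enum.
  by rewrite Ex_sum => [|k]; [rewrite big1// => k _; have [] := L k | have [] := L k].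
have [Lq cv] := Q_cvg.
have LQ' r : Li (fun w => `|Q r w - qv w|) by apply/Li_norm/LiB.
have Lqb : Li (fun w => `|qv w - qb|) by apply/Li_norm/LiB => //; exact: Li_cst.
have Lh r : Li (hitse r) by apply: inc_hits_Li; exact: measurable_away.
set rhs := (X in _ <= X).
have bound r : `|Ex (fun w => cos (alpha w + inc t w)) - (1 - qb / 2) * Ex (fun w => cos (alpha w))| <=
    rhs + (3 / 2 * Ex (fun w => `|Q r w - qv w|) + 3 * Ex (E r)).
  have [L0 E0] := LS r.
  have LU : Li (fun w => cos (alpha w + inc t w) - (1 - qb / 2) * cos (alpha w)).
    by apply: LiB; [exact: cos_Li|exact: LiZ].
  have -> : Ex (fun w => cos (alpha w + inc t w)) - (1 - qb / 2) * Ex (fun w => cos (alpha w))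
     = Ex (U r).
    by rewrite /U ExD// E0 addr0 ExB ?ExZ//; [exact: cos_Li | exact: LiZ].
  apply: (le_trans (Ex_abs (LiD LU L0))).
  pose V w := (delta + e / 2) * Q r w + qb * hitse r w +
    (3 / 2 * (`|Q r w - qv w| + `|qv w - qb|) + 3 * E r w).
  have LV1 : Li (fun w => (delta + e / 2) * Q r w + qb * hitse r w).
    by apply: LiD; apply: LiZ.
  have LV2 : Li (fun w => 3 / 2 * (`|Q r w - qv w| + `|qv w - qb|) + 3 * E r w).
    by apply: LiD; apply: LiZ => //; exact: LiD.
  apply: (@le_trans _ _ (Ex V)).
    apply: Ex_le; [exact/Li_norm/LiD|exact: LiD|] => w.
    apply: (le_trans (U_le r w)); rewrite lerD2l lerD2r ler_wpM2l//.
    by rewrite (le_trans _ (ler_normD _ _))// addrA subrK.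
  rewrite /V ExD// ExD; [|exact: LiZ..]; rewrite ExD; [|by apply/LiZ/LiD|exact: LiZ].
  rewrite !ExZ//; last exact: LiD.
  rewrite (ExD (LQ' r) Lqb) ExQ inc_isometry.
  have := inc_hits_le r e0; rewrite -/(hitse r) => hh.
  have : qb * Ex (hitse r) <= qb * (Ex qv / e ^+ 2) by rewrite ler_wpM2l.
  by rewrite /rhs /delta /S; lra.
have cvr : rhs + (3 / 2 * Ex (fun w => `|Q r w - qv w|) + 3 * Ex (E r)) @[r --> \oo] --> rhs.
  rewrite -[X in _ --> X]addr0; apply: cvgD; first exact: cvg_cst.
  rewrite -[X in _ --> X](_ : 3 / 2 * 0 + 3 * 0 = 0 :> R); last by ring.
  by apply: cvgD; apply: cvgMr.
rewrite -(cvg_lim _ cvr)//; apply: limr_ge; first by apply/cvg_ex; exists rhs.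
by apply: nearW => r; exact: bound.
Qed.

End cosine.

End counting_martingale.

(** * Moments of the Hawkes process *)

Section renewal_increments.
Context (R : realType) (d : nat) (phi : 'I_d -> 'I_d -> R -> R).
Hypothesis phi_ge0 : forall i j (t : R), 0 <= t -> 0 <= phi i j t.
Hypothesis phi_meas : forall i j, measurable_fun (`[0%R, +oo[ : set R) (phi i j).
Hypothesis phi_int : forall i j,
  (\int[lebesgue_measure]_(t in `[0%R, +oo[) (phi i j t)%:E < +oo)%E.
Hypothesis rho_lt1 : spectral_radius (kernel_mass phi) < 1.
Local Notation K := (kernel_mass phi).
Local Notation wint := (wint phi).

Lemma nd_measurable_sub (n : R -> R) u : (forall a b, a <= b -> n a <= n b) ->
  measurable_fun setT (fun x : R => n (u - x)).
Proof.
move=> nd; apply: (@measurableT_comp _ _ _ _ _ _ n); last exact: measurable_funB.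
by apply: nondecreasing_measurable => // a b; exact: nd.
Qed.

Variables (n x : 'I_d -> R -> R) (L h : R) (c : 'cV[R]_d).
Hypothesis n_nd : forall i a b, a <= b -> n i a <= n i b.
Hypothesis n0 : forall i a, a <= 0 -> n i a = 0.
Hypothesis nE : forall i u, 0 <= u -> u <= L ->
  n i u = x i u + \sum_(j < d) wint i j (fun v => n j (u - v)).
Hypothesis xc : forall i a b, 0 <= a -> a <= b -> b <= L -> b - a <= h ->
  x i b - x i a <= c i 0.
Hypothesis h0 : 0 <= h.
Hypothesis L0 : 0 <= L.

(** Let [G] be the vector of largest increments over windows of length at most [h]. A delayed window
    is again such a window, so the renewal equation gives [G <= c + K G], and the comparison
    principle concludes. *)
Lemma renewal_increment i a b : a <= b -> b <= L -> b - a <= h ->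
  n i b - n i a <= (invmx (1%:M - K) *m c) i 0.
Proof.
have mn j u : measurable_fun setT (fun x : R => n j (u - x)).
  by apply: nd_measurable_sub => a' b'; exact: n_nd.
(* Windows may start before time 0, where a delay can push them. *)
pose I j := [set z : R | exists a b, [/\ a <= b, b <= L, b - a <= h & z = n j b - n j a]].
have nge j u : 0 <= n j u.
  have [u0|u0] := leP u 0; first by rewrite n0.
  by rewrite -(@n0 j 0)// n_nd// ltW.
have Iub j : ubound (I j) (n j L).
  move=> _ [a' [b' [ab bL _ ->]]]; rewrite lerBlDr (le_trans (n_nd j bL))// lerDl.
  exact: nge.
have Isup j : has_sup (I j).
  split; last by exists (n j L).
  by exists 0, 0, 0; split; rewrite ?subrr.
pose G : 'cV[R]_d := \col_j sup (I j).
have key k u v : 0 <= u -> u <= v -> v <= L -> v - u <= h ->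
    n k v - n k u <= c k 0 + (K *m G) k 0.
  move=> u0 uv vL uvh.
  rewrite !nE//; [|exact: le_trans vL|exact: le_trans uv].
  rewrite opprD addrACA lerD ?xc// mxE -sumrB ler_sum// => j _.
  have nB w y : w <= L -> 0 <= y -> `|n j (w - y)| <= n j L.
    move=> wL y0; rewrite ger0_norm ?nge// n_nd// (le_trans _ wL)// gerBl//.
  rewrite -(wintB phi_ge0 phi_meas phi_int _ _ (B := n j L)).
  - rewrite -(wint_cst phi_ge0 phi_meas phi_int).
    apply: (wint_le phi_ge0 phi_meas phi_int _ _ (B := n j L)).
    + by apply: measurable_funB; exact: mn.
    + exact: measurable_cst.
    + move=> y y0; rewrite ger0_norm ?subr_ge0 ?n_nd ?lerD2r//.
      rewrite lerBlDr (@le_trans _ _ (n j L))// ?lerDl ?nge// n_nd//.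
      by rewrite (le_trans _ vL)// gerBl.
    + move=> y y0; rewrite mxE ger0_norm; last first.
        apply: ub_le_sup; first by exists (n j L).
        by exists 0, 0; split; rewrite ?subrr.
      by apply: sup_le_ub; [have [] := Isup j | exact: Iub].
    + move=> y y0; rewrite mxE; apply: ub_le_sup; first by exists (n j L).
      exists (u - y), (v - y); split => //.
      * by rewrite lerD2r.
      * by rewrite (le_trans _ vL)// gerBl.
      * by rewrite opprB addrA subrK.
  - exact: mn.
  - exact: mn.
  - by move=> y; apply: nB.
  - by move=> y; apply: nB; exact: le_trans vL.
have GE k : G k 0 <= c k 0 + (K *m G) k 0.
  rewrite mxE; apply: sup_le_ub; first by have [] := Isup k.
  move=> _ [a' [b' [ab bL bah ->]]].
  have [a0|a0] := leP 0 a'; first exact: key.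
  have [b0|b0] := leP b' 0.
    rewrite !n0 ?subrr//; last by rewrite ltW.
    have := @key k 0 0 (lexx 0) (lexx 0) L0; rewrite !subrr; exact.
  (* A window straddling 0 has the same increment as its part after 0. *)
  have -> : n k a' = n k 0 by rewrite !n0// ltW.
  apply: key => //; first exact: ltW.
  by rewrite subr0 (le_trans _ bah)// lerDl oppr_ge0 ltW.
move=> ab bL bah; apply: (@le_trans _ _ (G i 0)).
  rewrite mxE; apply: ub_le_sup; first by exists (n i L).
  by exists a, b.
apply: le_invmx_subK => //.
by move=> *; exact: kernel_mass_ge0.
Qed.

End renewal_increments.
Section hawkes_moments.
Context (R : realType) (disp : measure_display) (Omega : measurableType disp).
Context (P : probability Omega R).
Context (d : nat) (tau : nat -> Omega -> \bar R) (Z : nat -> Omega -> 'I_d).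
Context (mu : 'cV[R]_d) (phi : 'I_d -> 'I_d -> R -> R).
Hypothesis mu_ge0 : forall i, 0 <= mu i 0.
Hypothesis phi_ge0 : forall i j (t : R), 0 <= t -> 0 <= phi i j t.
Hypothesis phi_meas : forall i j, measurable_fun (`[0%R, +oo[ : set R) (phi i j).
Hypothesis hN : hawkes P tau Z mu phi.
Hypothesis phi_int : forall i j,
  (\int[lebesgue_measure]_(t in `[0%R, +oo[) (phi i j t)%:E < +oo)%E.
Hypothesis rho_lt1 : spectral_radius (kernel_mass phi) < 1.

Let tau_meas n : measurable_fun setT (tau n). Proof. by have [[]] := hN. Qed.
Let Z_meas n i : measurable (Z n @^-1` [set i]). Proof. by have [[]] := hN. Qed.
Let tau_gt0 n w : (0 < tau n w)%E. Proof. by have [[]] := hN. Qed.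
Let tau_nd n w : (tau n w <= tau n.+1 w)%E. Proof. by have [[]] := hN. Qed.
Let tau_inc n w : (tau n w < +oo)%E -> (tau n w < tau n.+1 w)%E.
Proof. by have [[_ _ _ _ h] _] := hN; exact: h. Qed.

Local Notation Ex := (Ex P).
Local Notation Li := (Li P).
Local Notation hit := (hit tau Z).
Local Notation np := (np tau Z).
Local Notation K := (kernel_mass phi).
Local Notation Lst := (Lst tau Z mu phi).
Local Notation Mst := (Mst tau Z mu phi).
Local Notation past := (past tau Z).
Local Notation wint := (wint phi).

Let A := invmx (1%:M - K).
Let K0 i j : 0 <= K i j. Proof. exact: kernel_mass_ge0. Qed.

Definition rate i : R := (A *m mu) i 0.

Lemma rate_ge0 i : 0 <= rate i.
Proof.
rewrite /rate mxE sumr_ge0// => j _; rewrite mulr_ge0//.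
exact: invmx_subK_ge0.
Qed.

Let past_meas t : <<s past t >> `<=` measurable.
Proof. exact: past_measurable. Qed.

Definition Lbnd n i t : R := mu i 0 * t + \sum_(j < d) K i j * n.+1%:R.

Lemma Lst_bnd n i t w : 0 <= t -> 0 <= Lst n i t w <= Lbnd n i t.
Proof.
move=> t0; rewrite Lst_ge0//= (le_trans (Lst_le Z mu_ge0 phi_ge0 phi_meas phi_int tau_gt0 tau_nd n i w t0))//.
rewrite lerD2l ler_sum// => j _; rewrite ler_wpM2l//; exact: np_le.
Qed.

Lemma Mst_bnd n i t w : 0 <= t -> `|Mst n i t w| <= n.+1%:R + Lbnd n i t.
Proof.
move=> t0; rewrite /Submission.Mst (le_trans (ler_normB _ _))//.
have /andP[L0 L1] := Lst_bnd n i w t0.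
rewrite lerD//; first exact: np_abs.
by rewrite ger0_norm.
Qed.

Lemma Mst_Gm n i t : 0 <= t -> Gm (past t) (Mst n i t).
Proof.
move=> t0; have [+ _ _] := hN.2 n i => /(_ t t0) h _ B mB; rewrite setTI.
have := h (EFin @` B) (measurable_image_EFin mB).
congr (_ _); apply/seteqP; split => w /=; rewrite compensatedE//.
  by move=> [r Br [<-]].
by move=> BM; exists (Mst n i t w).
Qed.

Lemma Mst_measurable n i t : 0 <= t -> measurable_fun setT (Mst n i t).
Proof. by move=> t0; exact: Gm_measurable (@past_meas t) (Mst_Gm n i t0). Qed.

Lemma Mst_Li n i t : 0 <= t -> Li (Mst n i t).
Proof.
move=> t0; apply: (@Li_bounded _ _ _ _ _ (n.+1%:R + Lbnd n i t)) => [|w].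
  exact: Mst_measurable.
exact: Mst_bnd.
Qed.

Lemma Mst_orth n i s t B : 0 <= s -> s <= t -> <<s past s >> B ->
  Ex (fun w => \1_B w * (Mst n i t w - Mst n i s w)) = 0.
Proof.
move=> s0 st FB; have t0 := le_trans s0 st.
have mB : measurable B by apply: past_meas FB.
have L u : 0 <= u -> Li (fun w => \1_B w * Mst n i u w).
  move=> u0; apply: (Li_le _ (Li_norm (Mst_Li n i u0))).
    by apply: measurable_funM; [exact: measurable_indic | exact: Mst_measurable].
  by move=> w; rewrite normrM ler_piMl// indicE; case: (_ \in _); rewrite normr_nat.
have E u : 0 <= u -> (\int[P]_(w in B) compensated tau Z mu phi n i u w)%E =
    (Ex (fun w => \1_B w * Mst n i u w))%:E.
  move=> u0; rewrite /Submission.Ex /Rintegral fineK; last first.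
    by apply: integrable_fin_num => //; exact: L.
  rewrite [LHS]integral_mkcond. apply: eq_integral => w _.
  rewrite patchE indicE; case: (w \in B); rewrite ?mul1r ?mul0r//.
  by rewrite compensatedE.
have FB' : history tau Z s B by rewrite historyE.
have [_ _ mart] := hN.2 n i.
have h := mart s t (introT andP (conj s0 st)) B FB'.
have EE := EFin_inj (etrans (esym (E t t0)) (etrans h (E s s0))).
under eq_fun do rewrite mulrBr.
apply: etrans (ExB (L t t0) (L s s0)) _.
by apply/eqP; rewrite subr_eq0; apply/eqP.
Qed.

Lemma Mst0 n i w : Mst n i 0 w = 0.
Proof.
rewrite /Submission.Mst np0// sub0r /Submission.Lst (_ : stopped_time tau n 0 w = 0); last first.
  by apply: stopE; exact: ltW.
rewrite /lp mulr0 add0r big1 ?oppr0// => j _.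
rewrite -[RHS](mulr0 (K i j)) -(wint_cst phi_ge0 phi_meas phi_int).
apply: eq_Rintegral => x _; have [x0|x0] := ltP x 0.
  by rewrite /kern patchE memNset ?mul0r//= in_itv/= andbT leNgt x0.
by rewrite np0// sub0r oppr_le0.
Qed.

Lemma Ex_Mst n i t : 0 <= t -> Ex (Mst n i t) = 0.
Proof.
move=> t0; have := @Mst_orth n i 0 t setT (lexx 0) t0.
have -> : (fun w => \1_setT w * (Mst n i t w - Mst n i 0 w)) = Mst n i t.
  by apply/funext => w; rewrite Mst0 subr0 indicT mul1r.
by apply; exact: (@measurableT _ (g_sigma_algebraType (past 0))).
Qed.

Lemma np_Li n i t : Li (np n i t).
Proof.
apply: (@Li_bounded _ _ _ _ _ n%:R); first exact: measurable_np.
by move=> w; exact: np_abs.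
Qed.

(** The stopped martingale has mean zero, so the mean count equals the mean compensator, which is at
    most [mu t + K] times the mean count. The resulting bound is uniform in [n]. *)
Lemma Ex_np_le n i t : 0 <= t -> Ex (np n.+1 i t) <= rate i * t.
Proof.
move=> t0; pose y : 'cV[R]_d := \col_i Ex (np n.+1 i t).
suff : y i 0 <= (A *m (t *: mu)) i 0.
  by rewrite mxE -scalemxAr mxE mulrC.
apply: (le_invmx_subK K0 rho_lt1) => k; rewrite mxE.
have E : Ex (np n.+1 k t) = Ex (Lst n k t).
  apply/eqP; rewrite -subr_eq0 -ExB ?Ex_Mst//; first exact: np_Li.
  have -> : Lst n k t = (fun w => np n.+1 k t w - Mst n k t w).
    by apply/funext => w; rewrite /Submission.Mst opprB addrC subrK.
  by apply: LiB; [exact: np_Li | exact: Mst_Li].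
rewrite E.
have LL : Li (Lst n k t).
  have -> : Lst n k t = (fun w => np n.+1 k t w - Mst n k t w).
    by apply/funext => w; rewrite /Submission.Mst opprB addrC subrK.
  by apply: LiB; [exact: np_Li | exact: Mst_Li].
have LS : Li (fun w => \sum_(j < d) K k j * np n.+1 j t w).
  by apply: Li_sum => j _; apply/LiZ/np_Li.
apply: (@le_trans _ _ (Ex (fun w => mu k 0 * t + \sum_(j < d) K k j * np n.+1 j t w))).
  apply: Ex_le => //; first by apply: LiD => //; exact: Li_cst.
  by move=> w; exact: Lst_le.
rewrite ExD//; last exact: Li_cst.
rewrite Ex_cst mxE mulrC lerD2l mxE.
rewrite (_ : (fun w => _) = (fun w => \sum_(j <- enum 'I_d) K k j * np n.+1 j t w)); last first.
  by apply/funext => w; rewrite big_enum.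
rewrite Ex_sum => [|j]; last by apply/LiZ/np_Li.
rewrite big_enum/=; apply: ler_sum => j _.
by rewrite ExZ ?mxE//; exact: np_Li.
Qed.

Definition noexp w : Prop := forall i (t : R), (jump_count tau Z i t w < +oo)%E.

Lemma integral_jump_count i t : 0 <= t ->
  (\int[P]_w jump_count tau Z i t w <= (rate i * t)%:E)%E.
Proof.
move=> t0; rewrite integral_nneseries//; last first.
  by move=> n; apply/measurable_EFinP; exact: measurable_hit.
apply: lime_le; first by apply: is_cvg_nneseries => n _ _; apply: integral_ge0 => w _; rewrite lee_fin hit_ge0.
exists 1%N => // -[//|n] _ /=.
rewrite big_mkord -ge0_integral_sum//; last first.
  by move=> k; apply/measurable_EFinP; exact: measurable_hit.
apply: le_trans (_ : (Ex (np n.+1 i t))%:E <= _)%E; last by rewrite lee_fin Ex_np_le.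
rewrite /Submission.Ex /Rintegral fineK; last by apply: integrable_fin_num => //; exact: np_Li.
rewrite le_eqVlt; apply/orP; left; apply/eqP; apply: eq_integral => w _.
by rewrite sumEFin.
Qed.

Lemma jump_count_nd i (s t : R) w : s <= t ->
  (jump_count tau Z i s w <= jump_count tau Z i t w)%E.
Proof.
move=> st; apply: lee_nneseries => n; first by rewrite lee_fin.
by move=> _; rewrite lee_fin hit_nd.
Qed.

(** The mean count at each integer time is finite by monotone convergence, and counts are monotone
    in time. *)
Lemma ae_noexp : {ae P, forall w, noexp w}.
Proof.
have h (n : nat) : {ae P, forall w, forall i, (jump_count tau Z i n%:R w < +oo)%E}.
  apply: (@filter_forall _ _ _ _ _) => i.
  have Ij : P.-integrable setT (jump_count tau Z i n%:R).
    apply/integrableP; split; first exact: measurable_jump_count.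
    under eq_integral do rewrite gee0_abs ?jump_count_ge0//.
    by apply: le_lt_trans (integral_jump_count i (ler0n _ n)) _; rewrite ltry.
  apply: filterS (integrable_ae measurableT Ij) => w /(_ I).
  by rewrite fin_numE => /andP[_]; rewrite ltey.
apply: filterS (ae_foralln h) => w hw i t.
have [n tn] : exists n : nat, t <= n%:R.
  by exists (Num.bound `|t|); rewrite (le_trans (ler_norm _)) ?(ltW (archi_boundP _)).
by apply: le_lt_trans (hw n i); exact: jump_count_nd.
Qed.

Definition count i t w : R := fine (jump_count tau Z i t w).

Definition lam i t w : R :=
  mu i 0 * t + \sum_(j < d) wint i j (fun x => count j (t - x) w).

Lemma count_np p t w : (forall k, (p <= k)%N -> (t%:E < tau k w)%E) ->
  forall u i, u <= t -> count i u w = np p i u w.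
Proof.
move=> pt u i ut; rewrite /count (jump_count_np (p := p))// => k pk.
rewrite /hit leNgt (_ : (u%:E < tau k w)%E)//.
by apply: le_lt_trans (pt k pk); rewrite lee_fin.
Qed.

Lemma lam_lp p t w : (forall k, (p <= k)%N -> (t%:E < tau k w)%E) ->
  forall u i, u <= t -> lam i u w = lp tau Z mu phi p i u w.
Proof.
move=> pt u i ut; rewrite /lam /lp; congr (_ + _); apply: eq_bigr => j _.
apply: eq_Rintegral => x _; have [x0|x0] := ltP x 0.
  by rewrite /kern patchE memNset ?mul0r//= in_itv/= andbT leNgt x0.
by rewrite (count_np pt)// (le_trans _ ut)// gerBl.
Qed.

(** If all jump times were at most [t], the total count over the finitely many marks would exceed
    every integer. *)
Lemma noexp_tau w t : noexp w -> exists p, forall k, (p <= k)%N -> (t%:E < tau k w)%E.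
Proof.
move=> ne; apply: contrapT => /forallNP H.
have tk k : (tau k w <= t%:E)%E.
  have /existsNP[k' /not_implyP[kk']] := H k.
  move/negP; rewrite -leNgt; apply: le_trans.
  exact: tau_mono.
have np_le_count p i : np p i t w <= count i t w.
  rewrite -lee_fin /count fineK; last first.
    by rewrite ge0_fin_numE ?ne// jump_count_ge0.
  rewrite jump_countE (nneseries_split 0 p); last by move=> k _; rewrite lee_fin.
  rewrite add0n big_mkord sumEFin leeDl//; apply: nneseries_ge0 => k _ _.
  by rewrite lee_fin.
pose c := \sum_i count i t w.
have h p : p%:R <= c.
  apply: (@le_trans _ _ (\sum_i np p i t w)); last exact: ler_sum.
  rewrite /np exchange_big/= -[X in X%:R]card_ord -sum1_card natr_sum.
  apply: ler_sum => k _; rewrite (bigD1 (Z k w))//= /hit tk eqxx/= lerDl.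
  by apply: sumr_ge0.
have := h (Num.bound c); apply/negP; rewrite -ltNge.
have c0 : 0 <= c by exact: h 0%N.
exact: archi_boundP.
Qed.

Lemma count_ge0 i t w : 0 <= count i t w.
Proof. by rewrite fine_ge0// jump_count_ge0. Qed.

Lemma measurable_count i t : measurable_fun setT (count i t).
Proof. by apply: measurableT_comp => //; exact: measurable_jump_count. Qed.

Lemma count_nd i s t w : noexp w -> s <= t -> count i s w <= count i t w.
Proof.
move=> ne st; have [p pt] := noexp_tau t ne.
by rewrite (count_np pt)// (count_np pt)// np_nd.
Qed.

Lemma count0 i t w : t <= 0 -> count i t w = 0.
Proof.
move=> t0; have pt k : (0 <= k)%N -> (t%:E < tau k w)%E.
  by move=> _; apply: le_lt_trans (tau_gt0 k w); rewrite lee_fin.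
by rewrite (count_np pt)// /np big_ord0.
Qed.

(* The limit of the stopped martingales; it exists outside explosions, and the
   [limn_esup] makes it adapted everywhere. *)
Definition comp_mart i t w : R := fine (limn_esup (fun n => (Mst n i t w)%:E)).

Lemma Mst_eventually i t w : noexp w -> 0 <= t ->
  \forall n \near \oo, Mst n i t w = count i t w - lam i t w.
Proof.
move=> ne t0; have [p pt] := noexp_tau t ne.
exists p => // n /= pn.
have nt k : (n.+1 <= k)%N -> (t%:E < tau k w)%E.
  by move=> nk; apply: pt; rewrite (leq_trans pn)// ltnW.
have nE : stopped_time tau n t w = t by apply: stopE; apply: ltW; exact: pt.
by rewrite /Submission.Mst /Submission.Lst nE (count_np nt)// (lam_lp nt).
Qed.

Lemma comp_martE i t w : noexp w -> 0 <= t -> comp_mart i t w = count i t w - lam i t w.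
Proof.
move=> ne t0; have h := Mst_eventually i ne t0.
have c : (Mst n i t w)%:E @[n --> \oo] --> (count i t w - lam i t w)%:E.
  by apply: cvg_near_cst; apply: filterS h => n ->.
by rewrite /comp_mart; have [_ ->] := cvg_limn_einf_sup c.
Qed.

Lemma Mst_cvg i t w : noexp w -> 0 <= t -> Mst n i t w @[n --> \oo] --> comp_mart i t w.
Proof.
move=> ne t0; rewrite comp_martE//; apply: (@cvg_near_cst _ R^o).
by apply: filterS (Mst_eventually i ne t0) => n ->.
Qed.

Lemma comp_mart_Gm i t : 0 <= t -> Gm (past t) (comp_mart i t).
Proof.
move=> t0; apply: (@measurableT_comp _ _ _ (g_sigma_algebraType (past t))) => //.
apply: (@measurable_fun_limn_esup _ (g_sigma_algebraType (past t))) => n.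
by apply/measurable_EFinP; exact: Mst_Gm.
Qed.

Lemma measurable_comp_mart i t : 0 <= t -> measurable_fun setT (comp_mart i t).
Proof. by move=> t0; exact: Gm_measurable (@past_meas t) (comp_mart_Gm i t0). Qed.

Lemma lam_le i t w : noexp w -> lam i t w <= mu i 0 * t + \sum_(j < d) K i j * count j t w.
Proof.
move=> ne; have [p pt] := noexp_tau t ne.
rewrite (lam_lp pt)//; apply: (le_trans (lp_le Z mu phi_ge0 phi_meas phi_int tau_gt0 _ _ _ _)).
by rewrite lerD2l ler_sum// => j _; rewrite (count_np pt).
Qed.

Lemma lam_ge0 i t w : noexp w -> 0 <= t -> 0 <= lam i t w.
Proof. by move=> ne t0; have [p pt] := noexp_tau t ne; rewrite (lam_lp pt)// lp_ge0. Qed.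

Lemma Mst_nice n s t w : s <= t ->
  nice_path s t (fun i u => np n.+1 i u w) (fun i u => np n.+1 i u w - Mst n i u w).
Proof.
move=> st.
have -> : (fun i u => np n.+1 i u w - Mst n i u w) = (fun i u => Lst n i u w).
  by apply/funext => i; apply/funext => u; rewrite /Submission.Mst opprB addrC subrK.
split.
- by move=> i a b _ ab _; exact: np_nd.
- by move=> i a b _ ab _; exact: Lst_nd.
- exact: np_sparse.
- exact: Lst_unif.
Qed.

Lemma count_nice s t w : 0 <= s -> s <= t -> noexp w ->
  nice_path s t (fun i u => count i u w) (fun i u => count i u w - comp_mart i u w).
Proof.
move=> s0 st ne; have [p pt] := noexp_tau t ne.
have lE i u : s <= u -> u <= t -> count i u w - comp_mart i u w = lp tau Z mu phi p i u w.
  move=> su ut; rewrite comp_martE//; last exact: le_trans su.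
  by rewrite opprB addrC subrK (lam_lp pt).
split.
- by move=> i a b _ ab _; exact: count_nd.
- move=> i a b sa ab bt; by rewrite (lE i a sa (le_trans ab bt)) (lE i b (le_trans sa ab) bt) lp_nd.
- have [g g0 gP] := np_sparse Z tau_gt0 tau_nd tau_inc p s t w.
  exists g => // a b sa ab bt bag.
  have E i : count i b w - count i a w = np p i b w - np p i a w.
    by rewrite !(count_np pt)// (le_trans ab).
  have [h|[i0 h]] := gP a b sa ab bt bag; [left => i|right; exists i0 => i]; by rewrite E.
- move=> i e e0; have [g g0 gP] := lp_unif_cont Z mu_ge0 phi_ge0 phi_meas phi_int tau_gt0 p s t w i e0.
  exists g => // a b sa ab bt bag.
  by rewrite (lE i a sa (le_trans ab bt)) (lE i b (le_trans sa ab) bt) gP.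
Qed.

Lemma Mst_counting n s t : 0 <= s -> s <= t ->
  counting_martingale P past (Mst n) (np n.+1) s t.
Proof.
move=> s0 st; split => //.
- by move=> u v; exact: past_nd.
- by move=> i u su ut; apply: Mst_Gm; exact: le_trans su.
- by move=> i u su ut; apply: Mst_Li; exact: le_trans su.
- by move=> i u v B su uv vt; apply: Mst_orth => //; exact: le_trans su.
- by move=> i u _ _; exact: measurable_np.
- by apply: aeW => w; exact: Mst_nice.
pose C := \sum_(i < d) (n.+1%:R + Lbnd n i t).
have t0 := le_trans s0 st.
apply: (@Li_bounded _ _ _ _ _ (C ^+ 2)).
  apply: measurable_funX; apply: measurable_funD; apply: measurable_sum => i.
    by apply: measurable_funB; exact: measurable_np.
  by apply: measurable_funB; apply: measurable_funB; try exact: measurable_np; exact: Mst_measurable.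
move=> w; rewrite ger0_norm ?sqr_ge0// /variation -big_split/=.
have bnd i : 0 <= np n.+1 i t w - np n.+1 i s w + (np n.+1 i t w - Mst n i t w -
    (np n.+1 i s w - Mst n i s w)) <= n.+1%:R + Lbnd n i t.
  have E u : np n.+1 i u w - Mst n i u w = Lst n i u w.
    by rewrite /Submission.Mst opprB addrC subrK.
  rewrite !E; have nd := np_nd tau Z n.+1 i w st.
  have ld := Lst_nd Z mu_ge0 phi_ge0 phi_meas phi_int tau_gt0 n i w st.
  have /andP[l0 l1] := Lst_bnd n i w t0.
  have /andP[l0' l1'] := Lst_bnd n i w s0.
  have n1 := np_le tau Z n.+1 i t w.
  have n0 := np_ge0 tau Z n.+1 i s w.
  move: nd ld l0 l1 l0' l1' n1 n0.
  move: (np _ _ t w) (np _ _ s w) (Lst n i t w) (Lst n i s w) (Lbnd n i t) (Lbnd n i s).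
  by move=> *; apply/andP; split; lra.
rewrite lerXn2r ?nnegrE//.
- by apply: sumr_ge0 => i _; have /andP[] := bnd i.
- by apply: sumr_ge0 => i _; have /andP[+ _] := bnd i; move/le_trans; apply; have /andP[] := bnd i.
- by apply: ler_sum => i _; have /andP[] := bnd i.
Qed.

Lemma Ex_Mst_sqr n i t : 0 <= t ->
  Li (fun w => Mst n i t w ^+ 2) /\ Ex (fun w => Mst n i t w ^+ 2) <= rate i * t.
Proof.
move=> t0; have cm := Mst_counting n (lexx 0) t0.
pose th (j : 'I_d) : R := (j == i)%:R.
have iE : inc (Mst n) 0 th t = Mst n i t.
  apply/funext => w; rewrite /inc (bigD1 i)//= big1 ?addr0.
    by rewrite /th eqxx mul1r Mst0 subr0.
  by move=> j ji; rewrite /th (negbTE ji) mul0r.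
have qE : qv (np n.+1) 0 t th = np n.+1 i t.
  apply/funext => w; rewrite /qv (bigD1 i)//= big1 ?addr0.
    by rewrite /th eqxx expr1n mul1r [X in _ - X]np0// subr0.
  by move=> j ji; rewrite /th (negbTE ji) expr0n mul0r.
have := inc_isometry cm th; have := inc_sqr_Li cm th t0 (lexx t).
by rewrite iE qE => L ->; split => //; exact: Ex_np_le.
Qed.

Lemma comp_mart_sqr i t : 0 <= t ->
  Li (fun w => comp_mart i t w ^+ 2) /\ Ex (fun w => comp_mart i t w ^+ 2) <= rate i * t.
Proof.
move=> t0; apply: (@Li_limit _ _ _ P (fun n w => Mst n i t w ^+ 2)).
- by move=> n; have [] := Ex_Mst_sqr n i t0.
- by apply: measurable_funX; exact: measurable_comp_mart.
- by move=> n w; exact: sqr_ge0.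
- apply: filterS ae_noexp => w ne; rewrite expr2; under eq_fun do rewrite expr2.
  by apply: cvgM; exact: Mst_cvg.
- by move=> n; have [] := Ex_Mst_sqr n i t0.
Qed.

Lemma count_Li i t : 0 <= t -> Li (count i t) /\ Ex (count i t) <= rate i * t.
Proof.
move=> t0; apply: (@Li_limit _ _ _ P (fun n => np n.+1 i t)).
- by move=> n; exact: np_Li.
- exact: measurable_count.
- by move=> n w; exact: np_ge0.
- apply: filterS ae_noexp => w ne; have [p pt] := noexp_tau t ne.
  apply: (@cvg_near_cst _ R^o); exists p => // n /= pn.
  by rewrite (count_np (p := n.+1) (t := t))// => k nk; apply: pt; rewrite (leq_trans pn)// ltnW.
- by move=> n; exact: Ex_np_le.
Qed.

(** From [N = M + Lambda <= |M| + mu t + K N] by comparison, path by path. This transfers square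
    integrability from [M] to [N]. *)
Lemma count_le_mart i t w : noexp w -> 0 <= t ->
  count i t w <= \sum_j A i j * (`|comp_mart j t w| + mu j 0 * t).
Proof.
move=> ne t0.
pose y : 'cV[R]_d := \col_k count k t w.
pose z : 'cV[R]_d := \col_k (`|comp_mart k t w| + mu k 0 * t).
suff : y i 0 <= (A *m z) i 0 by rewrite !mxE; under eq_bigr do rewrite !mxE.
apply: (le_invmx_subK K0 rho_lt1) => k.
rewrite [y k 0]mxE [z k 0]mxE mxE.
under eq_bigr do rewrite [y _ _]mxE.
have E := comp_martE k ne t0; have l := lam_le k t ne.
have n := ler_norm (comp_mart k t w).
have c : count k t w = comp_mart k t w + lam k t w by rewrite E subrK.
by rewrite [leLHS]c -addrA lerD.
Qed.

Lemma sqr_sum_le (I : finType) (x : I -> R) :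
  (\sum_i x i) ^+ 2 <= #|I|%:R * \sum_i x i ^+ 2.
Proof.
have -> : #|I|%:R * \sum_i x i ^+ 2 =
    \sum_(i : I) \sum_(j : I) (x i ^+ 2 / 2 + x j ^+ 2 / 2).
  rewrite [RHS](eq_bigr (fun i => #|I|%:R * (x i ^+ 2 / 2) + \sum_j x j ^+ 2 / 2)); last first.
    by move=> i _; rewrite big_split/= sumr_const mulr_natl.
  have h : \sum_i x i ^+ 2 = 2 * \sum_i x i ^+ 2 / 2.
    by rewrite mulr_sumr; apply: eq_bigr => i _; field.
  rewrite big_split/= sumr_const [in LHS]h mulr_sumr -[X in _ = _ + X]mulr_natl.
  by rewrite -!mulr_sumr; ring.
rewrite expr2 mulr_suml; apply: ler_sum => i _; rewrite mulr_sumr; apply: ler_sum => j _.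
by have := sqr_ge0 (x i - x j); rewrite sqrrB; lra.
Qed.

Lemma sqr_sum_Li (I : finType) (f : I -> Omega -> R) :
  (forall i, measurable_fun setT (f i)) -> (forall i, Li (fun w => f i w ^+ 2)) ->
  Li (fun w => (\sum_i f i w) ^+ 2).
Proof.
move=> mf Lf.
apply: (@Li_le _ _ _ _ _ (fun w => #|I|%:R * \sum_i f i w ^+ 2)).
- by apply: measurable_funX; exact: measurable_sum.
- by apply/LiZ/Li_sum.
- by move=> w; rewrite ger0_norm ?sqr_ge0// sqr_sum_le.
Qed.

Lemma sqrD_Li (f g : Omega -> R) : measurable_fun setT f -> measurable_fun setT g ->
  Li (fun w => f w ^+ 2) -> Li (fun w => g w ^+ 2) -> Li (fun w => (f w + g w) ^+ 2).
Proof.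
move=> mf mg Lf Lg.
apply: (@Li_le _ _ _ _ _ (fun w => 2 * (f w ^+ 2 + g w ^+ 2))).
- by apply: measurable_funX; exact: measurable_funD.
- by apply/LiZ/LiD.
- move=> w; rewrite ger0_norm ?sqr_ge0//.
  by have := sqr_ge0 (f w - g w); rewrite sqrrB sqrrD; lra.
Qed.

Lemma sqrZ_Li c (f : Omega -> R) : Li (fun w => f w ^+ 2) -> Li (fun w => (c * f w) ^+ 2).
Proof. by move=> Lf; under eq_fun do rewrite exprMn; exact: LiZ. Qed.

Lemma count_sqr_Li i t : 0 <= t -> Li (fun w => count i t w ^+ 2).
Proof.
move=> t0.
have mj j : measurable_fun setT (fun w => `|comp_mart j t w| + mu j 0 * t).
  apply: measurable_funD => //; apply: measurableT_comp => //.
  exact: measurable_comp_mart.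
apply: (@Li_le_ae _ _ _ _ _ (fun w => (\sum_j A i j * (`|comp_mart j t w| + mu j 0 * t)) ^+ 2)).
- by apply: measurable_funX; exact: measurable_count.
- apply: sqr_sum_Li => j; first by apply: measurable_funM.
  apply: sqrZ_Li; apply: sqrD_Li => //.
  + by apply: measurableT_comp => //; exact: measurable_comp_mart.
  + under eq_fun do rewrite real_normK ?num_real//.
    by have [] := comp_mart_sqr j t0.
  + exact: Li_cst.
- apply: filterS ae_noexp => w ne; rewrite ger0_norm ?sqr_ge0//.
  have c := count_le_mart i ne t0.
  by rewrite lerXn2r ?nnegrE ?count_ge0// (le_trans _ c)// count_ge0.
Qed.

Lemma comp_mart_Li i t : 0 <= t -> Li (comp_mart i t).
Proof.
move=> t0; apply: (@Li_le _ _ _ _ _ (fun w => 1 + comp_mart i t w ^+ 2)).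
- exact: measurable_comp_mart.
- by apply: LiD; [exact: Li_cst | have [] := comp_mart_sqr i t0].
- move=> w; rewrite -[X in 1 + X]real_normK ?num_real//.
  by have := sqr_ge0 (`|comp_mart i t w| - 1); rewrite sqrrB; have := normr_ge0 (comp_mart i t w); lra.
Qed.

(** A majorant of the stopped martingales that does not depend on the stopping index. *)
Let dom i t w := count i t w + (mu i 0 * t + \sum_(j < d) K i j * count j t w).

Let dom_Li i t : 0 <= t -> Li (dom i t).
Proof.
move=> t0; apply: LiD; first by have [] := count_Li i t0.
apply: LiD; first exact: Li_cst.
by apply: Li_sum => j _; apply: LiZ; have [] := count_Li j t0.
Qed.

Let Mst_dom n i t w : noexp w -> 0 <= t -> `|Mst n i t w| <= dom i t w.
Proof.
move=> ne t0; rewrite /Submission.Mst (le_trans (ler_normB _ _))//.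
have npc j : np n.+1 j t w <= count j t w.
  have [p pt] := noexp_tau t ne.
  have pt' k : (maxn p n.+1 <= k)%N -> (t%:E < tau k w)%E.
    by rewrite geq_max => /andP[pk _]; exact: pt.
  rewrite (count_np pt')// /np.
  rewrite -(subnKC (leq_maxr p n.+1)) big_split_ord/= lerDl; apply: sumr_ge0 => k _.
  exact: hit_ge0.
rewrite ger0_norm ?np_ge0// lerD// ger0_norm ?Lst_ge0//.
apply: (le_trans (Lst_le Z mu_ge0 phi_ge0 phi_meas phi_int tau_gt0 tau_nd n i w t0)).
by rewrite lerD2l ler_sum// => j _; rewrite ler_wpM2l.
Qed.

Lemma comp_mart_orth i s t B : 0 <= s -> s <= t -> <<s past s >> B ->
  Ex (fun w => \1_B w * (comp_mart i t w - comp_mart i s w)) = 0.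
Proof.
move=> s0 st FB; have t0 := le_trans s0 st.
have mB : measurable B by apply: past_meas FB.
have [| | | | |_ +] := @Ex_dominated _ _ _ P (fun n w => \1_B w * (Mst n i t w - Mst n i s w))
  (fun w => \1_B w * (comp_mart i t w - comp_mart i s w)) (fun w => dom i t w + dom i s w).
- move=> n; apply: measurable_funM; first exact: measurable_indic.
  by apply: measurable_funB; exact: Mst_measurable.
- apply: measurable_funM; first exact: measurable_indic.
  by apply: measurable_funB; exact: measurable_comp_mart.
- apply: filterS ae_noexp => w ne; apply: cvgM; first exact: cvg_cst.
  by apply: cvgB; exact: Mst_cvg.
- by apply: LiD; exact: dom_Li.
- apply: filterS ae_noexp => w ne n; rewrite normrM.
  apply: (@le_trans _ _ `|Mst n i t w - Mst n i s w|).
    by rewrite ler_piMl// indicE; case: (_ \in _); rewrite normr_nat.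
  by rewrite (le_trans (ler_normB _ _))// lerD// Mst_dom.
rewrite (_ : (fun n => _) = fun=> 0); last first.
  by apply/funext => n; exact: Mst_orth.
by move=> /(cvg_lim (@Rhausdorff R)) <-; exact: lim_cst.
Qed.

Lemma hawkes_counting s t : 0 <= s -> s <= t ->
  counting_martingale P past comp_mart count s t.
Proof.
move=> s0 st; have t0 := le_trans s0 st; split => //.
- by move=> u v; exact: past_nd.
- by move=> i u su ut; apply: comp_mart_Gm; exact: le_trans su.
- by move=> i u su ut; apply: comp_mart_Li; exact: le_trans su.
- by move=> i u v B su uv vt; apply: comp_mart_orth => //; exact: le_trans su.
- by move=> i u _ _; exact: measurable_count.
- by apply: filterS ae_noexp => w ne; exact: count_nice.
apply: (@Li_le_ae _ _ _ _ _ (fun w => (\sum_i (count i t w + (mu i 0 * t + \sum_j K i j * count j t w))) ^+ 2)).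
- apply: measurable_funX; apply: measurable_funD; apply: measurable_sum => i.
    by apply: measurable_funB; exact: measurable_count.
  by apply: measurable_funB; apply: measurable_funB; try exact: measurable_count; exact: measurable_comp_mart.
- have mK i j : measurable_fun setT (fun w => K i j * count j t w).
    by apply: measurable_funM => //; exact: measurable_count.
  have mS i : measurable_fun setT (fun w => \sum_j K i j * count j t w).
    exact: measurable_sum.
  apply: sqr_sum_Li => i.
    by apply: measurable_funD; [exact: measurable_count | exact: measurable_funD].
  apply: sqrD_Li; [exact: measurable_count|exact: measurable_funD|exact: count_sqr_Li|].
  apply: sqrD_Li => //; first exact: Li_cst.
  by apply: sqr_sum_Li => // j; apply: sqrZ_Li; exact: count_sqr_Li.
- apply: filterS ae_noexp => w ne; rewrite ger0_norm ?sqr_ge0// /variation -big_split/=.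
  have bnd i : 0 <= count i t w - count i s w + (count i t w - comp_mart i t w -
      (count i s w - comp_mart i s w)) <= count i t w + (mu i 0 * t + \sum_j K i j * count j t w).
    have [cnd lnd _ _] := count_nice s0 st ne.
    have E u : 0 <= u -> count i u w - comp_mart i u w = lam i u w.
      by move=> u0; rewrite comp_martE// opprB addrC subrK.
    have ll : lam i s w <= lam i t w by rewrite -(E t t0) -(E s s0); exact: lnd.
    rewrite (E t t0) (E s s0).
    move: ll (lam_ge0 i ne s0) (lam_le i t ne) (count_nd i ne st) (count_ge0 i s w).
    move: (lam i t w) (lam i s w) (count i t w) (count i s w) (_ + _) => *.
    by apply/andP; split; lra.
  rewrite lerXn2r ?nnegrE//.
  + by apply: sumr_ge0 => i _; have /andP[] := bnd i.
  + by apply: sumr_ge0 => i _; have /andP[+ _] := bnd i; move/le_trans; apply; have /andP[] := bnd i.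
  + by apply: ler_sum => i _; have /andP[] := bnd i.
Qed.

Lemma comp_mart0 i w : noexp w -> comp_mart i 0 w = 0.
Proof.
move=> ne; rewrite comp_martE// count0// sub0r /lam mulr0 add0r big1 ?oppr0// => j _.
rewrite -[RHS](mulr0 (K i j)) -(wint_cst phi_ge0 phi_meas phi_int).
apply: eq_Rintegral => x _; have [x0|x0] := ltP x 0.
  by rewrite /kern patchE memNset ?mul0r//= in_itv/= andbT leNgt x0.
by rewrite count0// sub0r oppr_le0.
Qed.

Lemma Ex_comp_mart i t : 0 <= t -> Ex (comp_mart i t) = 0.
Proof.
move=> t0; have h := @comp_mart_orth i 0 t setT (lexx 0) t0
  (@measurableT _ (g_sigma_algebraType (past 0))).
rewrite -h; apply: Ex_ae_eq.
- exact: measurable_comp_mart.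
- apply: measurable_funM; first exact: measurable_indic.
  by apply: measurable_funB; exact: measurable_comp_mart.
- by apply: filterS ae_noexp => w ne; rewrite comp_mart0// subr0 indicT mul1r.
Qed.

Definition mean i t : R := Ex (count i t).

Lemma count_Li_all i t : Li (count i t).
Proof.
have [t0|t0] := leP 0 t; first by have [] := count_Li i t0.
have -> : count i t = fun=> 0 by apply/funext => w; rewrite count0// ltW.
exact: Li_cst.
Qed.

Lemma mean0 i t : t <= 0 -> mean i t = 0.
Proof.
move=> t0; rewrite /mean -[RHS](Ex_cst P); congr (Submission.Ex _ _).
by apply/funext => w; rewrite count0.
Qed.

Lemma mean_nd i s t : s <= t -> mean i s <= mean i t.
Proof.
move=> st; apply: Ex_le_ae; [exact: count_Li_all..|].
by apply: filterS ae_noexp => w ne; exact: count_nd.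
Qed.

Lemma measurable_hit_pair j n (t : R) :
  measurable_fun setT (fun p : Omega * R => hit j n (t - p.2) p.1).
Proof.
rewrite (_ : (fun _ => _) = \1_([set p : Omega * R | (tau n p.1 + p.2%:E <= t%:E)%E] `&`
    ((fun p : Omega * R => Z n p.1) @^-1` [set j]))).
  apply: measurable_indic; apply: measurableI.
    rewrite -[X in measurable X]setTI; apply: emeasurable_fun_infty_c => //.
    apply: emeasurable_funD; first exact: (measurableT_comp (tau_meas n) measurable_fst).
    by apply/measurable_EFinP; exact: measurable_snd.
  rewrite (_ : _ @^-1` _ = (Z n @^-1` [set j]) `*` setT).
    by apply: measurableX => //; exact: Z_meas.
  by apply/seteqP; split => p //= [].
apply/funext => p; apply/esym/indic_iff => /=.
have -> : (tau n p.1 <= (t - p.2)%:E)%E = (tau n p.1 + p.2%:E <= t%:E)%E.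
  by rewrite EFinB leeBrDr.
by split => [[-> ->]|/andP[-> /eqP ->]]; rewrite ?eqxx.
Qed.

Local Notation leb := (@lebesgue_measure R).

Lemma mean_tonelli i j t :
  (\int[P]_w \int[leb]_x ((kern phi i j x)%:E * jump_count tau Z j (t - x) w) =
   (wint i j (fun x => mean j (t - x)))%:E)%E.
Proof.
rewrite (@fubini_tonelli _ _ _ _ _ P leb
  (fun p => (kern phi i j p.2)%:E * jump_count tau Z j (t - p.2)%R p.1)%E)/=; last 2 first.
- apply: emeasurable_funM.
    apply/measurable_EFinP; apply: (measurableT_comp (measurable_kern phi_meas i j)).
    exact: measurable_snd.
  apply: ge0_emeasurable_sum => n; first by move=> x _ _; rewrite lee_fin.
  by move=> _; apply/measurable_EFinP; exact: measurable_hit_pair.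
- by move=> p; rewrite mule_ge0 ?lee_fin ?kern_ge0// jump_count_ge0.
rewrite /Submission.wint /Rintegral fineK; last first.
  apply: integrable_fin_num => //.
  apply: (wint_integrable phi_ge0 phi_meas phi_int _ _ (B := mean j t)).
    by apply: nd_measurable_sub => a b; exact: mean_nd.
  move=> x x0; rewrite ger0_norm; first by rewrite mean_nd// gerBl.
  by apply: Ex_ge0 => w; exact: count_ge0.
apply: eq_integral => x _.
rewrite ge0_integralZl//; last 3 first.
- exact: measurable_jump_count.
- by move=> w _; exact: jump_count_ge0.
- by rewrite lee_fin kern_ge0.
rewrite EFinM; congr (_ * _)%E.
rewrite /mean /Submission.Ex /Rintegral fineK; last first.
  by apply: integrable_fin_num => //; exact: count_Li_all.
apply: ge0_ae_eq_integral => //.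
- exact: measurable_jump_count.
- by apply/measurable_EFinP; exact: measurable_count.
- by move=> w _; exact: jump_count_ge0.
- by move=> w _; rewrite lee_fin count_ge0.
apply: filterS ae_noexp => w ne _; rewrite /count fineK//.
by rewrite ge0_fin_numE ?ne// jump_count_ge0.
Qed.

(** The mean of the compensator is computed by Tonelli; the martingale part has mean zero. *)
Lemma meanE i t : 0 <= t ->
  mean i t = mu i 0 * t + \sum_(j < d) wint i j (fun x => mean j (t - x)).
Proof.
move=> t0.
have LM := comp_mart_Li i t0; have LC := count_Li_all i t.
have -> : mean i t = Ex (fun w => count i t w - comp_mart i t w).
  by rewrite ExB// Ex_comp_mart// subr0.
apply/EFin_inj.
rewrite /Submission.Ex /Rintegral fineK; last by apply: integrable_fin_num => //; exact: LiB.
rewrite EFinD -sumEFin.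
under [in RHS]eq_bigr do rewrite -mean_tonelli.
have mF j : measurable_fun setT (fun w => \int[leb]_x ((kern phi i j x)%:E * jump_count tau Z j (t - x) w))%E.
  apply: (@measurable_fun_fubini_tonelli_F _ _ _ _ _ leb
    (fun p => (kern phi i j p.2)%:E * jump_count tau Z j (t - p.2)%R p.1)%E).
  - apply: emeasurable_funM.
      apply/measurable_EFinP; apply: (measurableT_comp (measurable_kern phi_meas i j)).
      exact: measurable_snd.
    apply: ge0_emeasurable_sum => n; first by move=> x _ _; rewrite lee_fin.
    by move=> _; apply/measurable_EFinP; exact: measurable_hit_pair.
  - by move=> p; rewrite mule_ge0 ?lee_fin ?kern_ge0// jump_count_ge0.
have F0 j w : (0 <= \int[leb]_x ((kern phi i j x)%:E * jump_count tau Z j (t - x) w))%E.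
  by apply: integral_ge0 => x _; rewrite mule_ge0 ?lee_fin ?kern_ge0// jump_count_ge0.
rewrite -ge0_integral_sum//.
have -> : (mu i 0 * t)%:E = (\int[P]_w (mu i 0 * t)%:E)%E.
  by rewrite integral_cst//= [X in (_ * X)%E]probability_setT mule1.
rewrite -ge0_integralD//; last 3 first.
- by move=> w _; rewrite lee_fin mulr_ge0.
- by move=> w _; exact: sume_ge0.
- exact: emeasurable_sum.
have sE : {ae P, forall w, ((count i t w - comp_mart i t w)%:E =
    (mu i 0 * t)%:E + \sum_j \int[leb]_x ((kern phi i j x)%:E * jump_count tau Z j (t - x) w))%E}.
  apply: filterS ae_noexp => w ne.
  have [p pt] := noexp_tau t ne.
  rewrite comp_martE// opprB addrC subrK (lam_lp pt)//.
  rewrite -(cumulated_intensity_lp mu_ge0 phi_ge0 phi_meas phi_int tau_gt0 _ (p := p))//.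
    by rewrite cumulated_intensity.
  move=> j k pk; rewrite /hit leNgt (_ : (t%:E < tau k w)%E)//; exact: pt.
apply: ae_eq_integral => //.
- by apply/measurable_EFinP; exact: (LiM (LiB LC LM)).
- by apply: emeasurable_funD => //; exact: emeasurable_sum.
- by apply: filterS sE.
Qed.

Lemma mean_increment i a b : a <= b -> mean i b - mean i a <= rate i * (b - a).
Proof.
move=> ab.
have -> : rate i * (b - a) = (A *m ((b - a) *: mu)) i 0.
  by rewrite -scalemxAr [RHS]mxE mulrC.
(* The drift contributes exactly [(b - a) mu]. The horizon is [max 0 b] because [b] may be
   negative. *)
apply: (@renewal_increment _ _ _ phi_ge0 phi_meas phi_int rho_lt1 mean
  (fun i u => mu i 0 * u) (Num.max 0 b) (b - a)).
- by move=> k x y; exact: mean_nd.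
- by move=> k x; exact: mean0.
- by move=> k u u0 _; exact: meanE.
- by move=> k a' b' _ ab' _ bah; rewrite -mulrBr mulrC mxE ler_wpM2r.
- by rewrite subr_ge0.
- by rewrite le_max lexx.
- exact: ab.
- by rewrite le_max lexx orbT.
- exact: lexx.
Qed.

(* What is lost in replacing [\int_0^t phi(x) N(t - x) dx] by [K N(t)]. *)
Definition rem i t w : R :=
  \sum_j wint i j (fun x => count j t w - count j (t - x) w).

Let count_sub_meas j t w : noexp w -> measurable_fun setT (fun x : R => count j (t - x) w).
Proof. by move=> ne; apply: (nd_measurable_sub (n := fun u => count j u w)) => a b; exact: count_nd. Qed.

Let count_sub_bnd j (t : R) w (x : R) : noexp w -> 0 <= x -> `|count j (t - x) w| <= count j t w.
Proof. by move=> ne x0; rewrite ger0_norm ?count_ge0// count_nd// gerBl. Qed.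

Lemma rem_ge0 i t w : noexp w -> 0 <= rem i t w.
Proof.
move=> ne; apply: sumr_ge0 => j _; apply: wint_ge0 => // x x0.
by rewrite subr_ge0 count_nd// gerBl.
Qed.

Lemma remE i t w : noexp w -> 0 <= t ->
  rem i t w = comp_mart i t w + mu i 0 * t + \sum_j K i j * count j t w - count i t w.
Proof.
move=> ne t0; have -> : rem i t w =
    \sum_j (K i j * count j t w - wint i j (fun x => count j (t - x) w)).
  apply: eq_bigr => j _.
  rewrite (wintB phi_ge0 phi_meas phi_int _ _ (B := count j t w)).
  - by rewrite (wint_cst phi_ge0 phi_meas phi_int).
  - exact: measurable_cst.
  - exact: count_sub_meas.
  - by move=> x _; rewrite ger0_norm ?count_ge0.
  - by move=> x; exact: count_sub_bnd.
by rewrite sumrB comp_martE// /lam; ring.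
Qed.

Lemma countE i t w : noexp w -> 0 <= t ->
  count i t w = rate i * t + \sum_j A i j * (comp_mart j t w - rem j t w).
Proof.
move=> ne t0.
pose y : 'cV[R]_d := \col_k count k t w.
pose z : 'cV[R]_d := \col_k (comp_mart k t w - rem k t w).
have : (1%:M - K) *m y = t *: mu + z.
  have Ky k : (K *m y) k 0 = \sum_j K k j * count j t w.
    by rewrite mxE; apply: eq_bigr => j _; rewrite [y _ _]mxE.
  apply/colP => k; rewrite mulmxBl mul1mx.
  transitivity (y k 0 - (K *m y) k 0); first by rewrite [LHS]mxE [X in _ + X = _]mxE.
  transitivity (t * mu k 0 + z k 0); last by rewrite [RHS]mxE [X in _ = X + _]mxE.
  by rewrite Ky [y k 0]mxE [z k 0]mxE remE//; ring.
move=> /(congr1 (mulmx A)); rewrite mulmxA mulVmx ?mul1mx; last exact: subK_unit.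
move=> /colP/(_ i); rewrite mxE => ->; rewrite mulmxDr -scalemxAr mxE [X in X + _]mxE mulrC.
by congr (_ + _); rewrite mxE; apply: eq_bigr => j _; rewrite mxE.
Qed.

(** The mean number of jumps in []t - x, t]] is at most a constant times [min x t], so [tail]
    controls the mean of [rem]. *)
Definition tail i j t : R := wint i j (fun x => Num.min x t).

Let min_meas t : measurable_fun setT (fun x : R => Num.min x t).
Proof. exact: measurable_minr. Qed.

Let min_bnd (t x : R) : 0 <= t -> 0 <= x -> `|Num.min x t| <= t.
Proof. by move=> t0 x0; rewrite ger0_norm ?le_min ?x0// ge_min lexx orbT. Qed.

Lemma tail_ge0 i j t : 0 <= t -> 0 <= tail i j t.
Proof. by move=> t0; apply: wint_ge0 => // x x0; rewrite le_min x0. Qed.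

(** [rem] is defined path by path through an integral in [x]; the function [f] given by [remE] is a
    combination of integrable variables equal to it almost surely. *)
Lemma rem_Li i t : 0 <= t -> exists2 f : Omega -> R,
  Li f & {ae P, forall w, rem i t w = f w} /\ Ex f <= \sum_j rate j * tail i j t.
Proof.
move=> t0.
exists (fun w => comp_mart i t w + mu i 0 * t + \sum_j K i j * count j t w - count i t w).
  apply: LiB; last exact: count_Li_all.
  apply: LiD; last by apply: Li_sum => j _; apply: LiZ; exact: count_Li_all.
  by apply: LiD; [exact: comp_mart_Li | exact: Li_cst].
split; first by apply: filterS ae_noexp => w ne; exact: remE.
have LM := comp_mart_Li i t0.
have LS : Li (fun w => \sum_j K i j * count j t w).
  by apply: Li_sum => j _; apply: LiZ; exact: count_Li_all.
have LC := Li_cst P (mu i 0 * t).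
rewrite (ExB (LiD (LiD LM LC) LS) (count_Li_all i t)) (ExD (LiD LM LC) LS) (ExD LM LC).
rewrite Ex_comp_mart// Ex_cst add0r -/(mean i t).
rewrite (_ : Ex (fun w => \sum_j K i j * count j t w) = \sum_j K i j * mean j t); last first.
  rewrite (_ : (fun w => _) = (fun w => \sum_(j <- enum 'I_d) K i j * count j t w)); last first.
    by apply/funext => w; rewrite big_enum.
  rewrite Ex_sum => [|j]; last by apply: LiZ; exact: count_Li_all.
  by rewrite big_enum/=; apply: eq_bigr => j _; rewrite ExZ//; exact: count_Li_all.
rewrite meanE// opprD addrACA subrr add0r -sumrB; apply: ler_sum => j _.
have mm : measurable_fun setT (fun x : R => mean j (t - x)).
  by apply: nd_measurable_sub => a b; exact: mean_nd.
have mB (x : R) : 0 <= x -> `|mean j (t - x)| <= mean j t.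
  move=> x0; rewrite ger0_norm; first by rewrite mean_nd// gerBl.
  by apply: Ex_ge0 => w; exact: count_ge0.
rewrite -(wint_cst phi_ge0 phi_meas phi_int).
have m0 u : 0 <= mean j u by apply: Ex_ge0 => w; exact: count_ge0.
have mc (x : R) : 0 <= x -> `|mean j t| <= mean j t by move=> _; rewrite ger0_norm.
have wE := @wintB _ _ _ phi_ge0 phi_meas phi_int i j (fun=> mean j t) _ _
  (@measurable_cst _ _ _ _ setT (mean j t)) mm mc mB.
rewrite -wE /tail.
have -> : rate j * wint i j (fun x => Num.min x t) = wint i j (fun x => rate j * Num.min x t).
  rewrite /Submission.wint -RintegralZl//.
    by apply: eq_Rintegral => x _; rewrite mulrCA.
  apply: (wint_integrable phi_ge0 phi_meas phi_int _ _ (B := t)).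
    exact: min_meas.
  by move=> x x0; exact: min_bnd.
apply: (wint_le phi_ge0 phi_meas phi_int _ _ (B := mean j t + rate j * t)).
- by apply: measurable_funB; [exact: measurable_cst | exact: mm].
- by apply: measurable_funM; [exact: measurable_cst | exact: min_meas].
- move=> x x0; rewrite ger0_norm ?subr_ge0 ?mean_nd ?gerBl//.
  rewrite lerBlDr -addrA lerDl; apply: addr_ge0; last exact: m0.
  by apply: mulr_ge0; [exact: rate_ge0 | exact: t0].
- move=> x x0; rewrite normrM ger0_norm ?rate_ge0//.
  apply: (@le_trans _ _ (rate j * t)); first by rewrite ler_wpM2l ?rate_ge0// min_bnd.
  by rewrite lerDr; exact: m0.
- move=> x x0; rewrite /Num.min; case: ifP => xt.
    have e : t - (t - x) = x by ring.
    have := @mean_increment j (t - x) t; rewrite e; apply.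
    by rewrite gerBl.
  have tx : t <= x by rewrite leNgt xt.
  have z : mean j 0 = 0 by exact: mean0.
  have z' : mean j (t - x) = 0 by apply: mean0; rewrite subr_le0.
  by have := @mean_increment j 0 t t0; rewrite z z' !subr0.
Qed.

(** * Consequences of the half moment of the kernel *)

Section half_moment.
Hypothesis phi_half : forall i j,
  (\int[lebesgue_measure]_(t in `[0%R, +oo[)
       (Num.sqrt t * phi i j t)%:E < +oo)%E.

Let hk i j (x : R) : R := Num.sqrt x * kern phi i j x.

Let hk_ge0 i j x : 0 <= hk i j x.
Proof. by rewrite /hk mulr_ge0 ?sqrtr_ge0// kern_ge0. Qed.

Let measurable_hk i j : measurable_fun setT (hk i j).
Proof.
apply: measurable_funM; last exact: measurable_kern.
by apply: continuous_measurable_fun; exact: sqrt_continuous.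
Qed.

Lemma integrable_half i j : leb.-integrable setT (EFin \o hk i j).
Proof.
apply/integrableP; split; first by apply/measurable_EFinP; exact: measurable_hk.
under eq_integral do rewrite /= ger0_norm//.
rewrite (_ : (fun x => _) = (fun x => (Num.sqrt x * phi i j x)%:E) \_ `[0, +oo[); last first.
  by apply/funext => x; rewrite /hk /kern /patch; case: ifP; rewrite ?mulr0.
by rewrite -integral_mkcond; exact: phi_half.
Qed.

(** A minimum is at most the geometric mean: this is where the exponent 1/2 enters. *)
Let min_le_sqrt (x t : R) : 0 <= x -> 0 <= t -> Num.min x t <= Num.sqrt t * Num.sqrt x.
Proof.
move=> x0 t0; rewrite /Num.min; case: ltP => xt.
  by rewrite -[leLHS](sqr_sqrtr x0) expr2 ler_wpM2r ?sqrtr_ge0// ler_wsqrtr// ltW.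
by rewrite -[leLHS](sqr_sqrtr t0) expr2 ler_wpM2l ?sqrtr_ge0// ler_wsqrtr.
Qed.

Definition half i j : R := \int[leb]_(x in setT) hk i j x.

Lemma tail_le i j t : 0 <= t -> tail i j t <= Num.sqrt t * half i j.
Proof.
move=> t0; rewrite /half -RintegralZl//; last exact: integrable_half.
apply: le_Rintegral => //.
- apply: (wint_integrable phi_ge0 phi_meas phi_int _ _ (B := t)) => //.
  by move=> x x0; exact: min_bnd.
- rewrite (_ : EFin \o _ = (fun x => (Num.sqrt t)%:E * (hk i j x)%:E)%E).
    by apply: integrableZl => //; exact: integrable_half.
  by apply/funext => x; rewrite -EFinM.
move=> x _; have [x0|x0] := ltP x 0.
  by rewrite /hk /kern patchE memNset ?mul0r ?mulr0//= in_itv/= andbT leNgt x0.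
by rewrite /hk mulrA [leRHS]mulrC ler_wpM2l ?kern_ge0// min_le_sqrt.
Qed.

(** [min x T / sqrt T] tends to 0 for fixed [x] and is at most [sqrt x]. Dominated convergence
    improves the [O(sqrt T)] of [tail_le] to [o(sqrt T)]. *)
Lemma tail_cvg i j (T : nat -> R) : (forall n, 0 < T n) -> T n @[n --> \oo] --> +oo ->
  tail i j (T n) / Num.sqrt (T n) @[n --> \oo] --> 0.
Proof.
move=> T0 Too.
pose f_ n x := kern phi i j x * Num.min x (T n) / Num.sqrt (T n).
have [| | | | |_ +] := @Rintegral_dominated _ _ R leb setT measurableT f_ (cst 0) (hk i j).
- move=> n; apply: measurable_funM => //; apply: measurable_funM => //.
    exact: measurable_kern.
  exact: min_meas.
- exact: measurable_cst.
- apply: aeW => x _.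
  have [x0|x0] := ltP x 0.
    rewrite (_ : f_ ^~ x = fun=> 0); first exact: cvg_cst.
    by apply/funext => n; rewrite /f_ /kern patchE memNset ?mul0r//= in_itv/= andbT leNgt x0.
  apply/cvgrPdist_le => e e0.
  pose c := (kern phi i j x * x / e) ^+ 2.
  move/cvgryPge: Too => /(_ c); apply: filterS => n Tc.
  rewrite sub0r normrN ger0_norm; last first.
    by rewrite mulr_ge0 ?invr_ge0 ?sqrtr_ge0// mulr_ge0 ?kern_ge0// le_min x0 ltW.
  rewrite /f_ ler_pdivrMr ?sqrtr_gt0// [leRHS]mulrC -ler_pdivrMr//.
  apply: (@le_trans _ _ (kern phi i j x * x / e)).
    by rewrite ler_wpM2r ?invr_ge0 ?(ltW e0)// ler_wpM2l ?kern_ge0// ge_min lexx.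
  rewrite -[leLHS]ger0_norm; last by rewrite mulr_ge0 ?invr_ge0 ?(ltW e0)// mulr_ge0 ?kern_ge0.
  by rewrite -sqrtr_sqr ler_wsqrtr.
- exact: integrable_half.
- apply: aeW => x _ n; have [x0|x0] := ltP x 0.
    by rewrite /f_ /kern patchE memNset ?mul0r ?normr0//= in_itv/= andbT leNgt x0.
  rewrite ger0_norm; last first.
    by rewrite mulr_ge0 ?invr_ge0 ?sqrtr_ge0// mulr_ge0 ?kern_ge0// le_min x0 ltW.
  rewrite /f_ ler_pdivrMr ?sqrtr_gt0// /hk [leRHS]mulrAC mulrC.
  by rewrite ler_wpM2r ?kern_ge0// mulrC min_le_sqrt// ltW.
rewrite Rintegral_cst// mul0r.
rewrite (_ : (fun n => tail i j (T n) / _) = (fun n => \int[leb]_(x in setT) f_ n x))//.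
apply/funext => n; rewrite /tail /Submission.wint -RintegralZr//.
apply: (wint_integrable phi_ge0 phi_meas phi_int _ _ (B := T n)) => //.
by move=> x x0; apply: min_bnd => //; exact: ltW.
Qed.

(** The term [(1 + rate j) / 2] bounds the mean of [|M| / sqrt t], using [2 a <= 1 + a ^ 2] and the
    second moment of [M]; the inner sum bounds [rem / sqrt t]. *)
Definition dev_const i : R :=
  \sum_j A i j * ((1 + rate j) / 2 + \sum_k rate k * half j k).

Lemma count_deviation i t : 0 < t ->
  Ex (fun w => `|count i t w - rate i * t|) <= dev_const i * Num.sqrt t.
Proof.
move=> t0; have t0' := ltW t0; have st0 : 0 < Num.sqrt t by rewrite sqrtr_gt0.
have /choice[f fP] j : exists f : Omega -> R, [/\ Li f,
    {ae P, forall w, rem j t w = f w} & Ex f <= \sum_k rate k * tail j k t].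
  by have [f Lf [? ?]] := rem_Li j t0'; exists f.
pose g j w := (Num.sqrt t + comp_mart j t w ^+ 2 / Num.sqrt t) / 2.
have Lg j : Li (g j).
  rewrite /g; under eq_fun do rewrite mulrC [_ / Num.sqrt t]mulrC.
  by apply/LiZ/LiD; [exact: Li_cst|apply: LiZ; have [] := comp_mart_sqr j t0'].
have Eg j : Ex (g j) <= (1 + rate j) / 2 * Num.sqrt t.
  have [L2 E2] := comp_mart_sqr j t0'.
  rewrite /g; under eq_fun do rewrite mulrC [_ / Num.sqrt t]mulrC.
  rewrite ExZ; last by apply: LiD; [exact: Li_cst|exact: LiZ].
  rewrite ExD; [|exact: Li_cst|exact: LiZ].
  rewrite Ex_cst ExZ// [leRHS]mulrAC [leRHS]mulrC ler_wpM2l// mulrDl mul1r lerD2l.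
  rewrite mulrC ler_pdivrMr// -mulrA -expr2 sqr_sqrtr//.
have Lf j : Li (f j) by have [] := fP j.
have LS : Li (fun w => \sum_j A i j * (g j w + f j w)).
  by apply: Li_sum => j _; apply/LiZ/LiD.
apply: (@le_trans _ _ (Ex (fun w => \sum_j A i j * (g j w + f j w)))).
  apply: Ex_le_ae => //.
    by apply/Li_norm/LiB; [exact: count_Li_all|exact: Li_cst].
  have fr : {ae P, forall w, forall j, rem j t w = f j w}.
    by apply: (@filter_forall _ _ _ _ _) => j; have [] := fP j.
  apply: filterS2 ae_noexp fr => w ne fr.
  rewrite countE// addrAC subrr add0r (le_trans (ler_norm_sum _ _ _))//.
  apply: ler_sum => j _; rewrite normrM ger0_norm ?invmx_subK_ge0//.
  rewrite ler_wpM2l ?invmx_subK_ge0// (le_trans (ler_normB _ _))// lerD//.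
    rewrite /g ler_pdivlMr// -(ler_pM2r st0) [X in _ <= X]mulrDl mulfVK ?gt_eqF//.
    have : 0 <= (`|comp_mart j t w| - Num.sqrt t) ^+ 2 by exact: sqr_ge0.
    rewrite sqrrB -[in X in _ -> X]real_normK ?num_real// expr2.
    by move: (`|_|) (Num.sqrt t) => a b; lra.
  by rewrite -fr ger0_norm ?rem_ge0.
rewrite (_ : (fun w => _) = (fun w => \sum_(j <- enum 'I_d) A i j * (g j w + f j w))); last first.
  by apply/funext => w; rewrite big_enum.
rewrite Ex_sum => [|j]; last by apply/LiZ/LiD.
rewrite big_enum/= /dev_const mulr_suml; apply: ler_sum => j _.
rewrite ExZ; last exact: LiD.
rewrite -mulrA ler_wpM2l ?invmx_subK_ge0// ExD// mulrDl lerD//.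
have [_ _ /le_trans] := fP j; apply; rewrite mulr_suml; apply: ler_sum => k _.
by rewrite -mulrA ler_wpM2l ?rate_ge0// mulrC tail_le.
Qed.

End half_moment.

(** An interval is covered by at most [(b - a) / h + 1] windows of length at most [h]. *)
Lemma window_iterate (f : R -> R) (h G L : R) : 0 < h -> 0 <= G ->
  (forall a b, a <= b -> b <= L -> b - a <= h -> f b - f a <= G) ->
  forall a b, a <= b -> b <= L -> f b - f a <= G * ((b - a) / h + 1).
Proof.
move=> h0 G0 fG.
have H k : forall a b, a <= b -> b <= L -> b - a <= k%:R * h -> f b - f a <= k%:R * G.
  elim: k => [|k IH] a b ab bL bak.
    rewrite mul0r in bak *; have -> : a = b by apply/eqP; rewrite eq_le ab -subr_le0.
    by rewrite subrr ?mul0r.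
  have [bah|bah] := leP (b - a) h.
    apply: (le_trans (fG a b ab bL bah)); rewrite ler_peMl// ler1n.
    by [].
  have c1 : a <= b - h by rewrite lerBrDr -lerBrDl ltW.
  have c2 : b - h <= L by rewrite (le_trans _ bL)// gerBl ltW.
  have c3 : b - h - a <= k%:R * h by move: bak; rewrite -natr1 mulrDl mul1r; lra.
  have i1 := IH a (b - h) c1 c2 c3.
  have i2 : f b - f (b - h) <= G.
    by apply: fG => //; [rewrite gerBl ltW|rewrite opprB addrC subrK].
  by rewrite -natr1 mulrDl mul1r; lra.
move=> a b ab bL.
pose y := (b - a) / h.
have y0 : 0 <= y by rewrite divr_ge0 ?subr_ge0// ltW.
have [k /andP[k1 k2]] : exists k : nat, k%:R <= y + 1 < k.+1%:R.
  exists (Num.truncn (y + 1)).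
  by have := truncn_itv (addr_ge0 y0 ler01).
apply: (@le_trans _ _ (k%:R * G)); last by rewrite mulrC ler_wpM2l.
apply: H => //; rewrite -ler_pdivrMr//.
by move: k2; rewrite -natr1 ltrD2r => /ltW.
Qed.

(* The oscillation of [comp_mart] controls that of [count] on windows of
   length [h], by comparison with the renewal equation. *)
Lemma rem_le (w : Omega) (L h eta : R) : noexp w -> 0 < h -> 0 <= L -> 0 <= eta ->
  (forall i a b, 0 <= a -> a <= b -> b <= L -> b - a <= h ->
    comp_mart i b w - comp_mart i a w <= eta) ->
  forall i t, 0 <= t -> t <= L ->
  rem i t w <= \sum_j (\sum_k A j k * (eta + mu k 0 * h)) * (K i j + tail i j L / h).
Proof.
move=> ne h0 L0 eta0 osc i t t0 tL.
pose c : 'cV[R]_d := \col_k (eta + mu k 0 * h).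
have G j a b : a <= b -> b <= L -> b - a <= h ->
    count j b w - count j a w <= \sum_k A j k * (eta + mu k 0 * h).
  have -> : \sum_k A j k * (eta + mu k 0 * h) = (A *m c) j 0.
    by rewrite mxE; apply: eq_bigr => k _; rewrite [c _ _]mxE.
  apply: (@renewal_increment _ _ _ phi_ge0 phi_meas phi_int rho_lt1 (fun j u => count j u w)
    (fun j u => comp_mart j u w + mu j 0 * u) L h) => //.
  - by move=> *; exact: count_nd.
  - by move=> *; exact: count0.
  - by move=> k u u0 uL; rewrite comp_martE// /lam opprD addrA addrAC; ring.
  - move=> k a' b' a0 ab' bL' bah; rewrite opprD addrACA mxE lerD ?osc//.
    by rewrite -mulrBr ler_wpM2l.
  - exact: ltW.
have G0 j : 0 <= \sum_k A j k * (eta + mu k 0 * h).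
  apply: sumr_ge0 => k _; rewrite mulr_ge0 ?invmx_subK_ge0// addr_ge0// mulr_ge0//.
  exact: ltW.
apply: ler_sum => j _.
set g := \sum_k _.
(* Over a delay [x] the count grows by at most [g] per window, and [min x L / h + 1] bounds the
   number of windows. *)
apply: (@le_trans _ _ (wint i j (fun x => g * (Num.min x L / h + 1)))); last first.
  have I1 : leb.-integrable setT (EFin \o (fun x => kern phi i j x * Num.min x L)).
    apply: (wint_integrable phi_ge0 phi_meas phi_int _ _ (B := L)); first exact: min_meas.
    by move=> x; exact: min_bnd.
  have I2 : leb.-integrable setT (EFin \o (fun x => kern phi i j x * 1)).
    apply: (wint_integrable phi_ge0 phi_meas phi_int _ _ (B := 1)).
      exact: measurable_cst.
    by move=> x _; rewrite normr1.
  have E1 : tail i j L = \int[leb]_(x in setT) (kern phi i j x * Num.min x L) by [].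
  have E2 : K i j = \int[leb]_(x in setT) (kern phi i j x * 1).
    by have := wint_cst phi_ge0 phi_meas phi_int i j 1; rewrite mulr1 => <-.
  have -> : wint i j (fun x => g * (Num.min x L / h + 1)) =
      \int[leb]_(x in setT) (g / h * (kern phi i j x * Num.min x L) + g * (kern phi i j x * 1)).
    by apply: eq_Rintegral => x _; ring.
  have IZ (a : R) (f : R -> R) : leb.-integrable setT (EFin \o f) ->
      leb.-integrable setT (EFin \o (fun x => a * f x)).
    by move=> If; rewrite (_ : EFin \o _ = (fun x => a%:E * (f x)%:E)%E);
      [exact: integrableZl|apply/funext => x; rewrite -EFinM].
  rewrite RintegralD//; [|exact: IZ|exact: IZ].
  rewrite RintegralZl// RintegralZl// -E1 -E2.
  by rewrite le_eqVlt; apply/orP; left; apply/eqP; ring.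
apply: (wint_le phi_ge0 phi_meas phi_int _ _ (B := count j t w + g * (L / h + 1))).
- by apply: measurable_funB => //; exact: count_sub_meas.
- by apply: measurable_funM => //; apply: measurable_funD => //; apply: measurable_funM.
- move=> x x0; rewrite ger0_norm ?subr_ge0 ?count_nd ?gerBl//.
  rewrite lerBlDr -addrA lerDl addr_ge0 ?count_ge0// mulr_ge0// ?G0//.
  by rewrite addr_ge0// divr_ge0// ltW.
- move=> x x0; rewrite ger0_norm; last first.
    by rewrite mulr_ge0 ?G0// addr_ge0// divr_ge0 ?le_min ?x0// ltW.
  rewrite (@le_trans _ _ (g * (L / h + 1)))// ?lerDr ?count_ge0//.
  by rewrite ler_wpM2l ?G0// lerD2r ler_wpM2r ?invr_ge0 ?(ltW h0)// ge_min lexx orbT.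
move=> x x0.
have [xt|tx] := leP x t.
  have := @window_iterate _ h g L h0 (G0 j) (G j) (t - x) t.
  have e : t - (t - x) = x by ring.
  rewrite gerBl e => /(_ x0 tL); rewrite min_l//.
  exact: le_trans tL.
have := @window_iterate _ h g L h0 (G0 j) (G j) 0 t t0 tL.
have z : count j 0 w = 0 by exact: count0.
have z' : count j (t - x) w = 0 by apply: count0 => //; rewrite subr_le0 ltW.
rewrite z z' !subr0 => /le_trans; apply; rewrite ler_wpM2l ?G0// lerD2r ler_wpM2r ?invr_ge0 ?(ltW h0)//.
by rewrite le_min tL ltW.
Qed.

End hawkes_moments.

(** * Asymptotics of the rescaled martingale *)

Section iterated_contraction.
Context (R : realType).

Lemma sub_expRN_le (x : R) : 0 <= x -> `|1 - x - expR (- x)| <= x ^+ 2.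
Proof.
move=> x0; have h1 := expR_ge1Dx (- x); have h2 := expR_ge1Dx x.
have x1 : 0 < 1 + x by rewrite (lt_le_trans ltr01)// lerDl.
have h3 : expR (- x) <= (1 + x)^-1 by rewrite expRN lef_pV2 ?posrE ?expR_gt0.
have h4 : (1 + x)^-1 <= 1 - x + x ^+ 2.
  rewrite -div1r ler_pdivrMr//.
  have -> : (1 - x + x ^+ 2) * (1 + x) = 1 + x ^+ 3 by ring.
  by rewrite lerDl exprn_ge0.
by rewrite ler_distlC; apply/andP; split; move: h1 h3 h4; move: (expR _) (_^-1) (x ^+ 2) => a b c; lra.
Qed.

(** Since [sigma] and the [u k] are at most 1 in modulus, each step adds at most [eta + kappa] and
    earlier errors are not amplified. *)
Lemma iterated_contraction (u : nat -> R) (rho sigma eta kappa : R) n :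
  0 <= sigma <= 1 -> `|rho - sigma| <= kappa -> (forall k, (k <= n)%N -> `|u k| <= 1) ->
  (forall k, (k < n)%N -> `|u k.+1 - rho * u k| <= eta) ->
  `|u n - sigma ^+ n * u 0| <= n%:R * (eta + kappa).
Proof.
move=> /andP[s0 s1] rs; elim: n => [|n IH] u1 un.
  by rewrite expr0 mul1r subrr normr0 mul0r.
have e1 : `|u n.+1 - sigma * u n| <= eta + kappa.
  rewrite (_ : _ - _ = (u n.+1 - rho * u n) + (rho - sigma) * u n); last by ring.
  rewrite (le_trans (ler_normD _ _))// lerD ?un// normrM (le_trans _ rs)//.
  by rewrite ler_piMr// u1.
have {}IH : `|u n - sigma ^+ n * u 0| <= n%:R * (eta + kappa).
  by apply: IH => k kn; [apply: u1; exact: leqW|apply: un; exact: leqW].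
rewrite (_ : _ - _ = (u n.+1 - sigma * u n) + sigma * (u n - sigma ^+ n * u 0)); last first.
  by rewrite exprS; ring.
rewrite (le_trans (ler_normD _ _))// -natr1 mulrDl mul1r addrC lerD//.
by rewrite normrM (ger0_norm s0) (le_trans _ IH)// ler_piMl.
Qed.

Lemma cvg_inv_sqrt (T : nat -> R) : (forall n, 0 < T n) -> T n @[n --> \oo] --> +oo ->
  (Num.sqrt (T n))^-1 @[n --> \oo] --> 0.
Proof.
move=> T0 Too; apply/cvgrPdist_le => e e0.
move/cvgryPge: Too => /(_ (e^-1 ^+ 2)); apply: filterS => n Tn.
rewrite sub0r normrN ger0_norm ?invr_ge0 ?sqrtr_ge0//.
rewrite -[leRHS]invrK lef_pV2 ?posrE ?sqrtr_gt0 ?invr_gt0//.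
apply: (@le_trans _ _ (Num.sqrt (e^-1 ^+ 2))); last exact: ler_wsqrtr.
by rewrite sqrtr_sqr ler_norm.
Qed.

End iterated_contraction.

Section rescaled_martingale.
Context d0 (Omega : measurableType d0) (R : realType) (P : probability Omega R) (d : nat).
Context (F : R -> set (set Omega)) (X N : 'I_d -> R -> Omega -> R) (rate C : 'I_d -> R).
Local Notation Ex := (Ex P).
Local Notation Li := (Li P).
Hypothesis cmH : forall s t, 0 <= s -> s <= t -> counting_martingale P F X N s t.
Hypothesis rate_ge0 : forall i, 0 <= rate i.
Hypothesis C_ge0 : forall i, 0 <= C i.
Hypothesis N_Li : forall i t, Li (N i t).
Hypothesis N_dev : forall i t, 0 <= t ->
  Ex (fun w => `|N i t w - rate i * t|) <= C i * Num.sqrt t.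
Implicit Types (th : 'I_d -> R) (s t : R).

(** [qvar] is the value of the bracket for counts growing at constant rate, and [qdev] bounds the
    mean distance to it. *)
Definition qvar th h : R := \sum_i th i ^+ 2 * (rate i * h).
Definition qdev th t : R := 2 * (\sum_i th i ^+ 2 * C i) * Num.sqrt t.

Lemma qvar_ge0 th h : 0 <= h -> 0 <= qvar th h.
Proof. by move=> h0; apply: sumr_ge0 => i _; apply: mulr_ge0; [exact: sqr_ge0|exact: mulr_ge0]. Qed.

Lemma qdev_ge0 th t : 0 <= qdev th t.
Proof.
by rewrite !mulr_ge0 ?sqrtr_ge0// sumr_ge0// => i _; rewrite mulr_ge0 ?sqr_ge0.
Qed.

Lemma qdev_nd th s t : s <= t -> qdev th s <= qdev th t.
Proof.
move=> st; rewrite ler_wpM2l ?ler_wsqrtr// mulr_ge0// sumr_ge0// => i _.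
by rewrite mulr_ge0 ?sqr_ge0.
Qed.

Lemma qv_dev th s t : 0 <= s -> s <= t ->
  Ex (fun w => `|qv N s t th w - qvar th (t - s)|) <= qdev th t.
Proof.
move=> s0 st; have t0 := le_trans s0 st.
pose g i u w := `|N i u w - rate i * u|.
have Lg i u : Li (g i u) by apply/Li_norm/LiB; [exact: N_Li|exact: Li_cst].
have LG i : Li (fun w => th i ^+ 2 * (g i t w + g i s w)) by apply/LiZ/LiD.
apply: (@le_trans _ _ (Ex (fun w => \sum_(i <- enum 'I_d) th i ^+ 2 * (g i t w + g i s w)))).
  apply: Ex_le; first by apply/Li_norm/LiB; [exact: (qv_Li (cmH s0 st))|exact: Li_cst].
    by apply: Li_sum.
  move=> w; rewrite big_enum/= /qv /qvar -sumrB (le_trans (ler_norm_sum _ _ _))//.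
  apply: ler_sum => i _; rewrite -mulrBr normrM ger0_norm ?sqr_ge0// ler_wpM2l ?sqr_ge0//.
  rewrite (_ : _ - _ = (N i t w - rate i * t) - (N i s w - rate i * s)); last by ring.
  exact: ler_normB.
rewrite Ex_sum// big_enum/= /qdev mulrAC mulr_sumr; apply: ler_sum => i _.
rewrite ExZ; last exact: LiD.
rewrite ExD// mulrCA ler_wpM2l ?sqr_ge0//.
have h1 := N_dev i t0; have h2 := N_dev i s0.
have h3 : C i * Num.sqrt s <= C i * Num.sqrt t by rewrite ler_wpM2l// ler_wsqrtr.
move: h1 h2 h3; rewrite -/(g i t) -/(g i s).
move: (Ex _) (Ex _) (Num.sqrt s) (Num.sqrt t) => a b x y h1 h2 h3.
have -> : 2 * y * C i = C i * y + C i * y by ring.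
by rewrite lerD// (le_trans h2).
Qed.

Lemma Ex_qv_le th s t : 0 <= s -> s <= t -> Ex (qv N s t th) <= qvar th (t - s) + qdev th t.
Proof.
move=> s0 st; have L := qv_Li (cmH s0 st) th.
have := le_trans (Ex_abs (LiB L (Li_cst P (qvar th (t - s))))) (qv_dev th s0 st).
have -> : Ex (fun w => qv N s t th w - qvar th (t - s)) = Ex (qv N s t th) - qvar th (t - s).
  by apply: etrans (ExB L (Li_cst P _)) _; rewrite Ex_cst.
by move=> /(le_trans (ler_norm _)); rewrite lerBlDl.
Qed.

Lemma Ex_cos_le1 (f : Omega -> R) : measurable_fun setT f -> `|Ex (fun w => cos (f w))| <= 1.
Proof.
move=> mf; have L : Li (fun w => cos (f w)).
  apply: (@Li_bounded _ _ _ _ _ 1); last by move=> w; rewrite ler_norml cos_geN1 cos_le1.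
  by apply: measurableT_comp => //; apply: continuous_measurable_fun; exact: continuous_cos.
apply: le_trans (Ex_abs L) _; rewrite -[leRHS](Ex_cst P 1).
apply: Ex_le; [exact: Li_norm|exact: Li_cst|].
by move=> w; rewrite ler_norml cos_geN1 cos_le1.
Qed.

Lemma inc_split th s u t w : inc X s th t w = inc X s th u w + inc X u th t w.
Proof. by rewrite /inc -big_split/=; apply: eq_bigr => i _; ring. Qed.

(** [cos_increment] on [r.+1] equal cells, each with [qb = q / n]; the multipliers [1 - q / (2 n)]
    are compared with [exp (- q / (2 n))], whose product is exact. The tolerance [e] and the number
    of cells stay free until [block_cvg]. *)
Lemma cos_block th s t alpha (e : R) r (q := qvar th (t - s)) (dl := qdev th t)
    (n : R := r.+1%:R) : 0 <= s -> s <= t -> 0 < e -> Gm (F s) alpha ->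
  `|Ex (fun w => cos (alpha w + inc X s th t w)) - expR (- (q / 2)) * Ex (fun w => cos (alpha w))|
  <= n * (((2 * (\sum_i `|th i|) + e / 2) * (q / n + dl) + q / n * ((q / n + dl) / e ^+ 2)
     + 3 / 2 * dl) + (q / n / 2) ^+ 2).
Proof.
move=> s0 st e0 Ga.
have n0 : 0 < n by rewrite ltr0n.
have q0 : 0 <= q by rewrite qvar_ge0// subr_ge0.
have dl0 : 0 <= dl by exact: qdev_ge0.
pose gr := grid s t r.
have gs k : s <= gr k by exact: grid_ge.
have g0 k : 0 <= gr k by exact: le_trans (gs k).
have gt k : (k <= r.+1)%N -> gr k <= t by exact: grid_le_end.
pose u k := Ex (fun w => cos (alpha w + inc X s th (gr k) w)).
have Gu k : (k <= r.+1)%N -> Gm (F (gr k)) (fun w => alpha w + inc X s th (gr k) w).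
  move=> kr; apply: (@measurable_funD _ (g_sigma_algebraType (F (gr k)))).
    by apply: Gm_sub Ga; exact: (cm_nd (cmH s0 st)).
  by apply: (inc_Gm (cmH s0 st)) => //; exact: gt.
have mu_ k : (k <= r.+1)%N -> measurable_fun setT (fun w => alpha w + inc X s th (gr k) w).
  by move=> kr; apply: Gm_measurable (Gu k kr); exact: (cm_meas (cmH s0 st)).
have := @iterated_contraction _ u (1 - q / n / 2) (expR (- (q / n / 2)))
  ((2 * (\sum_i `|th i|) + e / 2) * (q / n + dl) + q / n * ((q / n + dl) / e ^+ 2)
     + 3 / 2 * dl) ((q / n / 2) ^+ 2) r.+1.
have -> : u 0 = Ex (fun w => cos (alpha w)).
  congr (Submission.Ex _ _); apply/funext => w.
  by rewrite /gr grid0 (inc_s X s th w) addr0.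
have -> : u r.+1 = Ex (fun w => cos (alpha w + inc X s th t w)) by rewrite /u /gr gridn.
have -> : expR (- (q / n / 2)) ^+ r.+1 = expR (- (q / 2)).
  by rewrite -expRM_natl; congr expR; rewrite /n; field; rewrite gt_eqF.
apply.
- by rewrite expR_ge0 expR_le1 oppr_le0 !divr_ge0// ltW.
- by apply: sub_expRN_le; rewrite !divr_ge0// ltW.
- by move=> k kr; apply: Ex_cos_le1; exact: mu_.
move=> k kr; have gk : gr k <= gr k.+1 by apply: grid_le.
have qn0 : 0 <= q / n by rewrite divr_ge0// ltW.
have step : gr k.+1 - gr k = (t - s) / n by exact: grid_step.
have qE : qvar th (gr k.+1 - gr k) = q / n.
  by rewrite step /q /qvar mulr_suml; apply: eq_bigr => i _; rewrite !mulrA.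
have dk : qdev th (gr k.+1) <= dl by apply: qdev_nd; exact: gt.
have D1 : Ex (qv N (gr k) (gr k.+1) th) <= q / n + dl.
  by rewrite (le_trans (Ex_qv_le th (g0 k) gk))// qE lerD2l.
have D2 : Ex (fun w => `|qv N (gr k) (gr k.+1) th w - q / n|) <= dl.
  by rewrite -qE (le_trans (qv_dev th (g0 k) gk)).
have D3 : 0 <= Ex (qv N (gr k) (gr k.+1) th).
  have L := qv_Li (cmH (g0 k) gk) th.
  rewrite -(Ex_cst P 0); apply: Ex_le_ae => //; first exact: Li_cst.
  exact: qv_ge0 (cmH (g0 k) gk) _.
have := cos_increment (cmH (g0 k) gk) th (Gu k (ltnW kr)) e0 qn0.
have -> : (fun w => cos (alpha w + inc X s th (gr k) w + inc X (gr k) th (gr k.+1) w)) =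
  (fun w => cos (alpha w + inc X s th (gr k.+1) w)).
  by apply/funext => w; rewrite -addrA -inc_split.
move/le_trans; apply; rewrite !lerD//.
- rewrite ler_wpM2l//; apply: addr_ge0; last by rewrite divr_ge0// ltW.
  by rewrite mulr_ge0// sumr_ge0.
- by rewrite ler_wpM2l// ler_wpM2r// invr_ge0 sqr_ge0.
- by rewrite ler_wpM2l// divr_ge0.
Qed.

Lemma qvar_scale th (T a b : R) : 0 < T ->
  qvar (fun i => th i * (Num.sqrt T)^-1) (T * b - T * a) = qvar th (b - a).
Proof.
move=> T0; apply: eq_bigr => i _.
have x2 : (Num.sqrt T)^-1 ^+ 2 = T^-1 by rewrite exprVn sqr_sqrtr// ltW.
by rewrite exprMn x2; field; rewrite gt_eqF.
Qed.

Lemma qdev_scale th (T b : R) : 0 < T -> 0 <= b ->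
  qdev (fun i => th i * (Num.sqrt T)^-1) (T * b) = (Num.sqrt T)^-1 * qdev th b.
Proof.
move=> T0 b0; have s0 : Num.sqrt T != 0 by rewrite gt_eqF ?sqrtr_gt0.
rewrite /qdev sqrtrM ?(ltW T0)//.
have -> : \sum_i (th i * (Num.sqrt T)^-1) ^+ 2 * C i =
    (Num.sqrt T)^-1 ^+ 2 * \sum_i th i ^+ 2 * C i.
  by rewrite mulr_sumr; apply: eq_bigr => i _; rewrite exprMn; ring.
by move: (\sum_i _) => q; field.
Qed.

Section asymptotics.
Variable T : nat -> R.
Hypothesis T_gt0 : forall n, 0 < T n.
Hypothesis T_pinfty : T n @[n --> \oo] --> +oo.
Let x n : R := (Num.sqrt (T n))^-1.
Let x0 n : 0 < x n. Proof. by rewrite invr_gt0 sqrtr_gt0. Qed.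
Let x_cvg : x n @[n --> \oo] --> 0. Proof. exact: cvg_inv_sqrt. Qed.

Lemma block_cvg th (a b : R) (alpha : nat -> Omega -> R) : 0 <= a -> a <= b ->
  (forall n, Gm (F (T n * a)) (alpha n)) ->
  Ex (fun w => cos (alpha n w + inc X (T n * a) (fun i => th i * x n) (T n * b) w)) -
  expR (- (qvar th (b - a) / 2)) * Ex (fun w => cos (alpha n w)) @[n --> \oo] --> 0.
Proof.
move=> a0 ab Ga; have b0 := le_trans a0 ab.
set q := qvar th (b - a).
have q0 : 0 <= q by rewrite qvar_ge0// subr_ge0.
apply/cvgrPdist_le => eps eps0.
(* Order of choices: [e] makes [e q / 2] small, then the number [m] of cells makes the next terms
   small, and only then does [T] grow. *)
pose e := eps / (2 * (q + 1)).
have q1 : 0 < q + 1 by rewrite ltr_wpDl.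
have e0 : 0 < e by rewrite divr_gt0// mulr_gt0.
pose y := 4 * (q ^+ 2 / e ^+ 2 + q ^+ 2 / 4) / eps.
have y0 : 0 <= y.
  by rewrite !(mulr_ge0, addr_ge0, divr_ge0, sqr_ge0, invr_ge0)// ltW.
pose r := Num.truncn y; pose m : R := r.+1%:R.
have m0 : 0 < m by rewrite ltr0n.
have ym : y < m by have /andP[] := truncn_itv y0.
pose S := \sum_i `|th i|; pose D := qdev th b.
pose L := e * q / 2 + (q ^+ 2 / e ^+ 2 + q ^+ 2 / 4) / m.
have L_lt : L < eps.
  have h1 : e * q / 2 <= eps / 4.
    rewrite /e (_ : _ / 2 = eps / 4 * (q / (q + 1))); last by field; rewrite gt_eqF.
    by rewrite ler_piMr ?divr_ge0 ?(ltW eps0)// ler_pdivrMr// mul1r lerDl.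
  have h2 : (q ^+ 2 / e ^+ 2 + q ^+ 2 / 4) / m <= eps / 4.
    rewrite ler_pdivrMr// -ler_pdivrMl ?divr_gt0//.
    by rewrite (_ : _^-1 * _ = y) ?ltW// /y; field; rewrite !gt_eqF.
  by move: h1 h2; rewrite /L; move: eps0; move: (e * q / 2) (_ / m) => u v; lra.
(* After scaling, the bound of [cos_block] is a polynomial in [x n]: [L] is its constant term, [c1]
   and [c2] its coefficients. *)
pose c1 := m * ((e / 2) * D + 2 * S * (q / m) + q / m * (D / e ^+ 2) + 3 / 2 * D).
pose c2 := m * (2 * S * D).
have cvL : L + x n * c1 + x n * x n * c2 @[n --> \oo] --> L.
  rewrite -[X in _ --> X](_ : L + 0 * c1 + 0 * 0 * c2 = L); last by ring.
  apply: cvgD; last by apply: cvgMl; exact: cvgM.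
  by apply: cvgD; [exact: cvg_cst|exact: cvgMl].
apply: filterS (cvgr_lt L cvL eps L_lt) => n Ln.
rewrite sub0r normrN; apply: (le_trans _ (ltW Ln)).
have Ta : 0 <= T n * a by rewrite mulr_ge0// ltW.
have Tab : T n * a <= T n * b by rewrite ler_wpM2l// ltW.
have := cos_block (fun i => th i * x n) r Ta Tab e0 (Ga n).
rewrite qvar_scale// qdev_scale// -/q -/D -/(x n) -/m.
have -> : \sum_i `|th i * x n| = x n * S.
  rewrite mulr_sumr; apply: eq_bigr => i _.
  by rewrite normrM mulrC (ger0_norm (ltW (x0 n))).
move/le_trans; apply; rewrite le_eqVlt; apply/orP; left; apply/eqP.
by rewrite /L /c1 /c2; field; rewrite !gt_eqF.
Qed.

(** Induction on the number of blocks: the earlier ones form a phase measurable at the start of the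
    last one, to which [block_cvg] applies. *)
Lemma fdd_cvg (th : nat -> 'I_d -> R) (t : nat -> R) (m : nat) (c : R) : 0 <= t 0 ->
  (forall k, (k < m)%N -> t k <= t k.+1) ->
  Ex (fun w => cos (c + \sum_(k < m) inc X (T n * t k) (fun i => th k i * x n) (T n * t k.+1) w))
    @[n --> \oo] --> cos c * expR (- (\sum_(k < m) qvar (th k) (t k.+1 - t k) / 2)).
Proof.
move=> t0; elim: m => [|m IH] tn.
  rewrite big_ord0 oppr0 expR0 mulr1.
  rewrite (_ : (fun n : nat => _) = fun=> cos c); first exact: cvg_cst.
  by apply/funext => n; under [X in Submission.Ex _ X]funext do rewrite big_ord0 addr0; rewrite Ex_cst.
have tge k : (k <= m)%N -> 0 <= t k.
  elim: k => // k IHk km; apply: le_trans (tn k _); first by apply: IHk; exact: ltnW.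
  by rewrite ltnS ltnW.
have tmono j k : (j <= k)%N -> (k <= m)%N -> t j <= t k.
  elim: k => [|k IHk]; first by rewrite leqn0 => /eqP ->.
  rewrite leq_eqVlt => /orP[/eqP ->//|jk] km.
  by apply: le_trans (tn k _); [apply: IHk => //; exact: ltnW|rewrite ltnS ltnW].
have {}IH := IH (fun k km => tn k (leqW km)).
pose alpha n w := c + \sum_(k < m) inc X (T n * t k) (fun i => th k i * x n) (T n * t k.+1) w.
have Ga n : Gm (F (T n * t m)) (alpha n).
  apply: (@measurable_funD _ (g_sigma_algebraType (F (T n * t m)))); first exact: measurable_cst.
  apply: (@measurable_sum _ (g_sigma_algebraType (F (T n * t m)))) => k.
  have k1 : t k <= t k.+1 by apply: tn; rewrite ltnS ltnW.
  have h1 : 0 <= T n * t k by rewrite mulr_ge0 ?(ltW (T_gt0 n))// tge// ltnW.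
  have h2 : T n * t k <= T n * t k.+1 by rewrite ler_wpM2l// ltW.
  have h3 : T n * t k.+1 <= T n * t m by rewrite ler_wpM2l ?(ltW (T_gt0 n))// tmono.
  apply: Gm_sub (inc_Gm (cmH h1 h2) _ h2 (lexx _)).
  exact: (cm_nd (cmH h1 h2)).
have B := block_cvg (th m) (tge m (leqnn m)) (tn m (ltnSn m)) Ga.
pose E := expR (- (qvar (th m) (t m.+1 - t m) / 2)).
rewrite big_ord_recr/= opprD expRD mulrA.
have -> : (fun n => Ex (fun w => cos (c + \sum_(k < m.+1)
     inc X (T n * t k) (fun i => th k i * x n) (T n * t k.+1) w))) =
  (fun n => (Ex (fun w => cos (alpha n w +
     inc X (T n * t m) (fun i => th m i * x n) (T n * t m.+1) w)) -
     E * Ex (fun w => cos (alpha n w))) + E * Ex (fun w => cos (alpha n w))).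
  apply/funext => n; rewrite subrK; congr (Submission.Ex _ _); apply/funext => w.
  by rewrite big_ord_recr/= addrA.
rewrite -[X in _ --> X]add0r; apply: cvgD; first exact: B.
by rewrite [X in _ --> X]mulrC; apply: cvgMr; exact: IH.
Qed.

(** The mean of [psi] is the second moment minus [2 (1 - E cos)]; its limit is at most
    [q - 2 + 2 exp (- q / 2) <= q ^ 2 / 2]. The bound is uniform in the grid, as [sup_event]
    requires. *)
Lemma osc_block th (a b e eta : R) : 0 <= a -> a <= b -> 0 < e -> 0 < eta ->
  \forall n \near \oo, forall r, psi e * Ex (hits (fun k =>
      inc X (T n * a) (fun i => th i * x n) (grid (T n * a) (T n * b) r k)) (away e) r.+1)
    <= qvar th (b - a) ^+ 2 / 2 + eta.
Proof.
move=> a0 ab e0 eta0; have b0 := le_trans a0 ab.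
set q := qvar th (b - a).
have q0 : 0 <= q by rewrite qvar_ge0// subr_ge0.
have B := block_cvg th a0 ab (fun n => @measurable_cst _ _ (g_sigma_algebraType _) _ setT (0 : R)).
have cv : q + x n * qdev th b - 2 + 2 * (Ex (fun w => cos (0 +
   inc X (T n * a) (fun i => th i * x n) (T n * b) w)) -
   expR (- (q / 2)) * Ex (fun w => cos 0)) + 2 * expR (- (q / 2)) @[n --> \oo] -->
   q - 2 + 2 * expR (- (q / 2)).
  rewrite -[X in _ --> X](_ : q + 0 * qdev th b - 2 + 2 * 0 + 2 * expR (- (q / 2)) = _); last by ring.
  apply: cvgD; last exact: cvg_cst.
  apply: cvgD; last by apply: cvgMr; exact: B.
  apply: cvgD; last exact: cvg_cst.
  by apply: cvgD; [exact: cvg_cst|exact: cvgMl].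
have lt : q - 2 + 2 * expR (- (q / 2)) < q ^+ 2 / 2 + eta.
  have := @sub_expRN_le _ (q / 2); rewrite divr_ge0// => /(_ isT).
  rewrite ler_distlC => /andP[_]; rewrite exprMn.
  have -> : (2^-1 : R) ^+ 2 = 4^-1 by field.
  by move: eta0; move: (expR _) (q ^+ 2) => u v; lra.
apply: filterS (cvgr_lt _ cv _ lt) => n Ln r.
have Ta : 0 <= T n * a by rewrite mulr_ge0// ltW.
have Tab : T n * a <= T n * b by rewrite ler_wpM2l// ltW.
have H := cmH Ta Tab; set th' := fun i => th i * x n.
have mpsi : measurable_fun setT (@psi R).
  apply: measurable_funB; first exact: measurable_funX.
  apply: measurable_funM => //; apply: measurable_funB => //.
  by apply: continuous_measurable_fun; exact: continuous_cos.
have mdpsi : measurable_fun setT (@dpsi R).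
  apply: measurable_funB; first exact: measurable_funM.
  apply: measurable_funM => //.
  by apply: continuous_measurable_fun; exact: continuous_sin.
have := @inc_doob _ _ _ _ _ _ _ _ _ _ H th' (@psi R) (@dpsi R) (away e) (psi e) 4 r
  (measurable_away e) (psi_ge0 e) (@psi_ge0 R) (@psi_convex R).
move=> /(_ _ mpsi mdpsi (@psi_le R) (@dpsi_le R)) /le_trans; apply.
  by move=> z /ltW; apply: psi_ge; exact: ltW.
apply: (le_trans _ (ltW Ln)).
have L1 := inc_sqr_Li H th' Tab (lexx _).
have mi := inc_measurable H th' Tab (lexx _).
have L2 : Li (fun w => cos (0 + inc X (T n * a) th' (T n * b) w)).
  apply: (@Li_bounded _ _ _ _ _ 1); last by move=> w; rewrite ler_norml cos_geN1 cos_le1.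
  apply: measurableT_comp; first by apply: continuous_measurable_fun; exact: continuous_cos.
  exact: measurable_funD.
have -> : @psi R \o inc X (T n * a) th' (T n * b) = (fun w =>
    (inc X (T n * a) th' (T n * b) w ^+ 2 - 2) +
    2 * cos (0 + inc X (T n * a) th' (T n * b) w)).
  by apply/funext => w; rewrite /= /psi add0r; ring.
apply: (@le_trans _ _ (q + x n * qdev th b - 2 +
  2 * Ex (fun w => cos (0 + inc X (T n * a) th' (T n * b) w)))).
  rewrite (ExD (LiB L1 (Li_cst P 2)) (LiZ 2 L2)) (ExB L1 (Li_cst P 2)) (ExZ 2 L2) Ex_cst.
  rewrite lerD2r lerD2r (inc_isometry H).
  have := Ex_qv_le th' Ta Tab; rewrite qvar_scale// qdev_scale//.
by rewrite cos0 Ex_cst mulr1 mulrBr addrA subrK.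
Qed.

End asymptotics.

End rescaled_martingale.

Section probability_bounds.
Context d0 (Omega : measurableType d0) (R : realType) (P : probability Omega R).
Local Notation Ex := (Ex P).
Local Notation Li := (Li P).

Lemma prob_le_Ex (A : set Omega) (f : Omega -> R) : measurable A -> Li f ->
  (forall w, 0 <= f w) -> (forall w, A w -> 1 <= f w) -> (P A <= (Ex f)%:E)%E.
Proof.
move=> mA Lf f0 f1; rewrite -[P A]fineK ?fin_num_measure// lee_fin -Ex_indic//.
apply: Ex_le => //; first exact: Li_indic.
by move=> w; rewrite indicE; have [/set_mem/f1//|_] := boolP (w \in A).
Qed.

Lemma prob_bigcup_le (I : finType) (A : I -> set Omega) (c : R) :
  (forall i, measurable (A i)) -> (forall i, (P (A i) <= c%:E)%E) ->
  measurable (\bigcup_i A i) /\ (P (\bigcup_i A i) <= (#|I|%:R * c)%:E)%E.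
Proof.
move=> mA Ac.
have H (s : seq I) : measurable (\bigcup_(i in [set` s]) A i) /\
    (P (\bigcup_(i in [set` s]) A i) <= ((size s)%:R * c)%:E)%E.
  elim: s => [|i s [mU IH]].
    by rewrite set_nil bigcup_set0 measure0 mul0r.
  have -> : [set` i :: s] = i |` [set` s].
    apply/seteqP; split => j /=; rewrite inE.
      by move=> /predU1P[|]; [left|right].
    by move=> [->|->]; rewrite ?eqxx ?orbT.
  rewrite bigcup_setU1; split; first exact: measurableU.
  apply: (le_trans (measureU2 _ (mA i) mU)).
  have -> : (size (i :: s))%:R * c = c + (size s)%:R * c by rewrite /= -natr1; ring.
  by rewrite EFinD; exact: leeD (Ac i) IH.
have := H (enum I); rewrite -cardE.
suff -> : [set` enum I] = [set: I] by [].
by apply/seteqP; split => i //= _; rewrite mem_enum.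
Qed.

End probability_bounds.

Section sup_event.
Context d0 (Omega : measurableType d0) (R : realType) (P : probability Omega R) (d : nat).
Context (F : R -> set (set Omega)) (X N : 'I_d -> R -> Omega -> R) (s t : R).
Hypothesis H : counting_martingale P F X N s t.
Variables (theta : 'I_d -> R) (e c : R).
Hypothesis e0 : 0 <= e.
Let y r k := inc X s theta (grid s t r k).
Hypothesis hc : forall r, Ex P (hits (y r) (away e) r.+1) <= c.

(* By right-continuity an excursion above [e] is seen by every fine enough grid. *)
Lemma sup_event : exists B : set Omega, [/\ measurable B, (P B <= c%:E)%E &
  forall w, ~ B w ->
    (forall i u, s <= u -> u < t -> X i v w @[v --> u^'+] --> X i u w) ->
    forall u, s <= u -> u <= t -> `|inc X s theta u w| <= e].
Proof.
have st := cm_le H.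
pose E r := [set w | 1 <= hits (y r) (away e) r.+1 w].
have mh r := measurable_inc_hits H theta r (measurable_away e).
have mE r : measurable (E r).
  rewrite /E -[X in measurable X]setTI.
  have := mh r measurableT [set` `[1, +oo[] (measurable_itv _).
  by congr measurable; apply/seteqP; split => w /=; rewrite in_itv/= andbT.
(* [G k] says that every grid from index [k] on sees an excursion. These events increase and [G k]
   lies in [E k], so their union keeps the bound [c]. *)
pose G k := \bigcap_(r in [set r | (k <= r)%N]) E r.
have mG k : measurable (G k) by apply: bigcap_measurable => //; exists k => /=.
have mB : measurable (\bigcup_k G k) by exact: bigcup_measurable.
exists (\bigcup_k G k); split => //.
  have ndG : nondecreasing_seq G.
    by move=> a b ab; apply/subsetPset => w h r /= br; apply: h => /=; exact: leq_trans br.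
  have cv := nondecreasing_cvg_mu (mu := P) mG mB ndG.
  rewrite -(cvg_lim _ cv)//; apply: lime_le; first by apply/cvg_ex; exists (P (\bigcup_k G k)).
  apply: nearW => k /=.
  apply: (@le_trans _ _ (P (E k))).
    by apply: le_measure; rewrite ?inE// => w; apply => /=.
  apply: (le_trans _ (_ : ((Ex P (hits (y k) (away e) k.+1))%:E <= _)%E)); last by rewrite lee_fin hc.
  apply: prob_le_Ex => //; first exact: inc_hits_Li H _ _ _ (measurable_away e).
  by move=> w; have /andP[] := hits01 (y k) (away e) k.+1 w.
move=> w nB rc u su ut; rewrite leNgt; apply/negP => eu; apply: nB.
suff [k0 hk0] : exists k0, forall r, (k0 <= r)%N ->
    exists2 k, (k <= r.+1)%N & away e (y r k w).
  exists k0 => // r /= /hk0[k kr ak]; rewrite /E /= leNgt; apply/negP => /hits0.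
  by move/(_ _ kr).
move: eu; have [->|utN] := eqVneq u t => eu.
  by exists 0%N => r _; exists r.+1; rewrite ?leqnn// /y gridn.
have {}ut : u < t by rewrite lt_neqAle utN.
have cvi : `|inc X s theta v w| @[v --> u^'+] --> `|inc X s theta u w|.
  apply: cvg_norm; rewrite /inc; apply: cvg_sumr => i.
  by apply: cvgMr; apply: cvgB; [exact: rc|exact: cvg_cst].
have [g /= g0 hg] := cvgr_gt _ cvi _ eu.
have [k0 _ hk0] := grid_mesh s t g0.
exists k0 => r /hk0/= mesh.
have ts : 0 < t - s by rewrite subr_gt0 (le_lt_trans su ut).
pose z := (u - s) / (t - s) * r.+1%:R.
have r0 : (0 : R) < r.+1%:R by rewrite ltr0n.
have z0 : 0 <= z by rewrite mulr_ge0 ?divr_ge0 ?subr_ge0// ltW.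
have /andP[z1 z2] := truncn_itv z0.
set k := Num.truncn z in z1 z2.
have uz : u = s + (t - s) * (z / r.+1%:R) by rewrite /z; field; rewrite !gt_eqF.
have kr : (k < r.+1)%N.
  rewrite -(ltr_nat R); apply: (le_lt_trans z1).
  by rewrite /z -[ltRHS]mul1r ltr_pM2r// ltr_pdivrMr// mul1r ltrD2r.
(* The right end of the cell containing [u] lies strictly after [u], within reach of
   right-continuity. *)
exists k.+1 => //; rewrite /y; apply: hg => /=.
  have gk : grid s t r k <= u.
    by rewrite [leRHS]uz /grid lerD2l ler_wpM2l ?(ltW ts)// ler_wpM2r ?invr_ge0// ltW.
  have gu : u <= grid s t r k.+1.
    by rewrite [leLHS]uz /grid lerD2l ler_wpM2l ?(ltW ts)// ler_wpM2r ?invr_ge0// ltW.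
  rewrite /ball_/= ler0_norm ?subr_le0// opprB (le_lt_trans _ (mesh k))//.
  by rewrite lerB.
by rewrite [ltLHS]uz /grid ltrD2l ltr_pM2l// ltr_pM2r// invr_gt0.
Qed.

End sup_event.

Section block_oscillation.
Context (R : realType) (f : R -> R) (L eta : R) (m : nat).
Hypotheses (L0 : 0 < L) (m0 : (0 < m)%N) (eta0 : 0 <= eta).
Hypothesis f_block : forall k u, (k < m)%N ->
  L * (k%:R / m%:R) <= u -> u <= L * (k.+1%:R / m%:R) -> `|f u - f (L * (k%:R / m%:R))| <= eta.

(** The index of the block containing [v]. It equals [m] at [v = 1], one past the last block, and
    this case is treated apart in [block_dev]. *)
Definition block (v : R) : nat := Num.truncn (v * m%:R).

Let m0' : (0 : R) < m%:R. Proof. by rewrite ltr0n. Qed.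

Lemma block_itv v : 0 <= v -> (block v)%:R / m%:R <= v /\ v < (block v).+1%:R / m%:R.
Proof.
move=> v0; have /truncn_itv/andP[h1 h2] : 0 <= v * m%:R by rewrite mulr_ge0.
by rewrite ler_pdivrMr// ltr_pdivlMr.
Qed.

Lemma block_le v : 0 <= v -> v <= 1 -> (block v <= m)%N.
Proof.
move=> v0 v1; have [h _] := block_itv v0.
by rewrite -(ler_nat R) -[leRHS]mul1r -ler_pdivrMr// (le_trans h).
Qed.

Lemma block_dev v : 0 <= v -> v <= 1 ->
  `|f (L * v) - f (L * ((block v)%:R / m%:R))| <= eta.
Proof.
move=> v0 v1; have [h1 h2] := block_itv v0.
have := block_le v0 v1; rewrite leq_eqVlt => /predU1P[km|km].
  have E : v = (block v)%:R / m%:R.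
    by apply/eqP; rewrite eq_le h1 andbT km divff ?gt_eqF.
  by rewrite -E subrr normr0.
by apply: f_block => //; rewrite ler_wpM2l ?(ltW L0)// ltW.
Qed.

(** Such a window meets at most two consecutive blocks: one deviation inside each and one across the
    first. *)
Lemma block_osc a b : 0 <= a -> a <= b -> b <= L -> b - a <= L / m%:R ->
  `|f b - f a| <= 3 * eta.
Proof.
move=> a0 ab bL ba.
pose va := a / L; pose vb := b / L.
have va0 : 0 <= va by rewrite divr_ge0// ltW.
have vab : va <= vb by rewrite ler_wpM2r ?invr_ge0// ltW.
have vb1 : vb <= 1 by rewrite ler_pdivrMr// mul1r.
have vb0 := le_trans va0 vab; have va1 := le_trans vab vb1.
have aE : a = L * va by rewrite /va; field; rewrite gt_eqF.
have bE : b = L * vb by rewrite /vb; field; rewrite gt_eqF.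
have d1 := block_dev va0 va1; have d2 := block_dev vb0 vb1.
rewrite -aE -bE in d1 d2.
have [a1 a2] := block_itv va0; have [b1 b2] := block_itv vb0.
have vba : vb <= va + m%:R^-1.
  by rewrite -lerBlDl /vb /va -mulrBl ler_pdivrMr// mulrC.
have kab : (block va <= block vb)%N.
  by rewrite -ltnS -(ltr_nat R) -(ltr_pM2r (_ : 0 < m%:R^-1)) ?invr_gt0//; lra.
have kba : (block vb <= (block va).+1)%N.
  rewrite -ltnS -(ltr_nat R) -(ltr_pM2r (_ : 0 < m%:R^-1)) ?invr_gt0//.
  rewrite (le_lt_trans b1)// (le_lt_trans vba)// -[X in _ < X%:R / _]addn1 natrD mulrDl mul1r.
  by rewrite ltrD2r.
have [kE|kN] := eqVneq (block vb) (block va).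
  rewrite kE in d2; move: d1 d2; rewrite !ler_norml.
  by move: (f b) (f a) (f _) => p q r; lra.
have kE : block vb = (block va).+1.
  by apply/eqP; rewrite eqn_leq kba ltn_neqAle eq_sym kN.
have km : (block va < m)%N by rewrite -kE block_le.
have d3 : `|f (L * ((block vb)%:R / m%:R)) - f (L * ((block va)%:R / m%:R))| <= eta.
  apply: f_block => //; rewrite kE// ler_wpM2l ?(ltW L0)// ler_wpM2r ?invr_ge0//.
  by rewrite ler_nat.
move: d1 d2 d3; rewrite !ler_norml.
by move: (f b) (f a) (f _) (f _) => p q r r'; lra.
Qed.

End block_oscillation.

(** * Uniform approximation of the rescaled process by step paths *)

Section hawkes_asymptotics.
Context (R : realType) (disp : measure_display) (Omega : measurableType disp).
Context (P : probability Omega R).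
Context (d : nat) (tau : nat -> Omega -> \bar R) (Z : nat -> Omega -> 'I_d).
Context (mu : 'cV[R]_d) (phi : 'I_d -> 'I_d -> R -> R).
Hypothesis mu_ge0 : forall i, 0 <= mu i 0.
Hypothesis phi_ge0 : forall i j (t : R), 0 <= t -> 0 <= phi i j t.
Hypothesis phi_meas : forall i j, measurable_fun (`[0%R, +oo[ : set R) (phi i j).
Hypothesis hN : hawkes P tau Z mu phi.
Hypothesis phi_int : forall i j,
  (\int[lebesgue_measure]_(t in `[0%R, +oo[) (phi i j t)%:E < +oo)%E.
Hypothesis rho_lt1 : spectral_radius (kernel_mass phi) < 1.
Hypothesis phi_half : forall i j,
  (\int[lebesgue_measure]_(t in `[0%R, +oo[)
       (Num.sqrt t * phi i j t)%:E < +oo)%E.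

Local Notation Ex := (Ex P).
Local Notation Li := (Li P).
Local Notation K := (kernel_mass phi).
Local Notation past := (past tau Z).
Local Notation count := (count tau Z).
Local Notation comp_mart := (comp_mart tau Z mu phi).
Local Notation noexp := (noexp tau Z).
Local Notation rate := (rate mu phi).
Local Notation rem := (rem tau Z phi).
Let A := invmx (1%:M - K).

Let tau_gt0 n w : (0 < tau n w)%E. Proof. by have [[]] := hN. Qed.
Let A_ge0 i j : 0 <= A i j.
Proof. by apply: invmx_subK_ge0 => //; exact: kernel_mass_ge0. Qed.
Let rate0 i : 0 <= rate i. Proof. exact: rate_ge0. Qed.
Let K0 i j : 0 <= K i j. Proof. exact: kernel_mass_ge0. Qed.

Let cmH s t : 0 <= s -> s <= t -> counting_martingale P past comp_mart count s t.
Proof. by move=> s0 st; exact: hawkes_counting. Qed.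

Let C i := `|dev_const mu phi i|.
Let C_ge0 i : 0 <= C i. Proof. exact: normr_ge0. Qed.
Let N_Li i t : Li (count i t).
Proof. exact: (count_Li_all mu_ge0 phi_ge0 phi_meas hN phi_int rho_lt1). Qed.
Let N_dev i t : 0 <= t -> Ex (fun w => `|count i t w - rate i * t|) <= C i * Num.sqrt t.
Proof.
rewrite le_eqVlt => /predU1P[<-|t0].
  rewrite sqrtr0 !mulr0 (_ : (fun w => _) = fun=> 0) ?Ex_cst//.
  by apply/funext => w; rewrite (count0 hN)// subr0 normr0.
have := count_deviation mu_ge0 phi_ge0 phi_meas hN phi_int rho_lt1 phi_half i t0.
by move/le_trans; apply; rewrite ler_wpM2r ?sqrtr_ge0// ler_norm.
Qed.

Lemma count_right_cst i u w : noexp w -> \forall v \near u^'+, count i v w = count i u w.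
Proof.
move=> ne; have [p pt] := noexp_tau hN (u + 1) ne.
have H (k : 'I_p) : \forall v \near u^'+, hit tau Z i k v w = hit tau Z i k u w.
  have [tu|] := leP (tau k w) u%:E.
    near=> v; rewrite /hit tu (le_trans tu)// lee_fin.
    by near: v; exact: nbhs_right_ge.
  move=> ut.
  have [g ug gt] : exists2 g, u < g & (g%:E <= tau k w)%E.
    case: (tau k w) ut => [r| |]//; last by exists (u + 1); rewrite ?ltrDl ?leey.
    by rewrite lte_fin => ur; exists r.
  near=> v; rewrite /hit [(tau k w <= u%:E)%E]leNgt ut/= leNgt.
  rewrite (lt_le_trans _ gt)// lte_fin.
  by near: v; exact: nbhs_right_lt.
have u1 : u < u + 1 by rewrite ltrDl.
near=> v.
have v1 : v <= u + 1 by near: v; exact: nbhs_right_le.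
have hv : forall k : 'I_p, hit tau Z i k v w = hit tau Z i k u w.
  by near: v; exact: filter_forall H.
rewrite (count_np Z pt i v1) (count_np Z pt i (ltW u1)).
by apply: eq_bigr => k _; exact: hv.
Unshelve. all: by end_near. Qed.

Lemma comp_mart_right i u w : noexp w -> 0 <= u ->
  comp_mart i v w @[v --> u^'+] --> comp_mart i u w.
Proof.
move=> ne u0; have [p pt] := noexp_tau hN (u + 1) ne.
have ME v : 0 <= v -> v <= u + 1 -> comp_mart i v w = count i v w - lp tau Z mu phi p i v w.
  move=> v0 v1; rewrite (comp_martE hN)//.
  by rewrite (lam_lp Z mu phi pt i v1).
apply/cvgrPdist_le => e e0.
have [g g0 gP] := lp_unif_cont Z mu_ge0 phi_ge0 phi_meas phi_int tau_gt0 p u (u + 1) w i e0.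
have h1 : u < u + 1 by rewrite ltrDl.
have h2 : u < u + g by rewrite ltrDl.
near=> v.
have uv : u <= v by near: v; exact: nbhs_right_ge.
have v1 : v <= u + 1 by near: v; exact: nbhs_right_le.
have vg : v < u + g by near: v; exact: nbhs_right_lt.
have cv : count i v w = count i u w by near: v; exact: count_right_cst.
rewrite ME ?(ltW h1)// ME ?(le_trans u0)// cv.
rewrite (_ : _ - _ = lp tau Z mu phi p i v w - lp tau Z mu phi p i u w); last by ring.
have L := lp_nd Z mu_ge0 phi_ge0 phi_meas phi_int tau_gt0 p i w uv.
by rewrite ger0_norm ?subr_ge0// gP// ltrBlDl.
Unshelve. all: by end_near. Qed.

Section sequence.
Variable T : nat -> R.
Hypothesis T_gt0 : forall n, 0 < T n.
Hypothesis T_pinfty : T n @[n --> \oo] --> +oo.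
Let x n : R := (Num.sqrt (T n))^-1.
Let s0 n : 0 < Num.sqrt (T n). Proof. by rewrite sqrtr_gt0. Qed.
Let x0 n : 0 < x n. Proof. by rewrite invr_gt0 sqrtr_gt0. Qed.

Lemma hawkes_fdd (th : nat -> 'I_d -> R) (t : nat -> R) (m : nat) (c : R) : 0 <= t 0 ->
  (forall k, (k < m)%N -> t k <= t k.+1) ->
  Ex (fun w => cos (c + \sum_(k < m)
    inc comp_mart (T n * t k) (fun i => th k i * x n) (T n * t k.+1) w))
    @[n --> \oo] --> cos c * expR (- (\sum_(k < m) qvar rate (th k) (t k.+1 - t k) / 2)).
Proof. exact: (fdd_cvg cmH rate0 C_ge0 N_Li N_dev). Qed.

(** Each of the [m d] pairs of a block and a coordinate fails with probability [O(1 / m ^ 2)], since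
    [qvar] over a block is of order [1 / m]; the union therefore has probability [O(1 / m)]. *)
Lemma osc_event (e dl : R) : 0 < e -> 0 < dl ->
  \forall m \near \oo, \forall n \near \oo, exists B : set Omega,
    [/\ measurable B, (P B <= dl%:E)%E & forall w, ~ B w -> noexp w ->
      forall k i u, (k < m)%N -> T n * (k%:R / m%:R) <= u -> u <= T n * (k.+1%:R / m%:R) ->
        `|comp_mart i u w - comp_mart i (T n * (k%:R / m%:R)) w| <= e * Num.sqrt (T n)].
Proof.
move=> e0 dl0; have pe0 := psi_gt0 e0.
pose D := d%:R * ((\sum_i rate i) ^+ 2 / 2 + 1) / psi e.
have D0 : 0 <= D.
  by rewrite divr_ge0 ?(ltW pe0)// mulr_ge0// addr_ge0// divr_ge0// sqr_ge0.
have : \forall m \near \oo, D / dl <= m%:R by exact: nbhs_infty_ger.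
apply: filterS2 (nbhs_infty_gt 0%N) => m m0 Dm.
have m0' : (0 : R) < m%:R by rewrite ltr0n.
(* The bound of [osc_block] over one block with slack [1 / m ^ 2], divided by [psi e]; thus
   [m d c = D / m <= dl]. *)
pose c := ((\sum_i rate i) ^+ 2 / 2 + 1) / m%:R ^+ 2 / psi e.
pose th (i j : 'I_d) : R := (j == i)%:R.
have qE i h : qvar rate (th i) h = rate i * h.
  rewrite /qvar (bigD1 i)//= /th eqxx expr1n mul1r big1 ?addr0// => j ji.
  by rewrite (negbTE ji) expr0n mul0r.
have incE i s u w n : inc comp_mart s (fun j => th i j * x n) u w =
    x n * (comp_mart i u w - comp_mart i s w).
  rewrite /inc (bigD1 i)//= /th eqxx mul1r big1 ?addr0// => j ji.
  by rewrite (negbTE ji) !mul0r.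
have near_all : \forall n \near \oo, forall ki : 'I_m * 'I_d, forall r,
    psi e * Ex (hits (fun l => inc comp_mart (T n * (ki.1%:R / m%:R))
      (fun j => th ki.2 j * x n)
      (grid (T n * (ki.1%:R / m%:R)) (T n * (ki.1.+1%:R / m%:R)) r l)) (away e) r.+1) <=
    psi e * c.
  apply: filter_forall => -[k i] /=.
  have a0 : (0 : R) <= k%:R / m%:R by rewrite divr_ge0.
  have ab : (k%:R / m%:R : R) <= k.+1%:R / m%:R by rewrite ler_wpM2r ?invr_ge0// ler_nat.
  have eta0 : 0 < (m%:R ^+ 2)^-1 :> R by rewrite invr_gt0 exprn_gt0.
  apply: filterS (osc_block cmH rate0 C_ge0 N_Li N_dev T_gt0 T_pinfty (th i) a0 ab e0 eta0).
  move=> n h r; apply: le_trans (h r) _; rewrite qE.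
  have -> : (k.+1%:R / m%:R - k%:R / m%:R : R) = m%:R^-1.
    by rewrite -mulrBl -natr1 addrAC subrr add0r mul1r.
  have -> : psi e * c = ((\sum_i rate i) ^+ 2 / 2 + 1) / m%:R ^+ 2.
    by rewrite /c; field; rewrite !gt_eqF.
  rewrite [leRHS]mulrDl mul1r lerD2r exprMn mulrAC exprVn ler_wpM2r ?(ltW eta0)//.
  rewrite ler_wpM2r// lerXn2r ?nnegrE ?sumr_ge0//.
  by rewrite (bigD1 i)//= lerDl sumr_ge0.
apply: filterS near_all => n hn.
have /choice[B BP] (ki : 'I_m * 'I_d) : exists B : set Omega,
    [/\ measurable B, (P B <= c%:E)%E & forall w, ~ B w -> noexp w ->
      forall u, T n * (ki.1%:R / m%:R) <= u -> u <= T n * (ki.1.+1%:R / m%:R) ->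
        `|comp_mart ki.2 u w - comp_mart ki.2 (T n * (ki.1%:R / m%:R)) w|
          <= e * Num.sqrt (T n)].
  case: ki (hn ki) => k i /= {}hn.
  have a0 : (0 : R) <= T n * (k%:R / m%:R) by rewrite mulr_ge0 ?divr_ge0// ltW.
  have ab : T n * (k%:R / m%:R) <= T n * (k.+1%:R / m%:R).
    by rewrite ler_wpM2l ?(ltW (T_gt0 n))// ler_wpM2r ?invr_ge0// ler_nat.
  have hc r : Ex (hits (fun l => inc comp_mart (T n * (k%:R / m%:R))
      (fun j => th i j * x n)
      (grid (T n * (k%:R / m%:R)) (T n * (k.+1%:R / m%:R)) r l)) (away e) r.+1) <= c.
    by have := hn r; rewrite ler_pM2l.
  have [B [mB Bc hB]] := sup_event (cmH a0 ab) hc.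
  exists B; split => // w nBw ne u ku uk.
  have rc j v : T n * (k%:R / m%:R) <= v -> v < T n * (k.+1%:R / m%:R) ->
      comp_mart j v' w @[v' --> v^'+] --> comp_mart j v w.
    by move=> v0 _; apply: comp_mart_right => //; exact: le_trans v0.
  have := hB w nBw rc u ku uk; rewrite incE normrM (ger0_norm (ltW (x0 n))).
  by rewrite mulrC ler_pdivrMr ?s0.
have [|mU PU] := @prob_bigcup_le _ _ _ P _ B c (fun ki => let: And3 h _ _ := BP ki in h).
  by move=> ki; have [] := BP ki.
exists (\bigcup_ki B ki); split => //.
  apply: (le_trans PU); rewrite lee_fin card_prod !card_ord natrM.
  have -> : m%:R * d%:R * c = D / m%:R by rewrite /c /D; field; rewrite !gt_eqF.
  by rewrite ler_pdivrMr// mulrC -ler_pdivrMr.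
move=> w nB ne k i u km ku uk.
have [_ _ h] := BP (Ordinal km, i).
by apply: h => //= Bw; apply: nB; exists (Ordinal km, i).
Qed.

(** The bound of [rem_le] in units of [c sqrt T], for windows of length [h = c sqrt T], oscillation
    [3 c sqrt T] and [tail <= h]. *)
Definition rem_const i : R := \sum_j (\sum_k A j k * (3 + mu k 0)) * (K i j + 1).

Let rem_const_ge0 i : 0 <= rem_const i.
Proof.
apply: sumr_ge0 => j _; rewrite mulr_ge0 ?addr_ge0// sumr_ge0// => k _.
by rewrite mulr_ge0// addr_ge0.
Qed.

Lemma hawkes_step_approx (e dl : R) : 0 < e -> 0 < dl ->
  \forall m \near \oo, \forall n \near \oo, exists B : set Omega,
    [/\ measurable B, (P B <= dl%:E)%E & forall w, ~ B w -> noexp w ->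
      forall v i, 0 <= v -> v <= 1 ->
        `|Num.sqrt (T n) * ((T n)^-1 * count i (T n * v) w - v * rate i) -
          \sum_j A i j * (x n * comp_mart j (T n * ((block m v)%:R / m%:R)) w)| <= e].
Proof.
move=> e0 dl0.
pose Q := \sum_i \sum_j A i j * (1 + rem_const j).
have Q0 : 0 <= Q.
  by apply: sumr_ge0 => i _; apply: sumr_ge0 => j _; rewrite mulr_ge0// addr_ge0.
pose c := e / (Q + 1).
have Q1 : 0 < Q + 1 by rewrite ltr_wpDl.
have c0 : 0 < c by rewrite divr_gt0.
apply: filterS2 (nbhs_infty_gt 0%N) (osc_event c0 dl0) => m m0 Hm.
have m0' : (0 : R) < m%:R by rewrite ltr0n.
(* For large [T], [tail] is at most the window length [c sqrt T]. *)
have t1 : \forall n \near \oo, forall ij : 'I_d * 'I_d,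
    tail phi ij.1 ij.2 (T n) / Num.sqrt (T n) <= c.
  apply: filter_forall => -[i j] /=.
  have cv := tail_cvg phi_ge0 phi_meas phi_int phi_half i j T_gt0 T_pinfty.
  by apply: filterS (cvgr_lt _ cv _ c0) => n /ltW.
(* This makes the window length [c sqrt T] at most [T / m], one block, so that [block_osc]
   applies. *)
have t2 : \forall n \near \oo, c * m%:R <= Num.sqrt (T n).
  move/cvgryPge: T_pinfty => /(_ ((c * m%:R) ^+ 2)); apply: filterS => n Tn.
  apply: (@le_trans _ _ (Num.sqrt ((c * m%:R) ^+ 2))); last exact: ler_wsqrtr.
  by rewrite sqrtr_sqr ler_norm.
apply: filterS3 Hm t1 t2 => n [B [mB PB hB]] tl rT.
exists B; split => // w nBw ne v i v0 v1.
have {}hB j := fun k u => hB w nBw ne k j u.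
set r := Num.sqrt (T n) in hB tl rT *.
have r0 : 0 < r by exact: s0.
have rr : r * r = T n by rewrite -expr2 sqr_sqrtr// ltW.
have eta0 : 0 <= c * r by rewrite mulr_ge0// ltW.
have dev j := block_dev (T_gt0 n) m0 eta0 (hB j) v0 v1.
have remb j : rem j (T n * v) w <= c * r * rem_const j.
  have Tv : T n * v <= T n by rewrite -[leRHS]mulr1 ler_wpM2l// ltW.
  have Tv0 : 0 <= T n * v by rewrite mulr_ge0// ltW.
  have h0 : 0 < c * r by rewrite mulr_gt0.
  have e3 : 0 <= 3 * (c * r) by rewrite mulr_ge0.
  have osc i' a b : 0 <= a -> a <= b -> b <= T n -> b - a <= c * r ->
      comp_mart i' b w - comp_mart i' a w <= 3 * (c * r).
    move=> a0 ab bT ba; apply: le_trans (ler_norm _) _.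
    apply: (block_osc (T_gt0 n) m0 eta0 (hB i') a0 ab bT).
    by rewrite (le_trans ba)// ler_pdivlMr// -rr mulrAC ler_wpM2r// ltW.
  have := rem_le mu_ge0 phi_ge0 phi_meas hN phi_int rho_lt1 ne h0 (ltW (T_gt0 n)) e3 osc j Tv0 Tv.
  move/le_trans; apply; rewrite mulr_sumr; apply: ler_sum => l _.
  rewrite [leRHS]mulrA; apply: ler_pM.
  - apply: sumr_ge0 => k _; apply: mulr_ge0; first exact: A_ge0.
    by apply: addr_ge0; [exact: e3|apply: mulr_ge0; [exact: mu_ge0|exact: eta0]].
  - apply: addr_ge0; first exact: K0.
    by apply: divr_ge0; [apply: (tail_ge0 phi_ge0); exact: ltW|exact: eta0].
  - rewrite mulr_sumr; apply: ler_sum => k _.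
    by rewrite le_eqVlt; apply/orP; left; apply/eqP; rewrite /A; ring.
  - rewrite lerD2l ler_pdivrMr// mul1r -ler_pdivrMr//.
    exact: (tl (j, l)).
have -> : r * ((T n)^-1 * count i (T n * v) w - v * rate i) =
    \sum_j A i j * (x n * (comp_mart j (T n * v) w - rem j (T n * v) w)).
  have Tv0 : 0 <= T n * v by rewrite mulr_ge0// ltW.
  rewrite (countE phi_ge0 phi_meas hN phi_int rho_lt1 i ne Tv0).
  rewrite -/A /x -/r -rr.
  set S := \sum_j A i j * (comp_mart j _ w - _).
  have -> : \sum_j A i j * (r^-1 * (comp_mart j (r * r * v) w - rem j (r * r * v) w)) = r^-1 * S.
    by rewrite mulr_sumr; apply: eq_bigr => j _; rewrite mulrCA.
  by field; rewrite gt_eqF.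
rewrite -sumrB (le_trans (ler_norm_sum _ _ _))//.
apply: (@le_trans _ _ (\sum_j A i j * (c * (1 + rem_const j)))).
  apply: ler_sum => j _; rewrite -mulrBr normrM ger0_norm// ler_wpM2l//.
  rewrite -mulrBr normrM ger0_norm ?(ltW (x0 n))// mulrC ler_pdivrMr//.
  have -> : c * (1 + rem_const j) * r = c * r + c * r * rem_const j by ring.
  rewrite addrAC (le_trans (ler_normB _ _))// lerD//.
  by rewrite ger0_norm//; exact: (rem_ge0 phi_ge0 hN).
apply: (@le_trans _ _ (c * Q)).
  under eq_bigr do rewrite mulrCA.
  rewrite -mulr_sumr ler_wpM2l ?(ltW c0)// /Q [leRHS](bigD1 i)//= lerDl.
  by apply: sumr_ge0 => k _; apply: sumr_ge0 => j _; rewrite mulr_ge0// addr_ge0.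
by rewrite /c mulrAC ler_pdivrMr// ler_wpM2l ?(ltW e0)// lerDl.
Qed.

End sequence.

End hawkes_asymptotics.

(** * Convergence of means from trigonometric test functions *)

Section bernstein.
Context (R : realType).

(* The mean of [F (a + S)] for [S] binomial with parameters [N] and [p]. *)
Fixpoint bern (N : nat) (F : nat -> R) (p : R) (a : nat) : R :=
  if N is N'.+1 then p * bern N' F p a.+1 + (1 - p) * bern N' F p a else F a.

(** Bias and variance: [a + S] has mean square distance [(a + N p - y) ^ 2 + N p (1 - p)] to [y].
    The recursion on [N] reproduces this identity. *)
Lemma bern_dist N (F : nat -> R) (p c alpha beta y : R) a : 0 <= p <= 1 ->
  (forall j : nat, `|c - F j| <= alpha + beta * (j%:R - y) ^+ 2) ->
  `|c - bern N F p a| <=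
    alpha + beta * ((a%:R + N%:R * p - y) ^+ 2 + N%:R * (p * (1 - p))).
Proof.
move=> /andP[p0 p1] cF; have q0 : 0 <= 1 - p by rewrite subr_ge0.
elim: N a => [|N IH] a.
  by rewrite !mul0r !addr0 /=; exact: cF.
rewrite /=; have h1 := IH a.+1; have h0 := IH a.
rewrite (_ : c - _ = p * (c - bern N F p a.+1) + (1 - p) * (c - bern N F p a)); last by ring.
apply: le_trans (ler_normD _ _) _; rewrite !normrM (ger0_norm p0) (ger0_norm q0).
apply: le_trans (lerD (ler_wpM2l p0 h1) (ler_wpM2l q0 h0)) _.
rewrite le_eqVlt; apply/orP; left; apply/eqP.
by rewrite -natr1 -[N.+1%:R]natr1; ring.
Qed.

End bernstein.

Section trig_test_functions.
Context (R : realType) (I : finType).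
Context d1 (Omega : measurableType d1) (P : probability Omega R).
Context d2 (Omega' : measurableType d2) (P' : probability Omega' R).
Variables (xi : nat -> I -> Omega -> R) (eta : I -> Omega' -> R) (C : R).
Hypothesis mxi : forall n i, measurable_fun setT (xi n i).
Hypothesis meta : forall i, measurable_fun setT (eta i).
Hypothesis xi2 : forall n i, Li P (fun w => xi n i w ^+ 2) /\ Ex P (fun w => xi n i w ^+ 2) <= C.
Hypothesis eta2 : forall i, Li P' (fun w => eta i w ^+ 2) /\ Ex P' (fun w => eta i w ^+ 2) <= C.
Hypothesis trig : forall (th : I -> R) c,
  Ex P (fun w => cos (c + \sum_i th i * xi n i w)) @[n --> \oo] -->
  Ex P' (fun w => cos (c + \sum_i th i * eta i w)).

Let xin n w i : R := xi n i w.
Let etan w i : R := eta i w.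
Let tc (th : I -> R) c (x : I -> R) : R := cos (c + \sum_i th i * x i).

(** Bounded functions whose product with every cosine of an affine form has convergent means.
    Keeping the cosine inside makes the class stable under multiplication by cosines, which is what
    allows coordinates to be treated one after the other. *)
Definition tame (f : (I -> R) -> R) : Prop :=
  [/\ forall n, measurable_fun setT (fun w => f (xin n w)),
      measurable_fun setT (fun w => f (etan w)),
      exists M : R, forall x, `|f x| <= M
    & forall th c, Ex P (fun w => f (xin n w) * tc th c (xin n w)) @[n --> \oo] -->
        Ex P' (fun w => f (etan w) * tc th c (etan w))].

Let mtc th c n : measurable_fun setT (fun w => tc th c (xin n w)).
Proof.
apply: measurableT_comp; first by apply: continuous_measurable_fun; exact: continuous_cos.
apply: measurable_funD => //; apply: measurable_sum => i.
by apply: measurable_funM => //; exact: mxi.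
Qed.

Let mtc' th c : measurable_fun setT (fun w => tc th c (etan w)).
Proof.
apply: measurableT_comp; first by apply: continuous_measurable_fun; exact: continuous_cos.
apply: measurable_funD => //; apply: measurable_sum => i.
by apply: measurable_funM => //; exact: meta.
Qed.

Let tc1 th c x : `|tc th c x| <= 1. Proof. by rewrite ler_norml cos_geN1 cos_le1. Qed.

Let tame_Li f th c n : tame f -> Li P (fun w => f (xin n w) * tc th c (xin n w)).
Proof.
move=> [mf _ [M fM] _]; apply: (@Li_bounded _ _ _ _ _ M).
  by apply: measurable_funM; [exact: mf|exact: mtc].
by move=> w; rewrite normrM -[leRHS]mulr1 ler_pM.
Qed.

Let tame_Li' f th c : tame f -> Li P' (fun w => f (etan w) * tc th c (etan w)).
Proof.
move=> [_ mf [M fM] _]; apply: (@Li_bounded _ _ _ _ _ M).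
  by apply: measurable_funM; [exact: mf|exact: mtc'].
by move=> w; rewrite normrM -[leRHS]mulr1 ler_pM.
Qed.

Lemma tame_cst (a : R) : tame (fun=> a).
Proof.
split; [by move=> n; exact: measurable_cst|exact: measurable_cst|by exists (`|a|)|].
move=> th c.
have L n : Li P (fun w => tc th c (xin n w)).
  by apply: (@Li_bounded _ _ _ _ _ 1); [exact: mtc|move=> w; exact: tc1].
have L' : Li P' (fun w => tc th c (etan w)).
  by apply: (@Li_bounded _ _ _ _ _ 1); [exact: mtc'|move=> w; exact: tc1].
rewrite ExZ//; under eq_fun do rewrite ExZ//.
by apply: cvgMr; exact: trig.
Qed.

Lemma tameD f g : tame f -> tame g -> tame (fun x => f x + g x).
Proof.
move=> tf tg; have [mf mf' [M fM] cf] := tf; have [mg mg' [M' gM] cg] := tg.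
split; [by move=> n; exact: measurable_funD|exact: measurable_funD| |].
  by exists (M + M') => x; rewrite (le_trans (ler_normD _ _))// lerD.
move=> th c; under [X in Submission.Ex _ X]funext do rewrite mulrDl.
rewrite ExD; [|exact: tame_Li'|exact: tame_Li'].
rewrite (_ : (fun n => _) = (fun n => Ex P (fun w => f (xin n w) * tc th c (xin n w)) +
   Ex P (fun w => g (xin n w) * tc th c (xin n w)))).
  by apply: cvgD; [exact: cf|exact: cg].
apply/funext => n; rewrite -ExD; [|exact: tame_Li|exact: tame_Li].
by congr (Submission.Ex _ _); apply/funext => w; rewrite mulrDl.
Qed.

Lemma tameZ a f : tame f -> tame (fun x => a * f x).
Proof.
move=> tf; have [mf mf' [M fM] cf] := tf.
split; [by move=> n; exact: measurable_funM|exact: measurable_funM| |].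
  by exists (`|a| * M) => x; rewrite normrM ler_wpM2l.
move=> th c; under [X in Submission.Ex _ X]funext do rewrite -mulrA.
rewrite ExZ; last exact: tame_Li'.
rewrite (_ : (fun n => _) = (fun n => a * Ex P (fun w => f (xin n w) * tc th c (xin n w)))).
  by apply: cvgMr; exact: cf.
apply/funext => n; rewrite -ExZ; last exact: tame_Li.
by congr (Submission.Ex _ _); apply/funext => w; rewrite mulrA.
Qed.

Lemma tame_cos f th b : tame f -> tame (fun x => f x * tc th b x).
Proof.
move=> tf; have [mf mf' [M fM] cf] := tf.
split.
- by move=> n; apply: measurable_funM; [exact: mf|exact: mtc].
- by apply: measurable_funM; [exact: mf'|exact: mtc'].
- by exists M => x; rewrite normrM -[leRHS]mulr1 ler_pM.
move=> th' c.
(* A product of two cosines is half the sum of the cosines of the sum and of the difference of the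
   phases. *)
have E x : f x * tc th b x * tc th' c x =
    2^-1 * (f x * tc (fun i => th i + th' i) (b + c) x) +
    2^-1 * (f x * tc (fun i => th i - th' i) (b - c) x).
  rewrite /tc; have -> : b + c + \sum_i (th i + th' i) * x i =
      (b + \sum_i th i * x i) + (c + \sum_i th' i * x i).
    by rewrite addrACA -big_split/=; congr (_ + _); apply: eq_bigr => i _; ring.
  have -> : b - c + \sum_i (th i - th' i) * x i =
      (b + \sum_i th i * x i) - (c + \sum_i th' i * x i).
    by rewrite opprD addrACA -sumrB; congr (_ + _); apply: eq_bigr => i _; ring.
  by move: (b + _) (c + _) => u v; rewrite cosD cosB; field.
under [X in Submission.Ex P' X]funext do rewrite E.
rewrite ExD; [|by apply: LiZ; exact: tame_Li'|by apply: LiZ; exact: tame_Li'].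
rewrite ExZ; last exact: tame_Li'.
rewrite ExZ; last exact: tame_Li'.
rewrite (_ : (fun n => _) = (fun n =>
  2^-1 * Ex P (fun w => f (xin n w) * tc (fun i => th i + th' i) (b + c) (xin n w)) +
  2^-1 * Ex P (fun w => f (xin n w) * tc (fun i => th i - th' i) (b - c) (xin n w)))).
  by apply: cvgD; apply: cvgMr; exact: cf.
apply/funext => n; rewrite -ExZ; last exact: tame_Li.
rewrite -ExZ; last exact: tame_Li.
rewrite -ExD; [|by apply: LiZ; exact: tame_Li|by apply: LiZ; exact: tame_Li].
by congr (Submission.Ex _ _); apply/funext => w; rewrite E.
Qed.

(** The weight [1 + \sum x_i ^ 2] has means bounded uniformly in [n], so the approximation may
    degrade at infinity. *)
Lemma tame_approx f : (exists M : R, forall x, `|f x| <= M) ->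
  (forall e : R, 0 < e -> exists2 g, tame g &
    forall x, `|f x - g x| <= e * (1 + \sum_i x i ^+ 2)) -> tame f.
Proof.
move=> [M fM] app.
have h k : (0 : R) < k.+1%:R^-1 by rewrite invr_gt0.
have /choice[g gP] k : exists g, tame g /\
  forall x, `|f x - g x| <= k.+1%:R^-1 * (1 + \sum_i x i ^+ 2).
  by have [g tg gf] := app _ (h k); exists g.
have cvg_g x : g k x @[k --> \oo] --> f x.
  apply/cvgrPdist_le => e e0; near=> k.
  have [_ /(_ x)/le_trans] := gP k; apply.
  rewrite mulrC ler_pdivrMr// -ler_pdivrMl//.
  near: k; near=> k; apply: (@le_trans _ _ k%:R); last by rewrite ler_nat.
  by near: k; exact: nbhs_infty_ger.
have mf n : measurable_fun setT (fun w => f (xin n w)).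
  apply: (@measurable_fun_cvg _ _ _ setT (fun k w => g k (xin n w))) => //.
  by move=> k; have [[]] := gP k.
have mf' : measurable_fun setT (fun w => f (etan w)).
  apply: (@measurable_fun_cvg _ _ _ setT (fun k w => g k (etan w))) => //.
  by move=> k; have [[]] := gP k.
split => //; first by exists M.
move=> th c.
have Lf n : Li P (fun w => f (xin n w) * tc th c (xin n w)).
  apply: (@Li_bounded _ _ _ _ _ M).
    by apply: measurable_funM; [exact: mf|exact: mtc].
  by move=> w; rewrite normrM -[leRHS]mulr1 ler_pM.
have Lf' : Li P' (fun w => f (etan w) * tc th c (etan w)).
  apply: (@Li_bounded _ _ _ _ _ M).
    by apply: measurable_funM; [exact: mf'|exact: mtc'].
  by move=> w; rewrite normrM -[leRHS]mulr1 ler_pM.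
apply/cvgrPdist_le => e e0.
pose D := 1 + #|I|%:R * C.
have Q n : Li P (fun w => 1 + \sum_i xin n w i ^+ 2) /\
    Ex P (fun w => 1 + \sum_i xin n w i ^+ 2) <= D.
  have L : Li P (fun w => \sum_i xin n w i ^+ 2).
    by apply: Li_sum => i _; have [] := xi2 n i.
  split; first by apply: LiD => //; exact: Li_cst.
  rewrite (ExD (Li_cst P 1) L) Ex_cst lerD2l.
  rewrite (_ : (fun w => _) = (fun w => \sum_(i <- enum I) xi n i w ^+ 2)); last first.
    by apply/funext => w; rewrite big_enum.
  rewrite Ex_sum => [|i]; last by have [] := xi2 n i.
  rewrite big_enum/= -sum1_card natr_sum mulr_suml; apply: ler_sum => i _.
  by rewrite mul1r; have [] := xi2 n i.
have Q' : Li P' (fun w => 1 + \sum_i etan w i ^+ 2) /\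
    Ex P' (fun w => 1 + \sum_i etan w i ^+ 2) <= D.
  have L : Li P' (fun w => \sum_i etan w i ^+ 2).
    by apply: Li_sum => i _; have [] := eta2 i.
  split; first by apply: LiD => //; exact: Li_cst.
  rewrite (ExD (Li_cst P' 1) L) Ex_cst lerD2l.
  rewrite (_ : (fun w => _) = (fun w => \sum_(i <- enum I) eta i w ^+ 2)); last first.
    by apply/funext => w; rewrite big_enum.
  rewrite Ex_sum => [|i]; last by have [] := eta2 i.
  rewrite big_enum/= -sum1_card natr_sum mulr_suml; apply: ler_sum => i _.
  by rewrite mul1r; have [] := eta2 i.
have D0 : 0 <= D.
  have [_] := Q'; apply: le_trans; apply: Ex_ge0 => w.
  by rewrite addr_ge0// sumr_ge0// => i _; exact: sqr_ge0.
pose e1 := e / (3 * (D + 1)).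
have D1 : 0 < D + 1 by rewrite ltr_wpDl.
have e10 : 0 < e1 by rewrite divr_gt0// mulr_gt0.
have [g0 tg g0f] := app e1 e10.
have e3 : 0 < e / 3 by rewrite divr_gt0.
have eD : e1 * D <= e / 3.
  rewrite /e1 (_ : _ * D = e / 3 * (D / (D + 1))); last by field; rewrite gt_eqF.
  by rewrite ler_piMr ?(ltW e3)// ler_pdivrMr// mul1r lerDl.
have [_ _ _ cg] := tg.
have B n : `|Ex P (fun w => f (xin n w) * tc th c (xin n w)) -
    Ex P (fun w => g0 (xin n w) * tc th c (xin n w))| <= e / 3.
  have [LQ EQ] := Q n; apply: le_trans eD.
  have Lg := tame_Li th c n tg.
  rewrite -(ExB (Lf n) Lg).
  apply: le_trans (Ex_abs (LiB (Lf n) Lg)) _.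
  apply: (@le_trans _ _ (Ex P (fun w => e1 * (1 + \sum_i xin n w i ^+ 2)))).
    apply: Ex_le; [exact/Li_norm/LiB|exact: LiZ|move=> w].
    by rewrite -mulrBl normrM -[leRHS]mulr1 ler_pM.
  by rewrite ExZ// ler_wpM2l// ltW.
have B' : `|Ex P' (fun w => f (etan w) * tc th c (etan w)) -
    Ex P' (fun w => g0 (etan w) * tc th c (etan w))| <= e / 3.
  have [LQ EQ] := Q'; apply: le_trans eD.
  have Lg := tame_Li' th c tg.
  rewrite -(ExB Lf' Lg).
  apply: le_trans (Ex_abs (LiB Lf' Lg)) _.
  apply: (@le_trans _ _ (Ex P' (fun w => e1 * (1 + \sum_i etan w i ^+ 2)))).
    apply: Ex_le; [exact/Li_norm/LiB|exact: LiZ|move=> w].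
    by rewrite -mulrBl normrM -[leRHS]mulr1 ler_pM.
  by rewrite ExZ// ler_wpM2l// ltW.
have /cvgrPdist_le/(_ _ e3) := cg th c; apply: filterS => n.
move: (B n) B'; move: (Submission.Ex _ _) (Submission.Ex _ _) (Submission.Ex _ _) (Submission.Ex _ _) => a b a' b'.
by rewrite !ler_norml; lra.
Unshelve. all: by end_near. Qed.

Let mul2_le_sqrD (a b : R) : 2 * a * b <= b ^+ 2 + a ^+ 2.
Proof.
rewrite -subr_ge0 (_ : _ - _ = (a - b) ^+ 2); last by ring.
exact: sqr_ge0.
Qed.

Let half_sum_le (a b c e : R) : b <= e / 2 -> a <= c -> a + e / 2 + b <= e + c.
Proof. lra. Qed.

Let sq_sin (y : R) : `|y - sin y| <= y ^+ 2.
Proof.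
have h3 := sin_sub_le y; rewrite distrC -[y ^+ 2]real_normK ?num_real//.
have [y2|y2] := leP `|y| 2.
  apply: le_trans h3 _; rewrite exprSr -mulrA ler_piMr ?sqr_ge0//.
  by rewrite ler_pdivrMr// mul1r.
have := sin_le_norm y; have := ler_normB (sin y) y.
by rewrite expr2; move: y2; move: `|y| `|sin y| `|_| => a b c; nra.
Qed.

(* One coordinate [x i] at a time is replaced by [L * sin (x i / L)], and the
   dependence on [p = (1 + sin (x i / L)) / 2] by a Bernstein polynomial. *)
Lemma tame_lip (s : seq I) (G : (I -> R) -> R) (Lam : R) (f : (I -> R) -> R) : 0 <= Lam ->
  (exists M : R, forall x, `|G x| <= M) ->
  (forall x y, `|G x - G y| <= Lam * \sum_i `|x i - y i|) ->
  (forall x y, {in s, x =1 y} -> G x = G y) ->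
  tame f -> tame (fun x => f x * G x).
Proof.
move=> Lm; elim: s G f => [|i s IH] G f [M GM] GL Gs tf.
  rewrite (_ : (fun x => _) = (fun x => G (fun=> 0) * f x)); first exact: tameZ.
  by apply/funext => x; rewrite mulrC (Gs x (fun=> 0)).
pose upd (v : R) (x : I -> R) k := if k == i then v else x k.
have [_ _ [B fB] _] := tf.
have B0 : 0 <= B := le_trans (normr_ge0 _) (fB (fun=> 0)).
have L0 : 0 <= `|Lam| by [].
pose La := `|Lam| + 1; have La0 : 0 < La by rewrite ltr_wpDl.
have GLa x y : `|G x - G y| <= La * \sum_i `|x i - y i|.
  apply: le_trans (GL x y) _; rewrite ler_wpM2r ?sumr_ge0//.
  by rewrite (le_trans (ler_norm _))// lerDl.
apply: tame_approx.
  by exists (B * M) => x; rewrite normrM ler_pM.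
move=> e e0; pose e1 := e / (B + 1).
have B1 : 0 < B + 1 by rewrite ltr_wpDl.
have e10 : 0 < e1 by rewrite divr_gt0.
(* The three errors are balanced: [La x ^ 2 / L = e1 x ^ 2], [La L kap = e1 / 2], and [N] brings the
   variance of the Bernstein polynomial below [e1 / 2]. *)
pose L := La / e1; have Lp : 0 < L by rewrite divr_gt0.
pose kap := e1 / (2 * (La * L)).
have kap0 : 0 < kap by apply: divr_gt0 => //; apply: mulr_gt0 => //; exact: mulr_gt0.
pose N := (Num.truncn (La * L / kap * (2 / e1))).+1.
have N0 : (0 : R) < N%:R by rewrite ltr0n.
have NB : La * L / kap / N%:R <= e1 / 2.
  rewrite ler_pdivrMr// -ler_pdivrMl ?divr_gt0// invf_div mulrC ltW// /N.
  have y0 : 0 <= La * L / kap * (2 / e1).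
    apply: mulr_ge0; apply: divr_ge0; rewrite ?(ltW kap0) ?(ltW e10)//.
    by apply: mulr_ge0; apply: ltW.
  by have /andP[] := truncn_itv y0.
pose p (x : I -> R) := (1 + sin (x i / L)) / 2.
have p01 x : 0 <= p x <= 1.
  have h1 := sin_le1 (x i / L); have h2 := sin_geN1 (x i / L).
  by rewrite /p; apply/andP; split; lra.
(* [p] is affine in a sine, that is in a cosine with phase shifted by [pi / 2]. *)
have tp h : tame h -> tame (fun x => h x * p x).
  move=> th_; pose thi k : R := (k == i)%:R / L.
  rewrite (_ : (fun x => _) = (fun x => 2^-1 * h x + 2^-1 * (h x * tc thi (- (pi / 2)) x))).
    by apply: tameD; [exact: tameZ|apply: tameZ; exact: tame_cos].
  apply/funext => x; rewrite /tc.
  have -> : \sum_k thi k * x k = x i / L.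
    rewrite (bigD1 i)//= /thi eqxx mul1r big1 ?addr0 1?mulrC// => k ki.
    by rewrite (negbTE ki) !mul0r.
  by rewrite cosD cosN sinN cos_pihalf sin_pihalf /p; field; rewrite ?gt_eqF.
have tq h : tame h -> tame (fun x => h x * (1 - p x)).
  move=> th_; rewrite (_ : (fun x => _) = (fun x => h x + (-1) * (h x * p x))).
    by apply: tameD => //; apply: tameZ; exact: tp.
  by apply/funext => x; ring.
(* The value of [L sin (x i / L) = L (2 p - 1)] when [p] is replaced by [j / N]. *)
pose v (j : nat) : R := L * (2 * (j%:R / N%:R) - 1).
(* The recursion of [bern] multiplies only by [p] and [1 - p], and its leaves no longer depend on
   coordinate [i]. *)
have tb n a h : tame h -> tame (fun x => h x * bern n (fun j => G (upd (v j) x)) (p x) a).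
  elim: n a h => [|n IHn] a h th_ /=.
    apply: IH th_; first by exists M.
      move=> x y; apply: le_trans (GL _ _) _.
      rewrite ler_wpM2l//; apply: ler_sum => k _; rewrite /upd; case: ifP => // _.
      by rewrite subrr normr0.
    move=> x y xy; apply: Gs => k; rewrite inE /upd; case: eqP => //= _; exact: xy.
  rewrite (_ : (fun x => _) = (fun x =>
     (h x * p x) * bern n (fun j => G (upd (v j) x)) (p x) a.+1 +
     (h x * (1 - p x)) * bern n (fun j => G (upd (v j) x)) (p x) a)).
    by apply: tameD; apply: IHn; [exact: tp|exact: tq].
  by apply/funext => x; ring.
exists (fun x => f x * bern N (fun j => G (upd (v j) x)) (p x) 0); first exact: tb.
move=> x; rewrite -mulrBr normrM.
have key : `|G x - bern N (fun j => G (upd (v j) x)) (p x) 0| <= e1 * (1 + \sum_i x i ^+ 2).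
  have := @bern_dist _ N (fun j => G (upd (v j) x)) (p x) (G x)
    (La * (x i ^+ 2 / L + L * kap)) (La * L / kap / N%:R ^+ 2) (N%:R * p x) 0 (p01 x).
  have H (j : nat) : `|G x - G (upd (v j) x)| <= La * (x i ^+ 2 / L + L * kap) +
      La * L / kap / N%:R ^+ 2 * (j%:R - N%:R * p x) ^+ 2.
    apply: le_trans (GLa _ _) _.
    have -> : \sum_k `|x k - upd (v j) x k| = `|x i - v j|.
      rewrite (bigD1 i)//= /upd eqxx big1 ?addr0// => k /negbTE ->.
      by rewrite subrr normr0.
    have -> : x i - v j = L * ((x i / L - sin (x i / L)) + 2 * (p x - j%:R / N%:R)).
      by rewrite /v /p; field; rewrite !gt_eqF.
    set z := p x - j%:R / N%:R.
    have -> : j%:R - N%:R * p x = - (N%:R * z) by rewrite /z; field; rewrite gt_eqF.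
    rewrite normrM (gtr0_norm Lp).
    have z2 : `|2 * z| <= kap + z ^+ 2 / kap.
      rewrite normrM ger0_norm// -(ler_pM2r kap0).
      have -> : (kap + z ^+ 2 / kap) * kap = kap ^+ 2 + z ^+ 2 by field; rewrite gt_eqF.
      by rewrite -[z ^+ 2]real_normK ?num_real//; exact: mul2_le_sqrD.
    have s2 : `|x i / L - sin (x i / L)| <= x i ^+ 2 / L ^+ 2.
      by rewrite -expr_div_n; exact: sq_sin.
    apply: (@le_trans _ _ (La * (L * (x i ^+ 2 / L ^+ 2 + (kap + z ^+ 2 / kap))))).
      rewrite ler_wpM2l ?(ltW La0)// ler_wpM2l ?(ltW Lp)//.
      by apply: le_trans (ler_normD _ _) _; exact: lerD.
    by rewrite le_eqVlt; apply/orP; left; apply/eqP; field; rewrite !gt_eqF.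
  move=> /(_ H)/le_trans; apply; rewrite add0r subrr expr0n add0r.
  have pq : p x * (1 - p x) <= 1 by have /andP[] := p01 x; nra.
  have E1 : La * (x i ^+ 2 / L + L * kap) = e1 * x i ^+ 2 + e1 / 2.
    by rewrite /kap /L; field; rewrite !gt_eqF.
  have E2 : La * L / kap / N%:R ^+ 2 * (N%:R * (p x * (1 - p x))) <= e1 / 2.
    rewrite (_ : _ * _ = La * L / kap / N%:R * (p x * (1 - p x))); last first.
      by field; rewrite !gt_eqF.
    apply: le_trans NB; rewrite ler_piMr// divr_ge0 ?(ltW N0)// divr_ge0 ?(ltW kap0)//.
    by rewrite mulr_ge0// ltW.
  have E3 : x i ^+ 2 <= \sum_i x i ^+ 2.
    by rewrite (bigD1 i)//= lerDl sumr_ge0// => k _; exact: sqr_ge0.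
  have E4 : e1 * x i ^+ 2 <= e1 * \sum_i x i ^+ 2 by rewrite ler_wpM2l// ltW.
  by rewrite E1 [leRHS]mulrDr [e1 * 1]mulr1; exact: half_sum_le.
apply: (@le_trans _ _ (B * (e1 * (1 + \sum_i x i ^+ 2)))); first by rewrite ler_pM.
rewrite mulrA ler_wpM2r//; first by rewrite addr_ge0// sumr_ge0// => k _; exact: sqr_ge0.
by rewrite /e1 mulrCA ler_piMr ?(ltW e0)// ler_pdivrMr// mul1r lerDl.
Qed.

Lemma trig_cvg (G : (I -> R) -> R) (Lam : R) : 0 <= Lam ->
  (exists M : R, forall x, `|G x| <= M) ->
  (forall x y, `|G x - G y| <= Lam * \sum_i `|x i - y i|) ->
  [/\ forall n, measurable_fun setT (fun w => G (fun i => xi n i w)),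
    measurable_fun setT (fun w => G (fun i => eta i w)) &
    Ex P (fun w => G (fun i => xi n i w)) @[n --> \oo] --> Ex P' (fun w => G (fun i => eta i w))].
Proof.
move=> L0 GM GL.
have [||mG mG' _ cG] := @tame_lip (enum I) G Lam (fun=> 1) L0 GM GL.
  move=> x y xy; congr G; apply/funext => i; apply: xy; exact: mem_enum.
  exact: tame_cst.
have E (x : I -> R) : 1 * G x * tc (fun=> 0) 0 x = G x.
  by rewrite /tc big1 ?addr0 ?cos0 ?mulr1 ?mul1r// => i _; rewrite mul0r.
split.
- by move=> n; have := mG n; rewrite (_ : (fun w => _) = (fun w => G (xin n w)))//;
    apply/funext => w; rewrite mul1r.
- by move: mG'; rewrite (_ : (fun w => _) = (fun w => G (etan w)))//;
    apply/funext => w; rewrite mul1r.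
have := cG (fun=> 0) 0.
rewrite (_ : (fun w => _) = (fun w => G (etan w))); last by apply/funext => w; rewrite E.
rewrite (_ : (fun n => _) = (fun n => Ex P (fun w => G (xin n w))))//.
by apply/funext => n; congr (Submission.Ex _ _); apply/funext => w; rewrite E.
Qed.

End trig_test_functions.

(** * Gaussian variables and Brownian increments *)

Section density.
Context d0 (T : measurableType d0) (R : realType).
Context (nu mu : {measure set T -> \bar R}) (g : T -> R).
Hypothesis nuE : forall A, measurable A -> nu A = (\int[mu]_(x in A) (g x)%:E)%E.
Hypothesis mg : measurable_fun setT g.
Hypothesis g0 : forall x, 0 <= g x.

Import HBNNSimple.

Let density_indic E : measurable E ->
  (\int[nu]_x (\1_E x)%:E = \int[mu]_x ((\1_E x)%:E * (g x)%:E))%E.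
Proof.
move=> mE; rewrite integral_indic//= setIT nuE// integral_mkcond/=.
apply: eq_integral => x _; rewrite patchE indicE; case: (x \in E).
  by rewrite mul1e.
by rewrite mul0e.
Qed.

Let density_nnsfun (f : {nnsfun T >-> R}) :
  (\int[nu]_x (f x)%:E = \int[mu]_x ((f x)%:E * (g x)%:E))%E.
Proof.
under [LHS]eq_integral do rewrite fimfunE -fsumEFin//.
rewrite [LHS]ge0_integral_fsum//; last 2 first.
  - by move=> r; exact/measurable_EFinP/measurableT_comp.
  - by move=> n x _; rewrite EFinM nnfun_muleindic_ge0.
under [RHS]eq_integral.
  move=> x xD; rewrite fimfunE -fsumEFin// muleC ge0_mule_fsumr; last first.
    by move=> r; rewrite EFinM nnfun_muleindic_ge0.
  over.
rewrite [RHS]ge0_integral_fsum//; last 2 first.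
  - move=> r; apply: emeasurable_funM; first exact/measurable_EFinP.
    by apply/measurable_EFinP; apply/measurableT_comp => //.
  - by move=> n x _; apply: mule_ge0; [rewrite lee_fin|rewrite EFinM nnfun_muleindic_ge0].
apply: eq_fsbigr => r _.
rewrite integralZl_indic_nnsfun//= density_indic//.
have [r0|r0] := leP 0 r; last first.
  have -> : f @^-1` [set r] = set0.
    by apply/seteqP; split => // x /= fx; have : 0 <= f x by []; rewrite fx leNgt r0.
  rewrite (eq_integral (fun=> 0%E)); last by move=> x _; rewrite indic0 mul0e.
  rewrite integral0 mule0 (eq_integral (fun=> 0%E)) ?integral0//.
  by move=> x _; rewrite indic0 mulr0 mule0.
rewrite -ge0_integralZl//.
- by apply: eq_integral => x _; rewrite muleA -EFinM muleC.
- apply: emeasurable_funM; last exact/measurable_EFinP.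
  exact/measurable_EFinP/measurable_indic.
- by move=> x _; rewrite mule_ge0 ?lee_fin.
Qed.

Lemma ge0_integral_density (f : T -> \bar R) : measurable_fun setT f ->
  (forall x, 0 <= f x)%E -> (\int[nu]_x f x = \int[mu]_x (f x * (g x)%:E))%E.
Proof.
move=> mf f0.
pose f_ := nnsfun_approx measurableT mf.
transitivity (lim (\int[nu]_x (f_ n x)%:E @[n --> \oo])%E).
  rewrite -monotone_convergence//=.
  - apply: eq_integral => ? /[!inE] xD; apply/esym/cvg_lim => //=.
    exact: cvg_nnsfun_approx.
  - by move=> n; exact/measurable_EFinP/measurable_funTS.
  - by move=> n ? _; rewrite lee_fin.
  - by move=> ? _ ? ? mn; rewrite lee_fin; exact/lefP/nd_nnsfun_approx.
rewrite [RHS](_ : _ = lim (\int[mu]_x ((f_ n x)%:E * (g x)%:E) @[n --> \oo])%E); last first.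
  rewrite -monotone_convergence//=.
  - apply: eq_integral => x /[!inE] xD; apply/esym/cvg_lim => //.
    by apply: cvgeZr => //; exact: cvg_nnsfun_approx.
  - by move=> n; apply: emeasurable_funM; exact/measurable_EFinP.
  - by move=> n ? _; rewrite mule_ge0 ?lee_fin.
  - by move=> ? _ ? ? ?; rewrite lee_wpmul2r ?lee_fin//; exact/lefP/nd_nnsfun_approx.
by apply: congr_lim; apply/funext => n /=; exact: density_nnsfun.
Qed.

End density.

Lemma gauss_exponent (F : fieldType) (a S X q : F) : (2 : F) != 0 -> S != 0 -> q != 0 ->
  q = 1 - 2 * a * S -> - X / (S / q *+ 2) = a * X + - X / (S *+ 2).
Proof.
move=> n2 S0 q0 qE; have aE : a = (1 - q) / (2 * S) by rewrite qE; field; rewrite n2 S0.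
by rewrite aE -[S / q *+ 2]mulr_natl -[S *+ 2]mulr_natl; field; rewrite n2 S0 q0.
Qed.

Section gaussian.
Context (R : realType) d0 (Omega : measurableType d0) (P : probability Omega R).
Context (X : Omega -> R) (s : R).
Hypothesis mX : measurable_fun setT X.
Hypothesis s0 : 0 < s.
Hypothesis law : forall B, measurable B -> P (X @^-1` B) = normal_prob 0 s B.
Local Notation Ex := (Ex P).
Local Notation Li := (Li P).
Local Notation leb := (@lebesgue_measure R).

Lemma gauss_integral_pdf (f : R -> R) : measurable_fun setT f -> (forall x, 0 <= f x) ->
  (\int[P]_w (f (X w))%:E = \int[leb]_x ((f x)%:E * (normal_pdf 0 s x)%:E))%E.
Proof.
move=> mf f0.
have mf' : measurable_fun setT (EFin \o f) by exact/measurable_EFinP.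
have f0' x : (0 <= (EFin \o f) x)%E by rewrite lee_fin.
have mX' : measurable_fun setT (X : Omega -> measurableTypeR R) by exact: mX.
have -> : (\int[P]_w (f (X w))%:E =
    \int[pushforward P (X : Omega -> measurableTypeR R)]_x (EFin \o f) x)%E.
  rewrite -[in LHS](preimage_setT (X : Omega -> measurableTypeR R)).
  by rewrite (@ge0_integral_pushforward _ _ Omega (measurableTypeR R) R _ mX' P setT (EFin \o f))//.
have D := @ge0_integral_density _ _ _ (normal_prob 0 s) leb (normal_pdf 0 s)
  (fun _ _ => erefl) (measurable_normal_pdf 0 s) (normal_pdf_ge0 0 s) (EFin \o f) mf' f0'.
apply: etrans D.
apply: (@eq_measure_integral _ (measurableTypeR R)) => A mA _; exact: law.
Qed.

Lemma lebesgue_measure_opp (A : set R) : measurable A ->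
  pushforward leb ((fun x : R => - x)%R : _ -> measurableTypeR R) A = leb A.
Proof.
have mf : measurable_fun setT ((fun x : R => - x)%R : _ -> measurableTypeR R).
  exact: oppr_measurable.
move=> mA; apply/esym/lebesgue_measure_unique => //= _ [[a b]] _ <-.
rewrite /pushforward (_ : _ @^-1` _ = `[(- b)%R, (- a)%R[%classic); last first.
  by apply/seteqP; split => x /=; rewrite !in_itv/= lerNl ltrNr andbC.
by rewrite !lebesgue_measure_itv/= !lte_fin ltrN2 -!EFinB opprK addrC.
Qed.

Lemma gauss_opp (f : R -> R) : measurable_fun setT f -> (forall x, 0 <= f x) ->
  (\int[P]_w (f (- X w))%:E = \int[P]_w (f (X w))%:E)%E.
Proof.
move=> mf f0.
have mo : measurable_fun setT ((fun x : R => - x)%R : _ -> measurableTypeR R).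
  exact: oppr_measurable.
have mf' : measurable_fun setT (fun x : R => f (- x)) by exact: measurableT_comp.
rewrite (gauss_integral_pdf mf')// gauss_integral_pdf//.
pose h (x : R) := ((f x)%:E * (normal_pdf 0 s x)%:E)%E.
have mh : measurable_fun setT h.
  apply: emeasurable_funM; apply/measurable_EFinP => //; exact: measurable_normal_pdf.
transitivity (\int[leb]_x h (- (x : R))%R)%E.
  apply: eq_integral => x _; rewrite /h; congr (_ * (_)%:E)%E.
  rewrite normal_pdfE ?gt_eqF// /normal_fun !subr0 sqrrN//.
rewrite -[in LHS](preimage_setT ((fun x : R => - x)%R : _ -> measurableTypeR R)).
rewrite -[LHS]/(\int[leb]_(s in (fun s : R => - s)%R @^-1` setT)
  (h \o (fun s : R => - s)%R : _ -> \bar R) s)%E.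
rewrite -(@ge0_integral_pushforward _ _ (measurableTypeR R) (measurableTypeR R) R
  _ mo leb setT h)//; last first.
  by move=> x _; apply: mule_ge0; rewrite lee_fin; [exact: f0|exact: normal_pdf_ge0].
by apply: eq_measure_integral => A mA _; exact: lebesgue_measure_opp.
Qed.

(** Multiplying the density by [exp (a x ^ 2)] gives [r^-1] times the centred normal density of
    standard deviation [s / r], where [r ^ 2 = 1 - 2 a s ^ 2]. *)
Lemma gauss_exp (a : R) : 0 < 1 - 2 * a * s ^+ 2 ->
  (\int[P]_w (expR (a * X w ^+ 2))%:E = ((Num.sqrt (1 - 2 * a * s ^+ 2))^-1)%:E)%E.
Proof.
move=> a0; have r0 : 0 < Num.sqrt (1 - 2 * a * s ^+ 2) by rewrite sqrtr_gt0.
set r := Num.sqrt _ in r0 *.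
have r2 : r ^+ 2 = 1 - 2 * a * s ^+ 2 by rewrite sqr_sqrtr// ltW.
have mf : measurable_fun setT (fun x : R => expR (a * x ^+ 2)).
  by apply: measurableT_comp => //; apply: measurable_funM => //; exact: measurable_funX.
rewrite (gauss_integral_pdf mf); last by move=> x; exact: expR_ge0.
pose t := s / r; have t0 : 0 < t by rewrite divr_gt0.
have peakE (u : R) : 0 < u -> normal_peak u = u^-1 * (Num.sqrt (pi *+ 2))^-1.
  move=> u0; rewrite /normal_peak -mulrnAr sqrtrM ?sqr_ge0// sqrtr_sqr ger0_norm ?(ltW u0)//.
  by rewrite invfM.
transitivity (\int[leb]_x (r^-1%:E * (normal_pdf 0 t x)%:E))%E.
  apply: eq_integral => x _; rewrite -!EFinM; congr EFin.
  rewrite !normal_pdfE ?gt_eqF// !peakE// /normal_fun !subr0.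
  have -> : - x ^+ 2 / (t ^+ 2 *+ 2) = a * x ^+ 2 + - x ^+ 2 / (s ^+ 2 *+ 2).
    rewrite /t expr_div_n; apply: gauss_exponent; rewrite ?gt_eqF ?exprn_gt0//.
  by rewrite expRD /t; field; rewrite !gt_eqF// sqrtr_gt0 mulrn_wgt0// pi_gt0.
rewrite integralZl//; last exact: integrable_normal_pdf.
by rewrite integral_normal_pdf mule1.
Qed.

Let z w := X w ^+ 2 / (4 * s ^+ 2).

(** At [a = 1 / (4 s ^ 2)] the mean is [sqrt 2]. This one exponential dominates both moments below,
    whose constants are not sharp. *)
Let gauss_exp2 : Li (fun w => expR (z w)) /\ Ex (fun w => expR (z w)) <= 2.
Proof.
have s2 : 0 < s ^+ 2 by rewrite exprn_gt0.
have a0 : 0 < 1 - 2 * (4 * s ^+ 2)^-1 * s ^+ 2.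
  by rewrite (_ : _ - _ = 2^-1) ?invr_gt0//; field; rewrite gt_eqF.
have mz : measurable_fun setT z.
  by apply: measurable_funM => //; exact: measurable_funX.
have E : (\int[P]_w (expR (z w))%:E = ((Num.sqrt 2^-1)^-1)%:E)%E.
  have := gauss_exp a0; rewrite (_ : 1 - _ = 2^-1); last by field; rewrite gt_eqF.
  by move=> <-; apply: eq_integral => w _; rewrite /z mulrC.
have L : Li (fun w => expR (z w)).
  apply/integrableP; split; first by apply/measurable_EFinP; exact: measurableT_comp.
  under eq_integral do rewrite /= ger0_norm ?expR_ge0//.
  by rewrite E ltry.
split => //; rewrite /Submission.Ex /Rintegral E/= sqrtrV// invrK.
by rewrite -[leRHS]ger0_norm// -sqrtr_sqr ler_wsqrtr// expr2 ler_peMl// ler1n.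
Qed.

Let z0 w : 0 <= z w.
Proof. by rewrite divr_ge0 ?sqr_ge0// mulr_ge0// sqr_ge0. Qed.

Let X2 w : X w ^+ 2 = 4 * s ^+ 2 * z w.
Proof. by rewrite /z; field; rewrite gt_eqF. Qed.

Lemma gauss_moment2 : Li (fun w => X w ^+ 2) /\ Ex (fun w => X w ^+ 2) <= 8 * s ^+ 2.
Proof.
have [L E] := gauss_exp2.
have le w : X w ^+ 2 <= 4 * s ^+ 2 * expR (z w).
  rewrite X2 ler_wpM2l//; first by rewrite mulr_ge0// sqr_ge0.
  by rewrite (le_trans _ (expR_ge1Dx _))// lerDr.
have L2 : Li (fun w => X w ^+ 2).
  apply: (@Li_le _ _ _ P _ (fun w => 4 * s ^+ 2 * expR (z w))).
  - exact: measurable_funX.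
  - exact: LiZ.
  - by move=> w; rewrite ger0_norm ?sqr_ge0.
split => //; apply: le_trans (Ex_le L2 (LiZ (4 * s ^+ 2) L) le) _.
rewrite ExZ//; have -> : 8 * s ^+ 2 = 4 * s ^+ 2 * 2 by ring.
by rewrite ler_wpM2l// mulr_ge0// sqr_ge0.
Qed.

Lemma gauss_moment4 : Li (fun w => X w ^+ 4) /\ Ex (fun w => X w ^+ 4) <= 128 * s ^+ 4.
Proof.
have [L E] := gauss_exp2.
have x4 w : X w ^+ 4 = 16 * s ^+ 4 * z w ^+ 2.
  by rewrite (exprM (X w) 2 2) X2; ring.
have ge w : z w ^+ 2 <= 4 * expR (z w).
  have -> : z w = z w / 2 + z w / 2 by field.
  rewrite expRD -expr2; set y := z w / 2.
  have y0 : 0 <= y by rewrite divr_ge0.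
  have -> : (y + y) ^+ 2 = 4 * y ^+ 2 by ring.
  rewrite ler_wpM2l// lerXn2r ?nnegrE ?expR_ge0//.
  by rewrite (le_trans _ (expR_ge1Dx _))// lerDr.
have s4 : 0 <= s ^+ 4 by rewrite exprn_ge0// ltW.
have le w : X w ^+ 4 <= 64 * s ^+ 4 * expR (z w).
  have -> : 64 * s ^+ 4 * expR (z w) = 16 * s ^+ 4 * (4 * expR (z w)) by ring.
  by rewrite x4 ler_wpM2l// mulr_ge0.
have L4 : Li (fun w => X w ^+ 4).
  apply: (@Li_le _ _ _ P _ (fun w => 64 * s ^+ 4 * expR (z w))).
  - exact: measurable_funX.
  - exact: LiZ.
  - by move=> w; rewrite ger0_norm// x4 mulr_ge0 ?sqr_ge0// mulr_ge0.
split => //; apply: le_trans (Ex_le L4 (LiZ (64 * s ^+ 4) L) le) _.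
rewrite ExZ//; have -> : 128 * s ^+ 4 = 64 * s ^+ 4 * 2 by ring.
by rewrite ler_wpM2l// mulr_ge0.
Qed.

Let mcos (th : R) : measurable_fun setT (fun w => cos (th * X w)).
Proof.
apply: measurableT_comp; first by apply: continuous_measurable_fun; exact: continuous_cos.
exact: measurable_funM.
Qed.

Let Lcos (th : R) : Li (fun w => cos (th * X w)).
Proof.
apply: (@Li_bounded _ _ _ _ _ 1); first exact: mcos.
by move=> w; rewrite ler_norml cos_geN1 cos_le1.
Qed.

Lemma gauss_sin (th : R) : Ex (fun w => sin (th * X w)) = 0.
Proof.
have ms : measurable_fun setT (fun x : R => sin (th * x)).
  apply: measurableT_comp; first by apply: continuous_measurable_fun; exact: continuous_sin.
  exact: measurable_funM.
(* [gauss_opp] concerns nonnegative functions, hence the shift by 1. *)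
have mf : measurable_fun setT (fun x : R => 1 + sin (th * x)) by exact: measurable_funD.
have f0 (x : R) : 0 <= 1 + sin (th * x) by have := sin_geN1 (th * x); lra.
have Ls : Li (fun w => sin (th * X w)).
  apply: (@Li_bounded _ _ _ _ _ 1); first exact: measurableT_comp ms mX.
  by move=> w; rewrite ler_norml sin_geN1 sin_le1.
have := congr1 fine (gauss_opp mf f0).
have -> : fine (\int[P]_w (1 + sin (th * - X w))%:E) = 1 - Ex (fun w => sin (th * X w)).
  have := ExB (Li_cst P 1) Ls; rewrite Ex_cst => <-.
  by rewrite /Submission.Ex /Rintegral; congr fine; apply: eq_integral => w _; rewrite mulrN sinN.
have -> : fine (\int[P]_w (1 + sin (th * X w))%:E) = 1 + Ex (fun w => sin (th * X w)).
  by have := ExD (Li_cst P 1) Ls; rewrite Ex_cst => <-.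
by move: (Submission.Ex _ _) => u; lra.
Qed.

(* [cos u] is compared with [exp (- u ^ 2 / 2)], whose Gaussian mean is explicit. *)
Lemma gauss_cos_le (th : R) :
  `|Ex (fun w => cos (th * X w)) - expR (- (th ^+ 2 * s ^+ 2 / 2))| <= 129 * (th ^+ 4 * s ^+ 4).
Proof.
have c4 (u : R) : `|cos u - expR (- (u ^+ 2 / 2))| <= u ^+ 4.
  have u4 : 0 <= u ^+ 4 by rewrite (exprM u 2 2) sqr_ge0.
  have h1 := one_sub_cos_le u.
  have h2 : u ^+ 2 / 2 - u ^+ 4 / 8 <= 1 - cos u.
    rewrite one_sub_cos; set h := u / 2; have -> : u = 2 * h by rewrite /h; field.
    have -> : (2 * h) ^+ 2 / 2 - (2 * h) ^+ 4 / 8 = 2 * (h ^+ 2 - h ^+ 4) by field.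
    rewrite ler_wpM2l//.
    have := sin_sub_le h; have := sin_le_norm h.
    have : h ^+ 2 - sin h ^+ 2 <= `|sin h - h| * (`|h| + `|sin h|).
      apply: le_trans (ler_norm _) _.
      have -> : h ^+ 2 - sin h ^+ 2 = - (sin h - h) * (h + sin h) by ring.
      by rewrite normrM normrN ler_wpM2l// ler_normD.
    have -> : h ^+ 4 = `|h| ^+ 4 by rewrite (exprM h 2 2) -[h ^+ 2]real_normK ?num_real// -exprM.
    move: (normr_ge0 h) (normr_ge0 (sin h)) (normr_ge0 (sin h - h)).
    move: `|h| `|sin h| `|sin h - h| => a b c a0 b0 c0 hh ba ca.
    have : c * (a + b) <= a ^+ 3 / 2 * (a + a).
      by apply: ler_pM => //; rewrite ?addr_ge0 ?lerD2l.
    have -> : a ^+ 3 / 2 * (a + a) = a ^+ 4 by field.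
    by move: hh; lra.
  have h3 := @sub_expRN_le _ (u ^+ 2 / 2); have u2 : 0 <= u ^+ 2 / 2 by rewrite divr_ge0 ?sqr_ge0.
  move: (h3 u2); have -> : (u ^+ 2 / 2) ^+ 2 = u ^+ 4 / 4 by field.
  by rewrite !ler_norml; move: u4 h1 h2; move: (expR _) (u ^+ 4) (cos u) => a b c; lra.
have [L4 E4] := gauss_moment4.
have y0 : 0 <= th ^+ 2 * s ^+ 2 by rewrite mulr_ge0 ?sqr_ge0.
set y := th ^+ 2 * s ^+ 2 in y0 *.
have a0 : 0 < 1 - 2 * (- th ^+ 2 / 2) * s ^+ 2.
  by rewrite (_ : _ - _ = 1 + y) ?ltr_wpDr// /y; field.
have G : Ex (fun w => expR (- ((th * X w) ^+ 2 / 2))) = (Num.sqrt (1 + y))^-1.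
  have := congr1 fine (gauss_exp a0); rewrite (_ : 1 - _ = 1 + y); last by rewrite /y; field.
  move=> /= <-; rewrite /Submission.Ex /Rintegral; congr fine; apply: eq_integral => w _.
  by congr (expR _)%:E; field.
have Le : Li (fun w => expR (- ((th * X w) ^+ 2 / 2))).
  apply: (@Li_bounded _ _ _ _ _ 1).
    apply: measurableT_comp => //; apply: measurableT_comp; first exact: oppr_measurable.
    by apply: measurable_funM => //; apply: measurable_funX; exact: measurable_funM.
  by move=> w; rewrite ger0_norm ?expR_ge0// expR_le1 oppr_le0 divr_ge0// sqr_ge0.
have D1 : `|Ex (fun w => cos (th * X w)) - (Num.sqrt (1 + y))^-1| <= 128 * (th ^+ 4 * s ^+ 4).
  rewrite -G -(ExB (Lcos th) Le); apply: le_trans (Ex_abs (LiB (Lcos th) Le)) _.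
  apply: (@le_trans _ _ (Ex (fun w => th ^+ 4 * X w ^+ 4))).
    apply: Ex_le; [exact/Li_norm/LiB|exact: LiZ|move=> w].
    by rewrite -exprMn.
  rewrite ExZ// mulrCA ler_wpM2l// (exprM th 2 2) sqr_ge0//.
have r0 : 0 < Num.sqrt (1 + y) by rewrite sqrtr_gt0 ltr_wpDr.
have r2 : Num.sqrt (1 + y) ^+ 2 = 1 + y by rewrite sqr_sqrtr// addr_ge0.
have D2 : `|(Num.sqrt (1 + y))^-1 - expR (- (y / 2))| <= y ^+ 2.
  have up : (Num.sqrt (1 + y))^-1 <= 1 - y / 2 + y ^+ 2.
    have q0 : 0 < 1 - y / 2 + y ^+ 2.
      rewrite (_ : _ + _ = (y - 4^-1) ^+ 2 + 15 / 16); last by field.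
      by rewrite ltr_wpDl ?sqr_ge0.
    rewrite -[leRHS]invrK lef_pV2 ?posrE ?invr_gt0//.
    rewrite -(@ler_pXn2r _ 2) ?nnegrE ?invr_ge0 ?(ltW r0) ?(ltW q0)// r2 exprVn.
    rewrite -div1r ler_pdivrMr ?exprn_gt0//.
    have -> : (1 + y) * (1 - y / 2 + y ^+ 2) ^+ 2 =
        1 + (5 / 4 * y ^+ 2 + 5 / 4 * y ^+ 3 + y ^+ 5) by field.
    have yn n : 0 <= y ^+ n by exact: exprn_ge0.
    by rewrite lerDl; apply: addr_ge0; [apply: addr_ge0; apply: mulr_ge0|].
  have lo : expR (- (y / 2)) <= (Num.sqrt (1 + y))^-1.
    rewrite expRN lef_pV2 ?posrE ?expR_gt0//.
    rewrite -(@ler_pXn2r _ 2) ?nnegrE ?expR_ge0 ?(ltW r0)// r2 -expRM_natl.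
    by rewrite (_ : 2%:R * (y / 2) = y) ?expR_ge1Dx//; field.
  have := expR_ge1Dx (- (y / 2)).
  by rewrite ler_norml; move: up lo; move: (expR _) (_^-1) (y ^+ 2) => a b c; lra.
have -> : th ^+ 4 * s ^+ 4 = y ^+ 2 by rewrite /y; ring.
have {}D1 : `|Ex (fun w => cos (th * X w)) - (Num.sqrt (1 + y))^-1| <= 128 * y ^+ 2.
  by move: D1; rewrite (_ : th ^+ 4 * s ^+ 4 = y ^+ 2)//; rewrite /y; ring.
by move: D1 D2; rewrite !ler_norml; move: (expR _) (_^-1) (y ^+ 2) (Submission.Ex _ _) => a b c e; lra.
Qed.

End gaussian.

Section layers.
Context (R : realType).

Lemma le0_of_le_inv (x C : R) : (forall k : nat, x <= C / k.+1%:R) -> x <= 0.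
Proof.
move=> h; rewrite leNgt; apply/negP => x0.
have C0 : 0 <= C by have := h 0%N; rewrite divr1; apply: le_trans; exact: ltW.
have y0 : 0 <= C / x by rewrite divr_ge0// ltW.
have /andP[_] := truncn_itv y0; rewrite ltr_pdivrMr// mulrC -ltr_pdivrMr ?ltr0n//.
by rewrite ltNge h.
Qed.

(** A layer decomposition: a function with values in [[0, 1]] is within [1 / (k + 1)] of an average
    of indicators of its level sets. *)
Lemma unit_layers (k : nat) (y : R) : 0 <= y <= 1 ->
  `|y - k.+1%:R^-1 * \sum_(a < k.+1) (a.+1%:R / k.+1%:R <= y)%R%:R| <= k.+1%:R^-1.
Proof.
move=> /andP[y0 y1]; have k0 : (0 : R) < k.+1%:R by rewrite ltr0n.
have z0 : 0 <= y * k.+1%:R by rewrite mulr_ge0.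
have /andP[n1 n2] := truncn_itv z0; set n := Num.truncn _ in n1 n2.
have nk : (n <= k.+1)%N.
  by rewrite -(ler_nat R) (le_trans n1)// -[leRHS]mul1r ler_wpM2r.
have S m : \sum_(a < m) ((a < n)%N)%:R = (minn m n)%:R :> R.
  elim: m => [|m IH]; first by rewrite big_ord0 min0n.
  rewrite big_ord_recr/= IH -natrD; congr (_%:R).
  case: (ltnP m n) => mn /=.
    by rewrite (minn_idPl mn) addn1.
  by rewrite (minn_idPr (leqW mn)) addn0.
have -> : \sum_(a < k.+1) (a.+1%:R / k.+1%:R <= y)%R%:R = n%:R :> R.
  rewrite -[in RHS](minn_idPr nk) -S; apply: eq_bigr => a _; congr ((nat_of_bool _)%:R).
  rewrite ler_pdivrMr//; apply/idP/idP => h.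
    by rewrite -ltnS -(ltr_nat R) (le_lt_trans h).
  by rewrite (le_trans _ n1)// ler_nat.
rewrite -(ler_pM2r k0) mulVf ?gt_eqF// -[X in _ * X](gtr0_norm k0) -normrM mulrBl.
rewrite mulrAC mulVf ?gt_eqF// mul1r ler_norml.
by move: n1 n2; rewrite -natr1; move: (y * _) => z; lra.
Qed.

End layers.

(** * Means of products and of cosines of independent variables *)

Section independence.
Context (R : realType) d0 (Omega : measurableType d0) (P : probability Omega R).
Local Notation Ex := (Ex P).
Local Notation Li := (Li P).

Lemma measurable_prod_cond (I : Type) (s : seq I) (p : pred I) (F : I -> Omega -> R) :
  (forall i, measurable_fun setT (F i)) ->
  measurable_fun setT (fun w => \prod_(i <- s | p i) F i w).
Proof.
move=> mF; elim: s => [|i s IH].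
  by under eq_fun do rewrite big_nil; exact: measurable_cst.
under eq_fun do rewrite big_cons.
by case: (p i) => //; exact: measurable_funM.
Qed.

(** Product rules pass from indicators to averages of level sets by linearity, with an error at most
    [(1 + |c|) / (k + 1)]. A function bounded by 1 is first mapped into [[0, 1]] by
    [(1 + f) / 2]. *)
Lemma indep_extend (X H : Omega -> R) (c : R) (f : R -> R) :
  measurable_fun setT X -> measurable_fun setT H -> (forall w, `|H w| <= 1) ->
  (forall B, measurable B -> Ex (fun w => \1_B (X w) * H w) = Ex (fun w => \1_B (X w)) * c) ->
  measurable_fun setT f -> (forall y, `|f y| <= 1) ->
  Ex (fun w => f (X w) * H w) = Ex (fun w => f (X w)) * c.
Proof.
move=> mX mH H1 hB.
have LH : Li H by apply: (@Li_bounded _ _ _ _ _ 1).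
have Lb (g : R -> R) : measurable_fun setT g -> (forall y, `|g y| <= 1) ->
    Li (fun w => g (X w)) /\ Li (fun w => g (X w) * H w).
  move=> mg g1; have mgX : measurable_fun setT (fun w => g (X w)) by exact: measurableT_comp.
  split; first by apply: (@Li_bounded _ _ _ _ _ 1).
  apply: (@Li_bounded _ _ _ _ _ 1); first exact: measurable_funM.
  by move=> w; rewrite normrM mulr_ile1.
have unit (g : R -> R) : measurable_fun setT g -> (forall y, 0 <= g y <= 1) ->
    Ex (fun w => g (X w) * H w) = Ex (fun w => g (X w)) * c.
  move=> mg g01.
  have g1 y : `|g y| <= 1 by have /andP[? ?] := g01 y; rewrite ger0_norm.
  have [Lg LgH] := Lb g mg g1.
  apply/eqP; rewrite -subr_eq0 -normr_le0; apply: (@le0_of_le_inv _ _ (1 + `|c|)) => k.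
  have k0 : (0 : R) < k.+1%:R^-1 by rewrite invr_gt0 ltr0n.
  pose B (a : 'I_k.+1) := [set y | a.+1%:R / k.+1%:R <= g y].
  have mB a : measurable (B a).
    rewrite /B -[X in measurable X]setTI.
    have := mg measurableT [set` `[a.+1%:R / k.+1%:R, +oo[] (measurable_itv _).
    by congr measurable; apply/seteqP; split => y /=; rewrite in_itv/= andbT.
  have mi a : measurable_fun setT (fun y : R => \1_(B a) y : R) by exact: measurable_indic.
  have i1 a y : `|\1_(B a) y : R| <= 1 by rewrite indicE; case: (_ \in _); rewrite normr_nat.
  pose gk (y : R) : R := k.+1%:R^-1 * \sum_(a < k.+1) \1_(B a) y.
  have gkE y : gk y = k.+1%:R^-1 * \sum_(a < k.+1) (a.+1%:R / k.+1%:R <= g y)%R%:R.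
    by congr (_ * _); apply: eq_bigr => a _; apply: indic_iff.
  have dist y : `|g y - gk y| <= k.+1%:R^-1 by rewrite gkE unit_layers.
  have Lk : Li (fun w => gk (X w)).
    by apply: LiZ; apply: Li_sum => a _; have [] := Lb _ (mi a) (i1 a).
  have LkH : Li (fun w => gk (X w) * H w).
    rewrite /gk; under eq_fun do rewrite -mulrA mulr_suml.
    by apply: LiZ; apply: Li_sum => a _; have [] := Lb _ (mi a) (i1 a).
  have E : Ex (fun w => gk (X w) * H w) = Ex (fun w => gk (X w)) * c.
    rewrite (_ : (fun w => _) = (fun w => k.+1%:R^-1 *
        \sum_(a <- enum 'I_k.+1) \1_(B a) (X w) * H w)); last first.
      by apply/funext => w; rewrite big_enum/= /gk -mulrA mulr_suml.
    rewrite ExZ; last by apply: Li_sum => a _; have [] := Lb _ (mi a) (i1 a).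
    rewrite Ex_sum => [|a]; last by have [] := Lb _ (mi a) (i1 a).
    rewrite [X in _ = X * c](_ : _ = Ex (fun w => k.+1%:R^-1 *
        \sum_(a <- enum 'I_k.+1) \1_(B a) (X w))); last first.
      by congr (Submission.Ex _ _); apply/funext => w; rewrite big_enum.
    rewrite ExZ; last by apply: Li_sum => a _; have [] := Lb _ (mi a) (i1 a).
    rewrite Ex_sum => [|a]; last by have [] := Lb _ (mi a) (i1 a).
    by rewrite -mulrA mulr_suml; congr (_ * _); apply: eq_bigr => a _; exact: hB.
  have -> : Ex (fun w => g (X w) * H w) - Ex (fun w => g (X w)) * c =
      (Ex (fun w => g (X w) * H w) - Ex (fun w => gk (X w) * H w)) -
      (Ex (fun w => g (X w)) - Ex (fun w => gk (X w))) * c by rewrite E; ring.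
  rewrite -(ExB LgH LkH) -(ExB Lg Lk) mulrDl mul1r.
  apply: le_trans (ler_normB _ _) _; apply: lerD.
    apply: le_trans (Ex_abs (LiB LgH LkH)) _; rewrite -[leRHS](Ex_cst P).
    apply: Ex_le; [exact/Li_norm/LiB|exact: Li_cst|move=> w].
    by rewrite -mulrBl normrM -[leRHS]mulr1 ler_pM.
  rewrite normrM mulrC ler_wpM2l//.
  apply: le_trans (Ex_abs (LiB Lg Lk)) _; rewrite -[leRHS](Ex_cst P).
  by apply: Ex_le; [exact/Li_norm/LiB|exact: Li_cst|move=> w].
have EH : Ex H = c.
  have := hB setT measurableT.
  rewrite (_ : (fun w => \1_setT (X w) * H w) = H); last first.
    by apply/funext => w; rewrite indicT mul1r.
  rewrite (_ : (fun w => \1_setT (X w)) = fun=> 1); last by apply/funext => w; rewrite indicT.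
  by rewrite Ex_cst mul1r.
move=> mf f1; pose g (y : R) := 2^-1 * (1 + f y).
have mg : measurable_fun setT g by apply: measurable_funM => //; exact: measurable_funD.
have g01 y : 0 <= g y <= 1.
  by have := f1 y; rewrite ler_norml /g => /andP[? ?]; apply/andP; split; lra.
have := unit g mg g01; have [Lf LfH] := Lb f mf f1.
have -> : (fun w => g (X w) * H w) = (fun w => 2^-1 * (H w + f (X w) * H w)).
  by apply/funext => w; rewrite /g; ring.
rewrite ExZ; last exact: LiD.
rewrite ExD// ExZ; last by apply: LiD => //; exact: Li_cst.
rewrite (ExD (Li_cst P 1) Lf) Ex_cst EH.
by move: (Submission.Ex _ _) (Submission.Ex _ _) => u v h; apply/eqP; move/eqP: h; rewrite -!mulrA; move=> /eqP h; apply/eqP; lra.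
Qed.

Context (I : finType) (X : I -> Omega -> R).
Hypothesis mX : forall i, measurable_fun setT (X i).
Hypothesis indep : mutually_independent P X.

Lemma indep_Ex (f : I -> R -> R) : (forall i, measurable_fun setT (f i)) ->
  (forall i y, `|f i y| <= 1) ->
  Ex (fun w => \prod_i f i (X i w)) = \prod_i Ex (fun w => f i (X i w)).
Proof.
(* Indices outside [s] still carry indicators; the induction frees one index at a time, and the base
   case is independence itself. *)
have H (s : seq I) : forall f : I -> R -> R, (forall i, measurable_fun setT (f i)) ->
    (forall i y, `|f i y| <= 1) ->
    (forall i, i \notin s -> exists2 B, measurable B & f i = \1_B) ->
    Ex (fun w => \prod_i f i (X i w)) = \prod_i Ex (fun w => f i (X i w)).
  elim: s => [|i s IH] {}f mf f1 fs.
    have /choice[B hB] i : exists B, measurable B /\ f i = \1_B.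
      by have [B mB fB] := fs i isT; exists B.
    have mB i := (hB i).1.
    have mXB i : measurable (X i @^-1` B i).
      by rewrite -[X in measurable X]setTI; exact: mX.
    have -> : (fun w => \prod_i f i (X i w)) = \1_(\bigcap_i (X i @^-1` B i)).
      apply/funext => w; have [h|h] := pselect ((\bigcap_i (X i @^-1` B i)) w).
        rewrite indicE mem_set// big1// => i _.
        by rewrite (hB i).2 indicE mem_set//; exact: h.
      rewrite indicE memNset//.
      have /existsNP[i /not_implyP[_ hi]] : ~ (forall i, setT i -> (X i @^-1` B i) w) by [].
      by rewrite (bigD1 i)//= (hB i).2 indicE memNset// mul0r.
    rewrite Ex_indic; last by apply: fin_bigcap_measurable => //; exact: finite_finset.
    rewrite indep//; transitivity (fine (\prod_i (fine (P (X i @^-1` B i)))%:E)%E).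
      by congr fine; apply: eq_bigr => i _; rewrite fineK// fin_num_measure.
    rewrite -(@big_morph _ _ EFin 1%E *%E 1 *%R EFinM erefl)/=.
    apply: eq_bigr => i _; rewrite -Ex_indic//; congr (Submission.Ex _ _).
    by apply/funext => w; rewrite (hB i).2.
  have mg j : measurable_fun setT (fun w => f j (X j w)) by exact: measurableT_comp.
  pose h w := \prod_(j | j != i) f j (X j w).
  have -> : (fun w => \prod_j f j (X j w)) = (fun w => f i (X i w) * h w).
    by apply/funext => w; rewrite (bigD1 i).
  rewrite [RHS](bigD1 i)//=; apply: indep_extend => //.
  - by apply: measurable_prod_cond => j.
  - move=> w; rewrite /h; elim/big_ind: _ => //; first by rewrite normr1.
    by move=> x y x1 y1; rewrite normrM mulr_ile1.
  move=> B mB; pose f' j := if j == i then \1_B else f j : R -> R.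
  have mf' j : measurable_fun setT (f' j).
    by rewrite /f'; case: ifP => // _; exact: measurable_indic.
  have f'1 j y : `|f' j y| <= 1.
    by rewrite /f'; case: ifP => // _; rewrite indicE; case: (_ \in _); rewrite normr_nat.
  have f's j : j \notin s -> exists2 B, measurable B & f' j = \1_B.
    move=> js; rewrite /f'; case: eqP => [_|/eqP ji]; first by exists B.
    by apply: fs; rewrite inE negb_or ji.
  have f'i : f' i = \1_B by rewrite /f' eqxx.
  have f'j j : j != i -> f' j = f j by rewrite /f' => /negbTE ->.
  have := IH f' mf' f'1 f's; rewrite [RHS](bigD1 i)//= f'i.
  have -> : \prod_(j | j != i) Ex (fun w => f' j (X j w)) =
      \prod_(j | j != i) Ex (fun w => f j (X j w)).
    by apply: eq_bigr => j /f'j ->.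
  move=> <-; congr (Submission.Ex _ _); apply/funext => w; rewrite (bigD1 i)//= f'i; congr (_ * _).
  by apply: eq_bigr => j /f'j ->.
by move=> mf f1; apply: (H (enum I)) => // i; rewrite mem_enum.
Qed.

Hypothesis sin0 : forall i (th : R), Ex (fun w => sin (th * X i w)) = 0.

(** In the expansion of the cosine of a sum, every term with a sine factor has mean zero by
    [sin0]. *)
Lemma indep_cos (th : I -> R) c :
  Ex (fun w => cos (c + \sum_i th i * X i w)) = cos c * \prod_i Ex (fun w => cos (th i * X i w)).
Proof.
pose cs (t y : R) := cos (t * y); pose sn (t y : R) := sin (t * y).
have mcs t : measurable_fun setT (cs t).
  apply: measurableT_comp; first by apply: continuous_measurable_fun; exact: continuous_cos.
  exact: measurable_funM.
have msn t : measurable_fun setT (sn t).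
  apply: measurableT_comp; first by apply: continuous_measurable_fun; exact: continuous_sin.
  exact: measurable_funM.
(* Indices leave [s] with a cosine or a sine as test function. The remaining sine is rewritten as a
   cosine with phase [c - pi / 2], which fits the induction hypothesis. *)
have H (s : seq I) : uniq s -> forall (f : I -> R -> R) c, (forall i, measurable_fun setT (f i)) ->
    (forall i y, `|f i y| <= 1) ->
    Ex (fun w => \prod_(i | i \notin s) f i (X i w) * cos (c + \sum_(i <- s) th i * X i w)) =
    \prod_(i | i \notin s) Ex (fun w => f i (X i w)) *
    (cos c * \prod_(i <- s) Ex (fun w => cos (th i * X i w))).
  elim: s => [_|i s IH /= /andP[nis us]] f {}c mf f1.
    rewrite big_nil mulr1 mulrC -indep_Ex//.
    have L : Li (fun w => \prod_i f i (X i w)).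
      apply: (@Li_bounded _ _ _ _ _ 1).
        by apply: measurable_prod_cond => i; exact: measurableT_comp.
      move=> w; elim/big_ind: _ => //; first by rewrite normr1.
      by move=> x y x1 y1; rewrite normrM mulr_ile1.
    rewrite -ExZ//; congr (Submission.Ex _ _); apply/funext => w.
    by rewrite big_nil addr0 mulrC.
  pose fc j := if j == i then cs (th i) else f j.
  pose fs j := if j == i then sn (th i) else f j.
  have mfc j : measurable_fun setT (fc j) by rewrite /fc; case: ifP.
  have mfs j : measurable_fun setT (fs j) by rewrite /fs; case: ifP.
  have fc1 j y : `|fc j y| <= 1.
    by rewrite /fc; case: ifP => // _; rewrite ler_norml cos_geN1 cos_le1.
  have fs1 j y : `|fs j y| <= 1.
    by rewrite /fs; case: ifP => // _; rewrite ler_norml sin_geN1 sin_le1.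
  have E1 w : \prod_(j | j \notin s) fc j (X j w) =
      cos (th i * X i w) * \prod_(j | j \notin i :: s) f j (X j w).
    rewrite (bigD1 i)//= {1}/fc eqxx; congr (_ * _); apply: eq_big => [j|j /andP[_ /negbTE]].
      by rewrite inE negb_or andbC.
    by rewrite /fc => ->.
  have E2 w : \prod_(j | j \notin s) fs j (X j w) =
      sin (th i * X i w) * \prod_(j | j \notin i :: s) f j (X j w).
    rewrite (bigD1 i)//= {1}/fs eqxx; congr (_ * _); apply: eq_big => [j|j /andP[_ /negbTE]].
      by rewrite inE negb_or andbC.
    by rewrite /fs => ->.
  have Lg (g : I -> R -> R) b : (forall j, measurable_fun setT (g j)) -> (forall j y, `|g j y| <= 1) ->
      Li (fun w => \prod_(j | j \notin s) g j (X j w) * cos (b + \sum_(j <- s) th j * X j w)).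
    move=> mg g1; apply: (@Li_bounded _ _ _ _ _ 1).
      apply: measurable_funM.
        by apply: measurable_prod_cond => j; exact: measurableT_comp.
      apply: measurableT_comp; first by apply: continuous_measurable_fun; exact: continuous_cos.
      apply: measurable_funD => //; apply: measurable_sum => j.
      by apply: measurable_funM => //; exact: mX.
    move=> w; rewrite normrM mulr_ile1// ?ler_norml ?cos_geN1 ?cos_le1//.
    rewrite -ler_norml; elim/big_ind: _ => //; first by rewrite normr1.
    by move=> x y x1 y1; rewrite normrM mulr_ile1.
  have -> : (fun w => \prod_(j | j \notin i :: s) f j (X j w) *
      cos (c + \sum_(j <- i :: s) th j * X j w)) = (fun w =>
      \prod_(j | j \notin s) fc j (X j w) * cos (c + \sum_(j <- s) th j * X j w) -
      \prod_(j | j \notin s) fs j (X j w) * cos (c - pi / 2 + \sum_(j <- s) th j * X j w)).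
    apply/funext => w; rewrite E1 E2 big_cons.
    have -> : cos (c - pi / 2 + \sum_(j <- s) th j * X j w) = sin (c + \sum_(j <- s) th j * X j w).
      by rewrite addrAC cosB cos_pihalf sin_pihalf mulr0 mulr1 add0r.
    move: (\sum_(j <- s) _) (\prod_(j | _) _) => v p.
    have -> : c + (th i * X i w + v) = th i * X i w + (c + v) by ring.
    by move: (c + v) (th i * X i w) => y u; rewrite cosD; ring.
  rewrite (ExB (Lg _ _ mfc fc1) (Lg _ _ mfs fs1)) IH// IH//.
  have -> : \prod_(j | j \notin s) Ex (fun w => fs j (X j w)) = 0.
    by rewrite (bigD1 i)//= /fs eqxx sin0 mul0r.
  rewrite mul0r subr0 big_cons (bigD1 i)//= {1}/fc eqxx.
  have -> : \prod_(j | (j \notin s) && (j != i)) Ex (fun w => fc j (X j w)) =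
      \prod_(j | j \notin i :: s) Ex (fun w => f j (X j w)).
    apply: eq_big => [j|j /andP[_ /negbTE]]; first by rewrite inE negb_or andbC.
    by rewrite /fc => ->.
  by rewrite /cs; ring.
have := H (enum I) (enum_uniq I) (fun=> cst 1) c.
rewrite big1 ?mul1r; last by move=> i; rewrite mem_enum.
rewrite big_enum/= => <-; last 2 first.
- by move=> i; exact: measurable_cst.
- by move=> i y; rewrite normr1.
congr (Submission.Ex _ _); apply/funext => w; rewrite [X in _ = X * _]big1 ?mul1r ?big_enum//.
Qed.

End independence.

Section brownian.
Context (R : realType) (disp : measure_display) (Omega : measurableType disp).
Context (P : probability Omega R) (d : nat) (W : R -> Omega -> 'cV[R]_d).
Hypothesis hW : standard_brownian P W.
Local Notation Ex := (Ex P).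
Local Notation Li := (Li P).

Definition bm_inc i s t w : R := W t w i 0 - W s w i 0.

Lemma measurable_bm_inc i s t : 0 <= s -> s <= t -> t <= 1 ->
  measurable_fun setT (bm_inc i s t).
Proof.
have [mW _ _ _ _] := hW; move=> s0 st t1.
by apply: measurable_funB; apply: mW; rewrite in_itv/= ?s0 ?t1 ?(le_trans s0)// (le_trans st).
Qed.

Let sd (s t : R) : 0 <= s -> s < t -> t <= 1 -> 0 < Num.sqrt (t - s) /\ Num.sqrt (t - s) ^+ 2 = t - s.
Proof.
move=> s0 st t1; split; first by rewrite sqrtr_gt0 subr_gt0.
by rewrite sqr_sqrtr// subr_ge0 ltW.
Qed.

Lemma bm_sin i s t th : 0 <= s -> s < t -> t <= 1 ->
  Ex (fun w => sin (th * bm_inc i s t w)) = 0.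
Proof.
move=> s0 st t1; have [_ _ _ law _] := hW; have [sd0 _] := sd s0 st t1.
exact: (gauss_sin (measurable_bm_inc i s0 (ltW st) t1) sd0 (law i s t s0 st t1)).
Qed.

Lemma bm_moment2 i s t : 0 <= s -> s < t -> t <= 1 ->
  Li (fun w => bm_inc i s t w ^+ 2) /\ Ex (fun w => bm_inc i s t w ^+ 2) <= 8 * (t - s).
Proof.
move=> s0 st t1; have [_ _ _ law _] := hW; have [sd0 <-] := sd s0 st t1.
exact: (gauss_moment2 (measurable_bm_inc i s0 (ltW st) t1) sd0 (law i s t s0 st t1)).
Qed.

Let times01 (m : nat) (t : nat -> R) : 0 <= t 0%N ->
  (forall k, (k < m)%N -> t k < t k.+1) -> t m <= 1 ->
  (forall k, (k <= m)%N -> 0 <= t k) /\ (forall k, (k <= m)%N -> t k <= 1).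
Proof.
move=> t0 tn tm; split=> k.
  elim: k => // k IH km; apply: le_trans (ltW (tn k km)); apply: IH; exact: ltnW.
move=> km; rewrite -(subKn km); elim: (m - k)%N (leq_subr k m) => [|j IH] jm.
  by rewrite subn0.
apply: le_trans (IH (ltnW jm)); have -> : (m - j = (m - j.+1).+1)%N by rewrite subnSK.
by apply: ltW; apply: tn; rewrite -subSn// subSS leq_subr.
Qed.

Lemma bm_cos_prod (m : nat) (t : nat -> R) (th : 'I_m * 'I_d -> R) c :
  0 <= t 0%N -> (forall k, (k < m)%N -> t k < t k.+1) -> t m <= 1 ->
  Ex (fun w => cos (c + \sum_p th p * bm_inc p.2 (t p.1) (t p.1.+1) w)) =
  cos c * \prod_p Ex (fun w => cos (th p * bm_inc p.2 (t p.1) (t p.1.+1) w)).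
Proof.
move=> t0 tn tm; have [_ _ _ _ ind] := hW.
have [tge tle] := times01 t0 tn tm.
apply: indep_cos.
- move=> p; apply: measurable_bm_inc; first by apply: tge; exact: ltnW.
    by apply: ltW; exact: tn.
  exact: tle.
- by apply: ind => // k km; exact: ltW (tn k km).
- move=> p u; apply: bm_sin; [by apply: tge; exact: ltnW|exact: tn|exact: tle].
Qed.

(* The increment is a sum of [n] independent ones, each with cosine mean
   [exp (- th ^ 2 (t - s) / 2 n) + O(n ^ -2)]. *)
Lemma bm_cos i s t th : 0 <= s -> s < t -> t <= 1 ->
  Ex (fun w => cos (th * bm_inc i s t w)) = expR (- (th ^+ 2 * (t - s) / 2)).
Proof.
move=> s0 st t1; apply/eqP; rewrite -subr_eq0 -normr_le0.
apply: (@le0_of_le_inv _ _ (129 * th ^+ 4 * (t - s) ^+ 2)) => n.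
have n0 : (0 : R) < n.+1%:R by rewrite ltr0n.
pose gr := grid s t n.
have step k : gr k.+1 - gr k = (t - s) / n.+1%:R by exact: grid_step.
have dpos : 0 < (t - s) / n.+1%:R by rewrite divr_gt0// subr_gt0.
have grs k : gr k < gr k.+1 by rewrite -subr_gt0 step.
have gr0 k : 0 <= gr k by apply: le_trans s0 _; apply: grid_ge; exact: ltW.
have gr1 k : (k <= n.+1)%N -> gr k <= 1.
  by move=> kn; apply: le_trans t1; apply: grid_le_end => //; exact: ltW.
pose ph k := Ex (fun w => cos (th * bm_inc i (gr k) (gr k.+1) w)).
pose thp (p : 'I_n.+1 * 'I_d) := th * (p.2 == i)%:R.
have -> : Ex (fun w => cos (th * bm_inc i s t w)) = \prod_(k < n.+1) ph k.
  have := @bm_cos_prod n.+1 gr thp 0 (gr0 0%N) (fun k _ => grs k) (gr1 n.+1 (leqnn _)).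
  rewrite cos0 mul1r.
  have -> : (fun w => cos (0 + \sum_p thp p * bm_inc p.2 (gr p.1) (gr p.1.+1) w)) =
      (fun w => cos (th * bm_inc i s t w)).
    apply/funext => w; congr cos; rewrite add0r.
    rewrite -(pair_big xpredT xpredT
      (fun k j => thp (k, j) * bm_inc j (gr k) (gr k.+1) w))/=.
    rewrite /bm_inc -[W t w i 0 - _](sum_grid s t (fun u => W u w i 0) n) mulr_sumr.
    apply: eq_bigr => k _; rewrite (bigD1 i)//= /thp/= eqxx mulr1 big1 ?addr0// => j ji.
    by rewrite (negbTE ji) mulr0 mul0r.
  move=> ->; rewrite -(pair_big xpredT xpredT
    (fun k j => Ex (fun w => cos (thp (k, j) * bm_inc j (gr k) (gr k.+1) w))))/=.
  apply: eq_bigr => k _; rewrite (bigD1 i)//= big1 ?mulr1 => [|j ji].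
    by rewrite /thp/= eqxx mulr1.
  rewrite /thp/= (negbTE ji) mulr0.
  by under [X in Submission.Ex _ X]funext do rewrite mul0r cos0; rewrite Ex_cst.
pose rho := expR (- (th ^+ 2 * ((t - s) / n.+1%:R) / 2)).
pose dl := 129 * (th ^+ 4 * ((t - s) / n.+1%:R) ^+ 2).
have phle k : (k <= n)%N -> `|ph k - rho| <= dl.
  move=> kn; have [_ _ _ law _] := hW.
  have [sd0 sd2] := sd (gr0 k) (grs k) (gr1 k.+1 kn).
  have := gauss_cos_le (measurable_bm_inc i (gr0 k) (ltW (grs k)) (gr1 k.+1 kn)) sd0
    (law i _ _ (gr0 k) (grs k) (gr1 k.+1 kn)) th.
  by rewrite (exprM (Num.sqrt _) 2 2) sd2 step.
have ph1 k : (k <= n)%N -> `|ph k| <= 1.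
  move=> kn; have mi := measurable_bm_inc i (gr0 k) (ltW (grs k)) (gr1 k.+1 kn).
  exact: (Ex_cos_le1 P (measurable_funM (@measurable_cst _ _ _ _ _ th) mi)).
have := @iterated_contraction _ (fun k => \prod_(j < k) ph j) rho rho dl 0 n.+1.
rewrite big_ord0 mulr1.
have -> : rho ^+ n.+1 = expR (- (th ^+ 2 * (t - s) / 2)).
  by rewrite /rho -expRM_natl; congr expR; field; rewrite gt_eqF.
have -> : n.+1%:R * (dl + 0) = 129 * th ^+ 4 * (t - s) ^+ 2 / n.+1%:R.
  by rewrite /dl; field; rewrite gt_eqF.
have pr1 k : (k <= n.+1)%N -> `|\prod_(j < k) ph j| <= 1.
  elim: k => [|k IH] kn; first by rewrite big_ord0 normr1.
  by rewrite big_ord_recr/= normrM mulr_ile1// ?IH ?ph1// ltnW.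
apply => //.
- by rewrite expR_ge0 expR_le1 oppr_le0 divr_ge0// mulr_ge0 ?sqr_ge0// ltW.
- by rewrite subrr normr0.
move=> k kn; rewrite big_ord_recr/= mulrC -mulrBl normrM.
by rewrite (le_trans _ (phle k kn))// ler_piMr// pr1// ltnW.
Qed.

Lemma bm_fdd (m : nat) (t : nat -> R) (th : 'I_m * 'I_d -> R) c :
  0 <= t 0%N -> (forall k, (k < m)%N -> t k < t k.+1) -> t m <= 1 ->
  Ex (fun w => cos (c + \sum_p th p * bm_inc p.2 (t p.1) (t p.1.+1) w)) =
  cos c * expR (- \sum_p (th p ^+ 2 * (t p.1.+1 - t p.1) / 2)).
Proof.
move=> t0 tn tm; rewrite bm_cos_prod//; congr (_ * _).
have [tge tle] := times01 t0 tn tm.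
rewrite -sumrN expR_sum; apply: eq_bigr => p _.
by apply: bm_cos; [apply: tge; exact: ltnW|exact: tn|exact: tle].
Qed.

End brownian.

(** * Functionals on the Skorokhod space *)

Section lower_integral.
Context d0 (Omega : measurableType d0) (R : realType) (P : probability Omega R).
Local Notation Ex := (Ex P).
Local Notation Li := (Li P).
Implicit Types (g h : Omega -> R) (M : R).

Import HBNNSimple.

(* For a nonnegative function [Ex] is a lower integral, monotone and
   superadditive without any measurability. *)
Lemma le_integral_any g h : (forall w, 0 <= g w) -> (forall w, g w <= h w) ->
  (\int[P]_w (g w)%:E <= \int[P]_w (h w)%:E)%E.
Proof.
move=> g0 gh; rewrite ge0_integralE; last by move=> w _; rewrite lee_fin.
rewrite ge0_integralE; last by move=> w _; rewrite lee_fin (le_trans (g0 w)).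
rewrite !patch_setT; apply: le_ereal_sup => _ [u /= ug <-]; exists u => //= w.
by apply: le_trans (ug w) _; rewrite lee_fin.
Qed.

Lemma integral_any_fin g M : (forall w, 0 <= g w <= M) ->
  (\int[P]_w (g w)%:E)%E = (Ex g)%:E.
Proof.
move=> gM; rewrite /Submission.Ex /Rintegral fineK// fin_numElt; apply/andP; split.
  apply: (@lt_le_trans _ _ 0%E); first exact: ltNyr.
  by apply: integral_ge0 => w _; rewrite lee_fin; have /andP[] := gM w.
have /integrableP[_] := Li_cst P M; apply: le_lt_trans.
apply: (@le_integral_any g (fun=> `|M|)) => w; have /andP[h1 h2] := gM w => //.
by rewrite (le_trans h2)// ler_norm.
Qed.

Lemma Ex_le_any g h M : (forall w, 0 <= g w) -> (forall w, g w <= h w) ->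
  (forall w, h w <= M) -> Ex g <= Ex h.
Proof.
move=> g0 gh hM; rewrite -lee_fin -(@integral_any_fin g M); last first.
  by move=> w; rewrite g0 (le_trans (gh w)).
rewrite -(@integral_any_fin h M); last by move=> w; rewrite hM (le_trans (g0 w)).
exact: le_integral_any.
Qed.

(** Superadditivity: simple functions below [g] and below [M - g] have a sum below [M]. This
    converts a lower bound for the complement into an upper bound for [g]. *)
Lemma Ex_add_compl g M : (forall w, 0 <= g w <= M) -> Ex g + Ex (fun w => M - g w) <= M.
Proof.
move=> gM; have g'M w : 0 <= M - g w <= M.
  by have /andP[? ?] := gM w; rewrite subr_ge0 gerBl; apply/andP.
have sfE (u : {nnsfun Omega >-> R}) : (forall w, u w <= M) ->
    sintegral P u = (Ex u)%:E /\ Li u.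
  move=> uM; have Lu : Li u.
    by apply: (@Li_bounded _ _ _ _ _ M) => // w; rewrite ger0_norm.
  split => //; rewrite -integralT_nnsfun; apply: (@integral_any_fin _ M) => w.
  by rewrite uM andbT.
have key (u v : {nnsfun Omega >-> R}) : (forall w, u w <= g w) ->
    (forall w, v w <= M - g w) -> Ex u + Ex v <= M.
  move=> ug vg.
  have [_ Lu] := sfE u (fun w => le_trans (ug w) (andP (gM w)).2).
  have [_ Lv] := sfE v (fun w => le_trans (vg w) (andP (g'M w)).2).
  rewrite -(ExD Lu Lv) -[leRHS](Ex_cst P); apply: Ex_le; [exact: LiD|exact: Li_cst|].
  by move=> w; have := ug w; have := vg w; move: (u w) (v w) (g w) => a b c; lra.
rewrite -lerBrDr -lee_fin -(integral_any_fin gM) ge0_integralE; last first.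
  by move=> w _; rewrite lee_fin; have /andP[] := gM w.
rewrite patch_setT; apply: ub_ereal_sup => _ [u /= ug <-].
have {}ug w : u w <= g w by rewrite -lee_fin; exact: ug.
have [-> _] := sfE u (fun w => le_trans (ug w) (andP (gM w)).2).
rewrite lee_fin lerBrDr addrC -lerBrDr -lee_fin -(integral_any_fin g'M).
rewrite ge0_integralE; last first.
  by move=> w _; rewrite lee_fin; have /andP[] := g'M w.
rewrite patch_setT; apply: ub_ereal_sup => _ [v /= vg <-].
have {}vg w : v w <= M - g w by rewrite -lee_fin; exact: vg.
have [-> _] := sfE v (fun w => le_trans (vg w) (andP (g'M w)).2).
by rewrite lee_fin lerBrDr addrC; exact: key.
Qed.

Lemma Ex_ge_ae g h M : (forall w, 0 <= g w <= M) -> measurable_fun setT h ->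
  (forall w, h w <= M) -> {ae P, forall w, h w <= g w} ->
  Ex (fun w => Num.max (h w) 0) <= Ex g.
Proof.
move=> gM mh hM [N [mN PN hN]].
pose k (w : Omega) := Num.max (h w) 0 * \1_(~` N) w.
have mm : measurable_fun setT (fun w => Num.max (h w) 0) by exact: measurable_maxr.
have mk : measurable_fun setT k.
  by apply: measurable_funM => //; apply: measurable_indic; exact: measurableC.
have -> : Ex (fun w => Num.max (h w) 0) = Ex k.
  apply: Ex_ae_eq => //; exists N; split => // w /= nk; apply: contrapT => nNw; apply: nk.
  by rewrite /k indicE mem_set// mulr1.
apply: (@Ex_le_any _ _ M).
- by move=> w; rewrite /k mulr_ge0// le_max lexx orbT.
- move=> w; rewrite /k indicE; have [/set_mem nNw|_] := boolP (_ \in _); last first.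
    by rewrite mulr0; have /andP[] := gM w.
  rewrite mulr1 ge_max; apply/andP; split; last by have /andP[] := gM w.
  by apply: contrapT => nle; apply: nNw; apply: hN => /= le; apply: nle.
- by move=> w; have /andP[] := gM w.
Qed.

(** The inequalities of [Ex_ge_ae] for [g] and for [M - g] are tight against [Ex_add_compl], so a
    function equal almost surely to a measurable one has the expected integral. *)
Lemma Ex_ae_any g h M : (forall w, 0 <= g w <= M) -> measurable_fun setT h ->
  (forall w, 0 <= h w <= M) -> {ae P, forall w, g w = h w} -> Ex g = Ex h.
Proof.
move=> gM mh hM gh.
have Lh : Li h.
  apply: (@Li_bounded _ _ _ _ _ M) => // w.
  by have /andP[? ?] := hM w; rewrite ger0_norm.
have E1 : Ex h <= Ex g.
  have -> : Ex h = Ex (fun w => Num.max (h w) 0).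
    by congr (Submission.Ex _ _); apply/funext => w; rewrite max_l//; have /andP[] := hM w.
  apply: (Ex_ge_ae gM) => //; first by move=> w; have /andP[] := hM w.
  by apply: filterS gh => w ->.
have g'M w : 0 <= M - g w <= M.
  by have /andP[? ?] := gM w; rewrite subr_ge0 gerBl; apply/andP.
have E2 : M - Ex h <= Ex (fun w => M - g w).
  have := ExB (Li_cst P M) Lh; rewrite Ex_cst => <-.
  have -> : Ex (fun w => M - h w) = Ex (fun w => Num.max (M - h w) 0).
    congr (Submission.Ex _ _); apply/funext => w; rewrite max_l// subr_ge0.
    by have /andP[] := hM w.
  apply: (Ex_ge_ae g'M); first exact: measurable_funB.
    by move=> w; rewrite gerBl; have /andP[] := hM w.
  by apply: filterS gh => w ->.
have := Ex_add_compl gM; apply: contraPP => /eqP; rewrite neq_lt => /orP[|] lt.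
  by move: E1; rewrite leNgt lt.
move: lt E2; move: (Submission.Ex _ _) (Submission.Ex _ _) (Submission.Ex _ _) => a b c lt E2.
by apply/negP; rewrite -ltNge; lra.
Qed.

Lemma expectation_any g M : (forall w, `|g w| <= M) ->
  (\int[P]_w (g w)%:E)%E =
  (Ex (fun w => Num.max (g w) 0) - Ex (fun w => Num.max (- g w) 0))%:E.
Proof.
move=> gM; have M0 (w : Omega) : 0 <= M := le_trans (normr_ge0 _) (gM w).
rewrite integralE EFinB.
have -> : (\int[P]_w ((EFin \o g)^\+ w) = \int[P]_w (Num.max (g w) 0)%:E)%E.
  by apply: eq_integral => w _; rewrite funeposE EFin_max.
have -> : (\int[P]_w ((EFin \o g)^\- w) = \int[P]_w (Num.max (- g w) 0)%:E)%E.
  by apply: eq_integral => w _; rewrite funenegE EFin_max.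
rewrite (@integral_any_fin _ M) ?(@integral_any_fin _ M)// => w;
  rewrite le_max lexx orbT ge_max (M0 w) andbT.
  by rewrite (le_trans _ (gM w))// -normrN ler_norm.
by rewrite (le_trans _ (gM w))// ler_norm.
Qed.

(** The almost sure limit [g] has no measurability of its own; [h] is a measurable version, set to 0
    on a measurable null set outside which convergence holds. *)
Lemma ae_bounded_limit (g_ : nat -> Omega -> R) g M :
  (forall n, measurable_fun setT (g_ n)) -> (forall n w, 0 <= g_ n w <= M) ->
  {ae P, forall w, g_ n w @[n --> \oo] --> g w} ->
  exists h, [/\ measurable_fun setT h, forall w, 0 <= h w <= M,
    {ae P, forall w, g w = h w} & Ex (g_ n) @[n --> \oo] --> Ex h].
Proof.
move=> mg gM [N [mN PN hN]].
pose h w := g w * \1_(~` N) w.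
pose h_ n w := g_ n w * \1_(~` N) w.
have mi : measurable_fun setT (\1_(~` N) : Omega -> R).
  by apply: measurable_indic; exact: measurableC.
have mh_ n : measurable_fun setT (h_ n) by exact: measurable_funM.
have cvh w : h_ n w @[n --> \oo] --> h w.
  rewrite /h_ /h indicE; have [/set_mem nNw|_] := boolP (_ \in _); last first.
    by rewrite mulr0; under eq_fun do rewrite mulr0; exact: cvg_cst.
  apply: cvgMl; apply: contrapT => nc; apply: nNw; apply: hN => /= c; exact: nc.
have mh : measurable_fun setT h.
  by apply: (@measurable_fun_cvg _ _ _ setT h_) => // w _; exact: cvh.
have h_M n w : 0 <= h_ n w <= M.
  rewrite /h_ indicE; have /andP[? gn] := gM n w.
  by case: (_ \in _); rewrite ?mulr1 ?mulr0 ?gM ?lexx ?(le_trans _ gn).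
have hM w : 0 <= h w <= M.
  have cl := cvh w; have cv : cvg (h_ n w @[n --> \oo]) by apply/cvg_ex; exists (h w).
  rewrite -(cvg_lim _ cl)//; apply/andP; split.
    by apply: limr_ge => //; apply: nearW => n; have /andP[] := h_M n w.
  by apply: limr_le => //; apply: nearW => n; have /andP[] := h_M n w.
have aeN : {ae P, forall w, ~ N w} by exists N; split => // w /= /contrapT.
exists h; split => //.
  by apply: filterS aeN => w nNw; rewrite /h indicE mem_set// mulr1.
have [| | | | |_ +] := @Ex_dominated _ _ _ P h_ h (cst M).
- by [].
- by [].
- by apply: aeW => w; exact: cvh.
- exact: Li_cst.
- apply: aeW => w n; have /andP[? ?] := h_M n w; by rewrite ger0_norm.
rewrite (_ : (fun n => Ex (h_ n)) = (fun n => Ex (g_ n)))//; apply/funext => n.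
apply: Ex_ae_eq => //; apply: filterS aeN => w nNw.
by rewrite /h_ indicE mem_set// mulr1.
Qed.

End lower_integral.

(** * Lipschitz minorants for the uniform distance *)

Section uniform_minorant.
Context (R : realType) (d : nat).
Local Notation D := (skorokhod_space R d).

Definition uclose (x y : R -> 'cV[R]_d) (r : R) : Prop :=
  forall v i, 0 <= v -> v <= 1 -> `|x v i 0 - y v i 0| <= r.

(** The identity is an admissible time change, so uniform closeness implies Skorokhod closeness.
    Halving [r] gives the strict inequality of the ball. *)
Lemma continuous_uclose (f : D -> R) (x : D) (e : R) : continuous f -> 0 < e ->
  exists2 r, 0 < r & forall y : D, uclose (sval x) (sval y) r -> `|f x - f y| < e.
Proof.
move=> cf e0; have /cvgrPdist_lt/(_ _ e0) := cf x.
move=> /nbhs_ballP[r /= r0 hr]; exists (r / 2); first by rewrite divr_gt0.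
move=> y xy; apply: hr; exists id; first exact: time_change_id.
move=> t; rewrite in_itv/= => /andP[t0 t1]; rewrite subrr normr0; split => //.
split => // i j; rewrite ord1 /ball/=; apply: le_lt_trans (xy t i t0 t1) _.
by rewrite ltr_pdivrMr// ltr_pMr// ltr1n.
Qed.

Variables (f : D -> R) (M : R).
Hypothesis fM : forall x, 0 <= f x <= M.
Hypothesis cf : continuous f.

Let vals (k : R) (x : D) : set R :=
  [set z | exists y r, [/\ 0 <= r, uclose (sval x) (sval y) r & z = f y + k * r]].

(* The largest [k]-Lipschitz function below [f], for the uniform distance. *)
Definition minorant (k : R) (x : D) : R := inf (vals k x).

Variable k : R.
Hypothesis k0 : 0 <= k.

Let vals_f x : vals k x (f x).
Proof.
by exists x, 0; split => // [v i _ _|]; rewrite ?subrr ?normr0// mulr0 addr0.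
Qed.

Let vals_ge0 x : lbound (vals k x) 0.
Proof.
by move=> _ [y [r [r0 _ ->]]]; rewrite addr_ge0 ?mulr_ge0//; have /andP[] := fM y.
Qed.

Lemma minorant_ge0 x : 0 <= minorant k x.
Proof. by apply: lb_le_inf; [exists (f x)|exact: vals_ge0]. Qed.

Lemma minorant_le x : minorant k x <= f x.
Proof. by apply: ge_inf; [exists 0; exact: vals_ge0|exact: vals_f]. Qed.

Lemma minorant_leM x : minorant k x <= M.
Proof. by apply: le_trans (minorant_le x) _; have /andP[] := fM x. Qed.

Lemma minorant_lip x y r : 0 <= r -> uclose (sval x) (sval y) r ->
  minorant k y <= minorant k x + k * r.
Proof.
move=> r0 xy; rewrite -lerBlDr; apply: lb_le_inf; first by exists (f x).
move=> _ [z [s [s0 xz ->]]]; rewrite lerBlDr -addrA -mulrDr.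
apply: ge_inf; first by exists 0; exact: vals_ge0.
exists z, (s + r); split => //; first exact: addr_ge0.
move=> v i v0 v1.
rewrite (_ : _ - _ = (sval x v i 0 - sval z v i 0) - (sval x v i 0 - sval y v i 0)); last by ring.
by rewrite (le_trans (ler_normB _ _))// lerD ?xz ?xy.
Qed.

End uniform_minorant.

Section minorant_limit.
Context (R : realType) (d : nat) (f : skorokhod_space R d -> R) (M : R).
Hypothesis fM : forall x, 0 <= f x <= M.
Hypothesis cf : continuous f.

(** A competitor within [r] of [x] has a value within [e] of [f x]; one farther away pays a penalty
    of at least [n r >= M]. *)
Lemma minorant_cvg x : minorant f n%:R x @[n --> \oo] --> f x.
Proof.
apply/cvgrPdist_le => e e0; have [r r0 hr] := continuous_uclose x cf e0.
have h : \forall n \near \oo, M / r <= n%:R by exact: nbhs_infty_ger.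
apply: filterS h => n Mn; rewrite ger0_norm ?subr_ge0 ?(minorant_le fM)//.
rewrite lerBlDr addrC -lerBlDr; apply: lb_le_inf.
  by exists (f x), x, 0; split => // [v i _ _|]; rewrite ?subrr ?normr0// mulr0 addr0.
move=> _ [y [s [s0 xy ->]]]; have [sr|rs] := leP s r.
  have : `|f x - f y| < e by apply: hr => v i v0 v1; apply: le_trans (xy v i v0 v1) _.
  rewrite ltr_norml => /andP[_]; rewrite ltrBlDr => h.
  by rewrite lerBlDr (le_trans (ltW h))// addrC lerD2r lerDl mulr_ge0.
have /andP[fx0 fx1] := fM x; have /andP[fy0 _] := fM y.
apply: (@le_trans _ _ (n%:R * s)); last by rewrite lerDr.
apply: (@le_trans _ _ M); first by rewrite lerBlDr (le_trans fx1)// lerDl ltW.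
by apply: (@le_trans _ _ (n%:R * r)); [rewrite -ler_pdivrMr|rewrite ler_wpM2l// ltW].
Qed.

End minorant_limit.

Section cadlag_paths.
Context (R : realType) (d : nat).
Implicit Types (x : R -> 'cV[R]_d) (f : R -> R).

Lemma cvg_colP (G : set_system R) (FG : Filter G) x (l : 'cV[R]_d) :
  (forall i, x s i 0 @[s --> G] --> l i 0) -> x s @[s --> G] --> l.
Proof.
move=> h; apply/cvg_ballP => e e0.
have : \forall s \near G, forall i, ball (l i 0) e (x s i 0).
  by apply: filter_forall => i; have /cvg_ballP/(_ _ e0) := h i.
by apply: filterS => s hs; split => // i j; rewrite ord1; exact: hs.
Qed.

Lemma cadlag_coord x :
  (forall i t, 0 <= t -> t < 1 -> x s i 0 @[s --> t^'+] --> x t i 0) ->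
  (forall i t, 0 < t -> t <= 1 -> cvg (x s i 0 @[s --> t^'-])) -> cadlag x.
Proof.
move=> hr hl; split => t /andP[t0 t1].
  by apply: cvg_colP => i; exact: hr.
apply/cvg_ex; exists (\col_i lim (x s i 0 @[s --> t^'-])).
by apply: cvg_colP => i; rewrite mxE; exact: hl.
Qed.

Lemma block_right m (t : R) : (0 < m)%N -> 0 <= t -> \forall s \near t^'+, block m s = block m t.
Proof.
move=> m0 t0; have [h1 h2] := block_itv m0 t0.
have m0' : (0 : R) < m%:R by rewrite ltr0n.
near=> s; have ts : t <= s by near: s; exact: nbhs_right_ge.
have sb : s < (block m t).+1%:R / m%:R by near: s; exact: nbhs_right_lt.
apply: truncn_def; rewrite -ler_pdivrMr// -ltr_pdivlMr//.
by rewrite sb (le_trans h1).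
Unshelve. all: by end_near. Qed.

Lemma block_left m (t : R) : (0 < m)%N -> 0 < t ->
  exists b, \forall s \near t^'-, block m s = b.
Proof.
move=> m0 t0; have [h1 h2] := block_itv m0 (ltW t0).
have m0' : (0 : R) < m%:R by rewrite ltr0n.
(* At a grid point the left limit is taken in the preceding block. *)
have [b bt tb] : exists2 b : nat, b%:R / m%:R < t & t <= b.+1%:R / m%:R.
  move: h1; rewrite le_eqVlt => /predU1P[E|lt]; last by exists (block m t) => //; exact: ltW.
  have b0 : (0 < block m t)%N.
    by rewrite lt0n; apply/eqP => b0; move: t0; rewrite -E b0 mul0r ltxx.
  exists (block m t).-1; last by rewrite prednK// E.
  by rewrite -[ltRHS]E ltr_pM2r ?invr_gt0// ltr_nat prednK.
exists b; near=> s.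
have bs : b%:R / m%:R < s by near: s; exact: nbhs_left_gt.
have st : s < t by near: s; exact: nbhs_left_lt.
apply: truncn_def; rewrite -ler_pdivrMr// -ltr_pdivlMr//.
by rewrite (ltW bs) (lt_le_trans st).
Unshelve. all: by end_near. Qed.

Lemma cadlag_step m (y : nat -> 'cV[R]_d) : (0 < m)%N -> cadlag (fun v => y (block m v)).
Proof.
move=> m0; split => t /andP[t0 t1].
  apply: cvg_colP => i; apply: (@cvg_near_cst _ R^o).
  by apply: filterS (block_right m0 t0) => s ->.
have [b hb] := block_left m0 t0.
apply/cvg_ex; exists (y b); apply: cvg_colP => i; apply: (@cvg_near_cst _ R^o).
by apply: filterS hb => s ->.
Qed.

Lemma within_cadlag x :
  (forall i, {within `[0, 1], continuous (fun v => x v i 0)}) -> cadlag x.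
Proof.
move=> cx; have c01 i := (continuous_within_itvP (fun v => x v i 0) (@ltr01 R)).1 (cx i).
apply: cadlag_coord => i t t0 t1; have [hin h0 h1] := c01 i.
  move: t0; rewrite le_eqVlt => /predU1P[<-//|t0].
  by apply: cvg_at_right_filter; apply: hin; rewrite in_itv/= t0.
apply/cvg_ex; exists (x t i 0).
move: t1; rewrite le_eqVlt => /predU1P[->//|t1].
by apply: cvg_at_left_filter; apply: hin; rewrite in_itv/= t0.
Qed.

(** Heine's theorem through compactness: near each [x], both [v] and the start of its block fall
    where [f] is within [e / 2] of [f x]. *)
Lemma step_uniform f (e : R) : {within `[0, 1], continuous f} -> 0 < e ->
  \forall m \near \oo, forall v, 0 <= v -> v <= 1 -> `|f v - f ((block m v)%:R / m%:R)| <= e.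
Proof.
move=> cf e0.
have loc (x : R) : 0 <= x <= 1 -> exists2 g : R, 0 < g &
    forall y, 0 <= y <= 1 -> `|x - y| < g -> `|f x - f y| <= e / 2.
  move=> x01; have /subspace_continuousP := cf => /(_ x).
  have xI : `[0, 1]%classic x by rewrite /= in_itv.
  have e2 : 0 < e / 2 by rewrite divr_gt0.
  move=> /(_ xI)/cvgrPdist_le/(_ _ e2); rewrite /prop_near1 /within/=.
  move=> /nbhs_ballP[g /= g0 hg]; exists g => // y y01 xy.
  by apply: hg => //=; rewrite in_itv.
have /compact_near_coveringP := @segment_compact R 0 1.
pose Q (m : nat) (v : R) := 0 <= v -> v <= 1 -> `|f v - f ((block m v)%:R / m%:R)| <= e.
move=> /(_ nat \oo Q) H.
have : \forall m \near \oo, `[0, 1]%classic `<=` Q m.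
  apply: H => x; rewrite /= in_itv/= => x01; have [g g0 hg] := loc x x01.
  have g2 : 0 < g / 2 by rewrite divr_gt0.
  near=> y m => y0 y1.
  have m0 : (0 < m)%N by near: m; exact: nbhs_infty_gt.
  have m0' : (0 : R) < m%:R by rewrite ltr0n.
  have [h1 h2] := block_itv m0 y0.
  have xy : `|x - y| < g / 2 by near: y; exact: nbhsx_ballx.
  have mg : (g / 2)^-1 < m%:R.
    near: m; apply: filterS (nbhs_infty_gtr (g / 2)^-1) => k; exact.
  have yb : `|y - (block m y)%:R / m%:R| < g / 2.
    rewrite ger0_norm ?subr_ge0// ltrBlDl (lt_le_trans h2)//.
    rewrite -natr1 mulrDl mul1r lerD2l -[leRHS]invrK lef_pV2 ?posrE ?invr_gt0//.
    exact: ltW.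
  have b01 : 0 <= ((block m y)%:R / m%:R : R) <= 1.
    by rewrite divr_ge0//= (le_trans h1).
  have yI : 0 <= y <= 1 by rewrite y0.
  have d1 : `|f x - f y| <= e / 2 by apply: hg => //; apply: lt_trans xy _; lra.
  have d2 : `|f x - f ((block m y)%:R / m%:R)| <= e / 2.
    apply: hg => //; rewrite (_ : _ - _ = (x - y) + (y - (block m y)%:R / m%:R)); last by ring.
    by rewrite (le_lt_trans (ler_normD _ _))// [ltRHS]splitr ltrD.
  rewrite (_ : _ - _ = (f x - f ((block m y)%:R / m%:R)) - (f x - f y)); last by ring.
  by rewrite (le_trans (ler_normB _ _))// [leRHS]splitr lerD.
by apply: filterS => m h v v0 v1; apply: h; rewrite /= ?in_itv/= ?v0.
Unshelve. all: by end_near. Qed.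

End cadlag_paths.

Section step_paths.
Context (R : realType) (d : nat) (B : 'M[R]_d).

Lemma sum_increments (g : nat -> R) m b : (b <= m)%N ->
  \sum_(k < m | (k < b)%N) (g k.+1 - g k) = g b - g 0%N.
Proof.
move=> bm; rewrite -(big_ord_widen m (fun k => g k.+1 - g k) bm).
elim: b {bm} => [|b IH]; first by rewrite big_ord0 subrr.
by rewrite big_ord_recr/= IH; ring.
Qed.

Lemma sum_increments0 (g : nat -> R) m b : g 0%N = 0 -> (b <= m)%N ->
  \sum_(k < m | (k < b)%N) (g k.+1 - g k) = g b.
Proof. by move=> g0 bm; rewrite sum_increments// g0 subr0. Qed.

Lemma sum_pair (I J : finType) (F : I * J -> R) : \sum_p F p = \sum_i \sum_j F (i, j).
Proof. by rewrite pair_bigA; apply: eq_bigr => -[]. Qed.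

(** The increments of the cells completed by time [v] are summed, so the path depends on finitely
    many variables and is constant on blocks. *)
Definition step_path (m : nat) (z : 'I_m * 'I_d -> R) (v : R) : 'cV[R]_d :=
  \col_i \sum_j B i j * \sum_(k < m | (k < block m v)%N) z (k, j).

Lemma to_skorokhodE (x : R -> 'cV[R]_d) : cadlag x -> sval (to_skorokhod x) = x.
Proof. by move=> cx; rewrite /to_skorokhod; case: pselect. Qed.

Lemma uclose_skorokhod (x y : R -> 'cV[R]_d) r : cadlag x -> cadlag y ->
  uclose x y r -> uclose (sval (to_skorokhod x)) (sval (to_skorokhod y)) r.
Proof.
move=> cx cy xy; exact (eq_ind_r (fun z => uclose z (sval (to_skorokhod y)) r)
  (eq_ind_r (fun z => uclose x z r) xy (to_skorokhodE cy)) (to_skorokhodE cx)).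
Qed.

Lemma cadlag_step_path m z : (0 < m)%N -> cadlag (@step_path m z).
Proof.
move=> m0; exact: (cadlag_step
  (fun b => \col_i \sum_j B i j * \sum_(k < m | (k < b)%N) z (k, j)) m0).
Qed.

Definition mass : R := \sum_i \sum_j `|B i j|.

Lemma mass_ge0 : 0 <= mass.
Proof. by apply: sumr_ge0 => i _; exact: sumr_ge0. Qed.

Lemma step_path_lip m (y z : 'I_m * 'I_d -> R) :
  uclose (step_path y) (step_path z) (mass * \sum_p `|y p - z p|).
Proof.
move=> v i v0 v1; rewrite !mxE -sumrB (le_trans (ler_norm_sum _ _ _))//.
apply: (@le_trans _ _ (\sum_j `|B i j| * \sum_p `|y p - z p|)).
  apply: ler_sum => j _; rewrite -mulrBr normrM ler_wpM2l// -sumrB.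
  rewrite (le_trans (ler_norm_sum _ _ _))//.
  rewrite sum_pair.
  rewrite big_mkcond/=; apply: ler_sum => k _.
  case: ifP => _; last exact: sumr_ge0.
  by rewrite [leRHS](bigD1 j)//= lerDl sumr_ge0.
rewrite -mulr_suml ler_wpM2r ?sumr_ge0// /mass [leRHS](bigD1 i)//= lerDl.
by apply: sumr_ge0 => k _; exact: sumr_ge0.
Qed.

End step_paths.

Lemma max0_lip (R : realDomainType) (a b : R) : `|Num.max a 0 - Num.max b 0| <= `|a - b|.
Proof.
wlog ab : a b / a <= b => [H|].
  by have [/H//|/ltW/H] := leP a b; rewrite distrC [leRHS]distrC.
rewrite ler0_norm ?subr_le0 ?ler0_norm ?subr_le0//; last first.
  by rewrite ge_max !le_max ab lexx !orbT.
rewrite !opprB; have [a0|a0] := leP a 0; have [b0|b0] := leP b 0; lra.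
Qed.

Lemma continuous_max0 (R : realType) (T : topologicalType) (f : T -> R) :
  continuous f -> continuous (fun y => Num.max (f y) 0).
Proof.
move=> cf y; apply/cvgrPdist_le => e e0; have /cvgrPdist_le/(_ _ e0) := cf y.
apply: (@filterS _ (nbhs y) (nbhs_filter y)) => z; apply: le_trans.
exact: max0_lip.
Qed.

Lemma continuous_subl (R : realType) (T : topologicalType) (f : T -> R) (c : R) :
  continuous f -> continuous (fun y => c - f y).
Proof. by move=> cf y; apply: cvgB; [exact: cvg_cst|exact: cf]. Qed.

(** * Lower bound for nonnegative functionals and convergence in law *)

Section hawkes_limit.
Context (R : realType) (disp : measure_display) (Omega : measurableType disp).
Context (P : probability Omega R).
Context (d : nat) (tau : nat -> Omega -> \bar R) (Z : nat -> Omega -> 'I_d).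
Context (mu : 'cV[R]_d) (phi : 'I_d -> 'I_d -> R -> R).
Hypothesis mu_ge0 : forall i, 0 <= mu i 0.
Hypothesis phi_ge0 : forall i j (t : R), 0 <= t -> 0 <= phi i j t.
Hypothesis phi_meas : forall i j, measurable_fun (`[0%R, +oo[ : set R) (phi i j).
Hypothesis hN : hawkes P tau Z mu phi.
Hypothesis phi_int : forall i j,
  (\int[lebesgue_measure]_(t in `[0%R, +oo[) (phi i j t)%:E < +oo)%E.
Hypothesis rho_lt1 : spectral_radius (kernel_mass phi) < 1.
Hypothesis phi_half : forall i j,
  (\int[lebesgue_measure]_(t in `[0%R, +oo[)
       (Num.sqrt t * phi i j t)%:E < +oo)%E.
Context (disp' : measure_display) (Omega' : measurableType disp').
Context (P' : probability Omega' R) (W : R -> Omega' -> 'cV[R]_d).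
Hypothesis hW : standard_brownian P' W.

Local Notation Ex := Submission.Ex.
Local Notation Li := Submission.Li.
Local Notation A := (invmx (1%:M - kernel_mass phi)).
Local Notation count := (count tau Z).
Local Notation comp_mart := (comp_mart tau Z mu phi).
Local Notation noexp := (noexp tau Z).
Local Notation rate := (rate mu phi).

Let rate0 i : 0 <= rate i. Proof. exact: rate_ge0. Qed.
Let ae_noexp : {ae P, forall w, noexp w}.
Proof. exact: (ae_noexp mu_ge0 phi_ge0 phi_meas hN phi_int rho_lt1). Qed.

Definition hawkes_path (T v : R) (w : Omega) : 'cV[R]_d :=
  Num.sqrt T *: (T^-1 *: count_vec tau Z (T * v) w - v *: (A *m mu)).

Definition limit_path (v : R) (w : Omega') : 'cV[R]_d :=
  A *m sqrt_diag (A *m mu) *m W v w.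

Lemma hawkes_pathE T v w i :
  hawkes_path T v w i 0 = Num.sqrt T * (T^-1 * count i (T * v) w - v * rate i).
Proof.
rewrite /hawkes_path [LHS]mxE; congr (_ * _); rewrite [LHS]mxE; congr (_ + _).
  by rewrite [LHS]mxE; congr (_ * _); rewrite [LHS]mxE.
by rewrite [LHS]mxE; congr (- _); rewrite [LHS]mxE.
Qed.

Lemma limit_pathE v w i :
  limit_path v w i 0 = \sum_j A i j * (Num.sqrt (rate j) * W v w j 0).
Proof.
rewrite /limit_path -mulmxA mxE; apply: eq_bigr => j _; congr (_ * _).
by rewrite /sqrt_diag mul_diag_mx [LHS]mxE [X in X * _]mxE.
Qed.

Lemma hawkes_path_cadlag T w : 0 < T -> noexp w -> cadlag (hawkes_path T ^~ w).
Proof.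
move=> T0 ne; apply: cadlag_coord => i t t0 t1.
  have [g /= g0 hg] := count_right_cst hN i (T * t) ne.
  rewrite (_ : (fun s => _) = (fun s =>
    Num.sqrt T * (T^-1 * count i (T * s) w - s * rate i))); last first.
    by apply/funext => s; rewrite hawkes_pathE.
  rewrite hawkes_pathE; apply: cvgMr; apply: cvgB.
    apply: cvgMr; apply: (@cvg_near_cst _ R^o).
    have tg : t < t + g / T by rewrite ltrDl divr_gt0.
    near=> s; have ts : t < s by near: s; exact: nbhs_right_gt.
    have sg : s < t + g / T by near: s; exact: nbhs_right_lt.
    apply: hg => /=; last by rewrite ltr_pM2l.
    rewrite /ball_/= ltr0_norm; last by rewrite subr_lt0 ltr_pM2l.
    by rewrite opprB -mulrBr mulrC -ltr_pdivlMr// ltrBlDl.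
  by apply: cvgMl; apply: cvg_at_right_filter; exact: cvg_id.
rewrite (_ : (fun s => _) = (fun s =>
  Num.sqrt T * (T^-1 * count i (T * s) w - s * rate i))); last first.
  by apply/funext => s; rewrite hawkes_pathE.
have cv : cvg (count i (T * s) w @[s --> t^'-]).
  apply: nondecreasing_at_left_is_cvgr.
    apply: nearW => x a b _ _ ab; apply: (count_nd hN) => //.
    by rewrite ler_wpM2l// ltW.
  apply: nearW => x; exists (count i (T * t) w) => _ [y /= + <-].
  rewrite in_itv/= => /andP[_ yu]; apply: (count_nd hN) => //.
  by rewrite ler_wpM2l ?ltW.
apply/cvg_ex; exists (Num.sqrt T * (T^-1 * lim (count i (T * s) w @[s --> t^'-]) - t * rate i)).
apply: cvgMr; apply: cvgB; first exact: cvgMr.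
by apply: cvgMl; apply: cvg_at_left_filter; exact: cvg_id.
Unshelve. all: by end_near. Qed.

Let aeW : {ae P', forall w, W 0 w = 0 /\ {within `[0, 1], continuous (W ^~ w)}}.
Proof. by have [_ h1 h2 _ _] := hW; apply: filterS2 h1 h2 => w ? ?; split. Qed.

Lemma limit_path_cont w i : {within `[0, 1], continuous (W ^~ w)} ->
  {within `[0, 1], continuous (fun v => limit_path v w i 0)}.
Proof.
move=> cW; rewrite (_ : (fun v => _) = (fun v =>
    \sum_j A i j * (Num.sqrt (rate j) * W v w j 0))); last first.
  by apply/funext => v; rewrite limit_pathE.
apply/subspace_continuousP => x x01; apply: cvg_sumr => j.
apply: cvgMr; apply: cvgMr.
have /subspace_continuousP/(_ x x01) c := cW.
exact: (cvg_comp (fun v => W v w) (fun y : 'cV[R]_d => y j 0) c (@coord_continuous _ _ _ j 0 _)).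
Qed.

Lemma limit_path_cadlag w : {within `[0, 1], continuous (W ^~ w)} ->
  cadlag (limit_path ^~ w).
Proof. by move=> cW; apply: within_cadlag => i; exact: limit_path_cont. Qed.

Section lower_bound.
Variable T : nat -> R.
Hypothesis T_gt0 : forall n, 0 < T n.
Hypothesis T_pinfty : T n @[n --> \oo] --> +oo.
Let x n : R := (Num.sqrt (T n))^-1.
Let x0 n : 0 < x n. Proof. by rewrite invr_gt0 sqrtr_gt0. Qed.

Let t (m k : nat) : R := k%:R / m%:R.
Let xi m n (p : 'I_m * 'I_d) w : R :=
  x n * (comp_mart p.2 (T n * t m p.1.+1) w - comp_mart p.2 (T n * t m p.1) w).
Let eta m (p : 'I_m * 'I_d) w : R :=
  Num.sqrt (rate p.2) * bm_inc W p.2 (t m p.1) (t m p.1.+1) w.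

Let t_ge0 m k : 0 <= t m k. Proof. by rewrite divr_ge0. Qed.
Let t_le1 m k : (k <= m)%N -> t m k <= 1.
Proof.
case: m => [|m] km; first by rewrite /t invr0 mulr0.
by rewrite ler_pdivrMr ?ltr0n// mul1r ler_nat.
Qed.
Let t_lt m k : (0 < m)%N -> t m k < t m k.+1.
Proof. by move=> m0; rewrite ltr_pM2r ?invr_gt0 ?ltr0n// ltr_nat. Qed.

Let xi_meas m n (p : 'I_m * 'I_d) : measurable_fun setT (xi n p).
Proof.
apply: measurable_funM => //; apply: measurable_funB;
  by apply: (measurable_comp_mart mu_ge0 phi_ge0 phi_meas hN phi_int);
     rewrite mulr_ge0// ltW.
Qed.

(** The factor 8 is that of [bm_moment2]; the martingale increments satisfy the bound with 4. *)
Let Cb : R := 8 * \sum_j rate j.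

Let rate_le j : rate j <= \sum_j rate j.
Proof. by rewrite (bigD1 j)//= lerDl sumr_ge0. Qed.

Let xi_sqr m n (p : 'I_m * 'I_d) : Li P (fun w => xi n p w ^+ 2) /\
  Ex P (fun w => xi n p w ^+ 2) <= Cb.
Proof.
have mx := xi_meas n p.
have ta : 0 <= T n * t m p.1.+1 by rewrite mulr_ge0// ltW.
have tb : 0 <= T n * t m p.1 by rewrite mulr_ge0// ltW.
have [La Ea] := comp_mart_sqr mu_ge0 phi_ge0 phi_meas hN phi_int rho_lt1 p.2 ta.
have [Lb Eb] := comp_mart_sqr mu_ge0 phi_ge0 phi_meas hN phi_int rho_lt1 p.2 tb.
pose g w := x n ^+ 2 * (2 * comp_mart p.2 (T n * t m p.1.+1) w ^+ 2 +
  2 * comp_mart p.2 (T n * t m p.1) w ^+ 2).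
have L2 := LiD (LiZ 2 La) (LiZ 2 Lb).
have Lg : Li P g by exact: LiZ.
have le w : xi n p w ^+ 2 <= g w.
  rewrite /xi /g exprMn ler_wpM2l ?sqr_ge0//.
  move: (comp_mart _ _ w) (comp_mart _ _ w) => a b.
  rewrite -subr_ge0 (_ : _ - _ = (a + b) ^+ 2); last by ring.
  exact: sqr_ge0.
have L : Li P (fun w => xi n p w ^+ 2).
  apply: (Li_le _ Lg); first exact: measurable_funX.
  by move=> w; rewrite ger0_norm ?sqr_ge0.
split => //; apply: le_trans (Ex_le L Lg le) _.
have -> : Ex P g = x n ^+ 2 * (2 * Ex P (fun w => comp_mart p.2 (T n * t m p.1.+1) w ^+ 2) +
    2 * Ex P (fun w => comp_mart p.2 (T n * t m p.1) w ^+ 2)).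
  apply: etrans (ExZ _ L2) _; congr (_ * _); apply: etrans (ExD (LiZ 2 La) (LiZ 2 Lb)) _.
  by congr (_ + _); [exact: (ExZ 2 La)|exact: (ExZ 2 Lb)].
have x2 : x n ^+ 2 = (T n)^-1 by rewrite exprVn sqr_sqrtr// ltW.
rewrite x2 mulrC ler_pdivrMr//.
have h k : (k <= m)%N -> rate p.2 * (T n * t m k) <= rate p.2 * T n.
  by move=> km; rewrite ler_wpM2l// ler_piMr ?t_le1// ltW.
have h1 := le_trans Ea (h _ (ltn_ord p.1)); have h2 := le_trans Eb (h _ (ltnW (ltn_ord p.1))).
apply: (@le_trans _ _ (4 * (rate p.2 * T n))).
  have two : (0 : R) <= 2 by [].
  apply: le_trans (lerD (ler_wpM2l two h1) (ler_wpM2l two h2)) _.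
  by rewrite -mulrDl -natrD.
rewrite mulrA ler_wpM2r ?(ltW (T_gt0 n))// /Cb ler_pM//.
by rewrite ler_nat.
Qed.

Let eta_sqr m (p : 'I_m * 'I_d) : measurable_fun setT (eta p : Omega' -> R) /\
  Li P' (fun w => eta p w ^+ 2) /\ Ex P' (fun w => eta p w ^+ 2) <= Cb.
Proof.
have m0 : (0 < m)%N by apply: leq_ltn_trans (ltn_ord p.1).
have lt := t_lt p.1 m0.
have mb := measurable_bm_inc hW p.2 (t_ge0 m p.1) (ltW lt) (t_le1 (ltn_ord p.1)).
split; first exact: measurable_funM.
have [L E] := bm_moment2 hW p.2 (t_ge0 m p.1) lt (t_le1 (ltn_ord p.1)).
have eE : (fun w => eta p w ^+ 2) =
    (fun w => rate p.2 * bm_inc W p.2 (t m p.1) (t m p.1.+1) w ^+ 2).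
  by apply/funext => w; rewrite /eta exprMn sqr_sqrtr.
rewrite eE; split; first exact: LiZ.
rewrite ExZ// mulrC /Cb; apply: ler_pM => //.
- by apply: Ex_ge0 => w; exact: sqr_ge0.
apply: le_trans E _; rewrite -[leRHS]mulr1 ler_wpM2l//.
by rewrite lerBlDr (le_trans (t_le1 (ltn_ord p.1)))// lerDl.
Qed.

Let trig m (th : 'I_m * 'I_d -> R) c : (0 < m)%N ->
  Ex P (fun w => cos (c + \sum_p th p * xi n p w)) @[n --> \oo] -->
  Ex P' (fun w => cos (c + \sum_p th p * eta p w)).
Proof.
(* [hawkes_fdd] takes coefficients indexed by all integers; those from [m] on are set to 0. *)
move=> m0; pose th' (k : nat) (j : 'I_d) : R := oapp (fun k' => th (k', j)) 0 (insub k).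
have th'E (k : 'I_m) j : th' k j = th (k, j) by rewrite /th' valK.
have tn k : (k < m)%N -> t m k <= t m k.+1 by move=> _; exact: ltW (t_lt k m0).
have := hawkes_fdd mu_ge0 phi_ge0 phi_meas hN phi_int rho_lt1 phi_half T_gt0 T_pinfty
  (th := th') (t := t m) (m := m) (c := c) (t_ge0 m 0) tn.
have -> : (fun n => Ex P (fun w => cos (c + \sum_(k < m)
     inc comp_mart (T n * t m k) (fun i => th' k i * (Num.sqrt (T n))^-1) (T n * t m k.+1) w))) =
  (fun n => Ex P (fun w => cos (c + \sum_p th p * xi n p w))).
  apply/funext => n; congr (Submission.Ex _ _); apply/funext => w; congr (cos (_ + _)).
  rewrite sum_pair.
  apply: eq_bigr => k _; rewrite /inc; apply: eq_bigr => j _.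
  by rewrite th'E /xi /= mulrA.
have -> : Ex P' (fun w => cos (c + \sum_p th p * eta p w)) =
   cos c * expR (- \sum_p ((th p * Num.sqrt (rate p.2)) ^+ 2 * (t m p.1.+1 - t m p.1) / 2)).
  have := bm_fdd hW (m := m) (t := t m) (fun p => th p * Num.sqrt (rate p.2)) c (t_ge0 m 0)
    (fun k _ => t_lt k m0) (t_le1 (leqnn m)).
  move=> <-; congr (Submission.Ex _ _); apply/funext => w; congr (cos (_ + _)).
  by apply: eq_bigr => p _; rewrite /eta mulrA.
suff -> : \sum_(k < m) qvar rate (th' k) (t m k.+1 - t m k) / 2 =
  \sum_p ((th p * Num.sqrt (rate p.2)) ^+ 2 * (t m p.1.+1 - t m p.1) / 2) by [].
rewrite sum_pair.
apply: eq_bigr => k _; rewrite /qvar mulr_suml; apply: eq_bigr => j _.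
by rewrite th'E exprMn sqr_sqrtr// !mulrA.
Qed.

Variables (f : skorokhod_space R d -> R) (M : R).
Hypothesis fM : forall y, 0 <= f y <= M.
Hypothesis cf : continuous f.

(** The minorant read on step paths: a bounded Lipschitz function of finitely many increments, to
    which [trig_cvg] applies. *)
Let G (k : nat) m (z : 'I_m * 'I_d -> R) : R :=
  minorant f k%:R (to_skorokhod (step_path A z)).

Let G_bound k m (z : 'I_m * 'I_d -> R) : 0 <= G k z <= M.
Proof. by rewrite (minorant_ge0 fM)// (minorant_leM fM). Qed.

Let G_lip k m (y z : 'I_m * 'I_d -> R) : (0 < m)%N ->
  `|G k y - G k z| <= (k%:R * mass A) * \sum_p `|y p - z p|.
Proof.
move=> m0; rewrite -mulrA ler_distlC.
have r0 : 0 <= mass A * \sum_p `|y p - z p| by rewrite mulr_ge0 ?mass_ge0// sumr_ge0.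
have h (u v : 'I_m * 'I_d -> R) : G k v <= G k u + k%:R * (mass A * \sum_p `|u p - v p|).
  apply: (minorant_lip fM) => //; first by rewrite mulr_ge0 ?mass_ge0// sumr_ge0.
  apply: uclose_skorokhod (cadlag_step_path A u m0) (cadlag_step_path A v m0) _.
  exact: step_path_lip.
have E : \sum_p `|z p - y p| = \sum_p `|y p - z p| by apply: eq_bigr => p _; exact: distrC.
by apply/andP; split; [rewrite lerBlDr -E|]; exact: h.
Qed.

Let G_cvg k m : (0 < m)%N -> [/\ forall n, measurable_fun setT (fun w => G k (fun p : 'I_m * 'I_d => xi n p w) : R),
    measurable_fun setT (fun w => G k (fun p : 'I_m * 'I_d => eta p w) : R) &
    Ex P (fun w => G k (fun p : 'I_m * 'I_d => xi n p w)) @[n --> \oo] -->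
    Ex P' (fun w => G k (fun p : 'I_m * 'I_d => eta p w))].
Proof.
move=> m0; have := @trig_cvg R ('I_m * 'I_d)%type _ _ P _ _ P' (fun n p => @xi m n p)
  (fun p => @eta m p) Cb (fun n p => @xi_meas m n p) (fun p => (@eta_sqr m p).1)
  (fun n p => @xi_sqr m n p) (fun p => (@eta_sqr m p).2) (fun th c => @trig m th c m0)
  (@G k m) (k%:R * mass A).
apply; first by rewrite mulr_ge0// mass_ge0.
  by exists M => z; have /andP[? ?] := G_bound k z; rewrite ger0_norm.
by move=> y z; exact: G_lip.
Qed.

Let t00 m : t m 0 = 0. Proof. exact: mul0r. Qed.

Let sum_fifths (e a b c g u v : R) : a - e / 5 <= b -> b - e / 5 <= c ->
  c - e / 5 <= g -> u <= e / 5 -> v <= e / 5 -> a - e <= g - u - v.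
Proof. lra. Qed.

Let step_xi m n v w i : (0 < m)%N -> 0 <= v -> v <= 1 -> noexp w ->
  step_path A (fun p : 'I_m * 'I_d => xi n p w) v i 0 =
  \sum_j A i j * (x n * comp_mart j (T n * ((block m v)%:R / m%:R)) w).
Proof.
move=> m0 v0 v1 ne; rewrite mxE; apply: eq_bigr => j _; congr (_ * _).
pose g k := x n * comp_mart j (T n * t m k) w.
have g0 : g 0%N = 0.
  have c0 : comp_mart j (T n * t m 0) w = 0.
    have -> : T n * t m 0 = 0 := etrans (congr1 _ (t00 m)) (mulr0 _).
    exact: (comp_mart0 phi_ge0 phi_meas hN phi_int j ne).
  by rewrite /g c0 mulr0.
apply: etrans (sum_increments0 g0 (block_le m0 v0 v1)).
by apply: eq_bigr => k _; exact: mulrBr.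
Qed.

Let step_eta m v w i : (0 < m)%N -> 0 <= v -> v <= 1 -> W 0 w = 0 ->
  step_path A (fun p : 'I_m * 'I_d => eta p w) v i 0 =
  limit_path ((block m v)%:R / m%:R) w i 0.
Proof.
move=> m0 v0 v1 W0; rewrite limit_pathE mxE; apply: eq_bigr => j _; congr (_ * _).
pose g k := Num.sqrt (rate j) * W (t m k) w j 0.
have g0 : g 0%N = 0.
  have c0 : W (t m 0) w j 0 = 0 by rewrite t00 W0 mxE.
  by rewrite /g c0 mulr0.
apply: etrans (sum_increments0 g0 (block_le m0 v0 v1)).
by apply: eq_bigr => k _; exact: mulrBr.
Qed.

(** [h] is a measurable version of the functional of the limit. Parameters are fixed in the order
    [k] (minorant), [m] (grid), [n] (time scale), and the loss [e] is split into five equal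
    parts. *)
Lemma hawkes_lower : exists h : Omega' -> R, [/\ measurable_fun setT h, forall w, 0 <= h w <= M,
  {ae P', forall w, f (to_skorokhod (limit_path ^~ w)) = h w} &
  forall e, 0 < e -> \forall n \near \oo,
    Ex P' h - e <= Ex P (fun w => f (to_skorokhod (hawkes_path (T n) ^~ w)))].
Proof.
(* Refining the grid on Brownian paths recovers the minorant of the limit path and gives it a
   measurable version. *)
have Hk (k : nat) : exists g : Omega' -> R, [/\ measurable_fun setT g, forall w, 0 <= g w <= M,
    {ae P', forall w, minorant f k%:R (to_skorokhod (limit_path ^~ w)) = g w} &
    Ex P' (fun w => G k (fun p : 'I_m.+1 * 'I_d => eta p w)) @[m --> \oo] --> Ex P' g].
  apply: (@ae_bounded_limit _ _ _ P' (fun m w => G k (fun p : 'I_m.+1 * 'I_d => eta p w))).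
  - by move=> m; have [_ mG _] := G_cvg k (ltn0Sn m).
  - by move=> m w; exact: G_bound.
  apply: filterS aeW => w [W0 cW]; apply/cvgrPdist_le => e e0.
  have k1 : (0 : R) < k%:R + 1 by rewrite ltr_wpDl.
  pose r := e / (k%:R + 1); have r0 : 0 < r by rewrite divr_gt0.
  have near_r : \forall m \near \oo, forall i v, 0 <= v -> v <= 1 ->
      `|limit_path v w i 0 - limit_path ((block m v)%:R / m%:R) w i 0| <= r.
    apply: filter_forall => i.
    have h := step_uniform (limit_path_cont (i := i) cW) r0.
    by apply: filterS h => m h v v0 v1; exact: h.
  have [N _ hNr] := near_r; exists N => // m Nm.
  have {}hNr := hNr m.+1 (leqW Nm).
  have cl := limit_path_cadlag cW.
  have cs := cadlag_step_path A (fun p : 'I_m.+1 * 'I_d => eta p w) (ltn0Sn m).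
  have uc : uclose (limit_path ^~ w) (step_path A (fun p : 'I_m.+1 * 'I_d => eta p w)) r.
    by move=> v i v0 v1; rewrite step_eta//; exact: hNr.
  have uc' : uclose (step_path A (fun p : 'I_m.+1 * 'I_d => eta p w)) (limit_path ^~ w) r.
    by move=> v i v0 v1; rewrite distrC; exact: uc.
  have kr : k%:R * r <= e.
    by rewrite /r mulrCA ler_piMr ?(ltW e0)// ler_pdivrMr// mul1r lerDl.
  have l1 := minorant_lip fM (ler0n R k) (ltW r0) (uclose_skorokhod cs cl uc').
  have l2 := minorant_lip fM (ler0n R k) (ltW r0) (uclose_skorokhod cl cs uc).
  rewrite ler_distlC; apply/andP; split.
    by rewrite lerBlDr; apply: le_trans l1 _; rewrite lerD2l.
  by apply: le_trans l2 _; rewrite lerD2l.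
have [g gP] := choice Hk.
have [h [mh hM fh gh]] : exists h : Omega' -> R, [/\ measurable_fun setT h, forall w, 0 <= h w <= M,
    {ae P', forall w, f (to_skorokhod (limit_path ^~ w)) = h w} &
    Ex P' (g k) @[k --> \oo] --> Ex P' h].
  apply: ae_bounded_limit; first by move=> k; have [] := gP k.
    by move=> k; have [] := gP k.
  have : {ae P', forall w, forall k, minorant f k%:R (to_skorokhod (limit_path ^~ w)) = g k w}.
    by apply/ae_foralln => k; have [] := gP k.
  apply: filterS => w gw; rewrite (_ : (fun k => g k w) =
    (fun k => minorant f k%:R (to_skorokhod (limit_path ^~ w)))).
    exact: minorant_cvg fM cf _.
  by apply/funext => k; rewrite gw.
exists h; split => // e e0.
have M0 : 0 <= M by have /andP[/le_trans h1 /h1] := fM (to_skorokhod (fun=> 0)).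
have e5 : 0 < e / 5 by rewrite divr_gt0.
have [k hk] : exists k, Ex P' h - e / 5 <= Ex P' (g k).
  have /cvgrPdist_le/(_ _ e5)[k _ hk] := gh; exists k.
  by have := hk k (leqnn k); rewrite ler_distlC => /andP[].
have [_ _ _ cG] := gP k.
pose dl := e / (5 * (M + 1)); have M1 : 0 < M + 1 by rewrite ltr_wpDl.
have dl0 : 0 < dl by rewrite divr_gt0// mulr_gt0.
have k1 : (0 : R) < k%:R + 1 by rewrite ltr_wpDl.
pose r := e / (5 * (k%:R + 1)); have r0 : 0 < r by rewrite divr_gt0// mulr_gt0.
have SA := hawkes_step_approx mu_ge0 phi_ge0 phi_meas hN phi_int rho_lt1 phi_half
  T_gt0 T_pinfty r0 dl0.
have [m [m1 m2]] : exists m, Ex P' (g k) - e / 5 <= Ex P' (fun w => G k (fun p : 'I_m.+1 * 'I_d => eta p w)) /\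
  \forall n \near \oo, exists B : set Omega,
    [/\ measurable B, (P B <= dl%:E)%E & forall w, ~ B w -> noexp w ->
      forall v i, 0 <= v -> v <= 1 ->
        `|Num.sqrt (T n) * ((T n)^-1 * count i (T n * v) w - v * rate i) -
          \sum_j A i j * (x n * comp_mart j (T n * ((block m.+1 v)%:R / m.+1%:R)) w)| <= r].
  have [N1 _ h1] := SA; have /cvgrPdist_le/(_ _ e5)[N2 _ h2] := cG.
  exists (maxn N1 N2); split; last by apply: h1; rewrite /= leqW// leq_maxl.
  by have := h2 _ (leq_maxr N1 N2); rewrite ler_distlC => /andP[].
have [mG _ cGn] := G_cvg k (ltn0Sn m).
have /cvgrPdist_le/(_ _ e5) near_G := cGn.
apply: filterS2 near_G m2 => n Gn [B [mB PB hB]].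
pose Gn_ w : R := G k (fun p : 'I_m.+1 * 'I_d => xi n p w).
pose lo w : R := Gn_ w - k%:R * r - M * \1_B w.
have LG : Li P Gn_.
  apply: (@Li_bounded _ _ _ _ _ M); first exact: mG.
  by move=> w; have /andP[? ?] := G_bound k (fun p : 'I_m.+1 * 'I_d => xi n p w); rewrite ger0_norm.
have LB := Li_indic P mB.
have Llo : Li P lo by apply: LiB; [apply: LiB => //; exact: Li_cst|exact: LiZ].
have lo_le w : noexp w -> lo w <= f (to_skorokhod (hawkes_path (T n) ^~ w)).
  move=> ne; rewrite /lo; have /andP[f0 _] := fM (to_skorokhod (hawkes_path (T n) ^~ w)).
  have kr : 0 <= k%:R * r by rewrite mulr_ge0// ltW.
  have [Bw|nBw] := pselect (B w).
    rewrite indicE mem_set// mulr1; apply: le_trans f0.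
    have /andP[_ GM] := G_bound k (fun p : 'I_m.+1 * 'I_d => xi n p w).
    rewrite subr_le0 lerBlDr; apply: le_trans GM _; by rewrite lerDl.
  rewrite indicE memNset// mulr0 subr0 lerBlDr.
  apply: (@le_trans _ _ (minorant f k%:R (to_skorokhod (hawkes_path (T n) ^~ w)) + k%:R * r)).
    apply: (minorant_lip fM) => //; first exact: ltW.
    apply: uclose_skorokhod (hawkes_path_cadlag (T_gt0 n) ne)
      (cadlag_step_path A (fun p => xi n p w) (ltn0Sn m)) _.
    by move=> v i v0 v1; rewrite hawkes_pathE step_xi//; exact: hB.
  by rewrite lerD2r (minorant_le fM).
have Elo : Ex P lo = Ex P Gn_ - k%:R * r - M * fine (P B).
  apply: etrans (ExB (LiB LG (Li_cst P (k%:R * r))) (LiZ M LB)) _; congr (_ - _).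
    by apply: etrans (ExB LG (Li_cst P _)) _; rewrite Ex_cst.
  by apply: etrans (ExZ M LB) _; rewrite Ex_indic.
have pB : fine (P B) <= dl.
  by rewrite -lee_fin fineK// fin_num_measure.
apply: (@le_trans _ _ (Ex P lo)).
  have kr : k%:R * r <= e / 5.
    rewrite /r (_ : k%:R * (e / (5 * (k%:R + 1))) = e / 5 * (k%:R / (k%:R + 1))); last by field; rewrite gt_eqF.
    by rewrite ler_piMr ?(ltW e5)// ler_pdivrMr// mul1r lerDl.
  have MB : M * fine (P B) <= e / 5.
    apply: le_trans (ler_wpM2l M0 pB) _.
    rewrite /dl (_ : M * (e / (5 * (M + 1))) = e / 5 * (M / (M + 1))); last by field; rewrite gt_eqF.
    by rewrite ler_piMr ?(ltW e5)// ler_pdivrMr// mul1r lerDl.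
  rewrite Elo; move: Gn; rewrite ler_distlC => /andP[Gn _].
  exact: sum_fifths hk m1 Gn kr MB.
have fX w : 0 <= f (to_skorokhod (hawkes_path (T n) ^~ w)) <= M by exact: fM.
have lom w : Num.max (lo w) 0 <= M.
  rewrite ge_max M0 andbT /lo; have /andP[_ GM] := G_bound k (fun p : 'I_m.+1 * 'I_d => xi n p w).
  apply: le_trans GM; rewrite lerBlDr lerBlDr -addrA lerDl addr_ge0 ?mulr_ge0//.
  exact: ltW.
apply: le_trans (Ex_ge_ae fX (LiM Llo) _ _); last first.
- by apply: filterS ae_noexp => w; exact: lo_le.
- by move=> w; apply: le_trans (lom w); rewrite le_max lexx.
apply: Ex_le => //; last by move=> w; rewrite le_max lexx.
apply: (@Li_bounded _ _ _ _ _ M); first by apply: measurable_maxr => //; exact: LiM Llo.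
by move=> w; rewrite ger0_norm// le_max lexx orbT.
Qed.

End lower_bound.

Section convergence.
Variables (f : skorokhod_space R d -> R) (M : R).
Hypothesis fM : forall y, 0 <= f y <= M.
Hypothesis cf : continuous f.
Let fX T w : R := f (to_skorokhod (hawkes_path T ^~ w)).
Let fY w : R := f (to_skorokhod (limit_path ^~ w)).

Let fM' y : 0 <= M - f y <= M.
Proof. by have /andP[? ?] := fM y; rewrite subr_ge0 gerBl; apply/andP. Qed.

Let cf' : continuous (fun y => M - f y).
Proof. exact: continuous_subl. Qed.

Let dist_between (a b c e : R) : a - e <= b -> M - a - e <= c -> b + c <= M -> `|a - b| <= e.
Proof. by move=> *; rewrite ler_norml; apply/andP; split; lra. Qed.

Lemma hawkes_cvg_seq (T : nat -> R) : (forall n, 0 < T n) -> T n @[n --> \oo] --> +oo ->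
  Ex P (fX (T n)) @[n --> \oo] --> Ex P' fY.
Proof.
move=> T0 Too.
have [h [mh hM fh hl]] := hawkes_lower T0 Too fM cf.
have [h' [mh' hM' fh' hl']] := hawkes_lower T0 Too fM' cf'.
have fYM w : 0 <= fY w <= M by exact: fM.
have Eh : Ex P' fY = Ex P' h by exact: (Ex_ae_any fYM mh hM fh).
have Lh : Li P' h.
  apply: (@Li_bounded _ _ _ _ _ M) => // w.
  by have /andP[? ?] := hM w; rewrite ger0_norm.
have Eh' : Ex P' h' = M - Ex P' fY.
  have fYM' w : 0 <= M - fY w <= M by exact: fM'.
  apply: etrans (esym (Ex_ae_any fYM' mh' hM' fh')) _.
  have hM1 w : 0 <= M - h w <= M.
    by have /andP[? ?] := hM w; rewrite subr_ge0 gerBl; apply/andP.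
  have fhM : {ae P', forall w, M - fY w = M - h w}.
    by apply: filterS fh => w E; rewrite /fY E.
  apply: etrans (Ex_ae_any fYM' _ hM1 fhM) _; first exact: measurable_funB.
  by apply: etrans (ExB (Li_cst P' M) Lh) _; rewrite Ex_cst Eh.
apply/cvgrPdist_le => e e0; apply: filterS2 (hl e e0) (hl' e e0) => n h1 h2.
(* The lower bound for [M - f] becomes an upper bound for [f], with no measurability of [f] along
   the rescaled path. *)
have h3 := Ex_add_compl P (fun w => fM (to_skorokhod (hawkes_path (T n) ^~ w))).
by rewrite Eh in Eh' *; rewrite Eh' in h2; exact: dist_between h1 h2 h3.
Qed.

Lemma hawkes_cvg : Ex P (fX T) @[T --> +oo] --> Ex P' fY.
Proof.
apply/cvg_pinftyP => u u_oo.
(* A sequence tending to infinity may start with nonpositive terms; changing them does not affect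
   the limit. *)
pose T n := if 0 < u n then u n else 1.
have T0 n : 0 < T n by rewrite /T; case: ifP.
have Tu : \forall n \near \oo, T n = u n.
  by move/cvgryPgt: u_oo => /(_ 0); apply: filterS => n un; rewrite /T un.
have Too : T n @[n --> \oo] --> +oo.
  apply/cvgryPge => B; move/cvgryPge: u_oo => /(_ B).
  by apply: filterS2 Tu => n ->.
apply: cvg_trans (hawkes_cvg_seq T0 Too); apply: near_eq_cvg.
by apply: filterS Tu => n ->.
Qed.

End convergence.

End hawkes_limit.

Theorem corollary1 (R : realType)
  (disp : measure_display) (Omega : measurableType disp)
  (P : probability Omega R) (d : nat)
  (tau : nat -> Omega -> \bar R) (Z : nat -> Omega -> 'I_d)
  (mu : 'cV[R]_d) (phi : 'I_d -> 'I_d -> R -> R)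
  (mu_ge0 : forall i, 0 <= mu i 0)
  (phi_ge0 : forall i j (t : R), 0 <= t -> 0 <= phi i j t)
  (phi_meas : forall i j, measurable_fun (`[0%R, +oo[ : set R) (phi i j))
  (hN : hawkes P tau Z mu phi)
  (phi_int : forall i j,
    (\int[lebesgue_measure]_(t in `[0%R, +oo[) (phi i j t)%:E < +oo)%E)
  (rho_lt1 : spectral_radius (kernel_mass phi) < 1)
  (phi_half : forall i j,
    (\int[lebesgue_measure]_(t in `[0%R, +oo[)
       (Num.sqrt t * phi i j t)%:E < +oo)%E)
  (disp' : measure_display) (Omega' : measurableType disp')
  (P' : probability Omega' R) (W : R -> Omega' -> 'cV[R]_d)
  (hW : standard_brownian P' W) :
  let A := invmx (1%:M - kernel_mass phi) in
  cvg_in_law_skorokhod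
    P (fun T v w => Num.sqrt T *:
         (T^-1 *: count_vec tau Z (T * v) w - v *: (A *m mu)))
    P' (fun v w => A *m sqrt_diag (A *m mu) *m W v w).
Proof.
move=> A; have [mW aeW0 aeWc _ _] := hW.
have ne := ae_noexp mu_ge0 phi_ge0 phi_meas hN phi_int rho_lt1.
split.
- move=> T T0; split.
    move=> v i _; rewrite (_ : (fun w => _) = (fun w => Num.sqrt T *
      (T^-1 * count tau Z i (T * v) w - v * rate mu phi i))); last first.
      by apply/funext => w; exact: hawkes_pathE.
    apply: measurable_funM => //; apply: measurable_funB => //.
    by apply: measurable_funM => //; exact: (measurable_count hN).
  by apply: filterS ne => w; exact: (hawkes_path_cadlag hN T0).
- split.
    move=> v i v01; rewrite (_ : (fun w => _) = (fun w =>
      \sum_j A i j * (Num.sqrt (rate mu phi j) * W v w j 0))); last first.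
      by apply/funext => w; exact: limit_pathE.
    apply: measurable_sum => j; apply: measurable_funM => //.
    by apply: measurable_funM => //; exact: mW.
  by apply: filterS aeWc => w; exact: limit_path_cadlag.
move=> f cf [M fM]; have M0 : 0 <= M := le_trans (normr_ge0 _) (fM (to_skorokhod (fun=> 0))).
rewrite unlock.
pose fX T w : R := f (to_skorokhod (hawkes_path tau Z mu phi T ^~ w)).
pose fY w : R := f (to_skorokhod (limit_path mu phi W ^~ w)).
pose pos (u : R) := Num.max u 0.
have bnd (g : skorokhod_space R d -> R) : (forall y, `|g y| <= M) ->
    forall y, 0 <= Num.max (g y) 0 <= M.
  by move=> gM y; rewrite le_max lexx orbT ge_max M0 andbT (le_trans (ler_norm _)).
(* [expectation_any] splits the mean of a bounded functional into its positive and negative parts,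
   each continuous with values in [[0, M]]. *)
have cN := continuous_subl (c := 0) cf.
have Nf y : `|0 - f y| <= M by rewrite sub0r normrN.
have c1 := hawkes_cvg mu_ge0 phi_ge0 phi_meas hN phi_int rho_lt1 phi_half hW
  (bnd f fM) (continuous_max0 cf).
have c2 := hawkes_cvg mu_ge0 phi_ge0 phi_meas hN phi_int rho_lt1 phi_half hW
  (bnd _ Nf) (continuous_max0 cN).
have EX T : (\int[P]_w (fX T w)%:E = (Ex P (fun w => Num.max (fX T w) 0) -
    Ex P (fun w => Num.max (0 - fX T w) 0))%:E)%E.
  rewrite (@expectation_any _ _ _ P (fX T) M) => [|w]; last exact: fM.
  by congr (_ - Submission.Ex _ _)%:E; apply/funext => w; rewrite sub0r.
have EY : (\int[P']_w (fY w)%:E = (Ex P' (fun w => Num.max (fY w) 0) -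
    Ex P' (fun w => Num.max (0 - fY w) 0))%:E)%E.
  rewrite (@expectation_any _ _ _ P' fY M) => [|w]; last exact: fM.
  by congr (_ - Submission.Ex _ _)%:E; apply/funext => w; rewrite sub0r.
rewrite -[X in _ --> X]/(\int[P']_w (fY w)%:E)%E EY.
rewrite -[X in X @ _]/(fun T => \int[P]_w (fX T w)%:E)%E (funext EX).
by apply: cvg_EFin; [exact: nearW|exact: cvgB c1 c2].
Qed.
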